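(* Let $d\ge 1$, let $\mathbf{M}(\mathbf{u})$ be a given entire $d\times d$ matrix-valued function of $\mathbf{u}$, and consider the Cauchy problem $$\partial_T\mathbf{u}=\mathbf{M}(\mathbf{u})\,\partial_X\mathbf{u},\qquad \mathbf{u}|_{T=0}=\mathbf{u}_0,\qquad X\in\mathbb{R},\ T\ge 0,$$ for an unknown $\mathbf{u}=(u_1(X,T),\dots,u_d(X,T))$. Let $s>1$ and $\sigma_0>0$. Then for every $R>0$ there exists $\eta=\eta(R,s,\sigma_0)>0$ such that for every $\mathbf{u}_0\in G^s_{\sigma_0}$ with $\|\mathbf{u}_0\|_{G^s_{\sigma_0}}\le R$ there exists a unique local solution $\mathbf{u}(T)\in G^s_{\sigma(T)}$ of this problem, where $\sigma(T):=\sigma_0-\eta T$ and $T\in[0,\sigma_0/\eta]$, and moreover $$\sup_{T\in[0,\sigma_0/\eta]}\|\mathbf{u}(T)\|_{G^s_{\sigma(T)}}\le R.$$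
   Context: For $s,\sigma\ge 0$ the Gevrey space $G^s_\sigma=G^s_\sigma(\mathbb{R})$ consists of the (scalar- or vector-valued) functions on $\mathbb{R}$ with finite norm $\|\mathbf{u}\|_{G^s_\sigma}:=\big\|e^{\sigma(|\xi|+1)}(1+|\xi|^{2s})^{1/2}\,\widehat{\mathbf{u}}(\xi)\big\|_{L^2}$, where $\widehat{\mathbf{u}}$ is the Fourier transform of $\mathbf{u}$ in $X$. The matrix function $\mathbf{M}$ is fixed, so $\eta$ may also depend on it. *)

(* Defs.v *)
From HB Require Import structures.
From mathcomp Require Import all_boot all_order all_algebra.
From mathcomp Require Import complex.
From mathcomp Require Import all_classical all_reals all_analysis.
Set Implicit Arguments.
Unset Strict Implicit.
Unset Printing Implicit Defensive.
Import Order.TTheory GRing.Theory Num.Theory.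
Import numFieldNormedType.Exports.
Local Open Scope classical_set_scope.
Local Open Scope ring_scope.

(* The norm topology on R[i], the one a numFieldType carries by default. *)
HB.instance Definition _ (R : rcfType) := NormedModule.copy R[i] R[i]^o.

(* Throughout, C^d is 'cV[R[i]]_d.  [complex.Re] and [complex.Im] are the
   R-valued real and imaginary parts (not the R[i]-valued 'Re and 'Im). *)

Section Gevrey.
Context {R : realType} {d : nat}.
Local Notation C := R[i].
Local Notation mu := (@lebesgue_measure R).

Definition cvec_norm (v : 'cV[C]_d) : R :=
  Num.sqrt (\sum_(i < d) (complex.Re (v i 0) ^+ 2 + complex.Im (v i 0) ^+ 2)).

Definition cvec_measurable (f : R -> 'cV[C]_d) : Prop :=
  forall i : 'I_d, measurable_fun [set: R] (fun x => complex.Re (f x i 0)) /\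
                   measurable_fun [set: R] (fun x => complex.Im (f x i 0)).

Definition L2norm (f : R -> 'cV[C]_d) : \bar R :=
  ('N[mu]_2%:E [EFin \o cvec_norm \o f])%E.

Definition square_integrable (f : R -> 'cV[C]_d) : Prop :=
  cvec_measurable f /\ (L2norm f < +oo)%E.

Definition cintegral (A : set R) (g : R -> C) : C :=
  Complex (\int[mu]_(x in A) complex.Re (g x))%R
          (\int[mu]_(x in A) complex.Im (g x))%R.

(* exp(- i t) *)
Definition cexpNi (t : R) : C := Complex (cos t) (- sin t).

Definition fourier_trunc (a : R) (u : R -> 'cV[C]_d) (xi : R) : 'cV[C]_d :=
  \col_(i < d) (real_complex R (Num.sqrt (2 * pi))^-1 *
    cintegral `[- a, a] (fun x => u x i 0 * cexpNi (x * xi))).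

(* The Fourier transform on L^2, with the unitary normalization
     \hat u(xi) = (2 pi)^{-1/2} \int u(x) exp(- i x xi) dx,
   the integral being the limit in L^2 of its truncations to [-a, a]. *)
Definition is_fourier (u v : R -> 'cV[C]_d) : Prop :=
  square_integrable v /\
  L2norm (fun xi => v xi - fourier_trunc a u xi) @[a --> +oo] --> 0%E.

(* By Plancherel's theorem, a square integrable u has a transform, and it is
   unique up to equality almost everywhere; [fourier u] is a representative. *)
Definition fourier (u : R -> 'cV[C]_d) : R -> 'cV[C]_d :=
  xget (fun=> 0) [set v | is_fourier u v].

Definition gevrey_weight (s sigma xi : R) : R :=
  expR (sigma * (`|xi| + 1)) * Num.sqrt (1 + `|xi| `^ (2 * s)).

Definition gevrey_norm (s sigma : R) (u : R -> 'cV[C]_d) : \bar R :=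
  L2norm (fun xi => real_complex R (gevrey_weight s sigma xi) *: fourier u xi).

Definition gevrey (s sigma : R) (u : R -> 'cV[C]_d) : Prop :=
  square_integrable u /\ (gevrey_norm s sigma u < +oo)%E.

(* Differentiability over the field R[i], i.e. M is holomorphic on C^d. *)
Definition entire (M : 'cV[C]_d -> 'M[C]_d) : Prop :=
  forall z : 'cV[C]_d, differentiable M z.

(* l is the derivative at x, relative to A, of a C^d-valued function of a real
   variable; relative to an interval it is one-sided at the end points. *)
Definition is_deriv_within (A : set R) (f : R -> 'cV[C]_d) (x : R)
    (l : 'cV[C]_d) : Prop :=
  real_complex R (t - x)^-1 *: (f t - f x)
    @[t --> within (A `\ x) (nbhs x)] --> l.

(* \sup_{0 <= T <= sigma0/eta} || u(T) ||_{G^s_{sigma(T)}},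
   where sigma(T) = sigma0 - eta T *)
Definition gevrey_sup (s sigma0 eta : R) (u : R -> R -> 'cV[C]_d) : \bar R :=
  ereal_sup [set gevrey_norm s (sigma0 - eta * T) (u T)
            | T in `[0, sigma0 / eta]].

(* Solutions u(T, X) on [0, sigma0/eta] of u_T = M(u) u_X, u(0) = u0, with
   u(T) in G^s_{sigma(T)}, bounded in this scale of spaces.
   Elements of G^s_sigma are classes of functions modulo equality almost
   everywhere, so the initial condition holds almost everywhere in X.
   The equation holds classically for T < sigma0/eta, where sigma(T) > 0 and
   u(T) is real analytic.  At T = sigma0/eta the radius is 0 and u(T) has only
   Sobolev regularity s > 1, so u_X need not exist pointwise; there u is tied
   to the equation by its continuity in T. *)
Definition is_solution (M : 'cV[C]_d -> 'M[C]_d) (s sigma0 eta : R)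
    (u0 : R -> 'cV[C]_d) (u : R -> R -> 'cV[C]_d) : Prop :=
  [/\ forall T, T \in `[0, sigma0 / eta] ->
        gevrey s (sigma0 - eta * T) (u T),
      (gevrey_sup s sigma0 eta u < +oo)%E,
      {ae mu, forall X, u 0 X = u0 X},
      forall X, {within `[0, sigma0 / eta], continuous (fun T => u T X)} &
      forall T X, T \in `[0, sigma0 / eta[ ->
        exists2 uX : 'cV[C]_d,
          is_deriv_within [set: R] (u T) X uX &
          is_deriv_within `[0, sigma0 / eta] (fun t => u t X) T
            (M (u T X) *m uX)].

End Gevrey.

(* Main.v *)
Require Import Defs.
From HB Require Import structures.
From mathcomp Require Import all_boot all_order all_algebra.
From mathcomp Require Import complex ring lra.
From mathcomp Require Import all_classical all_reals all_analysis.
From mathcomp Require Import measurable_realfun.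
Set Implicit Arguments.
Unset Strict Implicit.
Unset Printing Implicit Defensive.
Import Order.TTheory GRing.Theory Num.Theory.
Import numFieldNormedType.Exports.
Import ComplexField.Normc.
Local Open Scope classical_set_scope.
Local Open Scope ring_scope.

(* Functions are measured by weighted L^2 norms of their Fourier transforms; for s > 1/2 these norms
   are submultiplicative up to a constant, and d/dX costs a factor 1/(rho' - rho) when the radius
   drops from rho' to rho.  By Cauchy's formula, an entire M acts on such functions through an
   absolutely convergent power series.  The solution is the Cauchy-Kovalevskaya series
   sum_n a_n(X) T^n, with norms of a_n at most K C^n / ((n+1)^2 (sigma0 - rho)^n); it converges up
   to the time sigma0/eta as soon as eta is a large multiple of C.

   The bound by r itself, without a loss of constants, comes from the shrinking radius: it
   contributes -2 eta |k^(1/2) u|^2 (k = 1 + |xi|) to the derivative of |u(T)|^2, and this dominates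
   the term M(u) u_X, which loses half a derivative on each factor.

   For uniqueness, finite differences in X commute with the derivative in T, so that the pointwise
   equation suffices: by induction on j, the difference w of two solutions satisfies
     |D_h1 ... D_hn w(T)| <= rho (Q T)^j (n+j)!/j! al^n |h1 ... hn|   for every j,
   and n = 0, j -> oo gives w = 0 for small T. *)

(** * Complex-valued integrals *)

(** All spaces are described on the transform side: a function is [IF g] at every point, with a
    weighted bound on [g], so that products, derivatives and sums are pointwise identities, and the
    L^2 transform of the statement enters only when data are converted into this form and back. The
    hypothesis s > 1 is what the energy argument asks for: M(u) u_x is estimated with the weight
    exponent s - 1/2, which must itself exceed 1/2 for products to be controlled. The energy is not
    differentiated in T. It is compared over short time steps at the radius theta (sigma0 - eta T),
    theta < 1, where the series has spare analyticity to make the error of a step O(h^2); afterwards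
    theta tends to 1. Power series in d variables are an inductive predicate, so that each estimate
    on M(u) is an induction over it, carried out in an abstract scale of norms with numbers,
    weighted transforms and difference classes as instances. A competing solution is given only by
    the pointwise equation and a bound in T, without joint regularity in (T, X), which is why
    uniqueness is proved with sup norms of differences and not by energy. *)

Section real_sequences.
Variable R : realType.
Implicit Types (u v : nat -> R) (x l : R).

Lemma le_cvg u x l : (forall n, x <= u n) -> u n @[n --> \oo] --> l -> x <= l.
Proof.
move=> xu ul; rewrite -(cvg_lim _ ul)//; apply: limr_ge; last exact: nearW.
by apply/cvg_ex; exists l.
Qed.

Lemma cvg0D u v : u n @[n --> \oo] --> 0 -> v n @[n --> \oo] --> 0 ->
  u n + v n @[n --> \oo] --> 0.
Proof. by move=> u0 v0; rewrite -(addr0 (0 : R)); exact: cvgD. Qed.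

Lemma cvg0Z (c : R) u : u n @[n --> \oo] --> 0 -> c * u n @[n --> \oo] --> 0.
Proof. by move=> u0; rewrite -(mulr0 c); apply: cvgM => //; exact: cvg_cst. Qed.

Lemma squeeze0 u v : (forall n, 0 <= u n <= v n) -> v n @[n --> \oo] --> 0 ->
  u n @[n --> \oo] --> 0.
Proof.
move=> uv v0; apply: (@squeeze_cvgr _ _ _ _ (fun=> 0) v) => //; first exact: nearW.
exact: cvg_cst.
Qed.

End real_sequences.

Section complex_modulus.
Variable R : realType.
Local Notation C := R[i].
Local Notation Re := (@complex.Re R).
Local Notation Im := (@complex.Im R).
Implicit Types (z w : C) (t : R).

Lemma normc_ge0 z : 0 <= normc z.
Proof. by case: z => a b; rewrite sqrtr_ge0. Qed.

Lemma sqr_normcE z : normc z ^+ 2 = Re z ^+ 2 + Im z ^+ 2.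
Proof. by case: z => a b /=; rewrite sqr_sqrtr// addr_ge0// sqr_ge0. Qed.

Lemma normc_norm z : `|z| = (normc z)%:C%C.
Proof. by case: z. Qed.

Lemma normc_real t : normc t%:C%C = `|t|.
Proof. by rewrite /= expr0n addr0 sqrtr_sqr. Qed.

Lemma normc_Re z : `|Re z| <= normc z.
Proof.
case: z => a b /=; rewrite -sqrtr_sqr ler_wsqrtr// lerDl sqr_ge0//.
Qed.

Lemma normc_Im z : `|Im z| <= normc z.
Proof.
case: z => a b /=; rewrite -sqrtr_sqr ler_wsqrtr// lerDr sqr_ge0//.
Qed.

Lemma le_normcB z w : normc (z - w) <= normc z + normc w.
Proof. by rewrite (le_trans (le_normcD _ _))// normcN. Qed.

Lemma normcB z w : normc (z - w) = normc (w - z).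
Proof. by rewrite -normcN opprB. Qed.

Lemma normc_le_ReIm z : normc z <= `|Re z| + `|Im z|.
Proof.
case: z => a b; rewrite (_ : Complex a b = a%:C%C + Complex 0 b); last by simpc.
apply: le_trans (le_normcD _ _) _; apply: lerD; first by rewrite normc_real /= addr0.
by rewrite /= expr0n add0r sqrtr_sqr add0r.
Qed.

Lemma normc_sum (I : Type) (s : seq I) (P : pred I) (F : I -> C) :
  normc (\sum_(i <- s | P i) F i) <= \sum_(i <- s | P i) normc (F i).
Proof.
elim/big_rec2 : _ => [|i y x _ h]; first by rewrite normc0.
by rewrite (le_trans (le_normcD _ _))// lerD2l.
Qed.

Lemma normcX z n : normc (z ^+ n) = normc z ^+ n.
Proof. by elim: n => [|n ih]; rewrite ?normc1// !exprS normcM ih. Qed.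

Lemma normc_conj z : normc z^*%C = normc z.
Proof. by case: z => a b /=; rewrite sqrrN. Qed.

Lemma normc_eq0 z : (normc z == 0) = (z == 0).
Proof. by apply/eqP/eqP => [/eq0_normc//|->]; rewrite normc0. Qed.

Lemma mulc_conj z : z * z^*%C = (normc z ^+ 2)%:C%C.
Proof.
by rewrite sqr_normcE; case: z => a b /=; apply/eqP; rewrite eq_complex/=; apply/andP; split; apply/eqP; ring.
Qed.

Lemma ReMc z w : Re (z * w) =
  Re z * Re w - Im z * Im w.
Proof. by case: z w => [a b] [c d]. Qed.

Lemma ImMc z w : Im (z * w) =
  Re z * Im w + Im z * Re w.
Proof. by case: z w => [a b] [c d]. Qed.

Lemma ReDc z w : Re (z + w) = Re z + Re w.
Proof. by case: z w => [a b] [c d]. Qed.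

Lemma ImDc z w : Im (z + w) = Im z + Im w.
Proof. by case: z w => [a b] [c d]. Qed.

Lemma ReNc z : Re (- z) = - Re z.
Proof. by case: z. Qed.

Lemma ImNc z : Im (- z) = - Im z.
Proof. by case: z. Qed.

Lemma Re_sum (I : Type) (s : seq I) (P : pred I) (F : I -> C) :
  Re (\sum_(i <- s | P i) F i) = \sum_(i <- s | P i) Re (F i).
Proof. by elim/big_rec2 : _ => // i y x _ <-; rewrite ReDc. Qed.

Lemma Im_sum (I : Type) (s : seq I) (P : pred I) (F : I -> C) :
  Im (\sum_(i <- s | P i) F i) = \sum_(i <- s | P i) Im (F i).
Proof. by elim/big_rec2 : _ => // i y x _ <-; rewrite ImDc. Qed.

Lemma complexP z w : Re z = Re w ->
  Im z = Im w -> z = w.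
Proof. by case: z w => [a b] [c d] /= -> ->. Qed.

Definition cexpi t : C := Complex (cos t) (sin t).

Lemma normc_expi t : normc (cexpi t) = 1.
Proof. by rewrite /= cos2Dsin2 sqrtr1. Qed.

Lemma cexpiD s t : cexpi (s + t) = cexpi s * cexpi t.
Proof. by apply: complexP => /=; rewrite ?cosD ?sinD//; ring. Qed.

Lemma cexpi0 : cexpi 0 = 1.
Proof. by apply: complexP; rewrite /= ?cos0 ?sin0. Qed.

Lemma cexpiNE t : cexpi (- t) = cexpNi t.
Proof. by rewrite /cexpi /cexpNi cosN sinN. Qed.

Lemma cexpi_conj t : (cexpi t)^*%C = cexpi (- t).
Proof. by rewrite /cexpi /= cosN sinN. Qed.

Definition is_cderive (f : R -> C) (t : R) (l : C) : Prop :=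
  is_derive t 1 (Re \o f) (Re l) /\
  is_derive t 1 (Im \o f) (Im l).

(* Rotating by the unit number [conj D / |D|], D = f b - f a, reduces to the real mean value theorem. *)
Lemma complex_mvt (f f' : R -> C) (g g' : R -> R) (a b : R) : a <= b ->
  (forall t, t \in `]a, b[ -> is_cderive f t (f' t)) ->
  (forall t, t \in `]a, b[ -> is_derive t 1 g (g' t)) ->
  {within `[a, b], continuous (Re \o f)} ->
  {within `[a, b], continuous (Im \o f)} ->
  {within `[a, b], continuous g} ->
  (forall t, t \in `]a, b[ -> normc (f' t) <= g' t) ->
  normc (f b - f a) <= g b - g a.
Proof.
move=> ab df dg cRe cIm cg fg.
set D := f b - f a.
pose p := Re D / normc D; pose q := Im D / normc D.
(* If [D = 0], division by zero makes [p = q = 0], which still satisfies this bound and the identity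
   after it. *)
have pq1 : normc (Complex p (- q)) <= 1.
  rewrite -(@ler_pXn2r _ 2)// ?nnegrE ?normc_ge0// sqr_normcE/= sqrrN expr1n.
  rewrite /p /q !expr_div_n -mulrDl -sqr_normcE.
  have [->|D0] := eqVneq (normc D) 0; first by rewrite expr0n/= mul0r.
  by rewrite divff// expf_eq0/= (negbTE D0).
have pqD : p * Re D + q * Im D = normc D.
  have [D0|D0] := eqVneq (normc D) 0; first by rewrite /p /q D0 invr0 !(mulr0, mul0r) addr0.
  rewrite /p /q !(mulrAC _ (normc D)^-1) -mulrDl -!expr2 -sqr_normcE expr2 -mulrA divff ?mulr1//.
pose phi t := p * Re (f t) + q * Im (f t) - g t.
have dphi t : t \in `]a, b[ ->
    is_derive t 1 phi (p * Re (f' t) + q * Im (f' t) - g' t).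
  move=> tab; have [h1 h2] := df t tab; have h3 := dg t tab.
  have h4 : is_derive t 1 (fun t => Re (f t)) (Re (f' t)) by [].
  have h5 : is_derive t 1 (fun t => Im (f t)) (Im (f' t)) by [].
  by apply: is_derive_eq.
have : phi b <= phi a.
  apply: (@ler0_derive1_nincr _ phi a b _ _ _ a b); [ | | |exact: lexx|exact: ab|exact: lexx].
  - by move=> x xab; have := dphi x xab => -[].
  - move=> x xab; rewrite derive1E; have := dphi x xab => -[_ ->].
    rewrite subr_le0 (le_trans _ (fg x xab))//.
    have -> : p * Re (f' x) + q * Im (f' x) =
      Re (Complex p (- q) * f' x) by rewrite ReMc/= mulNr opprK.
    rewrite (le_trans (ler_norm _))// (le_trans (normc_Re _))// normcM.
    by rewrite ler_piMl ?normc_ge0.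
  - move=> x; apply: cvgB; last exact: cg.
    by apply: cvgD; apply: cvgM; [exact: cvg_cst|exact: cRe|exact: cvg_cst|exact: cIm].
rewrite /phi -subr_ge0 -[X in _ -> X <= _]pqD ReDc ImDc ReNc ImNc.
by rewrite -subr_ge0 => h; rewrite -subr_ge0; move: h; congr (_ <= _); ring.
Qed.

Lemma is_cderive_expi t : is_cderive cexpi t (Complex 0 1 * cexpi t).
Proof.
split.
  rewrite ReMc/= mul0r mul1r add0r; exact: is_derive_cos.
rewrite ImMc/= mul0r mul1r add0r; exact: is_derive_sin.
Qed.

Lemma normc_expiN_sub1 t : normc (cexpi (- t) - 1) = normc (cexpi t - 1).
Proof.
by rewrite -normc_conj; congr normc; apply: complexP; rewrite /= ?cosN ?sinN//; ring.
Qed.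

Lemma cexpi_sub1 t : normc (cexpi t - 1) <= `|t|.
Proof.
wlog t0 : t / 0 <= t.
  by move=> h; have [/h//|/ltW t0] := leP 0 t; rewrite -normc_expiN_sub1 -normrN h// oppr_ge0.
rewrite ger0_norm// -cexpi0 -[leRHS]subr0.
apply: (@complex_mvt cexpi (fun t => Complex 0 1 * cexpi t) id (fun=> 1)) => //.
- by move=> x _; exact: is_cderive_expi.
- by apply: continuous_subspaceT => x; exact: continuous_cos.
- by apply: continuous_subspaceT => x; exact: continuous_sin.
- by apply: continuous_subspaceT => x; exact: cvg_id.
- by move=> x _; rewrite normcM normc_expi mulr1 /= expr0n expr1n add0r sqrtr1.
Qed.

(** Mean value inequality against t^2: the derivative of e^{it} - 1 - it is i (e^{it} - 1), of
    modulus at most |t| by [cexpi_sub1]. Conjugation reduces to t >= 0. *)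
Lemma cexpi_sub1_lin t : normc (cexpi t - 1 - Complex 0 t) <= t ^+ 2.
Proof.
wlog t0 : t / 0 <= t.
  move=> h; have [/h//|/ltW t0] := leP 0 t; rewrite -sqrrN -normc_conj.
  have -> : (cexpi t - 1 - Complex 0 t)^*%C = cexpi (- t) - 1 - Complex 0 (- t).
    by apply: complexP; rewrite /= ?cosN ?sinN//; ring.
  by apply: h; rewrite oppr_ge0.
pose f t := cexpi t - 1 - Complex 0 t.
have -> : cexpi t - 1 - Complex 0 t = f t - f 0.
  by rewrite /f cexpi0 subrr; apply: complexP => /=; ring.
rewrite (_ : t ^+ 2 = t ^+ 2 - 0 ^+ 2); last by rewrite expr0n subr0.
apply: (@complex_mvt f (fun t => Complex 0 1 * (cexpi t - 1)) (fun t => t ^+ 2)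
  (fun t => 2 * t)) => //.
- move=> x _; split.
    rewrite (_ : _ \o f = fun t => cos t - 1); last by apply/funext => y /=; ring.
    by apply: is_derive_eq; rewrite ReMc /=; ring.
  rewrite (_ : _ \o f = fun t => sin t - t); last by apply/funext => y /=; ring.
  by apply: is_derive_eq; rewrite ImMc /=; ring.
- move=> x _; have h : is_derive x 1 (@id R) 1 by exact: is_derive_id.
  have := is_deriveX 2 h; rewrite expr1 /GRing.scale/= mulr1; exact.
- apply: continuous_subspaceT => x.
  rewrite (_ : _ \o f = fun t => cos t - 1); last by apply/funext => y /=; ring.
  by apply: cvgB; [exact: continuous_cos|exact: cvg_cst].
- apply: continuous_subspaceT => x.
  rewrite (_ : _ \o f = fun t => sin t - t); last by apply/funext => y /=; ring.
  by apply: cvgB; [exact: continuous_sin|exact: cvg_id].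
- by apply: continuous_subspaceT => x; apply: exprn_continuous.
- move=> x; rewrite in_itv => /andP[x0 _]; rewrite normcM.
  rewrite (_ : normc (Complex 0 1) = 1) ?mul1r; last by rewrite /= expr0n expr1n add0r sqrtr1.
  have {}x0 : 0 < x by [].
  rewrite (le_trans (cexpi_sub1 _))// gtr0_norm//; lra.
Qed.

End complex_modulus.

Section complex_measurable.
Context d (T : measurableType d) (R : realType).
Local Notation C := R[i].
Local Notation Re := (@complex.Re R).
Local Notation Im := (@complex.Im R).
Variable D : set T.
Implicit Types g h : T -> C.

Definition cmeas g := measurable_fun D (fun x => Re (g x)) /\
  measurable_fun D (fun x => Im (g x)).

Lemma cmeas_cst (c : C) : cmeas (fun=> c).
Proof. by split; exact: measurable_cst. Qed.

Lemma cmeasD g h : cmeas g -> cmeas h -> cmeas (fun x => g x + h x).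
Proof.
move=> [g1 g2] [h1 h2]; split.
  by under eq_fun do rewrite ReDc; exact: measurable_funD.
by under eq_fun do rewrite ImDc; exact: measurable_funD.
Qed.

Lemma cmeasM g h : cmeas g -> cmeas h -> cmeas (fun x => g x * h x).
Proof.
move=> [g1 g2] [h1 h2]; split.
  by under eq_fun do rewrite ReMc; apply: measurable_funB; exact: measurable_funM.
by under eq_fun do rewrite ImMc; apply: measurable_funD; exact: measurable_funM.
Qed.

Lemma cmeasN g : cmeas g -> cmeas (fun x => - g x).
Proof.
move=> [g1 g2]; split.
  by under eq_fun do rewrite ReNc; exact: measurable_funN.
by under eq_fun do rewrite ImNc; exact: measurable_funN.
Qed.

Lemma cmeasB g h : cmeas g -> cmeas h -> cmeas (fun x => g x - h x).
Proof. by move=> mg mh; apply: cmeasD => //; exact: cmeasN. Qed.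

Lemma cmeasZ (c : C) g : cmeas g -> cmeas (fun x => c * g x).
Proof. by move=> mg; apply: cmeasM => //; exact: cmeas_cst. Qed.

Lemma cmeas_real (f : T -> R) : measurable_fun D f -> cmeas (fun x => (f x)%:C%C).
Proof. by move=> mf; split => //=; exact: measurable_cst. Qed.

Lemma cmeas_conj g : cmeas g -> cmeas (fun x => (g x)^*%C).
Proof.
move=> [g1 g2]; split.
  by rewrite (_ : (fun x => _) = (fun x => Re (g x)))//; apply/funext => x; case: (g x).
rewrite (_ : (fun x => _) = (fun x => - Im (g x))); first exact: measurable_funN.
by apply/funext => x; case: (g x).
Qed.

Lemma cmeas_sum (I : Type) (s : seq I) (F : I -> T -> C) :
  (forall i, cmeas (F i)) -> cmeas (fun x => \sum_(i <- s) F i x).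
Proof.
move=> mF; elim: s => [|i s ih].
  by under eq_fun do rewrite big_nil; exact: cmeas_cst.
by under eq_fun do rewrite big_cons; exact: cmeasD.
Qed.

Lemma measurable_normc g : cmeas g -> measurable_fun D (fun x => normc (g x)).
Proof.
move=> [g1 g2].
rewrite (_ : (fun _ => _) = (fun x => Num.sqrt (Re (g x) ^+ 2 + Im (g x) ^+ 2))); last first.
  by apply/funext => x; case: (g x).
apply: (measurableT_comp (continuous_measurable_fun (@sqrt_continuous R))).
by apply: measurable_funD; exact: measurable_funX.
Qed.

Lemma cmeas_expi (f : T -> R) : measurable_fun D f -> cmeas (fun x => cexpi (f x)).
Proof.
move=> mf; split => /=; apply: measurableT_comp => //; apply: continuous_measurable_fun.
  exact: continuous_cos.
exact: continuous_sin.
Qed.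

End complex_measurable.

Lemma cmeas_comp d1 d2 (T1 : measurableType d1) (T2 : measurableType d2)
    (R : realType) (g : T2 -> R[i]) (f : T1 -> T2) :
  cmeas setT g -> measurable_fun setT f -> cmeas setT (fun x => g (f x)).
Proof.
by move=> [g1 g2] mf; split; [apply: (measurableT_comp g1 mf)|apply: (measurableT_comp g2 mf)].
Qed.

Section complex_integral.
Context d (T : measurableType d) (R : realType).
Local Notation C := R[i].
Local Notation Re := (@complex.Re R).
Local Notation Im := (@complex.Im R).
Variable mu : {measure set T -> \bar R}.
Implicit Types (g h : T -> C) (D : set T).

Definition cint D g : C := Complex (\int[mu]_(x in D) Re (g x)) (\int[mu]_(x in D) Im (g x)).

Definition cintegrable D g := cmeas D g /\ (\int[mu]_(x in D) (normc (g x))%:E < +oo)%E.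

Lemma eq_cint D g h : {in D, g =1 h} -> cint D g = cint D h.
Proof. by move=> gh; congr Complex; apply: eq_Rintegral => x xD; rewrite gh. Qed.

Section domain.
Variable D : set T.
Hypothesis mD : measurable D.

Lemma le_cintegrable g (f : T -> R) : cmeas D g -> measurable_fun D f ->
  (forall x, D x -> normc (g x) <= f x) -> (\int[mu]_(x in D) (f x)%:E < +oo)%E ->
  cintegrable D g.
Proof.
move=> mg mf gf foo; split => //; apply: le_lt_trans foo.
apply: ge0_le_integral => //.
- by move=> x _; rewrite lee_fin normc_ge0.
- by apply/measurable_EFinP; exact: measurable_normc.
- exact/measurable_EFinP.
Qed.

Lemma integrable_Re g : cintegrable D g -> mu.-integrable D (EFin \o (fun x => Re (g x))).
Proof.
move=> [[g1 g2] goo]; apply/integrableP; split; first exact/measurable_EFinP.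
apply: le_lt_trans goo; apply: ge0_le_integral => //.
- by apply: measurableT_comp => //; exact/measurable_EFinP.
- by apply/measurable_EFinP; exact: measurable_normc.
- by move=> x _ /=; rewrite lee_fin normc_Re.
Qed.

Lemma integrable_Im g : cintegrable D g -> mu.-integrable D (EFin \o (fun x => Im (g x))).
Proof.
move=> [[g1 g2] goo]; apply/integrableP; split; first exact/measurable_EFinP.
apply: le_lt_trans goo; apply: ge0_le_integral => //.
- by apply: measurableT_comp => //; exact/measurable_EFinP.
- by apply/measurable_EFinP; exact: measurable_normc.
- by move=> x _ /=; rewrite lee_fin normc_Im.
Qed.

Lemma cintegrable_ReIm g : mu.-integrable D (EFin \o (fun x => Re (g x))) ->
  mu.-integrable D (EFin \o (fun x => Im (g x))) -> cintegrable D g.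
Proof.
move=> /integrableP[g1 h1] /integrableP[g2 h2].
apply: (@le_cintegrable g (fun x => `|Re (g x)| + `|Im (g x)|)).
- by split; apply/measurable_EFinP.
- by apply: measurable_funD; apply: measurableT_comp => //; exact/measurable_EFinP.
- by move=> x _; exact: normc_le_ReIm.
- under eq_integral do rewrite EFinD.
  rewrite ge0_integralD//; first exact: lte_add_pinfty.
    by apply/measurable_EFinP; apply: measurableT_comp => //; exact/measurable_EFinP/g1.
  by apply/measurable_EFinP; apply: measurableT_comp => //; exact/measurable_EFinP/g2.
Qed.

Lemma cintegrableD g h : cintegrable D g -> cintegrable D h ->
  cintegrable D (fun x => g x + h x).
Proof.
move=> ig ih; apply: cintegrable_ReIm.
  rewrite (_ : _ \o _ = (EFin \o (fun x => Re (g x))) \+ (EFin \o (fun x => Re (h x)))); last first.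
    by apply/funext => x /=; rewrite ReDc EFinD.
  by apply: integrableD => //; exact: integrable_Re.
rewrite (_ : _ \o _ = (EFin \o (fun x => Im (g x))) \+ (EFin \o (fun x => Im (h x)))); last first.
  by apply/funext => x /=; rewrite ImDc EFinD.
by apply: integrableD => //; exact: integrable_Im.
Qed.

Lemma cintegrableZ (c : C) g : cintegrable D g -> cintegrable D (fun x => c * g x).
Proof.
move=> [mg goo]; split; first exact: cmeasZ.
under eq_integral do rewrite normcM EFinM.
rewrite ge0_integralZl//; first by rewrite lte_mul_pinfty// lee_fin normc_ge0.
- by apply/measurable_EFinP; exact: measurable_normc.
- by move=> x _; rewrite lee_fin normc_ge0.
- by rewrite lee_fin normc_ge0.
Qed.

Lemma cintD g h : cintegrable D g -> cintegrable D h ->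
  cint D (fun x => g x + h x) = cint D g + cint D h.
Proof.
move=> ig ih; apply: complexP; rewrite ?ReDc ?ImDc/=.
  under eq_Rintegral do rewrite ReDc.
  by rewrite RintegralD//; exact: integrable_Re.
under eq_Rintegral do rewrite ImDc.
by rewrite RintegralD//; exact: integrable_Im.
Qed.

Lemma cintZ (c : C) g : cintegrable D g -> cint D (fun x => c * g x) = c * cint D g.
Proof.
move=> ig; have ir := integrable_Re ig; have ii := integrable_Im ig.
have aux (a b : R) : \int[mu]_(x in D) (a * Re (g x) + b * Im (g x)) =
    a * \int[mu]_(x in D) Re (g x) + b * \int[mu]_(x in D) Im (g x).
  rewrite RintegralD ?RintegralZl//.
    exact: (integrableZl mD a ir).
  exact: (integrableZl mD b ii).
apply: complexP; rewrite ?ReMc ?ImMc/=.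
  under eq_Rintegral do rewrite ReMc -mulNr.
  by rewrite aux mulNr.
under eq_Rintegral do rewrite ImMc addrC.
by rewrite aux addrC.
Qed.

Lemma cintN g : cintegrable D g -> cint D (fun x => - g x) = - cint D g.
Proof.
by move=> ig; rewrite -mulN1r -cintZ//; apply: eq_cint => x _; rewrite mulN1r.
Qed.

Lemma cint_conj g : cintegrable D g -> cint D (fun x => (g x)^*%C) = (cint D g)^*%C.
Proof.
move=> ig; apply: complexP => /=.
  by congr fine; apply: eq_integral => x _; case: (g x).
rewrite -mulN1r -RintegralZl//; last exact: integrable_Im.
by congr fine; apply: eq_integral => x _; rewrite mulN1r; case: (g x).
Qed.

Lemma cintegrableN g : cintegrable D g -> cintegrable D (fun x => - g x).
Proof.
move=> /(cintegrableZ (- 1)); by under eq_fun do rewrite mulN1r.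
Qed.

Lemma cintegrableB g h : cintegrable D g -> cintegrable D h ->
  cintegrable D (fun x => g x - h x).
Proof. by move=> ig ih; apply: cintegrableD => //; exact: cintegrableN. Qed.

Lemma cintB g h : cintegrable D g -> cintegrable D h ->
  cint D (fun x => g x - h x) = cint D g - cint D h.
Proof. by move=> ig ih; rewrite cintD ?cintN//; exact: cintegrableN. Qed.

Lemma cintegrable0 : cintegrable D (fun=> 0).
Proof.
by split; [exact: cmeas_cst|under eq_integral do rewrite normc0; rewrite integral0].
Qed.

Lemma cintegrable_sum (I : Type) (s : seq I) (F : I -> T -> C) :
  (forall i, cintegrable D (F i)) -> cintegrable D (fun x => \sum_(i <- s) F i x).
Proof.
move=> iF; elim: s => [|i s ih].
  by under eq_fun do rewrite big_nil; exact: cintegrable0.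
by under eq_fun do rewrite big_cons; exact: cintegrableD.
Qed.

Lemma cint0 : cint D (fun=> 0) = 0.
Proof. by rewrite /cint /= /Rintegral integral0. Qed.

(** Multiplication by [c], the conjugate of the integral over its modulus, turns the integral into
    its own modulus, and then only the real part of the integrand counts. An infinite right-hand
    side makes the claim trivial. *)
Lemma normc_cint_le g : cmeas D g ->
  ((normc (cint D g))%:E <= \int[mu]_(x in D) (normc (g x))%:E)%E.
Proof.
move=> mg.
have [goo|] := boolP (\int[mu]_(x in D) (normc (g x))%:E < +oo)%E; last first.
  by rewrite -leNgt leye_eq => /eqP ->; exact: leey.
have ig : cintegrable D g by [].
pose c := (normc (cint D g))^-1%:C%C * (cint D g)^*%C.
have c1 : normc c <= 1.
  rewrite normcM normc_real normc_conj ger0_norm ?invr_ge0 ?normc_ge0//.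
  by have [->|h] := eqVneq (normc (cint D g)) 0; rewrite ?mulr0// mulVf.
have cE : (normc (cint D g))%:C%C = cint D (fun x => c * g x).
  rewrite cintZ// /c -mulrA [_^*%C * _]mulrC mulc_conj -rmorphM; congr (_%:C%C).
  by have [->|h] := eqVneq (normc (cint D g)) 0; rewrite ?expr0n ?mulr0// expr2 mulKf.
have -> : normc (cint D g) = \int[mu]_(x in D) Re (c * g x).
  by have := congr1 Re cE.
rewrite /Rintegral fineK; last first.
  by apply: integrable_fin_num => //; apply: integrable_Re; exact: cintegrableZ.
have icg := integrable_Re (cintegrableZ c ig).
apply: le_trans (lee_abs _) _; apply: le_trans (le_abse_integral _ _ _) _ => //.
  by case/integrableP : icg.
apply: ge0_le_integral => //.
- by apply: measurableT_comp => //; case/integrableP : icg.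
- by apply/measurable_EFinP; exact: measurable_normc.
- move=> x _; rewrite /= lee_fin (le_trans (normc_Re _))// normcM.
  by rewrite ler_piMl ?normc_ge0.
Qed.

Lemma cint_dct (g_ : nat -> T -> C) g (f : T -> R) :
  (forall n, cmeas D (g_ n)) -> cmeas D g -> mu.-integrable D (EFin \o f) ->
  {ae mu, forall x, D x -> normc (g_ n x - g x) @[n --> \oo] --> 0} ->
  (forall n x, D x -> normc (g_ n x) <= f x) ->
  normc (cint D (g_ n) - cint D g) @[n --> \oo] --> 0.
Proof.
move=> mg_ mg fi g_g g_f.
have fpart (P : C -> R) : (forall z, `|P z| <= normc z) ->
   (forall z w, P (z - w) = P z - P w) ->
   (forall n, measurable_fun D (fun x => P (g_ n x))) -> measurable_fun D (fun x => P (g x)) ->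
   \int[mu]_(x in D) P (g_ n x) @[n --> \oo] --> \int[mu]_(x in D) P (g x).
  move=> Ple PB mPn mP.
  have cvP x : normc (g_ n x - g x) @[n --> \oo] --> 0 ->
      (P (g_ n x))%:E @[n --> \oo] --> (P (g x))%:E.
    move=> g_gx; apply: cvg_EFin; first by apply: nearW.
    apply/cvgrPdist_le => e e0; near=> n => /=.
    rewrite distrC -PB (le_trans (Ple _))// -[leLHS]ger0_norm ?normc_ge0//.
    rewrite -[X in `|X|]subr0; near: n.
    by move/cvgrPdistC_le : g_gx; apply.
  have [|||||ig _ cv] := @dominated_convergence _ _ _ mu D mD
     (fun n x => (P (g_ n x))%:E) (fun x => (P (g x))%:E) (EFin \o f).
  - by move=> n; exact/measurable_EFinP.
  - exact/measurable_EFinP.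
  - by apply: filterS g_g => x h Dx; apply: cvP; exact: h.
  - exact: fi.
  - by apply: aeW => x n Dx; rewrite /= lee_fin (le_trans (Ple _))// g_f.
  by apply: fine_cvg; rewrite fineK//; exact: integrable_fin_num.
have cr : \int[mu]_(x in D) Re (g_ n x) @[n --> \oo] --> \int[mu]_(x in D) Re (g x).
  apply: fpart => [z|z w|n|]; [exact: normc_Re|by rewrite ReDc ReNc|exact: (mg_ n).1|exact: mg.1].
have ci : \int[mu]_(x in D) Im (g_ n x) @[n --> \oo] --> \int[mu]_(x in D) Im (g x).
  apply: fpart => [z|z w|n|]; [exact: normc_Im|by rewrite ImDc ImNc|exact: (mg_ n).2|exact: mg.2].
apply: (@squeeze_cvgr _ _ _ _ (fun=> 0) (fun n => `|Re (cint D (g_ n) - cint D g)| + `|Im (cint D (g_ n) - cint D g)|)).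
- by apply: nearW => n; rewrite normc_ge0 normc_le_ReIm.
- exact: cvg_cst.
- rewrite [X in _ --> X](_ : 0 = `|0 : R| + `|0 : R|); last by rewrite normr0 addr0.
  apply: cvgD.
    apply: cvg_norm => /=; rewrite -(subrr (\int[mu]_(x in D) Re (g x))).
    by apply: cvgB => //; exact: cvg_cst.
  apply: cvg_norm => /=; rewrite -(subrr (\int[mu]_(x in D) Im (g x))).
  by apply: cvgB => //; exact: cvg_cst.
Unshelve. all: by end_near. Qed.

End domain.
End complex_integral.

Section complex_fubini.
Context d1 d2 (T1 : measurableType d1) (T2 : measurableType d2) (R : realType).
Local Notation C := R[i].
Local Notation Re := (@complex.Re R).
Local Notation Im := (@complex.Im R).
Variables (m1 : {sigma_finite_measure set T1 -> \bar R})
  (m2 : {sigma_finite_measure set T2 -> \bar R}).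

Lemma measurable_Rintegral2 (f : T1 * T2 -> R) : measurable_fun setT f ->
  (\int[m1]_x \int[m2]_y `|f (x, y)|%:E < +oo)%E ->
  measurable_fun setT (fun x => \int[m2]_y f (x, y)).
Proof.
move=> mf foo.
apply: (measurableT_comp (fine_measurable measurableT)).
apply: (@measurable_fubini_F _ _ _ _ _ m1 m2 (EFin \o f)).
by apply/integrable12ltyP => //; exact/measurable_EFinP.
Qed.

(** In an iterated real integral the inner one may be infinite on a null set, where [fine] replaces
    it by 0; integrability of the outer one makes the replacement invisible. *)
Lemma Rintegral_integral (d : measure_display) (T : measurableType d)
    (mu : {measure set T -> \bar R}) (f : T -> \bar R) : mu.-integrable setT f ->
  \int[mu]_x fine (f x) = fine (\int[mu]_x f x).
Proof.
move=> fi; congr fine; apply: ae_eq_integral => //.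
- by case/integrableP : fi => mf _; apply/measurable_EFinP; exact: (measurableT_comp (fine_measurable measurableT)).
- by case/integrableP : fi.
- have := integrable_ae measurableT fi; apply: filterS => x /(_ I) h _.
  by rewrite fineK.
Qed.

Lemma Rintegral_fubini (f : T1 * T2 -> R) : measurable_fun setT f ->
  (\int[m1]_x \int[m2]_y `|f (x, y)|%:E < +oo)%E ->
  \int[m1]_x \int[m2]_y f (x, y) = \int[m2]_y \int[m1]_x f (x, y).
Proof.
move=> mf foo.
have fi : (m1 \x m2)%E.-integrable setT (EFin \o f).
  by apply/integrable12ltyP => //; exact/measurable_EFinP.
rewrite (@Rintegral_integral _ _ m1 (fun x => \int[m2]_y (f (x, y))%:E)%E); last first.
  exact: (integrable_fubini_F fi).
rewrite (@Rintegral_integral _ _ m2 (fun y => \int[m1]_x (f (x, y))%:E)%E); last first.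
  have mf' : measurable_fun setT (fun yx : T2 * T1 => f (yx.2, yx.1)).
    by apply: (measurableT_comp mf); apply: measurable_fun_pair; [exact: measurable_snd|exact: measurable_fst].
  apply: (@integrable_fubini_F _ _ _ _ _ m2 m1 (fun yx : T2 * T1 => (f (yx.2, yx.1))%:E)).
  apply/integrable12ltyP; first exact/measurable_EFinP.
  rewrite /= -(@fubini_tonelli _ _ _ _ _ m1 m2 (fun xy => `|f xy|%:E)) //.
  by apply/measurable_EFinP; exact: measurableT_comp.
by congr fine; exact: (Fubini fi).
Qed.

Variable G : T1 * T2 -> C.
Hypothesis mG : cmeas setT G.
Hypothesis Goo : (\int[m1]_x \int[m2]_y (normc (G (x, y)))%:E < +oo)%E.

Let part_oo (P : C -> R) : (forall z, `|P z| <= normc z) ->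
  measurable_fun setT (fun x => P (G x)) ->
  (\int[m1]_x \int[m2]_y `|P (G (x, y))|%:E < +oo)%E.
Proof.
move=> Ple mP; apply: le_lt_trans Goo.
have mPn : measurable_fun setT (fun xy => `|P (G xy)|%:E).
  by apply/measurable_EFinP; exact: measurableT_comp.
have mGn : measurable_fun setT (fun xy => (normc (G xy))%:E).
  by apply/measurable_EFinP; exact: measurable_normc.
apply: ge0_le_integral => //.
- by move=> x _; exact: integral_ge0.
- by apply: (@measurable_fun_fubini_tonelli_F _ _ _ _ _ m2 (fun xy => `|P (G xy)|%:E)) => // x; rewrite lee_fin.
- by apply: (@measurable_fun_fubini_tonelli_F _ _ _ _ _ m2 (fun xy => (normc (G xy))%:E)) => // x; rewrite lee_fin normc_ge0.
- move=> x _; apply: ge0_le_integral => //.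
  + exact: (measurableT_comp mPn (pair1_measurable x)).
  + exact: (measurableT_comp mGn (pair1_measurable x)).
  + by move=> y _; rewrite lee_fin.
Qed.

Lemma cmeas_cint : cmeas setT (fun x => cint m2 setT (fun y => G (x, y))).
Proof.
split => /=; apply: (@measurable_Rintegral2 (fun xy => _ (G xy))).
- exact: mG.1.
- by apply: part_oo; [exact: normc_Re|exact: mG.1].
- exact: mG.2.
- by apply: part_oo; [exact: normc_Im|exact: mG.2].
Qed.

Lemma cint_fubini : cint m1 setT (fun x => cint m2 setT (fun y => G (x, y))) =
  cint m2 setT (fun y => cint m1 setT (fun x => G (x, y))).
Proof.
apply: complexP => /=; apply: (@Rintegral_fubini (fun xy => _ (G xy))).
- exact: mG.1.
- by apply: part_oo; [exact: normc_Re|exact: mG.1].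
- exact: mG.2.
- by apply: part_oo; [exact: normc_Im|exact: mG.2].
Qed.

End complex_fubini.

(** * Square integrable functions *)

(** Optimizing t in the weighted arithmetic-geometric mean: t = b / a gives the product. If a or b
    vanishes no optimum is attained, and a large or small t contradicts e > 0 instead.
    Cauchy-Schwarz estimates are first proved in the form of the hypothesis, which is linear in the
    two integrals. *)
Lemma amgm_opt (R : realType) (e a b : R) : 0 <= a -> 0 <= b ->
  (forall t, 0 < t -> e <= (t * a ^+ 2 + b ^+ 2 / t) / 2) -> e <= a * b.
Proof.
move=> a0 b0 h; have [e0|e0] := leP e 0; first by rewrite (le_trans e0)// mulr_ge0.
have [a00|a00] := eqVneq a 0.
  have t0 : 0 < b ^+ 2 / e + 1 by rewrite ltr_wpDl// divr_ge0// ?sqr_ge0// ltW.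
  have := h _ t0; rewrite a00 expr0n mulr0 add0r mul0r ler_pdivlMr// ler_pdivlMr//.
  rewrite mulrDr mulr1 (_ : e * 2 * (b ^+ 2 / e) = 2 * b ^+ 2); last by field; rewrite gt_eqF.
  by have := sqr_ge0 b; lra.
have {}a0 : 0 < a by rewrite lt_neqAle eq_sym a00.
have [b00|b00] := eqVneq b 0.
  have t0 : 0 < e / a ^+ 2 by rewrite divr_gt0// exprn_gt0.
  have := h _ t0; rewrite b00 expr0n mul0r addr0 mulr0 divfK ?gt_eqF ?exprn_gt0//; lra.
have {}b0 : 0 < b by rewrite lt_neqAle eq_sym b00.
have t0 : 0 < b / a by rewrite divr_gt0.
have := h _ t0.
by rewrite invf_div (_ : b / a * a ^+ 2 + b ^+ 2 * (a / b) = 2 * (a * b)); [lra|field; rewrite !gt_eqF].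
Qed.

Section L2_bounds.
Context d (T : measurableType d) (R : realType) (mu : {measure set T -> \bar R}).
Local Notation C := R[i].
Implicit Types (f g h : T -> R) (K : R).

Lemma le_integral_fin f g : measurable_fun setT f -> measurable_fun setT g ->
  (forall x, 0 <= f x) -> (forall x, f x <= g x) ->
  (\int[mu]_x (f x)%:E <= \int[mu]_x (g x)%:E)%E.
Proof.
move=> mf mg f0 fg; apply: ge0_le_integral => //.
- by move=> x _; rewrite lee_fin.
- exact/measurable_EFinP.
- exact/measurable_EFinP.
- by move=> x _; rewrite lee_fin.
Qed.

Lemma integral_finD f g : measurable_fun setT f -> measurable_fun setT g ->
  (forall x, 0 <= f x) -> (forall x, 0 <= g x) ->
  (\int[mu]_x (f x + g x)%:E = \int[mu]_x (f x)%:E + \int[mu]_x (g x)%:E)%E.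
Proof.
move=> mf mg f0 g0; under eq_integral do rewrite EFinD.
rewrite ge0_integralD//; [|exact/measurable_EFinP| |exact/measurable_EFinP];
  by move=> x _; rewrite lee_fin.
Qed.

Lemma integral_finZ (c : R) f : measurable_fun setT f -> 0 <= c ->
  (forall x, 0 <= f x) ->
  (\int[mu]_x (c * f x)%:E = c%:E * \int[mu]_x (f x)%:E)%E.
Proof.
move=> mf c0 f0; under eq_integral do rewrite EFinM.
by rewrite ge0_integralZl//; [exact/measurable_EFinP|move=> x _; rewrite lee_fin].
Qed.

(** The bound enters squared, which avoids roots of possibly infinite integrals; measurability
    belongs to the notion. *)
Definition L2le K h := measurable_fun setT h /\
  (\int[mu]_x (h x ^+ 2)%:E <= (K ^+ 2)%:E)%E.

Lemma L2le_le K h f : measurable_fun setT f -> (forall x, `|f x| <= h x) ->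
  L2le K h -> L2le K f.
Proof.
move=> mf fh [mh hK]; split=> //; apply: le_trans hK; apply: le_integral_fin.
- exact: measurable_funX.
- exact: measurable_funX.
- by move=> x; exact: sqr_ge0.
- move=> x; rewrite -[f x ^+ 2]real_normK ?num_real//.
  by rewrite ler_pXn2r// ?nnegrE// (le_trans _ (fh x)).
Qed.

Lemma L2le_leK K K' h : 0 <= K <= K' -> L2le K h -> L2le K' h.
Proof.
move=> /andP[K0 KK] [mh hK]; split=> //; rewrite (le_trans hK)// lee_fin.
by rewrite ler_pXn2r// nnegrE// (le_trans K0).
Qed.

Lemma L2le_ext K f h : (forall x, f x = h x) -> L2le K f -> L2le K h.
Proof. by move=> /funext ->. Qed.

Lemma L2le0 K : L2le K (fun=> 0).
Proof.
split; first exact: measurable_cst.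
by under eq_integral do rewrite expr0n/=; rewrite integral0 lee_fin sqr_ge0.
Qed.

Lemma L2leZ c K h : L2le K h -> L2le (`|c| * K) (fun x => c * h x).
Proof.
move=> [mh hK]; split; first exact: measurable_funM.
under eq_integral do rewrite exprMn.
rewrite integral_finZ ?sqr_ge0//; last 2 first.
- exact: measurable_funX.
- by move=> x; exact: sqr_ge0.
rewrite (_ : (`|c| * K) ^+ 2 = c ^+ 2 * K ^+ 2); last by rewrite exprMn real_normK// num_real.
by rewrite [leRHS]EFinM; apply: lee_wpmul2l => //; rewrite lee_fin sqr_ge0.
Qed.

(** For each t > 0, |f h| <= t f^2 / 2 + h^2 / (2 t) pointwise; integrating and optimizing in t by
    [amgm_opt] gives the product of the norms. *)
Lemma L2le_CS K1 K2 f h : 0 <= K1 -> 0 <= K2 -> L2le K1 f -> L2le K2 h ->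
  (\int[mu]_x (`|f x * h x|)%:E <= (K1 * K2)%:E)%E.
Proof.
move=> K10 K20 [mf fK] [mh hK].
have ub t : 0 < t -> (\int[mu]_x (`|f x * h x|)%:E <=
    ((t * K1 ^+ 2 + K2 ^+ 2 / t) / 2)%:E)%E.
  move=> t0; have t20 : 0 <= t / 2 by rewrite divr_ge0// ltW.
  have t20' : 0 <= t^-1 / 2 by rewrite divr_ge0// invr_ge0 ltW.
  apply: (@le_trans _ _ (\int[mu]_x (t / 2 * f x ^+ 2 + t^-1 / 2 * h x ^+ 2)%:E)%E).
    apply: le_integral_fin => //.
    - by apply: measurableT_comp => //; exact: measurable_funM.
    - by apply: measurable_funD; apply: measurable_funM => //; exact: measurable_funX.
    - move=> x; rewrite normrM -[f x ^+ 2]real_normK ?num_real// -[h x ^+ 2]real_normK ?num_real//.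
      rewrite -subr_ge0; set a := `|f x|; set b := `|h x|.
      rewrite (_ : _ - _ = t^-1 / 2 * (t * a - b) ^+ 2); last by field; rewrite gt_eqF.
      by rewrite mulr_ge0// sqr_ge0.
  rewrite integral_finD; last 4 first.
  - by apply: measurable_funM => //; exact: measurable_funX.
  - by apply: measurable_funM => //; exact: measurable_funX.
  - by move=> x; rewrite mulr_ge0// sqr_ge0.
  - by move=> x; rewrite mulr_ge0// sqr_ge0.
  rewrite !integral_finZ//; try exact: measurable_funX; try by move=> x; exact: sqr_ge0.
  rewrite (_ : (t * K1 ^+ 2 + K2 ^+ 2 / t) / 2 = t / 2 * K1 ^+ 2 + t^-1 / 2 * K2 ^+ 2); last by ring.
  by rewrite EFinD !EFinM leeD// lee_pmul// ?lee_fin//;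
    apply: integral_ge0 => x _; rewrite lee_fin sqr_ge0.
have fin : (\int[mu]_x (`|f x * h x|)%:E)%E \is a fin_num.
  rewrite ge0_fin_numE; first by rewrite (le_lt_trans (ub 1 ltr01))// ltry.
  by apply: integral_ge0 => x _; rewrite lee_fin.
rewrite -(fineK fin) lee_fin; apply: amgm_opt => // t t0.
by rewrite -lee_fin fineK// ub.
Qed.

Lemma L2leD K1 K2 f h : 0 <= K1 -> 0 <= K2 -> L2le K1 f -> L2le K2 h ->
  L2le (K1 + K2) (fun x => f x + h x).
Proof.
move=> K10 K20 fK1 hK2; have CS := L2le_CS K10 K20 fK1 hK2.
have [[mf fK] [mh hK]] := (fK1, hK2).
have mfh : measurable_fun setT (fun x => `|f x * h x|).
  by apply: measurableT_comp => //; exact: measurable_funM.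
split; first exact: measurable_funD.
apply: (@le_trans _ _ (\int[mu]_x (f x ^+ 2 + h x ^+ 2 + 2 * `|f x * h x|)%:E)%E).
  apply: le_integral_fin.
  - by apply: measurable_funX; exact: measurable_funD.
  - apply: measurable_funD; last exact: measurable_funM.
    by apply: measurable_funD; exact: measurable_funX.
  - by move=> x; exact: sqr_ge0.
  - by move=> x; rewrite sqrrD; have := ler_norm (f x * h x); lra.
rewrite integral_finD; last 4 first.
- by apply: measurable_funD; exact: measurable_funX.
- exact: measurable_funM.
- by move=> x; rewrite addr_ge0 ?sqr_ge0.
- by move=> x; rewrite mulr_ge0.
rewrite integral_finD ?integral_finZ//; try exact: measurable_funX; try by move=> x; exact: sqr_ge0.
rewrite (_ : (K1 + K2) ^+ 2 = K1 ^+ 2 + K2 ^+ 2 + 2 * (K1 * K2)); last by ring.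
rewrite [leRHS]EFinD; apply: leeD; first by rewrite [leRHS]EFinD; exact: leeD.
rewrite [leRHS]EFinM.
by apply: lee_wpmul2l => //; rewrite lee_fin.
Qed.

Lemma L2le_sum (f_ : nat -> T -> R) (K_ : nat -> R) N : (forall n, 0 <= K_ n) ->
  (forall n, L2le (K_ n) (f_ n)) ->
  L2le (\sum_(n < N) K_ n) (fun x => \sum_(n < N) f_ n x).
Proof.
move=> K0 fK; elim: N => [|N ih].
  by rewrite big_ord0; apply: L2le_ext (L2le0 0) => x; rewrite big_ord0.
rewrite big_ord_recr/=; have := L2leD (sumr_ge0 _ (fun (i : 'I_N) _ => K0 i)) (K0 N) ih (fK N).
by apply: L2le_ext => x; rewrite big_ord_recr.
Qed.

(* Riesz-Fischer: outside the null set [~` A] the series converges absolutely. *)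
Lemma L2_series (f_ : nat -> T -> C) (K_ : nat -> R) K :
  (forall n, cmeas setT (f_ n)) ->
  (forall n, 0 <= K_ n) -> (forall n, L2le (K_ n) (fun x => normc (f_ n x))) ->
  (forall N, \sum_(n < N) K_ n <= K) ->
  exists (A : set T) (f : T -> C) (h : T -> R), [/\ measurable A, mu (~` A) = 0%E, cmeas setT f, L2le K h &
    forall x, [/\ 0 <= h x, x \notin A -> f x = 0,
      x \in A -> forall N, \sum_(n < N) normc (f_ n x) <= h x &
      x \in A -> normc (\sum_(n < N) f_ n x - f x) @[N --> \oo] --> 0]].
Proof.
move=> mf K0 fK sK.
have K_ge0 : 0 <= K by have := sK 0%N; rewrite big_ord0.
pose H N x := \sum_(n < N) normc (f_ n x).
have H0 N x : 0 <= H N x by apply: sumr_ge0 => n _; exact: normc_ge0.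
have HL N : L2le (\sum_(n < N) K_ n) (H N) by exact: (L2le_sum N K0 fK).
have mH N : measurable_fun setT (H N) by have [] := HL N.
have ndH x : nondecreasing_seq (fun N => H N x).
  by apply/nondecreasing_seqP => N; rewrite /H big_ord_recr/= lerDl normc_ge0.
(* The squares of the partial sums of moduli increase; by monotone convergence their limit has
   integral at most K^2, hence is finite off a null set. *)
pose G x := limn (fun N => (H N x ^+ 2)%:E).
have mH2 N : measurable_fun setT (fun x => (H N x ^+ 2)%:E).
  by apply/measurable_EFinP; exact: measurable_funX.
have ndH2 x : nondecreasing_seq (fun N => (H N x ^+ 2)%:E).
  by move=> m n mn; rewrite lee_fin ler_pXn2r ?nnegrE//; exact: ndH.
have cvG x : (H N x ^+ 2)%:E @[N --> \oo] --> G x.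
  by apply: ereal_nondecreasing_is_cvgn.
have leG N x : ((H N x ^+ 2)%:E <= G x)%E.
  apply: lime_ge; first by apply: ereal_nondecreasing_is_cvgn.
  by exists N => // n /= Nn; exact: ndH2.
have G0 x : (0 <= G x)%E by apply: le_trans (leG 0%N x); rewrite lee_fin sqr_ge0.
have mG : measurable_fun setT G.
  by apply: (emeasurable_fun_cvg (fun N x => (H N x ^+ 2)%:E)).
have GK : (\int[mu]_x G x <= (K ^+ 2)%:E)%E.
  rewrite /G monotone_convergence//; last by move=> n x _; rewrite lee_fin sqr_ge0.
  apply: lime_le; last first.
    apply: nearW => N; have [_ /le_trans] := HL N; apply.
    by rewrite lee_fin ler_pXn2r ?nnegrE//; apply: sumr_ge0 => n _.
  apply: ereal_nondecreasing_is_cvgn => m n mn; apply: ge0_le_integral => //.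
  - by move=> x _; rewrite lee_fin sqr_ge0.
  - by move=> x _; exact: ndH2.
pose A := [set x | G x \is a fin_num].
have mA : measurable A.
  have := emeasurable_fin_num measurableT mG; by rewrite setTI.
have A0 : mu (~` A) = 0%E.
  have iG : mu.-integrable setT G.
    apply/integrableP; split => //; under eq_integral do rewrite gee0_abs//.
    by rewrite (le_lt_trans GK)// ltry.
  have [N [mN N0 sN]] := integrable_ae measurableT iG.
  apply/eqP; rewrite eq_le measure_ge0 andbT -N0; apply: le_measure; rewrite ?inE//.
    exact: measurableC.
  by move=> x /= Ax; apply: sN => /= /(_ I).
pose h x := Num.sqrt (fine (G x)).
have mh : measurable_fun setT h.
  apply: (measurableT_comp (continuous_measurable_fun (@sqrt_continuous R))).
  exact: (measurableT_comp (fine_measurable measurableT)).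
have hH x : x \in A -> forall N, H N x <= h x.
  rewrite inE /A/= => Gx N; rewrite -(@ler_pXn2r _ 2)// ?nnegrE ?sqrtr_ge0//.
  by rewrite sqr_sqrtr ?fine_ge0// -lee_fin fineK.
(* The indicator of [A] makes the series converge at every point, so that the limit is measurable as
   a pointwise limit and vanishes off [A]. *)
have summable (P : C -> R) x : (forall z, `|P z| <= normc z) ->
    cvgn (fun N => \sum_(n < N) P (f_ n x) * \1_A x).
  move=> Ple.
  have -> : (fun N => \sum_(n < N) P (f_ n x) * \1_A x) = series (fun n => P (f_ n x) * \1_A x).
    by apply/funext => N; rewrite /series/= big_mkord.
  apply: normed_cvg.
  rewrite (_ : [normed series _] = fun N => \sum_(n < N) `|P (f_ n x) * \1_A x|); last first.
    by apply/funext => N; rewrite -(big_mkord xpredT (fun n => `|P (f_ n x) * \1_A x|)).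
  apply: nondecreasing_is_cvgn.
    by apply/nondecreasing_seqP => N; rewrite big_ord_recr/= lerDl.
  exists (h x) => _ [N _ <-]; have [xA|xA] := boolP (x \in A); last first.
    by rewrite big1 ?sqrtr_ge0// => n _; rewrite indicE (negbTE xA) mulr0 normr0.
  apply: le_trans (hH x xA N); apply: ler_sum => n _.
  by rewrite indicE xA mulr1.
pose part (P : C -> R) x := limn (fun N => \sum_(n < N) P (f_ n x) * \1_A x).
pose f x := Complex (part (@complex.Re R) x) (part (@complex.Im R) x).
have mpart (P : C -> R) : (forall z, `|P z| <= normc z) ->
    (forall n, measurable_fun setT (fun x => P (f_ n x))) -> measurable_fun setT (part P).
  move=> Ple mP; apply: (@measurable_fun_cvg _ _ _ _ (fun N x => \sum_(n < N) P (f_ n x) * \1_A x)).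
  - move=> N; apply: measurable_sum => n; apply: measurable_funM => //.
  - by move=> x _; exact: summable.
have nRe := @normc_Re R; have nIm := @normc_Im R.
exists A, f, h; split => //.
- by split; apply: mpart => // n; have [] := mf n.
- split=> //; under eq_integral do rewrite /h sqr_sqrtr ?fine_ge0//.
  apply: le_trans GK; rewrite le_eqVlt; apply/orP; left; apply/eqP.
  apply: ae_eq_integral => //.
    by apply/measurable_EFinP; exact: (measurableT_comp (fine_measurable measurableT)).
  exists (~` A); split => //; first exact: measurableC.
  by move=> x /= + Ax; apply => _; rewrite fineK.
move=> x; split.
- exact: sqrtr_ge0.
- move=> xA; rewrite /f /part; under eq_fun do under eq_bigr do rewrite indicE (negbTE xA) mulr0.
  under [X in Complex _ (limn X)]eq_fun do under eq_bigr do rewrite indicE (negbTE xA) mulr0.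
  by rewrite (_ : (fun=> _) = fun=> 0) ?lim_cst//; apply/funext => N; rewrite big1.
- exact: hH.
- move=> xA.
  apply: (@squeeze_cvgr _ _ _ _ (fun=> 0) (fun N =>
     `|\sum_(n < N) complex.Re (f_ n x) - part (@complex.Re R) x| +
     `|\sum_(n < N) complex.Im (f_ n x) - part (@complex.Im R) x|)).
  + apply: nearW => N; rewrite normc_ge0 (le_trans (normc_le_ReIm _))//.
    by rewrite ReDc ImDc ReNc ImNc Re_sum Im_sum.
  + exact: cvg_cst.
  + have cv (P : C -> R) : (forall z, `|P z| <= normc z) ->
        `|\sum_(n < N) P (f_ n x) - part P x| @[N --> \oo] --> 0.
      move=> Ple; rewrite [X in _ --> X](_ : 0 = `|part P x - part P x|); last by rewrite subrr normr0.
      apply: cvg_norm; apply: cvgB; last exact: cvg_cst.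
      rewrite (_ : (fun N => _) = fun N => \sum_(n < N) P (f_ n x) * \1_A x); first exact: summable.
      by apply/funext => N; apply: eq_bigr => n _; rewrite indicE xA mulr1.
    by have := cvgD (cv _ nRe) (cv _ nIm); rewrite addr0; exact.
Qed.

End L2_bounds.

(** * Translation and reflection invariance, Young's inequality *)

Section lebesgue_invariance.
Variable R : realType.
Local Notation C := R[i].
Local Notation mu := (@lebesgue_measure R).

Let mtr (a : R) : measurable_fun [set: measurableTypeR R]
  (fun x : measurableTypeR R => (x + a : measurableTypeR R)).
Proof. exact: measurable_funD. Qed.

Let mopp : measurable_fun [set: measurableTypeR R]
  (fun x : measurableTypeR R => (- x : measurableTypeR R)).
Proof. exact: oppr_measurable. Qed.

(** Lebesgue measure is the only measure giving half-open intervals their length, and the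
    pushforward does so. *)
Lemma lebesgue_translation (a : R) (A : set (measurableTypeR R)) : measurable A ->
  pushforward mu (fun x : measurableTypeR R => (x + a : measurableTypeR R)) A = mu A.
Proof.
move=> mA; apply/esym.
pose nu : {measure set (measurableTypeR R) -> \bar R} :=
  measure_function_pushforward__canonical__measure_function_Measure mu (mtr a).
apply: (@lebesgue_measure_unique _ nu) => // X [[x y] xy <-].
rewrite /nu/= /pushforward (_ : _ @^-1` _ = `]x - a, y - a]%classic); last first.
  by apply/seteqP; split => z /=; rewrite !in_itv/= ltrBlDr lerBrDr.
rewrite !lebesgue_measure_itv/= !lte_fin ltrD2r -!EFinD.
by congr (if _ then _%:E else _); ring.
Qed.

Lemma lebesgue_reflection (A : set (measurableTypeR R)) : measurable A ->
  pushforward mu (fun x : measurableTypeR R => (- x : measurableTypeR R)) A = mu A.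
Proof.
move=> mA; apply/esym.
pose nu : {measure set (measurableTypeR R) -> \bar R} :=
  measure_function_pushforward__canonical__measure_function_Measure mu mopp.
apply: (@lebesgue_measure_unique _ nu) => // X [[x y] xy <-].
rewrite /nu/= /pushforward (_ : _ @^-1` _ = `[- y, - x[%classic); last first.
  by apply/seteqP; split => z /=; rewrite !in_itv/= andbC ltrNr lerNl.
rewrite !lebesgue_measure_itv/= !lte_fin ltrN2 -!EFinD opprK addrC.
by [].
Qed.

Lemma integral_translation (a : R) (f : R -> \bar R) : measurable_fun setT f ->
  (\int[mu]_x f (x + a)%R = \int[mu]_x f x)%E.
Proof.
have ge0 (g : R -> \bar R) : measurable_fun setT g -> (forall x, 0 <= g x)%E ->
    (\int[mu]_x g (x + a)%R = \int[mu]_x g x)%E.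
  move=> mg g0; transitivity (\int[pushforward mu (fun x : measurableTypeR R => (x + a : measurableTypeR R)%R)]_x g x)%E.
    have := ge0_integral_pushforward (mtr a) mu measurableT mg (fun y _ => g0 y).
    by rewrite preimage_setT => ->.
  by apply: eq_measure_integral => A mA _; exact: lebesgue_translation.
move=> mf; rewrite integralE [RHS]integralE.
congr (_ - _)%E.
  rewrite -(ge0 f^\+%E)//; last exact: measurable_funepos.
  by apply: eq_integral => x _; rewrite (funepos_comp f (fun x : R => x + a)).
rewrite -(ge0 f^\-%E)//; last exact: measurable_funeneg.
by apply: eq_integral => x _; rewrite (funeneg_comp f (fun x : R => x + a)).
Qed.

Lemma integral_reflection (f : R -> \bar R) : measurable_fun setT f ->
  (\int[mu]_x f (- x)%R = \int[mu]_x f x)%E.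
Proof.
have ge0 (g : R -> \bar R) : measurable_fun setT g -> (forall x, 0 <= g x)%E ->
    (\int[mu]_x g (- x)%R = \int[mu]_x g x)%E.
  move=> mg g0; transitivity (\int[pushforward mu (fun x : measurableTypeR R => (- x : measurableTypeR R)%R)]_x g x)%E.
    have := ge0_integral_pushforward mopp mu measurableT mg (fun y _ => g0 y).
    by rewrite preimage_setT => ->.
  by apply: eq_measure_integral => A mA _; exact: lebesgue_reflection.
move=> mf; rewrite integralE [RHS]integralE.
congr (_ - _)%E.
  rewrite -(ge0 f^\+%E)//; last exact: measurable_funepos.
  by apply: eq_integral => x _; rewrite (funepos_comp f (fun x : R => - x)).
rewrite -(ge0 f^\-%E)//; last exact: measurable_funeneg.
by apply: eq_integral => x _; rewrite (funeneg_comp f (fun x : R => - x)).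
Qed.

Lemma lebesgue_integral_sub (b : R) (f : R -> \bar R) : measurable_fun setT f ->
  (\int[mu]_x f (b - x)%R = \int[mu]_x f x)%E.
Proof.
move=> mf; rewrite -[RHS](integral_translation b)// -[RHS]integral_reflection.
  by apply: eq_integral => x _; rewrite addrC.
exact: (measurableT_comp mf (mtr b)).
Qed.

Lemma cint_translation (a : R) (g : R -> C) : cmeas setT g ->
  cint mu setT (fun x => g (x + a)) = cint mu setT g.
Proof.
move=> [m1 m2]; rewrite /cint /Rintegral.
rewrite (@integral_translation a (fun x => (complex.Re (g x))%:E)); last exact/measurable_EFinP.
by rewrite (@integral_translation a (fun x => (complex.Im (g x))%:E)); last exact/measurable_EFinP.
Qed.

Lemma measurable_conv_kernel (G H : R -> R) : measurable_fun setT G -> measurable_fun setT H ->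
  measurable_fun setT (fun xy : R * R => (G xy.2 * H (xy.1 - xy.2))%:E).
Proof.
move=> mG mH; apply/measurable_EFinP; apply: measurable_funM.
  exact: (measurableT_comp mG measurable_snd).
apply: (measurableT_comp mH); apply: measurable_funB; [exact: measurable_fst|exact: measurable_snd].
Qed.

(** Cauchy-Schwarz for the measure G(z) dz, of mass at most [a], bounds the square of the
    convolution by [a] times the convolution of G with H^2; Tonelli and translation invariance
    integrate the latter. *)
Lemma young_L1_L2 (G H : R -> R) (a K : R) : 0 < a -> 0 <= K ->
  measurable_fun setT G -> (forall x, 0 <= G x) -> (forall x, 0 <= H x) ->
  (\int[mu]_x (G x)%:E <= a%:E)%E -> L2le mu K H ->
  (\int[mu]_x (\int[mu]_z (G z * H (x - z))%:E) ^+ 2 <= ((a * K) ^+ 2)%:E)%E.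
Proof.
move=> a0 K0 mG G0 H0 Ga [mH HK].
have mGH := measurable_conv_kernel mG mH.
have mGH2 : measurable_fun setT (fun xy : R * R => (G xy.2 * H (xy.1 - xy.2) ^+ 2)%:E).
  exact: (measurable_conv_kernel mG (measurable_funX 2 mH)).
pose E x := (\int[mu]_z (G z * H (x - z))%:E)%E.
pose I x := (\int[mu]_z (G z * H (x - z) ^+ 2)%:E)%E.
have mE : measurable_fun setT E.
  apply: (@measurable_fun_fubini_tonelli_F _ _ _ _ _ mu (fun xy : R * R => (G xy.2 * H (xy.1 - xy.2))%:E)) => // x.
  by rewrite lee_fin mulr_ge0.
have mI : measurable_fun setT I.
  apply: (@measurable_fun_fubini_tonelli_F _ _ _ _ _ mu (fun xy : R * R => (G xy.2 * H (xy.1 - xy.2) ^+ 2)%:E)) => // x.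
  by rewrite lee_fin mulr_ge0// sqr_ge0.
have E0 x : (0 <= E x)%E by apply: integral_ge0 => z _; rewrite lee_fin mulr_ge0.
have I0 x : (0 <= I x)%E by apply: integral_ge0 => z _; rewrite lee_fin mulr_ge0// sqr_ge0.
have mHx x : measurable_fun setT (fun z : R => H (x - z)).
  by apply: (measurableT_comp mH); apply: measurable_funB.
have mHx2 x : measurable_fun setT (fun z : R => H (x - z) ^+ 2) := measurable_funX 2 (mHx x).
have mGHx x : measurable_fun setT (fun z : R => G z * H (x - z)) := measurable_funM mG (mHx x).
have mGHx2 x : measurable_fun setT (fun z : R => G z * H (x - z) ^+ 2) := measurable_funM mG (mHx2 x).
have ub x t : 0 < t -> (E x <= ((t / 2)%:E * \int[mu]_z (G z)%:E + (t^-1 / 2)%:E * I x)%E)%E.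
  move=> t0; rewrite -!integral_finZ//; last 4 first.
  - exact: mGHx2.
  - by rewrite divr_ge0// invr_ge0 ltW.
  - by move=> z; rewrite mulr_ge0// sqr_ge0.
  - by rewrite divr_ge0// ltW.
  rewrite -integral_finD; last 4 first.
  - exact: measurable_funM.
  - exact: (measurable_funM _ (mGHx2 x)).
  - by move=> z; rewrite mulr_ge0// divr_ge0// ltW.
  - by move=> z; rewrite !mulr_ge0// ?invr_ge0 ?sqr_ge0 ?ltW.
  apply: le_integral_fin.
  - exact: mGHx.
  - by apply: measurable_funD; [exact: measurable_funM|exact: (measurable_funM _ (mGHx2 x))].
  - by move=> z; rewrite mulr_ge0.
  - move=> z; rewrite -subr_ge0.
    apply: (@le_trans _ _ (G z * (t^-1 / 2 * (t - H (x - z)) ^+ 2))).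
      by rewrite mulr_ge0// mulr_ge0 ?sqr_ge0// divr_ge0// invr_ge0 ltW.
    by rewrite le_eqVlt; apply/orP; left; apply/eqP; field; rewrite gt_eqF.
(* [ub] with the best t; [a > 0] also settles the case of an infinite right-hand side. *)
have EI x : (E x ^+ 2 <= a%:E * I x)%E.
  have [Ioo|] := boolP (I x < +oo)%E; last first.
    by rewrite -leNgt leye_eq => /eqP ->; rewrite gt0_muley ?lte_fin// leey.
  have Ifin : I x \is a fin_num by rewrite ge0_fin_numE.
  have sqa : Num.sqrt a ^+ 2 = a by rewrite sqr_sqrtr// ltW.
  have sqI : Num.sqrt (fine (I x)) ^+ 2 = fine (I x) by rewrite sqr_sqrtr// fine_ge0.
  have {}ub t : 0 < t -> (E x <= ((t * Num.sqrt a ^+ 2 + Num.sqrt (fine (I x)) ^+ 2 / t) / 2)%:E)%E.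
    move=> t0; apply: le_trans (ub x t t0) _.
    rewrite sqa sqI mulrDl EFinD; apply: leeD.
      rewrite (_ : t * a / 2 = t / 2 * a); last by ring.
      by rewrite [leRHS]EFinM; apply: lee_wpmul2l => //; rewrite lee_fin divr_ge0// ltW.
    by rewrite -{1}(fineK Ifin) -EFinM lee_fin mulrC mulrA.
  have Efin : E x \is a fin_num by rewrite ge0_fin_numE// (le_lt_trans (ub 1 ltr01))// ltry.
  have : fine (E x) <= Num.sqrt a * Num.sqrt (fine (I x)).
    by apply: amgm_opt; rewrite ?sqrtr_ge0// => t t0; rewrite -lee_fin fineK// ub.
  rewrite -(@ler_pXn2r _ 2) ?nnegrE ?mulr_ge0 ?sqrtr_ge0 ?fine_ge0//.
  rewrite exprMn sqa sqI => h.
  by rewrite -(fineK Efin) -(fineK Ifin) -EFin_expe -EFinM lee_fin.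
have IK : (\int[mu]_x I x <= (a * K ^+ 2)%:E)%E.
  rewrite /I (@fubini_tonelli _ _ _ _ _ mu mu (fun xy : R * R => (G xy.2 * H (xy.1 - xy.2) ^+ 2)%:E))//; last first.
    by move=> x; rewrite lee_fin mulr_ge0// sqr_ge0.
  rewrite (_ : (\int[mu]_y _)%E = (\int[mu]_z ((G z)%:E * \int[mu]_x (H x ^+ 2)%:E))%E); last first.
    apply: eq_integral => z _; rewrite /= integral_finZ//; last 2 first.
    - by apply: measurable_funX; apply: (measurableT_comp mH); exact: measurable_funB.
    - by move=> x; exact: sqr_ge0.
    rewrite (@integral_translation (- z) (fun x : R => (H x ^+ 2)%:E))//.
    by apply/measurable_EFinP; exact: measurable_funX.
  rewrite ge0_integralZr//; last 3 first.
  - exact/measurable_EFinP.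
  - by move=> z _; rewrite lee_fin.
  - by apply: integral_ge0 => z _; rewrite lee_fin sqr_ge0.
  rewrite EFinM; apply: lee_pmul => //; apply: integral_ge0 => z _; rewrite lee_fin//.
  exact: sqr_ge0.
apply: (@le_trans _ _ (\int[mu]_x (a%:E * I x))%E).
  apply: ge0_le_integral => //.
  - by move=> x _; exact: (expe_ge0 2 (E0 x)).
  - by apply: emeasurable_funM.
  - by apply: emeasurable_funM.
  - by move=> x _; exact: EI.
rewrite ge0_integralZl//; last by rewrite lee_fin ltW.
apply: (@le_trans _ _ (a%:E * (a * K ^+ 2)%:E)%E).
  by apply: lee_wpmul2l => //; rewrite lee_fin ltW.
by rewrite -EFinM lee_fin (_ : a * (a * K ^+ 2) = (a * K) ^+ 2)//; ring.
Qed.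

End lebesgue_invariance.

(** * The Abel kernel and Bessel's inequality *)

Section poisson_kernel.
Variable R : realType.
Local Notation C := R[i].
Local Notation mu := (@lebesgue_measure R).
Local Notation Re := (@complex.Re R).
Local Notation Im := (@complex.Im R).

Let mscal (a : R) : measurable_fun [set: measurableTypeR R]
  (fun x : measurableTypeR R => (a * x : measurableTypeR R)).
Proof. exact: measurable_funM. Qed.

Lemma integral_scale (a : R) (f : R -> \bar R) : 0 < a ->
  measurable_fun setT f -> (forall x, 0 <= f x)%E ->
  (a%:E * \int[mu]_x f (a * x)%R = \int[mu]_x f x)%E.
Proof.
move=> a0 mf f0.
pose nu : {measure set (measurableTypeR R) -> \bar R} :=
  measure_function_pushforward__canonical__measure_function_Measure mu (mscal a).
pose r : {nonneg R} := NngNum (ltW a0).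
have scE (A : set (measurableTypeR R)) : measurable A -> mscale r nu A = mu A.
  move=> mA; apply/esym.
  apply: (@lebesgue_measure_unique _ (mscale r nu)) => // X [[x y] xy <-].
  rewrite [RHS](_ : _ = (a%:E * mu ((fun t : measurableTypeR R => (a * t : measurableTypeR R)%R) @^-1` `]x, y]%classic))%E)//=.
  rewrite (_ : (_ @^-1` _) = `]x / a, y / a]%classic); last first.
    by apply/seteqP; split => z /=; rewrite !in_itv/= ltr_pdivrMr// ler_pdivlMr// mulrC.
  rewrite !lebesgue_measure_itv/= !lte_fin ltr_pM2r ?invr_gt0//; case: ifPn => _; last by rewrite mule0.
  by rewrite -!EFinD -EFinM; congr _%:E; field; rewrite gt_eqF.
transitivity (\int[mscale r nu]_x f x)%E; last first.
  by apply: eq_measure_integral => A mA _; exact: scE.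
rewrite ge0_integral_mscale//; congr (_ * _)%E.
have := ge0_integral_pushforward (mscal a) mu measurableT mf (fun y _ => f0 y).
by rewrite preimage_setT => ->.
Qed.

(** Abel's summation factor: it regularizes the inversion integral, and its transform is the Poisson
    kernel ([cint_abel_expi]). *)
Definition abel (e x : R) : R := expR (- (e * `|x|)).

Lemma abel_ge0 e x : 0 <= abel e x.
Proof. exact: expR_ge0. Qed.

Lemma measurable_abel e : measurable_fun [set: R] (abel e).
Proof.
apply: measurableT_comp => //; apply: measurable_funN; exact: measurable_funM.
Qed.

Lemma continuous_abel e : continuous (abel e).
Proof.
move=> x; apply: (@continuous_comp _ _ _ (fun x => - (e * `|x|)) expR).
  apply: cvgN; apply: cvgM; first exact: cvg_cst.
  exact: norm_continuous.
exact: continuous_expR.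
Qed.

(* [abel_cos e z] antiderivative of exp(-e x) cos (z x). *)
Let prim (e z x : R) := expR (- (e * x)) * (z * sin (z * x) - e * cos (z * x)) / (e ^+ 2 + z ^+ 2).

(** The summand 1 keeps the integrand nonnegative, so that the fundamental theorem on a half-line
    for nonnegative functions applies; the cosine integral is later recovered by subtraction. *)
Lemma integral_abel_1cos (e z : R) : 0 < e ->
  (\int[mu]_x (abel e x * (1 + cos (z * x)))%:E = (2 * (e^-1 + e / (e ^+ 2 + z ^+ 2)))%:E)%E.
Proof.
move=> e0; have ez : 0 < e ^+ 2 + z ^+ 2 by rewrite ltr_pwDl ?exprn_gt0// sqr_ge0.
rewrite ge0_symfun_integralT; last 3 first.
- by move=> x; rewrite mulr_ge0 ?abel_ge0//; have := cos_geN1 (z * x); lra.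
- move=> x; apply: cvgM; first exact: continuous_abel.
  apply: cvgD; first exact: cvg_cst.
  apply: (@continuous_comp _ _ _ (fun x => z * x) cos); last exact: continuous_cos.
  by apply: cvgM; [exact: cvg_cst|exact: cvg_id].
- by move=> x; rewrite /= /abel normrN mulrN cosN.
rewrite EFinM; congr (_ * _)%E.
pose F (x : R) : R := - e^-1 * expR (- (e * x)) + prim e z x.
have dF (x : R) : is_derive x 1 F (expR (- (e * x)) * (1 + cos (z * x))).
  have he : is_derive x 1 (fun x : R => expR (- (e * x))) (expR (- (e * x)) * - e).
    apply: (@is_derive1_comp _ expR (fun x : R => - (e * x))).
    by apply: is_derive_eq; rewrite /GRing.scale/=; ring.
  have hs : is_derive x 1 (fun x : R => sin (z * x)) (cos (z * x) * z).
    apply: (@is_derive1_comp _ sin (fun x : R => z * x)).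
    by apply: is_derive_eq; rewrite /GRing.scale/=; ring.
  have hc : is_derive x 1 (fun x : R => cos (z * x)) (- sin (z * x) * z).
    apply: (@is_derive1_comp _ cos (fun x : R => z * x)).
    by apply: is_derive_eq; rewrite /GRing.scale/=; ring.
  apply: is_derive_eq; rewrite /GRing.scale/=; field.
  by rewrite !gt_eqF.
have cF : continuous F.
  by move=> x; apply/differentiable_continuous/derivable1_diffP; have [] := dF x.
have F0 : F 0 = - (e^-1 + e / (e ^+ 2 + z ^+ 2)).
  by rewrite /F /prim !mulr0 oppr0 expR0 sin0 cos0; field; rewrite !gt_eqF.
transitivity (0%:E - (F 0)%:E)%E; last by rewrite F0 EFinN oppeK add0e.
rewrite -(@ge0_continuous_FTC2y _ (fun x => expR (- (e * x)) * (1 + cos (z * x))) F 0 0).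
- rewrite set_itvcy; apply: eq_integral => x; rewrite inE/= => x0.
  by rewrite /abel ger0_norm.
- by move=> x _; rewrite mulr_ge0 ?expR_ge0//; have := cos_geN1 (z * x); lra.
- apply: continuous_subspaceT => x; apply: cvgM.
    apply: (@continuous_comp _ _ _ (fun x : R => - (e * x)) expR); last exact: continuous_expR.
    by apply: cvgN; apply: cvgM; [exact: cvg_cst|exact: cvg_id].
  apply: cvgD; first exact: cvg_cst.
  apply: (@continuous_comp _ _ _ (fun x => z * x) cos); last exact: continuous_cos.
  by apply: cvgM; [exact: cvg_cst|exact: cvg_id].
(* [b] bounds the bracket that multiplies e^{-e x} in [F], whence [F] tends to 0 at infinity. *)
- pose b := e^-1 + (`|z| + e) / (e ^+ 2 + z ^+ 2).
  have exp0 : b * expR (- (e * x)) @[x --> +oo%R] --> b * 0.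
    apply: cvgM; first exact: cvg_cst.
    apply: (@cvg_comp _ _ _ (fun x : R => e * x) (fun x => expR (- x)) _ +oo%R); last exact: cvgr_expR.
    apply/cvgryPge => A; exists (A / e); split; rewrite ?num_real// => x /ltW.
    by rewrite ler_pdivrMr// mulrC.
  have Fb x : `|F x| <= b * expR (- (e * x)).
    have -> : F x = expR (- (e * x)) * (- e^-1 + (z * sin (z * x) - e * cos (z * x)) / (e ^+ 2 + z ^+ 2)).
      by rewrite /F /prim; ring.
    rewrite normrM ger0_norm ?expR_ge0// mulrC ler_pM2r ?expR_gt0//.
    rewrite (le_trans (ler_normD _ _))// normrN gtr0_norm ?invr_gt0// lerD2l.
    rewrite normrM [`|_^-1|]gtr0_norm ?invr_gt0// ler_pM2r ?invr_gt0//.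
    rewrite (le_trans (ler_normB _ _))// !normrM [`|e|]gtr0_norm//.
    by rewrite lerD// ?ler_piMr ?sin_max ?cos_max// ltW.
  rewrite mulr0 in exp0.
  apply/norm_cvg0P; apply: (squeeze_cvgr _ (cvg_cst 0) exp0).
  by apply: nearW => x; rewrite normr_ge0 Fb.
- by move=> x _; have [] := dF x.
- by apply: cvg_at_right_filter; exact: cF.
- by move=> x _; rewrite derive1E; have [_ ->] := dF x.
Qed.

Lemma integral_abel (e : R) : 0 < e -> (\int[mu]_x (abel e x)%:E = (2 / e)%:E)%E.
Proof.
move=> e0; have := integral_abel_1cos 0 e0.
under eq_integral do rewrite mul0r cos0 mulrC.
rewrite integral_finZ//; last 2 first.
- exact: measurable_abel.
- exact: abel_ge0.
rewrite expr0n addr0 (_ : e^-1 + e / e ^+ 2 = 2 / e); last by field; rewrite gt_eqF.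
move=> /(congr1 (fun y => (2^-1)%:E * y)%E); rewrite muleA -!EFinM !mulrA.
by rewrite -natr1 mulVf// mul1e mul1r.
Qed.

Lemma cintegrable_abel (e : R) (k : R -> C) : 0 < e -> cmeas setT k ->
  (forall x, normc (k x) <= 1) -> cintegrable mu setT (fun x => (abel e x)%:C%C * k x).
Proof.
move=> e0 mk k1; apply: (@le_cintegrable _ _ _ mu setT measurableT _ (abel e)).
- by apply: cmeasM => //; apply: cmeas_real; exact: measurable_abel.
- exact: measurable_abel.
- by move=> x _; rewrite normcM normc_real ger0_norm ?abel_ge0// ler_piMr ?abel_ge0.
- by rewrite integral_abel// ltry.
Qed.

(** Normalized as the transform of [abel e]: the total mass is 2 pi ([integral_poisson]), and the
    kernel concentrates at 0 as e tends to 0. *)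
Definition poisson (e z : R) : R := 2 * e / (e ^+ 2 + z ^+ 2).

(** Real part: the difference of [integral_abel_1cos] and [integral_abel]. Imaginary part: the
    integrand is odd, so the integral equals its own opposite. *)
Lemma cint_abel_expi (e z : R) : 0 < e ->
  cint mu setT (fun x => (abel e x)%:C%C * cexpi (z * x)) = (poisson e z)%:C%C.
Proof.
move=> e0; have mz : measurable_fun [set: R] (fun x : R => z * x) by exact: measurable_funM.
have ik : cintegrable mu setT (fun x => (abel e x)%:C%C * cexpi (z * x)).
  by apply: cintegrable_abel => //; [exact: cmeas_expi|move=> x; rewrite normc_expi].
have ir := integrable_Re measurableT ik; have ii := integrable_Im measurableT ik.
have ia : mu.-integrable setT (EFin \o abel e).
  apply/integrableP; split; first by apply/measurable_EFinP; exact: measurable_abel.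
  under eq_integral do rewrite /= ger0_norm ?abel_ge0//.
  by rewrite integral_abel// ltry.
apply: complexP => /=.
  have := integral_abel_1cos z e0; have := integral_abel e0.
  rewrite (_ : (fun x : R => (abel e x * (1 + cos (z * x)))%:E) =
    (fun x : R => (abel e x + Re ((abel e x)%:C%C * cexpi (z * x)))%:E)); last first.
    by apply/funext => x; rewrite ReMc/= mul0r subr0 mulrDr mulr1.
  move=> h1 /(congr1 fine)/=.
  have := RintegralD measurableT ia ir; rewrite /Rintegral => -> /=.
  rewrite h1/= => h2.
  apply: (@addrI _ (2 / e)); rewrite h2 /poisson; field.
  by rewrite !gt_eqF// ltr_pwDl ?exprn_gt0// sqr_ge0.
have : \int[mu]_x Im ((abel e x)%:C%C * cexpi (z * x)) = - \int[mu]_x Im ((abel e x)%:C%C * cexpi (z * x)).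
  rewrite {1}/Rintegral -integral_reflection; last by case/integrableP : ii.
  rewrite -mulN1r -RintegralZl//; congr fine; apply: eq_integral => x _; congr _%:E.
  by rewrite !ImMc/= /abel normrN mulrN sinN !mul0r !addr0; ring.
have h0 (t : R) : t = - t -> t = 0 by lra.
by move=> /h0.
Qed.

Lemma poisson_ge0 e z : 0 < e -> 0 <= poisson e z.
Proof. by move=> e0; rewrite divr_ge0// ?mulr_ge0 ?ltW// ltr_pwDl ?exprn_gt0// sqr_ge0. Qed.

Lemma poissonN e z : poisson e (- z) = poisson e z.
Proof. by rewrite /poisson sqrrN. Qed.

Lemma continuous_poisson (e : R) : 0 < e -> continuous (poisson e).
Proof.
move=> e0 x; apply: cvgM; first exact: cvg_cst.
apply: cvgV; first by rewrite gt_eqF// ltr_pwDl ?exprn_gt0// sqr_ge0.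
by apply: cvgD; [exact: cvg_cst|exact: exprn_continuous].
Qed.

Lemma measurable_poisson (e : R) : 0 < e -> measurable_fun [set: R] (poisson e).
Proof. by move=> e0; apply: continuous_measurable_fun; exact: continuous_poisson. Qed.

Lemma poisson_scale (e z : R) : 0 < e -> e * poisson e (e * z) = poisson 1 z.
Proof.
move=> e0; rewrite /poisson; field.
rewrite (_ : e * e + e * z * (e * z) = e ^+ 2 * (1 + z ^+ 2)); last by ring.
by rewrite !gt_eqF ?mulr_gt0 ?exprn_gt0// ?expr1n ?ltr_pwDl// ?sqr_ge0.
Qed.

Lemma integral_poisson (e : R) : 0 < e -> (\int[mu]_z (poisson e z)%:E = (2 * pi)%:E)%E.
Proof.
move=> e0.
rewrite -(@integral_scale e)//; last 2 first.
- by apply/measurable_EFinP; exact: measurable_poisson.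
- by move=> x; rewrite lee_fin poisson_ge0.
rewrite -integral_finZ//=; last 3 first.
- apply: (measurableT_comp (measurable_poisson e0)); exact: measurable_funM.
- exact: ltW.
- by move=> x; exact: poisson_ge0.
under eq_integral do rewrite poisson_scale//.
rewrite ge0_symfun_integralT; last 3 first.
- by move=> x; exact: poisson_ge0.
- exact: continuous_poisson.
- by move=> x; rewrite /= poissonN.
rewrite EFinM; congr (_ * _)%E.
transitivity (pi%:E - (2 * atan 0 : R)%:E)%E; last by rewrite atan0 mulr0 sube0.
rewrite -(@ge0_continuous_FTC2y _ (poisson 1) (fun x => 2 * atan x) 0 pi).
- by rewrite set_itvcy; apply: eq_integral.
- by move=> x _; exact: poisson_ge0.
- by apply: continuous_subspaceT; exact: continuous_poisson.
- rewrite (_ : pi = 2 * (pi / 2)); last by field.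
  by apply: cvgM; [exact: cvg_cst|exact: cvgy_atan].
- by move=> x _; apply: derivableM => //; exact: derivable_atan.
- apply: cvg_at_right_filter; apply: cvgM; first exact: cvg_cst.
  exact: continuous_atan.
- move=> x _; have h : is_derive (x : R) 1 (@atan R) (1 + x ^+ 2)^-1.
    by apply: DeriveDef; [exact: derivable_atan|rewrite -derive1E derive1_atan].
  have [_ ] : is_derive (x : R) 1 (fun x : R => 2 * atan x) (2 * (1 + x ^+ 2)^-1) by apply: is_derive_eq.
  by rewrite derive1E => ->; rewrite /poisson expr1n mulr1.
Qed.

End poisson_kernel.

(** * Fourier integrals of integrable functions *)

Section fourier_L1.
Variable R : realType.
Local Notation C := R[i].
Local Notation mu := (@lebesgue_measure R).
Local Notation Re := (@complex.Re R).
Local Notation Im := (@complex.Im R).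
Implicit Types (g h : R -> C).

Local Notation cintR := (cint mu setT).
Local Notation cinteg := (cintegrable mu setT).
Local Notation cmeasR := (@cmeas _ (measurableTypeR R) R setT).

(* [s = -1] gives the Fourier transform, [s = 1] its inverse, up to (2 pi)^(-1/2). *)
Definition tf (s : R) g (y : R) : C := cintR (fun x => g x * cexpi (s * (x * y))).

Lemma cintegrable_mulb g (k : R -> C) : cinteg g -> cmeasR k ->
  (forall x, normc (k x) <= 1) -> cinteg (fun x => g x * k x).
Proof.
move=> [mg goo] mk k1.
apply: (@le_cintegrable _ _ _ mu setT measurableT _ (fun x => normc (g x))) => //.
- exact: cmeasM.
- exact: measurable_normc.
- by move=> x _; rewrite normcM ler_piMr// normc_ge0.
Qed.

Lemma measurable_expi1 (s y : R) : cmeasR (fun x : R => cexpi (s * (x * y))).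
Proof. by apply: cmeas_expi; apply: measurable_funM => //; exact: measurable_funM. Qed.

Lemma normc_tf (s : R) g y : cinteg g ->
  ((normc (tf s g y))%:E <= \int[mu]_x (normc (g x))%:E)%E.
Proof.
move=> [mg goo]; apply: le_trans.
  by apply: normc_cint_le => //; apply: cmeasM => //; exact: measurable_expi1.
by under eq_integral do rewrite normcM normc_expi mulr1.
Qed.

Lemma kernel_bound (k : R * R -> C) (w h : R -> C) : cinteg w -> cinteg h ->
  cmeas setT k -> (forall xy, normc (k xy) <= 1) ->
  (\int[mu]_x \int[mu]_y (normc (w x * k (x, y) * h y))%:E < +oo)%E.
Proof.
move=> [mw woo] [mh hoo] mk k1.
apply: (@le_lt_trans _ _ (\int[mu]_x ((normc (w x))%:E * \int[mu]_y (normc (h y))%:E))%E).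
  apply: ge0_le_integral => //.
  - by move=> x _; apply: integral_ge0 => y _; rewrite lee_fin normc_ge0.
  - apply: (@measurable_fun_fubini_tonelli_F _ _ _ _ _ mu (fun xy => (normc (w xy.1 * k xy * h xy.2))%:E)).
      apply/measurable_EFinP; apply: measurable_normc; apply: cmeasM.
        apply: cmeasM => //; exact: (cmeas_comp mw measurable_fst).
      exact: (cmeas_comp mh measurable_snd).
    by move=> x; rewrite lee_fin normc_ge0.
  - apply: emeasurable_funM; last exact: measurable_cst.
    by apply/measurable_EFinP; exact: measurable_normc.
  - move=> x _; rewrite -integral_finZ ?normc_ge0//; [|exact: measurable_normc|by move=> y; exact: normc_ge0].
    apply: le_integral_fin.
    + apply: measurable_normc; apply: cmeasM => //; apply: cmeasM; first exact: cmeas_cst.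
      exact: (cmeas_comp mk (pair1_measurable x)).
    + by apply: measurable_funM => //; exact: measurable_normc.
    + by move=> y; exact: normc_ge0.
    + by move=> y; rewrite !normcM ler_wpM2r ?normc_ge0// ler_piMr ?normc_ge0.
rewrite ge0_integralZr//; last 3 first.
- by apply/measurable_EFinP; exact: measurable_normc.
- by move=> x _; rewrite lee_fin normc_ge0.
- by apply: integral_ge0 => y _; rewrite lee_fin normc_ge0.
by rewrite lte_mul_pinfty// ?integral_ge0// => [x _|]; rewrite ?lee_fin ?normc_ge0// ge0_fin_numE// integral_ge0// => x _; rewrite lee_fin normc_ge0.
Qed.

Let cmeas_k (k : R * R -> C) (w h : R -> C) : cmeasR w -> cmeasR h -> cmeas setT k ->
  cmeas setT (fun xy : R * R => w xy.1 * k xy * h xy.2).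
Proof.
move=> mw mh mk; apply: cmeasM; last exact: (cmeas_comp mh measurable_snd).
by apply: cmeasM => //; exact: (cmeas_comp mw measurable_fst).
Qed.

Let cinteg_k (k : R * R -> C) (h : R -> C) x : cinteg h -> cmeas setT k ->
  (forall xy, normc (k xy) <= 1) -> cinteg (fun y => k (x, y) * h y).
Proof.
move=> ih mk k1.
rewrite (_ : (fun _ => _) = (fun y => h y * k (x, y))); last by apply/funext => y; rewrite mulrC.
by apply: cintegrable_mulb => //; exact: (cmeas_comp mk (pair1_measurable x)).
Qed.

(** Fubini asks for integrability in x as well, which a bounded kernel does not give over the whole
    line: the integrable weight [abel 1] is inserted and divided out again. *)
Lemma cmeas_kernel (k : R * R -> C) (h : R -> C) : cinteg h ->
  cmeas setT k -> (forall xy, normc (k xy) <= 1) ->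
  cmeasR (fun x => cintR (fun y => k (x, y) * h y)).
Proof.
move=> ih mk k1.
have ia : cinteg (fun x => (abel 1 x)%:C%C).
  have := @cintegrable_abel R 1 (fun=> 1) ltr01 (cmeas_cst _ _).
  under eq_fun do rewrite mulr1; apply => x; by rewrite normc1.
have ma := ia.1; have mh := ih.1.
have m1 := @cmeas_cint _ _ (measurableTypeR R) (measurableTypeR R) R mu mu
  (fun xy => (abel 1 xy.1)%:C%C * k xy * h xy.2) (cmeas_k ma mh mk) (kernel_bound ia ih mk k1).
have -> : (fun x => cintR (fun y => k (x, y) * h y)) = (fun x : R => (abel 1 x)^-1%:C%C *
    cintR (fun y => (abel 1 x)%:C%C * k (x, y) * h y)).
  apply/funext => x.
  rewrite (_ : (fun y => (abel 1 x)%:C%C * k (x, y) * h y) = fun y => (abel 1 x)%:C%C * (k (x, y) * h y)); last first.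
    by apply/funext => y; rewrite mulrA.
  rewrite (cintZ measurableT _ (cinteg_k x ih mk k1)).
  by rewrite mulrA -rmorphM mulVf ?mul1r// gt_eqF// expR_gt0.
apply: cmeasM; last exact: m1.
apply: cmeas_real.
rewrite (_ : (fun x => _) = (fun x : R => expR (`|x|))); last first.
  by apply/funext => x; rewrite /abel -expRN opprK mul1r.
by apply: measurableT_comp => //; exact: normr_measurable.
Qed.

Lemma cint_swap (k : R * R -> C) g h : cinteg g -> cinteg h ->
  cmeas setT k -> (forall xy, normc (k xy) <= 1) ->
  cintR (fun x => g x * cintR (fun y => k (x, y) * h y)) =
  cintR (fun y => h y * cintR (fun x => k (x, y) * g x)).
Proof.
move=> ig ih mk k1; have mg := ig.1; have mh := ih.1.
have := @cint_fubini _ _ (measurableTypeR R) (measurableTypeR R) R mu mu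
  (fun xy => g xy.1 * k xy * h xy.2) (cmeas_k mg mh mk) (kernel_bound ig ih mk k1).
rewrite /= => fub.
transitivity (cintR (fun x => cintR (fun y => g x * k (x, y) * h y))).
  apply: eq_cint => x _; rewrite -(cintZ measurableT _ (cinteg_k x ih mk k1)).
  by apply: eq_cint => y _; rewrite mulrA.
rewrite fub; apply: eq_cint => y _.
have mk' : cmeas setT (fun yx : R * R => k (yx.2, yx.1)).
  by apply: (cmeas_comp mk); apply: measurable_fun_pair; [exact: measurable_snd|exact: measurable_fst].
have ik : cinteg (fun x => k (x, y) * g x) := cinteg_k y ig mk' (fun xy => k1 _).
rewrite -(cintZ measurableT _ ik).
have mul3 (a b c : C) : a * b * c = c * (b * a) by ring.
by apply: eq_cint => x _; exact: mul3.
Qed.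

Lemma cmeas_tf (s : R) g : cinteg g -> cmeasR (tf s g).
Proof.
move=> ig; have := @cmeas_kernel (fun yx : R * R => cexpi (s * (yx.2 * yx.1))) g ig.
rewrite /tf; under [X in _ -> _ -> cmeas _ X]eq_fun do under eq_cint do rewrite mulrC.
apply; last by move=> xy; rewrite normc_expi.
apply: cmeas_expi; apply: measurable_funM => //; apply: measurable_funM.
  exact: measurable_snd.
exact: measurable_fst.
Qed.

Lemma cinteg_abel_tf (e s : R) h : 0 < e -> cinteg h ->
  cinteg (fun x => (abel e x)%:C%C * tf s h x).
Proof.
move=> e0 ih; pose N := fine (\int[mu]_x (normc (h x))%:E).
have Nfin : (\int[mu]_x (normc (h x))%:E)%E \is a fin_num.
  rewrite ge0_fin_numE; first exact: ih.2.
  by apply: integral_ge0 => x _; rewrite lee_fin normc_ge0.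
apply: (@le_cintegrable _ _ _ mu setT measurableT _ (fun x => N * abel e x)).
- by apply: cmeasM; [apply: cmeas_real; exact: measurable_abel|exact: cmeas_tf].
- by apply: measurable_funM => //; exact: measurable_abel.
- move=> x _; rewrite normcM normc_real ger0_norm ?abel_ge0// mulrC ler_wpM2r ?abel_ge0//.
  by rewrite -lee_fin /N fineK// normc_tf.
- rewrite integral_finZ ?integral_abel//; last 3 first.
  + exact: measurable_abel.
  + by rewrite fine_ge0// integral_ge0// => x _; rewrite lee_fin normc_ge0.
  + exact: abel_ge0.
  by rewrite -EFinM ltry.
Qed.

Lemma poisson_sign (e s z : R) : s ^+ 2 = 1 -> poisson e (s * z) = poisson e z.
Proof. by move=> s1; rewrite /poisson exprMn s1 mul1r. Qed.

(** Inversion with the Abel factor inserted: exchanging the integrals leaves the transform of the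
    factor, hence a convolution with the Poisson kernel. The sign [s] covers the transform and its
    inverse at once, the kernel being even. *)
Lemma tf_abel_tf (e s : R) h y : 0 < e -> s ^+ 2 = 1 -> cinteg h ->
  tf s (fun x => (abel e x)%:C%C * tf (- s) h x) y =
  cintR (fun x => h x * (poisson e (y - x))%:C%C).
Proof.
move=> e0 s1 ih.
have ia : cinteg (fun x => (abel e x)%:C%C).
  have := @cintegrable_abel R e (fun=> 1) e0 (cmeas_cst _ _).
  under eq_fun do rewrite mulr1; apply => x; by rewrite normc1.
have mk : cmeas setT (fun xy : R * R => cexpi (s * (xy.1 * (y - xy.2)))).
  apply: cmeas_expi; apply: measurable_funM => //; apply: measurable_funM; first exact: measurable_fst.
  by apply: measurable_funB => //; exact: measurable_snd.
have k1 (xy : R * R) : normc (cexpi (s * (xy.1 * (y - xy.2)))) <= 1 by rewrite normc_expi.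
transitivity (cintR (fun x => (abel e x)%:C%C * cintR (fun t => cexpi (s * (x * (y - t))) * h t))).
  rewrite /tf; apply: eq_cint => x _; rewrite -mulrA; congr (_ * _).
  rewrite mulrC -cintZ//; last first.
    by apply: cintegrable_mulb => //; [exact: measurable_expi1|move=> t; rewrite normc_expi].
  apply: eq_cint => t _; rewrite mulrCA mulrC -cexpiD; congr (cexpi _ * _); ring.
rewrite (@cint_swap (fun xy : R * R => cexpi (s * (xy.1 * (y - xy.2)))) _ _ ia ih mk k1).
apply: eq_cint => x _; congr (_ * _); rewrite -(poisson_sign _ _ s1) -cint_abel_expi//.
by apply: eq_cint => t _; rewrite mulrC; congr (_ * cexpi _) => /=; ring.
Qed.

(** Parseval's formula before the limit: as e tends to 0 the Abel factor tends to 1 and the Poisson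
    mean to 2 pi times the identity. Bessel's inequality and Parseval against indicators are both
    taken from here. *)
Lemma cint_abel_tf2 (e s : R) g h : 0 < e -> s ^+ 2 = 1 -> cinteg g -> cinteg h ->
  cintR (fun x => (abel e x)%:C%C * tf (- s) h x * tf s g x) =
  cintR (fun y => g y * cintR (fun x => h x * (poisson e (y - x))%:C%C)).
Proof.
move=> e0 s1 ig ih.
have iw := cinteg_abel_tf (- s) e0 ih.
have mk : cmeas setT (fun xy : R * R => cexpi (s * (xy.2 * xy.1))).
  apply: cmeas_expi; apply: measurable_funM => //; apply: measurable_funM.
    exact: measurable_snd.
  exact: measurable_fst.
transitivity (cintR (fun x => (abel e x)%:C%C * tf (- s) h x *
    cintR (fun t => cexpi (s * (t * x)) * g t))).
  by apply: eq_cint => x _; congr (_ * _); apply: eq_cint => t _; rewrite mulrC.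
rewrite (@cint_swap (fun xy : R * R => cexpi (s * (xy.2 * xy.1))) _ _ iw ig mk); last first.
  by move=> xy; rewrite normc_expi.
apply: eq_cint => y _; rewrite -(tf_abel_tf y e0 s1 ih) /tf; congr (_ * _).
by apply: eq_cint => t _; rewrite mulrC; congr (_ * cexpi (_ * _)); rewrite mulrC.
Qed.

End fourier_L1.

Section fatou.
Context d (T : measurableType d) (R : realType) (mu : {measure set T -> \bar R}).

Lemma ae_mono (P Q : T -> Prop) : (forall x, P x -> Q x) ->
  {ae mu, forall x, P x} -> {ae mu, forall x, Q x}.
Proof. by move=> PQ; apply: filterS. Qed.

Lemma ae_and (P Q : T -> Prop) : {ae mu, forall x, P x} -> {ae mu, forall x, Q x} ->
  {ae mu, forall x, P x /\ Q x}.
Proof. by apply: filterS2. Qed.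

Lemma L2le_lim (f_ : nat -> T -> R) (f : T -> R) K : measurable_fun setT f ->
  (forall n, L2le mu K (f_ n)) -> {ae mu, forall x, f_ n x @[n --> \oo] --> f x} ->
  L2le mu K f.
Proof.
move=> mf fK cvf; split=> //.
have mfn n : measurable_fun setT (f_ n) by have [] := fK n.
have mf2 n : measurable_fun setT (fun x => (f_ n x ^+ 2)%:E).
  by apply/measurable_EFinP; exact: measurable_funX.
apply: (@le_trans _ _ (\int[mu]_x limn_einf (fun n => (f_ n x ^+ 2)%:E))%E).
  rewrite le_eqVlt; apply/orP; left; apply/eqP; apply: ae_eq_integral => //.
  - by apply/measurable_EFinP; exact: measurable_funX.
  - rewrite (_ : (fun x => _) = (fun x => - limn_esup (fun n => - (f_ n x ^+ 2)%:E)))%E; last first.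
      apply/funext => x; rewrite -limn_einfN; congr limn_einf; apply/funext => n /=.
      by rewrite opprK.
    apply: measurableT_comp => //; apply: measurable_fun_limn_esup => n.
    exact: measurableT_comp.
  - apply: filterS cvf => x h _.
    have h2 : (f_ n x ^+ 2)%:E @[n --> \oo] --> (f x ^+ 2)%:E.
      apply: cvg_EFin; first by apply: nearW.
      by rewrite expr2; exact: (cvgM h h).
    by have [-> _] := cvg_limn_einf_sup h2.
apply: le_trans.
  apply: fatou => //.
  by move=> n x _; rewrite lee_fin sqr_ge0.
apply: le_trans (limn_einf_sup _) _.
rewrite limn_esup_lim; apply: lime_le.
  exact: is_cvg_esups.
apply: nearW => n; apply: ub_ereal_sup => _ [k _ <-].
by have [] := fK k.
Qed.

End fatou.

Section bessel.
Variable R : realType.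
Local Notation C := R[i].
Local Notation mu := (@lebesgue_measure R).
Implicit Types (g h : R -> C).
Local Notation cintR := (cint mu setT).
Local Notation cinteg := (cintegrable mu setT).
Local Notation cmeasR := (@cmeas _ (measurableTypeR R) R setT).

Lemma poisson_le (e z : R) : 0 < e -> poisson e z <= 2 / e.
Proof.
move=> e0; rewrite /poisson ler_pdivrMr ?ltr_pwDl ?exprn_gt0 ?sqr_ge0//.
rewrite mulrDr (_ : 2 / e * e ^+ 2 = 2 * e); last by field; rewrite gt_eqF.
by rewrite lerDl mulr_ge0 ?sqr_ge0// divr_ge0// ltW.
Qed.

(** The lemmas on kernels ask for modulus at most 1; e / 2 is the inverse of the maximum of
    [poisson e]. *)
Lemma normc_poisson_scaled (e z : R) : 0 < e -> normc (e / 2 * poisson e z)%:C%C <= 1.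
Proof.
move=> e0; rewrite normc_real ger0_norm; last first.
  by rewrite mulr_ge0 ?poisson_ge0// divr_ge0// ltW.
have := poisson_le z e0; rewrite ler_pdivlMr// => h1.
by rewrite mulrAC ler_pdivrMr// mul1r mulrC.
Qed.

Lemma poisson_scaledE (e y x : R) (c : C) : 0 < e ->
  c * (poisson e (y - x))%:C%C = (2 / e)%:C%C * ((e / 2 * poisson e (y - x))%:C%C * c).
Proof.
move=> e0; rewrite mulrA -rmorphM mulrC; congr (_%:C%C * _).
by field; rewrite gt_eqF.
Qed.

Lemma cinteg_poisson (e y : R) h : 0 < e -> cinteg h ->
  cinteg (fun x => h x * (poisson e (y - x))%:C%C).
Proof.
move=> e0 ih.
rewrite (_ : (fun x => _) = fun x => (2 / e)%:C%C * (h x * (e / 2 * poisson e (y - x))%:C%C)); last first.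
  by apply/funext => x; rewrite poisson_scaledE// [_ * h x]mulrC.
apply: cintegrableZ => //; apply: cintegrable_mulb => //.
  apply: cmeas_real; apply: measurable_funM => //.
  by apply: (measurableT_comp (measurable_poisson e0)); exact: measurable_funB.
by move=> x; exact: normc_poisson_scaled.
Qed.

Lemma cint_real (f : R -> R) : cintR (fun x => (f x)%:C%C) = (\int[mu]_x f x)%:C%C.
Proof. by apply: complexP => //=; rewrite /Rintegral integral0_eq. Qed.

(** [cint_abel_tf2] with [h] the conjugate of [g]: the left side becomes the weighted integral of
    the squared transform, the right side the pairing of g with a Poisson mean [P] of its conjugate,
    of L^2 norm at most 2 pi K by Young's inequality. *)
Lemma bessel_abel (e s K : R) g : 0 < e -> s ^+ 2 = 1 -> 0 <= K -> cinteg g ->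
  L2le mu K (fun x => normc (g x)) ->
  (\int[mu]_x (abel e x * normc (tf s g x) ^+ 2)%:E <= (2 * pi * K ^+ 2)%:E)%E.
Proof.
move=> e0 s1 K0 ig gK; have [mg goo] := ig.
have igc : cinteg (fun y => (g y)^*%C).
  by split; [exact: cmeas_conj|under eq_integral do rewrite normc_conj].
have cM (a b : C) : (a * b)^*%C = a^*%C * b^*%C by exact: rmorphM.
have conj_tf x : (tf s g x)^*%C = tf (- s) (fun y => (g y)^*%C) x.
  rewrite /tf -cint_conj//; last first.
    by apply: cintegrable_mulb => //; [exact: measurable_expi1|move=> t; rewrite normc_expi].
  by apply: eq_cint => t _; rewrite cM cexpi_conj mulNr.
have mtf := cmeas_tf s ig.
have mabs : measurable_fun setT (fun x => abel e x * normc (tf s g x) ^+ 2).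
  apply: measurable_funM; first exact: measurable_abel.
  by apply: measurable_funX; exact: measurable_normc.
pose N := fine (\int[mu]_x (normc (g x))%:E).
have Nfin : (\int[mu]_x (normc (g x))%:E)%E \is a fin_num.
  by rewrite ge0_fin_numE//; apply: integral_ge0 => x _; rewrite lee_fin normc_ge0.
have N0 : 0 <= N by rewrite fine_ge0// integral_ge0// => x _; rewrite lee_fin normc_ge0.
have tfN x : normc (tf s g x) <= N by rewrite -lee_fin /N fineK// normc_tf.
have abs_ge0 x : 0 <= abel e x * normc (tf s g x) ^+ 2 by rewrite mulr_ge0 ?abel_ge0 ?sqr_ge0.
have Xfin : (\int[mu]_x (abel e x * normc (tf s g x) ^+ 2)%:E)%E \is a fin_num.
  rewrite ge0_fin_numE; last by apply: integral_ge0 => x _; rewrite lee_fin.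
  apply: (@le_lt_trans _ _ (\int[mu]_x (N ^+ 2 * abel e x)%:E)%E).
    apply: le_integral_fin => //.
      by apply: measurable_funM => //; exact: measurable_abel.
    move=> x; rewrite mulrC ler_wpM2r ?abel_ge0// ler_pXn2r// nnegrE//.
    exact: normc_ge0.
  rewrite integral_finZ ?sqr_ge0 ?integral_abel// -?EFinM ?ltry//.
    exact: measurable_abel.
  exact: abel_ge0.
pose P y := cintR (fun x => (g x)^*%C * (poisson e (y - x))%:C%C).
have XE : (fine (\int[mu]_x (abel e x * normc (tf s g x) ^+ 2)%:E))%:C%C =
    cintR (fun y => g y * P y).
  rewrite -(cint_abel_tf2 e0 s1 ig igc) -cint_real; apply: eq_cint => x _.
  have mul3 (a b c : C) : a * b * c = a * (c * b) by ring.
  by rewrite -conj_tf mul3 mulc_conj -rmorphM.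
have mP : cmeasR P.
  rewrite (_ : P = fun y => (2 / e)%:C%C * cintR (fun x => (e / 2 * poisson e (y - x))%:C%C * (g x)^*%C)); last first.
    apply/funext => y; rewrite /P; under eq_cint do rewrite (poisson_scaledE _ _ _ e0).
    rewrite cintZ//; under eq_fun do rewrite mulrC.
    apply: cintegrable_mulb => //; last by move=> x; exact: normc_poisson_scaled.
    apply: cmeas_real; apply: measurable_funM => //.
    by apply: (measurableT_comp (measurable_poisson e0)); exact: measurable_funB.
  apply: cmeasZ; apply: (@cmeas_kernel _ (fun yx => (e / 2 * poisson e (yx.1 - yx.2))%:C%C)) => //.
    apply: cmeas_real; apply: measurable_funM => //.
    apply: (measurableT_comp (measurable_poisson e0)).
    by apply: measurable_funB; [exact: measurable_fst|exact: measurable_snd].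
  by move=> yx; exact: normc_poisson_scaled.
have pi0 : 0 < 2 * pi :> R by rewrite mulr_gt0// pi_gt0.
have LP : L2le mu (2 * pi * K) (fun y => normc (P y)).
  split; first exact: measurable_normc.
  have := @young_L1_L2 R (poisson e) (fun x => normc (g x)) (2 * pi) K pi0 K0
    (measurable_poisson e0) (fun x => poisson_ge0 x e0) (fun x => normc_ge0 (g x)).
  rewrite integral_poisson// lexx => /(_ isT gK); apply: le_trans.
  have PE y : ((normc (P y))%:E <= \int[mu]_z (poisson e z * normc (g (y - z)))%:E)%E.
    apply: le_trans; first by apply: normc_cint_le => //; have [] := cinteg_poisson y e0 igc.
    rewrite -[leLHS](lebesgue_integral_sub y); last first.
      by apply/measurable_EFinP; apply: measurable_normc; have [] := cinteg_poisson y e0 igc.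
    rewrite le_eqVlt; apply/orP; left; apply/eqP; apply: eq_integral => z _.
    by rewrite normcM normc_conj normc_real ger0_norm ?poisson_ge0// opprB addrCA subrr addr0 mulrC.
  apply: ge0_le_integral => //.
  - by move=> y _; rewrite lee_fin sqr_ge0.
  - by apply/measurable_EFinP; apply: measurable_funX; exact: measurable_normc.
  - have mY : measurable_fun setT (fun y : R => \int[mu]_z (poisson e z * normc (g (y - z)))%:E)%E.
      apply: (@measurable_fun_fubini_tonelli_F _ _ _ _ _ mu (fun xy : R * R => (poisson e xy.2 * normc (g (xy.1 - xy.2)))%:E)).
        exact: (@measurable_conv_kernel R (poisson e) (fun x => normc (g x)) (measurable_poisson e0) (measurable_normc mg)).
      by move=> x; rewrite lee_fin mulr_ge0 ?normc_ge0 ?poisson_ge0.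
    exact: emeasurable_funM.
  - move=> y _; rewrite EFin_expe !expe2; apply: lee_pmul => //; exact: normc_ge0.
have mg' : L2le mu K (fun x => normc (g x)) by [].
rewrite -(fineK Xfin) lee_fin.
have -> : fine (\int[mu]_x (abel e x * normc (tf s g x) ^+ 2)%:E) = normc (cintR (fun y => g y * P y)).
  by rewrite -XE normc_real ger0_norm// fine_ge0// integral_ge0// => x _; rewrite lee_fin.
rewrite -lee_fin; apply: le_trans.
  by apply: normc_cint_le => //; exact: cmeasM.
have piK0 : 0 <= 2 * pi * K by rewrite mulr_ge0// ltW.
have := L2le_CS K0 piK0 mg' LP.
under eq_integral do rewrite ger0_norm ?mulr_ge0 ?normc_ge0// -normcM.
by rewrite mulrCA expr2 mulrA.
Qed.

Lemma bessel (s K : R) g : s ^+ 2 = 1 -> 0 <= K -> cinteg g ->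
  L2le mu K (fun x => normc (g x)) ->
  L2le mu (Num.sqrt (2 * pi) * K) (fun x => normc (tf s g x)).
Proof.
move=> s1 K0 ig gK.
have mtf : measurable_fun setT (fun x => normc (tf s g x)) by apply: measurable_normc; exact: cmeas_tf.
(* The rate is halved because the factor gets squared: its square is the Abel factor of
   [bessel_abel]. *)
apply: (@L2le_lim _ (measurableTypeR R) R mu (fun n x => abel (n.+1%:R^-1 / 2) x * normc (tf s g x))) => //.
  move=> n; split; first by apply: measurable_funM => //; exact: measurable_abel.
  rewrite exprMn sqr_sqrtr; last by rewrite mulr_ge0// pi_ge0.
  have n0 : 0 < n.+1%:R^-1 :> R by rewrite invr_gt0.
  apply: le_trans (bessel_abel n0 s1 K0 ig gK).
  rewrite le_eqVlt; apply/orP; left; apply/eqP; apply: eq_integral => x _; congr _%:E.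
  rewrite exprMn; congr (_ * _); rewrite /abel expr2 -expRD; congr expR; field.
  by rewrite addrC natr1.
apply: aeW => x; rewrite -[X in _ --> X]mul1r; apply: cvgM; last exact: cvg_cst.
have h1 : - (n.+1%:R^-1 / 2 * `|x|) @[n --> \oo] --> (0 : R).
  rewrite -oppr0 -(mul0r `|x|) -(mul0r (2^-1)); apply: cvgN; apply: cvgM; last exact: cvg_cst.
  by apply: cvgM; [exact: cvg_harmonic|exact: cvg_cst].
have : expR (- (n.+1%:R^-1 / 2 * `|x|)) @[n --> \oo] --> expR (0 : R).
  by apply: continuous_cvg h1; exact: continuous_expR.
by rewrite expR0.
Qed.

Local Notation ind a b := (\1_`[a, b]%classic : R -> R).

Lemma measurable_ind (a b : R) : measurable_fun [set: R] (ind a b).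
Proof. by apply: measurable_indic; exact: measurable_itv. Qed.

Lemma ind_01 (a b x : R) : 0 <= ind a b x <= 1.
Proof. by rewrite indicE; case: (_ \in _); rewrite /= ?lexx ?ler01. Qed.

Lemma ind_continuous (a b y : R) : y != a -> y != b -> {for y, continuous (ind a b)}.
Proof.
move=> ya yb; have : \forall z \near y, ind a b y = ind a b z.
  rewrite !indicE; have [|yin] := boolP (y \in `[a, b]%classic).
    rewrite inE/= in_itv/= => /andP[ay yb'].
    have : y \in `]a, b[ by rewrite in_itv/= !lt_neqAle eq_sym ya yb ay yb'.
    move=> /near_in_itv; apply: filterS => z; rewrite in_itv/= => /andP[az zb].
    by rewrite indicE mem_set//= in_itv/= !ltW.
  have [yltab|by_] : y < a \/ b < y.
    apply/orP; move: yin; apply: contraNT; rewrite negb_or -!leNgt => /andP[h1 h2].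
    by rewrite mem_set//= in_itv/= h1 h2.
  - have : y \in `]y - 1, a[ by rewrite in_itv/= yltab ltrBlDr ltrDl ltr01.
    move=> /near_in_itv; apply: filterS => z; rewrite in_itv/= => /andP[_ za].
    by rewrite indicE memNset//= in_itv/= leNgt za.
  - have : y \in `]b, y + 1[ by rewrite in_itv/= by_ ltrDl ltr01.
    move=> /near_in_itv; apply: filterS => z; rewrite in_itv/= => /andP[bz _].
    by rewrite indicE memNset//= in_itv/= [z <= b]leNgt bz andbF.
move=> h; rewrite /continuous_at; apply: cvg_trans (near_eq_cvg h) _.
exact: cvg_cst.
Qed.

(** Rescaling fixes the kernel to [poisson 1] and moves the parameter into the argument of [h];
    dominated convergence then uses continuity at the single point [y]. *)
Lemma poisson_approx (h : R -> R) y : measurable_fun setT h -> (forall x, 0 <= h x <= 1) ->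
  {for y, continuous h} ->
  \int[mu]_x (h x * poisson n.+1%:R^-1 (y - x)) @[n --> \oo] --> 2 * pi * h y.
Proof.
move=> mh h01 ch.
have h0 x : 0 <= h x by case/andP : (h01 x).
have e0 n : 0 < n.+1%:R^-1 :> R by rewrite invr_gt0.
have mY (e : R) : 0 < e -> measurable_fun setT (fun x : R => h (y - x) * poisson e x).
  move=> e_gt0; apply: measurable_funM; last exact: measurable_poisson.
  by apply: (measurableT_comp mh); exact: measurable_funB.
have mf n : measurable_fun setT (fun z : R => h (y - n.+1%:R^-1 * z) * poisson 1 z).
  apply: measurable_funM; last exact: measurable_poisson.
  by apply: (measurableT_comp mh); apply: measurable_funB => //; exact: measurable_funM.
have E n : (\int[mu]_x (h x * poisson n.+1%:R^-1 (y - x))%:E =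
    \int[mu]_z (h (y - n.+1%:R^-1 * z) * poisson 1 z)%:E)%E.
  rewrite -(lebesgue_integral_sub y); last first.
    apply/measurable_EFinP; apply: measurable_funM => //.
    by apply: (measurableT_comp (measurable_poisson (e0 n))); exact: measurable_funB.
  under eq_integral do rewrite opprB addrCA subrr addr0.
  rewrite -[LHS](@integral_scale _ _ (fun x => (h (y - x) * poisson n.+1%:R^-1 x)%:E) (e0 n)); last 2 first.
  - by apply/measurable_EFinP; exact: mY.
  - by move=> x; rewrite lee_fin mulr_ge0// poisson_ge0.
  have mz : measurable_fun setT (fun z : R => n.+1%:R^-1 * z) by exact: measurable_funM.
  have mYz : measurable_fun setT (fun z : R => h (y - n.+1%:R^-1 * z) * poisson n.+1%:R^-1 (n.+1%:R^-1 * z)).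
    exact: (measurableT_comp (mY _ (e0 n)) mz).
  rewrite -(integral_finZ mu mYz (ltW (e0 n))); last by move=> x; rewrite mulr_ge0// poisson_ge0.
  by apply: eq_integral => z _; rewrite mulrCA poisson_scale.
rewrite /Rintegral; under eq_fun do rewrite E.
have ip : mu.-integrable setT (EFin \o poisson (1 : R)).
  apply/integrableP; split; first by apply/measurable_EFinP; exact: measurable_poisson.
  under eq_integral do rewrite /= ger0_norm ?poisson_ge0//.
  by rewrite integral_poisson// ltry.
have [|||||_ _ cv] := @dominated_convergence _ _ _ mu setT measurableT
   (fun n z => (h (y - n.+1%:R^-1 * z) * poisson 1 z)%:E) (fun z => (h y * poisson 1 z)%:E)
   (EFin \o poisson 1).
- by move=> n; apply/measurable_EFinP; exact: mf.
- by apply/measurable_EFinP; apply: measurable_funM => //; exact: measurable_poisson.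
- apply: aeW => z _; apply: cvg_EFin; first by apply: nearW.
  rewrite (_ : fine \o _ = fun n => h (y - n.+1%:R^-1 * z) * poisson 1 z)//.
  apply: cvgM; last exact: cvg_cst.
  apply: continuous_cvg => //; rewrite -[X in _ --> X]subr0; apply: cvgB; first exact: cvg_cst.
  by rewrite -(mul0r z); apply: cvgM; [exact: cvg_harmonic|exact: cvg_cst].
- exact: ip.
- apply: aeW => z n _; rewrite /= lee_fin normrM !ger0_norm ?poisson_ge0//.
  by rewrite ler_piMl ?poisson_ge0//; case/andP : (h01 (y - n.+1%:R^-1 * z)).
rewrite (_ : 2 * pi * h y = fine (\int[mu]_z (h y * poisson 1 z)%:E)); last first.
  rewrite integral_finZ//; last 2 first.
  - exact: measurable_poisson.
  - by move=> x; exact: poisson_ge0.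
  by rewrite integral_poisson//= mulrC.
apply: fine_cvg; rewrite fineK; first exact: cv.
rewrite integral_finZ//; last 2 first.
- exact: measurable_poisson.
- by move=> x; exact: poisson_ge0.
by rewrite integral_poisson.
Qed.

Lemma cinteg_ind (a b : R) : cinteg (fun x => (ind a b x)%:C%C).
Proof.
split; first by apply: cmeas_real; exact: measurable_ind.
have foo : (lebesgue_measure (`[a, b]%classic : set R) < +oo)%E.
  by rewrite lebesgue_measure_itv/= lte_fin; case: ifPn => _; rewrite -?EFinB ltry.
have n_ind x : normc (ind a b x)%:C%C = ind a b x.
  by rewrite normc_real ger0_norm//; have /andP[] := ind_01 a b x.
under eq_integral do rewrite n_ind.
have := @integral_indic _ _ _ mu setT measurableT `[a, b]%classic (measurable_itv _).
by rewrite setIT => ->.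
Qed.

Lemma ae_neq2 (a b : R) : {ae mu, forall y : R, y != a /\ y != b}.
Proof.
exists ([set a] `|` [set b]); split; first exact: measurableU.
- by apply: countable_lebesgue_measure0; apply: finite_set_countable; exact: finite_set2.
- move=> y /= /not_andP[] /negP; rewrite negbK => /eqP ->; [by left|by right].
Qed.

Lemma L2le_ind (a b : R) : exists2 K, 0 <= K & L2le mu K (ind a b).
Proof.
have [m foo] := cinteg_ind a b.
exists (Num.sqrt (fine (\int[mu]_x (normc (ind a b x)%:C%C)%:E))); first exact: sqrtr_ge0.
split; first exact: measurable_ind.
rewrite sqr_sqrtr; last by rewrite fine_ge0// integral_ge0// => x _; rewrite lee_fin normc_ge0.
rewrite fineK; last first.
  by rewrite ge0_fin_numE//; apply: integral_ge0 => x _; rewrite lee_fin normc_ge0.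
rewrite le_eqVlt; apply/orP; left; apply/eqP; apply: eq_integral => x _; congr _%:E.
by rewrite normc_real indicE; case: (_ \in _); rewrite /= ?normr1 ?normr0 ?expr1n ?expr0n.
Qed.

(* Parseval against the indicator of an interval; letting the Abel factor tend to 1. *)
Lemma cint_tf_ind (s K a b : R) g : s ^+ 2 = 1 -> 0 <= K -> cinteg g -> L2le mu K (fun x => normc (g x)) ->
  cintR (fun x => tf (- s) (fun y => (ind a b y)%:C%C) x * tf s g x) =
  (2 * pi)%:C%C * cintR (fun x => g x * (ind a b x)%:C%C).
Proof.
move=> s1 K0 ig gK; have mg := ig.1; have ii := cinteg_ind a b.
have s1' : (- s) ^+ 2 = 1 by rewrite sqrrN.
pose h x := (ind a b x)%:C%C.
have [Ki Ki0 indK] := L2le_ind a b.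
have hK : L2le mu Ki (fun x => normc (h x)).
  apply: L2le_le indK; first by apply: measurable_normc; exact: ii.1.
  by move=> x; rewrite /h normc_real normr_id ger0_norm//; have /andP[] := ind_01 a b x.
have tg := bessel s1 K0 ig gK; have th := bessel s1' Ki0 ii hK.
set Kg := Num.sqrt _ * K in tg; set Kh := Num.sqrt _ * _ in th.
have Kg0 : 0 <= Kg by rewrite mulr_ge0// sqrtr_ge0.
have Kh0 : 0 <= Kh by rewrite mulr_ge0// sqrtr_ge0.
have CS := L2le_CS Kh0 Kg0 th tg.
pose e (n : nat) : R := n.+1%:R^-1.
have e0 n : 0 < e n by rewrite invr_gt0.
pose F x := tf (- s) h x * tf s g x.
have mF : cmeasR F by apply: cmeasM; exact: cmeas_tf.
have iF : mu.-integrable setT (EFin \o (fun x => normc (F x))).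
  apply/integrableP; split; first by apply/measurable_EFinP; exact: measurable_normc.
  apply: le_lt_trans (ltry (Kh * Kg)); apply: le_trans CS.
  by rewrite le_eqVlt; apply/orP; left; apply/eqP; apply: eq_integral => x _; rewrite /comp /F normcM.
pose Q n y := cintR (fun x => h x * (poisson (e n) (y - x))%:C%C).
have QE n y : Q n y = (\int[mu]_x (ind a b x * poisson (e n) (y - x)))%:C%C.
  by rewrite -cint_real; apply: eq_cint => x _; rewrite /h -rmorphM.
have QL n : cintR (fun x => (abel (e n) x)%:C%C * F x) = cintR (fun y => g y * Q n y).
  by rewrite /F -(cint_abel_tf2 (e0 n) s1 ig ii); apply: eq_cint => x _; rewrite mulrA.
(* Left side: the product of the two transforms is integrable by Bessel and Cauchy-Schwarz, so the
   Abel factor may tend to 1. *)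
have c1 : normc (cintR (fun x => (abel (e n) x)%:C%C * F x) - cintR F) @[n --> \oo] --> 0.
  apply: (cint_dct measurableT _ mF iF).
  - by move=> n; apply: cmeasM => //; apply: cmeas_real; exact: measurable_abel.
  - apply: aeW => x _.
    rewrite (_ : (fun n => _) = fun n => `|abel (e n) x - 1| * normc (F x)); last first.
      by apply/funext => n; rewrite -normc_real rmorphB -normcM rmorph1 mulrBl mul1r.
    rewrite -[X in _ --> X](mul0r (normc (F x))); apply: cvgM; last exact: cvg_cst.
    apply/norm_cvg0P; rewrite -(subrr (1 : R)); apply: cvgB; last exact: cvg_cst.
    have h1 : - (e n * `|x|) @[n --> \oo] --> (0 : R).
      rewrite -oppr0 -(mul0r `|x|); apply: cvgN; apply: cvgM; last exact: cvg_cst.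
      exact: cvg_harmonic.
    have : expR (- (e n * `|x|)) @[n --> \oo] --> expR (0 : R).
      by apply: continuous_cvg h1; exact: continuous_expR.
    by rewrite expR0.
  - move=> n x _; rewrite normcM normc_real ger0_norm ?abel_ge0// ler_piMl ?normc_ge0//.
    by rewrite /abel -expR0 ler_expR oppr_le0 mulr_ge0// ltW.
have mQ n : cmeasR (Q n).
  rewrite (_ : Q n = fun y => (2 / e n)%:C%C * cintR (fun x => (e n / 2 * poisson (e n) (y - x))%:C%C * h x)); last first.
    apply/funext => y; rewrite /Q; under eq_cint do rewrite (poisson_scaledE _ _ _ (e0 n)).
    rewrite cintZ//; under eq_fun do rewrite mulrC.
    apply: cintegrable_mulb => //; last by move=> x; exact: normc_poisson_scaled.
    apply: cmeas_real; apply: measurable_funM => //.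
    by apply: (measurableT_comp (measurable_poisson (e0 n))); exact: measurable_funB.
  apply: cmeasZ; apply: (@cmeas_kernel _ (fun yx => (e n / 2 * poisson (e n) (yx.1 - yx.2))%:C%C)) => //.
    apply: cmeas_real; apply: measurable_funM => //.
    apply: (measurableT_comp (measurable_poisson (e0 n))).
    by apply: measurable_funB; [exact: measurable_fst|exact: measurable_snd].
  by move=> yx; exact: normc_poisson_scaled.
have Qle n y : normc (Q n y) <= 2 * pi.
  rewrite -lee_fin -(integral_poisson (e0 n)).
  have iP : cinteg (fun x => h x * (poisson (e n) (y - x))%:C%C) := cinteg_poisson y (e0 n) ii.
  apply: le_trans; first by apply: normc_cint_le => //; exact: iP.1.
  rewrite -(@lebesgue_integral_sub _ y (fun z => (poisson (e n) z)%:E)); last first.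
    by apply/measurable_EFinP; exact: measurable_poisson.
  apply: le_integral_fin.
  - by apply: measurable_normc; exact: iP.1.
  - by apply: (measurableT_comp (measurable_poisson (e0 n))); exact: measurable_funB.
  - by move=> x; exact: normc_ge0.
  - move=> x; have /andP[i0 i1] := ind_01 a b x.
    by rewrite normcM !normc_real !ger0_norm ?poisson_ge0// ler_piMl ?poisson_ge0.
(* Right side: the Poisson mean of the indicator tends to 2 pi times the indicator except at the two
   end points, under the majorant 2 pi |g|. *)
have c2 : normc (cintR (fun y => g y * Q n y) - cintR (fun y => g y * ((2 * pi)%:C%C * h y))) @[n --> \oo] --> 0.
  apply: (@cint_dct _ _ _ mu setT measurableT _ _ (fun y => 2 * pi * normc (g y))).
  - by move=> n; exact: cmeasM.
  - by apply: cmeasM => //; apply: cmeasZ; exact: ii.1.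
  - apply/integrableP; split.
      by apply/measurable_EFinP; apply: measurable_funM => //; exact: measurable_normc.
    have pi2 : 0 <= 2 * pi :> R by rewrite mulr_ge0// pi_ge0.
    have n2 y : `|2 * pi * normc (g y)| = 2 * pi * normc (g y).
      by rewrite ger0_norm// mulr_ge0// normc_ge0.
    under eq_integral do rewrite /comp abse_EFin n2.
    rewrite integral_finZ//; last 2 first.
    + exact: measurable_normc.
    + by move=> x; exact: normc_ge0.
    by rewrite lte_mul_pinfty//; exact: ig.2.
  - apply: ae_mono (ae_neq2 a b) => y [ya yb] _.
    rewrite (_ : (fun n => _) = fun n => normc (g y) * `|(\int[mu]_x (ind a b x * poisson (e n) (y - x))) - 2 * pi * ind a b y|); last first.
      by apply/funext => n; rewrite QE /h -rmorphM -mulrBr -rmorphB normcM normc_real.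
    rewrite -[X in _ --> X](mulr0 (normc (g y))); apply: cvgM; first exact: cvg_cst.
    apply/norm_cvg0P; rewrite -(subrr (2 * pi * ind a b y)); apply: cvgB; last exact: cvg_cst.
    apply: poisson_approx; [exact: measurable_ind|exact: ind_01|exact: ind_continuous].
  - by move=> n y _; rewrite normcM mulrC ler_wpM2r ?normc_ge0.
rewrite (_ : (fun y => g y * ((2 * pi)%:C%C * h y)) = fun y => (2 * pi)%:C%C * (g y * h y)) in c2; last first.
  by apply/funext => y; rewrite mulrCA.
rewrite cintZ// in c2; last first.
  apply: cintegrable_mulb => //; first exact: ii.1.
  by move=> x; rewrite normc_real; have /andP[i0 i1] := ind_01 a b x; rewrite ger0_norm.
apply/eqP; rewrite -subr_eq0 -normc_eq0; apply/eqP.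
set L := cintR _; set M := (_ * _).
have hle n : normc (L - M) <= normc (cintR (fun x => (abel (e n) x)%:C%C * F x) - L) + normc (cintR (fun y => g y * Q n y) - M).
  rewrite QL [X in _ <= X + _]normcB (le_trans _ (le_normcD _ _))// subrKA//.
apply/eqP; rewrite eq_le normc_ge0 andbT.
exact: (le_cvg hle (cvg0D c1 c2)).
Qed.

End bessel.

(** * The Fourier transform on L2 *)

Section fourier_L2.
Variable R : realType.
Local Notation C := R[i].
Local Notation mu := (@lebesgue_measure R).
Local Notation Re := (@complex.Re R).
Local Notation Im := (@complex.Im R).
Implicit Types (g h u v : R -> C).
Local Notation cintR := (cint mu setT).
Local Notation cinteg := (cintegrable mu setT).
Local Notation cmeasR := (@cmeas _ (measurableTypeR R) R setT).
Local Notation ind a b := (\1_`[a, b]%classic : R -> R).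
Local Notation c0 := (Num.sqrt (2 * pi : R))^-1.

Lemma ler_dist_normc (z w : C) : `|normc z - normc w| <= normc (z - w).
Proof.
rewrite ler_norml lerBlDr [_ <= _ - _]lerBrDr addrC lerBlDr; apply/andP; split.
  by have := le_normcD z (w - z); rewrite addrC subrK normcB.
by have := le_normcD (z - w) w; rewrite subrK.
Qed.

Definition L2f u := cmeasR u /\ exists2 K, 0 <= K & L2le mu K (fun x => normc (u x)).

Lemma L2fB u v : L2f u -> L2f v -> L2f (fun x => u x - v x).
Proof.
move=> [mu_ [K K0 uK]] [mv [L L0 vL]]; split; first exact: cmeasB.
exists (K + L); first exact: addr_ge0.
apply: L2le_le (L2leD K0 L0 uK vL); first by apply: measurable_normc; exact: cmeasB.
by move=> x; rewrite ger0_norm ?normc_ge0// le_normcB.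
Qed.

Lemma cintegrable_L2M u v : L2f u -> L2f v -> cinteg (fun x => u x * v x).
Proof.
move=> [mu_ [K K0 uK]] [mv [L L0 vL]]; split; first exact: cmeasM.
apply: le_lt_trans (ltry (K * L)); apply: le_trans (L2le_CS K0 L0 uK vL).
rewrite le_eqVlt; apply/orP; left; apply/eqP; apply: eq_integral => x _.
by rewrite -normcM ger0_norm ?normc_ge0.
Qed.

Lemma cintMBl u v w : L2f u -> L2f v -> L2f w ->
  cintR (fun x => (u x - v x) * w x) = cintR (fun x => u x * w x) - cintR (fun x => v x * w x).
Proof.
move=> uL vL wL; rewrite -cintB//; try exact: cintegrable_L2M.
by apply: eq_cint => x _; rewrite mulrBl.
Qed.

Lemma normc_cint_CS (K L : R) u v : cmeasR u -> cmeasR v -> 0 <= K -> 0 <= L ->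
  L2le mu K (fun x => normc (u x)) -> L2le mu L (fun x => normc (v x)) ->
  normc (cintR (fun x => u x * v x)) <= K * L.
Proof.
move=> mu_ mv K0 L0 uK vL; rewrite -lee_fin; apply: le_trans.
  by apply: normc_cint_le => //; exact: cmeasM.
apply: le_trans (L2le_CS K0 L0 uK vL).
rewrite le_eqVlt; apply/orP; left; apply/eqP; apply: eq_integral => x _.
by rewrite -normcM ger0_norm ?normc_ge0.
Qed.

Lemma L2f_ind (a b : R) : L2f (fun x => (ind a b x)%:C%C).
Proof.
split; first by have [] := cinteg_ind a b.
have [K K0 [m h]] := L2le_ind a b; exists K => //.
apply: L2le_le (conj m h); first by apply: measurable_normc; have [] := cinteg_ind a b.
by move=> x; rewrite normc_real normr_id ger0_norm//; have /andP[] := ind_01 a b x.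
Qed.

Definition trunc (a : R) u x : C := (ind (- a) a x)%:C%C * u x.

Lemma normc_trunc a u x : normc (trunc a u x) <= normc (u x).
Proof.
have /andP[i0 i1] := ind_01 (- a) a x.
by rewrite normcM normc_real ger0_norm// ler_piMl ?normc_ge0.
Qed.

Lemma trunc_tail_le a b u x : a <= b -> normc (u x - trunc b u x) <= normc (u x - trunc a u x).
Proof.
move=> ab; rewrite /trunc !indicE.
have [xa|_] := boolP (x \in `[- a, a]%classic).
  rewrite mem_set ?mul1r ?subrr//; move: xa; rewrite inE/= !in_itv/= => /andP[h1 h2].
  by rewrite (le_trans _ h1) ?(le_trans h2)// lerN2.
rewrite mul0r subr0; case: (_ \in _); rewrite ?mul1r ?subrr ?mul0r ?subr0//.
by rewrite normc0 normc_ge0.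
Qed.

Lemma L2f_trunc a u : L2f u -> L2f (trunc a u).
Proof.
move=> [mu_ [K K0 uK]]; have m : cmeasR (trunc a u).
  by apply: cmeasM => //; have [] := cinteg_ind (- a) a.
split=> //; exists K => //; apply: L2le_le uK; first exact: measurable_normc.
by move=> x; rewrite ger0_norm ?normc_ge0// normc_trunc.
Qed.

Lemma cinteg_trunc a u : L2f u -> cinteg (trunc a u).
Proof. by move=> uL; apply: cintegrable_L2M => //; exact: L2f_ind. Qed.

(** Dominated convergence along integer truncations; the tail decreases with the truncation, which
    gives all larger real [a]. *)
Lemma L2_tail u (e : R) : L2f u -> 0 < e -> exists A : nat, forall a : R, A%:R <= a ->
  L2le mu e (fun x => normc (u x - trunc a u x)).
Proof.
move=> uL e0; have [mu_ [K K0 [mK uK]]] := uL.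
have mt a : measurable_fun setT (fun x => normc (u x - trunc a u x)).
  by apply: measurable_normc; apply: cmeasB => //; have [] := L2f_trunc a uL.
have [|||||_ _ cv] := @dominated_convergence _ _ _ mu setT measurableT
   (fun n x => (normc (u x - trunc n%:R u x) ^+ 2)%:E) (cst 0%E)
   (fun x => (normc (u x) ^+ 2)%:E).
- by move=> n; apply/measurable_EFinP; exact: (measurable_funX 2 (mt n%:R)).
- exact: measurable_cst.
- apply: aeW => x _; apply: cvg_near_cst.
  near=> n; rewrite /trunc indicE mem_set ?mul1r ?subrr ?normc0 ?expr0n//.
  rewrite /= in_itv/= -ler_norml; near: n; exact: nbhs_infty_ger.
- apply/integrableP; split; first by apply/measurable_EFinP; exact: measurable_funX.
  under eq_integral do rewrite abse_EFin ger0_norm ?sqr_ge0//.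
  by rewrite (le_lt_trans uK)// ltry.
- apply: aeW => x n _; rewrite lee_fin ger0_norm ?sqr_ge0// ler_pXn2r ?nnegrE ?normc_ge0//.
  rewrite /trunc indicE; case: (_ \in _); rewrite ?mul1r ?subrr ?mul0r ?subr0//.
  by rewrite normc0 normc_ge0.
rewrite integral0 in cv.
have e20 : (0%R%:E < (e ^+ 2)%:E)%E by rewrite lte_fin exprn_gt0.
have [A _ hA] : \forall n \near \oo, (\int[mu]_x (normc (u x - trunc n%:R u x) ^+ 2)%:E < (e ^+ 2)%:E)%E.
  apply: (cv [set y | (y < (e ^+ 2)%:E)%E]); apply: open_nbhs_nbhs; split => //.
  exact: open_ereal_lt_ereal.
exists A => a Aa.
apply: (@L2le_le _ (measurableTypeR R) R mu e (fun x => normc (u x - trunc A%:R u x))); first exact: (mt a).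
  by move=> x; rewrite ger0_norm ?normc_ge0// trunc_tail_le.
by split; [exact: (mt A%:R)|apply: ltW; apply: hA => /=].
Unshelve. all: by end_near. Qed.

Lemma tfB (s : R) g h y : cinteg g -> cinteg h ->
  tf s (fun x => g x - h x) y = tf s g y - tf s h y.
Proof.
move=> ig ih; rewrite /tf -cintB//; first by apply: eq_cint => x _; rewrite mulrBl.
  by apply: cintegrable_mulb => //; [exact: measurable_expi1|move=> t; rewrite normc_expi].
by apply: cintegrable_mulb => //; [exact: measurable_expi1|move=> t; rewrite normc_expi].
Qed.

Lemma c0_gt0 : 0 < c0. Proof. by rewrite invr_gt0 sqrtr_gt0 mulr_gt0// pi_gt0. Qed.

Lemma L2le_ctf (s K : R) g : s ^+ 2 = 1 -> 0 <= K -> cinteg g -> L2le mu K (fun x => normc (g x)) ->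
  L2le mu K (fun x => normc (c0%:C%C * tf s g x)).
Proof.
move=> s1 K0 ig gK; have := L2leZ c0 (bessel s1 K0 ig gK).
rewrite gtr0_norm ?c0_gt0// mulrA mulVf ?mul1r; last by rewrite gt_eqF// -invr_gt0 c0_gt0.
by apply: L2le_ext => x; rewrite normcM normc_real gtr0_norm ?c0_gt0.
Qed.

(** The inverse Fourier transform as an integral, hence with a value at every point when [g] is
    integrable. *)
Definition IF g x : C := c0%:C%C * tf 1 g x.

Definition FT (a : R) u y : C := c0%:C%C * tf (-1) (trunc a u) y.

Lemma cmeas_FT a u : L2f u -> cmeasR (FT a u).
Proof. by move=> uL; apply: cmeasZ; apply: cmeas_tf; exact: cinteg_trunc. Qed.

Lemma FTB_le (K a b : R) u : L2f u -> 0 <= K ->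
  L2le mu K (fun x => normc (trunc a u x - trunc b u x)) ->
  L2le mu K (fun x => normc (FT a u x - FT b u x)).
Proof.
move=> uL K0 h; have s1 : (-1) ^+ 2 = 1 :> R by rewrite sqrrN expr1n.
have i1 := cinteg_trunc a uL; have i2 := cinteg_trunc b uL.
have := L2le_ctf s1 K0 (cintegrableB measurableT i1 i2) h.
by apply: L2le_ext => x; rewrite tfB// /FT mulrBr.
Qed.

(* The scalar counterpart of [is_fourier]. *)
Definition isF u v := L2f v /\ forall e : R, 0 < e -> exists A : R, forall a, A <= a ->
  L2le mu e (fun x => normc (v x - FT a u x)).

Lemma L2le_triangle (K L : R) u v w : cmeasR u -> cmeasR v -> cmeasR w -> 0 <= K -> 0 <= L ->
  L2le mu K (fun x => normc (u x - v x)) -> L2le mu L (fun x => normc (v x - w x)) ->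
  L2le mu (K + L) (fun x => normc (u x - w x)).
Proof.
move=> m1 m2 m3 K0 L0 h1 h2; apply: L2le_le (L2leD K0 L0 h1 h2).
  by apply: measurable_normc; exact: cmeasB.
move=> x; rewrite ger0_norm ?normc_ge0//.
by rewrite -(subrKA (v x) (u x)) le_normcD.
Qed.

(** By Bessel's inequality truncated transforms differ by no more than the truncations, hence form a
    Cauchy family. A subsequence with geometric gaps is summed as a telescoping series by
    [L2_series], and Fatou's lemma compares the limit with every late truncation. *)
Lemma isF_exists u : L2f u -> exists v, isF u v.
Proof.
move=> uL; have [mu_ [K K0 uK]] := uL.
pose eps (k : nat) : R := 2^-1 ^+ k.
have eps0 k : 0 < eps k by rewrite exprn_gt0// invr_gt0.
have /choice[A hA] (k : nat) := L2_tail uL (eps0 k).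
(* A sum of thresholds dominates each of them, so that [B k] lies beyond [A j] for all j <= k. *)
pose B k : R := (\sum_(j < k.+1) A j)%N%:R.
have AB j k : (j <= k)%N -> (A j)%:R <= B k.
  move=> jk; rewrite ler_nat; have jk' : (j < k.+1)%N by [].
  by rewrite (bigD1 (Ordinal jk'))//= leq_addr.
have mT a : cmeasR (trunc a u) by have [] := L2f_trunc a uL.
have TT a b k : (A k)%:R <= a -> (A k)%:R <= b ->
    L2le mu (eps k + eps k) (fun x => normc (trunc a u x - trunc b u x)).
  move=> ka kb; apply: (@L2le_triangle _ _ _ u) => //; [exact: ltW|exact: ltW| |exact: hA].
  by apply: L2le_ext (hA k a ka) => x; rewrite normcB.
have FF a b k : (A k)%:R <= a -> (A k)%:R <= b ->
    L2le mu (eps k + eps k) (fun x => normc (FT a u x - FT b u x)).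
  by move=> ka kb; apply: FTB_le (TT _ _ _ ka kb) => //; rewrite addr_ge0// ltW.
pose f_ n x := if n is n'.+1 then FT (B n'.+1) u x - FT (B n') u x else FT (B 0%N) u x.
pose K_ n := if n is n'.+1 then eps n' + eps n' else K.
have mf n : cmeasR (f_ n).
  by case: n => [|n]; [exact: cmeas_FT|apply: cmeasB; exact: cmeas_FT].
have K_0 n : 0 <= K_ n by case: n => [//|n]; rewrite /= addr_ge0// ltW.
have fK n : L2le mu (K_ n) (fun x => normc (f_ n x)).
  case: n => [|n]; last by apply: FF; exact: AB.
  apply: L2le_ctf => //; [by rewrite sqrrN expr1n|exact: cinteg_trunc|].
  apply: L2le_le uK; first exact: measurable_normc.
  by move=> x; rewrite ger0_norm ?normc_ge0// normc_trunc.
have epsS n : eps n = eps n.+1 + eps n.+1 by rewrite /eps exprS; lra.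
(* The gaps are 2 eps n with eps n = 2^-n, which add up to less than 4. *)
have sumE N : \sum_(n < N.+1) K_ n = K + 4 * (1 - eps N).
  elim: N => [|N ih]; first by rewrite big_ord_recr big_ord0/= /eps expr0; lra.
  rewrite big_ord_recr/= ih (epsS N); lra.
have sK N : \sum_(n < N) K_ n <= K + 4.
  case: N => [|N]; first by rewrite big_ord0; lra.
  by rewrite sumE; have := eps0 N; lra.
have fE N x : \sum_(n < N.+1) f_ n x = FT (B N) u x.
  elim: N => [|N ih]; first by rewrite big_ord_recr big_ord0/= add0r.
  by rewrite big_ord_recr/= ih addrC subrK.
have [D [f [h [mD D0 mf0 hK hf]]]] := L2_series mf K_0 fK sK.
have fh x : normc (f x) <= h x.
  have [h0 fD hD cv] := hf x; have [xD|xD] := boolP (x \in D); last by rewrite fD// normc0.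
  have cvh : normc (\sum_(n < N) f_ n x - f x) + h x @[N --> \oo] --> 0 + h x.
    by apply: cvgD; [exact: cv|exact: cvg_cst].
  rewrite add0r in cvh; rewrite -(cvg_lim _ cvh)//; apply: limr_ge; first by apply/cvg_ex; eexists; exact: cvh.
  apply: nearW => N; set S := \sum_(n < N) _.
  have := le_normcB S (S - f x); rewrite subKr addrC => /le_trans; apply.
  by rewrite lerD2l (le_trans (normc_sum _ _ _))// hD.
have Kp : 0 <= K + 4 by rewrite addr_ge0.
exists f; split.
  split=> //; exists (K + 4) => //; apply: L2le_le hK; first exact: measurable_normc.
  by move=> x; rewrite ger0_norm ?normc_ge0.
move=> e e0.
have [k ke] : exists k, eps k + eps k <= e.
  have := @cvg_expr R 2^-1; rewrite ger0_norm ?invr_ge0// => /(_ _)/cvgrPdist_le H.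
  have e20 : 0 < e / 2 by rewrite divr_gt0.
  have [|k _ /(_ k)/= ] := H _ _ e20; first by lra.
  rewrite leqnn sub0r normrN ger0_norm; last by rewrite ltW.
  by move=> /(_ isT) hk; exists k; rewrite /eps; lra.
exists (A k)%:R => a Aa.
apply: (@L2le_leK _ _ _ _ (eps k + eps k)); first by rewrite ke andbT addr_ge0// ltW.
apply: (@L2le_lim _ (measurableTypeR R) R mu (fun n x => normc (FT (B (n + k)%N) u x - FT a u x))).
- by apply: measurable_normc; apply: cmeasB => //; exact: cmeas_FT.
- by move=> n; apply: FF => //; apply: AB; exact: leq_addl.
- exists (~` D); split; [exact: measurableC|exact: D0|].
  apply: subsetC => x Dx; have [_ _ _ /(_ (mem_set Dx)) cv] := hf x.
  have {}cv : normc (FT (B (n + k)%N) u x - f x) @[n --> \oo] --> 0.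
    rewrite -(cvg_shiftn k.+1) in cv; apply: cvg_trans cv; apply: near_eq_cvg.
    by apply: nearW => n; rewrite /= addnS fE.
  apply/cvgrPdist_le => e' e'0; move/cvgrPdist_le : cv => /(_ _ e'0); apply: filterS => n.
  rewrite sub0r normrN ger0_norm ?normc_ge0// => hn; apply: le_trans hn.
  apply: le_trans (ler_dist_normc _ _) _.
  by rewrite opprB addrA subrK normcB.
Qed.

Lemma L2le_ae0 (f : R -> R) : (forall e : R, 0 < e -> L2le mu e f) -> {ae mu, forall x, f x = 0}.
Proof.
move=> h; have [mf _] := h 1 ltr01.
have m2 : measurable_fun [set: measurableTypeR R] (fun x => (f x ^+ 2)%:E).
  by apply/measurable_EFinP; exact: measurable_funX.
have I0 : (\int[mu]_x `|(f x ^+ 2)%:E| = 0)%E.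
  under eq_integral do rewrite abse_EFin ger0_norm ?sqr_ge0//.
  apply/eqP; rewrite eq_le; apply/andP; split; last first.
    by apply: integral_ge0 => x _; rewrite lee_fin sqr_ge0.
  apply/lee_addgt0Pr => e e0; rewrite add0e.
  have se : 0 < Num.sqrt e by rewrite sqrtr_gt0.
  have [_ ] := h _ se.
  by rewrite sqr_sqrtr// ltW.
have /(ae_eq_integral_abs mu measurableT m2) := I0.
apply: ae_mono => x /(_ I)/= [] /eqP; rewrite sqrf_eq0 => /eqP.
exact.
Qed.

Lemma isF_unique u v w : isF u v -> isF u w -> L2f u -> {ae mu, forall x, v x = w x}.
Proof.
move=> [vL hv] [wL hw] uL.
have : {ae mu, forall x, normc (v x - w x) = 0}.
  apply: L2le_ae0 => e e0; have e20 : 0 < e / 2 by rewrite divr_gt0.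
  have [A hA] := hv _ e20; have [B hB] := hw _ e20.
  pose a := Num.max A B.
  rewrite (_ : e = e / 2 + e / 2); last by lra.
  apply: (@L2le_triangle _ _ _ (FT a u)); rewrite ?ltW//; [exact: vL.1|exact: cmeas_FT|exact: wL.1| |].
    by apply: hA; rewrite le_max lexx.
  have hB' : L2le mu (e / 2) (fun x => normc (w x - FT a u x)) by apply: hB; rewrite le_max lexx orbT.
  by apply: L2le_ext hB' => x; rewrite normcB.
by apply: ae_mono => x /eqP; rewrite normc_eq0 subr_eq0 => /eqP.
Qed.

Lemma Re_cint_ind (P : C -> R) u (a b : R) : (forall (r : R) z, P (r%:C%C * z) = r * P z) ->
  \int[mu]_x P (u x * (ind a b x)%:C%C) = \int[mu]_(x in `[a, b]) P (u x).
Proof.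
move=> PZ; rewrite [RHS]Rintegral_mkcond; congr fine; apply: eq_integral => x _; congr _%:E.
by rewrite mulrC PZ patchE indicE; case: ifPn => _; rewrite ?mul1r ?mul0r.
Qed.

(** At a Lebesgue point the function is the derivative of its indefinite integral, here identically
    zero. *)
Lemma ae0_of_itv (f : R -> R) : measurable_fun setT f ->
  (forall a b : R, mu.-integrable `[a, b] (EFin \o f)) ->
  (forall a b : R, \int[mu]_(x in `[a, b]) f x = 0) -> {ae mu, forall x, f x = 0}.
Proof.
move=> mf fi f0.
have lf : locally_integrable [set: R] f.
  split=> //; first exact: openT.
  move=> K _ cK; have [M [_ hM]] := compact_bounded cK.
  pose b := `|M| + 1; have Kb : K `<=` `[- b, b]%classic.
    move=> x Kx; rewrite /= in_itv/= -ler_norml; apply: hM => //.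
    by rewrite /b (le_lt_trans (ler_norm M))// ltrDl.
  have /integrableP[_] := fi (- b) b; apply: le_lt_trans.
  apply: ge0_subset_integral => //.
  - exact: compact_measurable.
  - by apply/measurable_EFinP; apply: measurableT_comp => //; exact: measurable_funTS.
suff H (x : R) : lebesgue_pt f x -> f x = 0 by exact: ae_mono (lebesgue_differentiation lf).
move=> lx.
have x1 : x < x + 1 by rewrite ltrDl.
have xle : x - 1 < x by rewrite ltrBlDr ltrDl.
have xa : (BLeft (x - 1)%R < BRight x)%E by exact: xle.
have [_ <-] := FTC1_lebesgue_pt x1 (fi (x - 1) (x + 1)) xa lx.
rewrite (_ : (fun y => _) = cst 0) ?derive1_cst//.
by apply/funext => y; rewrite f0.
Qed.

Lemma L2f_ae0 u : L2f u -> (forall a b : R, cintR (fun x => u x * (ind a b x)%:C%C) = 0) ->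
  {ae mu, forall x, u x = 0}.
Proof.
move=> uL h; have mu_ := uL.1.
have ii a b : cinteg (fun x => u x * (ind a b x)%:C%C).
  by apply: cintegrable_L2M => //; exact: L2f_ind.
have ZRe (r : R) z : Re (r%:C%C * z) = r * Re z by rewrite ReMc/= mul0r subr0.
have ZIm (r : R) z : Im (r%:C%C * z) = r * Im z by rewrite ImMc/= mul0r addr0.
have itg (P : C -> R) a b : (forall (r : R) z, P (r%:C%C * z) = r * P z) ->
    mu.-integrable setT (EFin \o (fun x => P (u x * (ind a b x)%:C%C))) ->
    mu.-integrable `[a, b] (EFin \o (fun x => P (u x))).
  have mI : measurable (`[a, b]%classic : set (measurableTypeR R)) by exact: measurable_itv.
  move=> PZ Pi; rewrite integrable_mkcond//.
  suff -> : ((EFin \o (fun x : R => P (u x))) \_ `[a, b]) =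
    (EFin \o (fun x : R => P (u x * (ind a b x)%:C%C))) by exact: Pi.
  by apply/funext => x; rewrite /= patchE indicE mulrC PZ; case: ifPn => _; rewrite ?mul1r ?mul0r.
have hRe : {ae mu, forall x, Re (u x) = 0}.
  apply: ae0_of_itv; first exact: mu_.1.
    by move=> a b; apply: itg => //; apply: integrable_Re.
  by move=> a b; rewrite -Re_cint_ind//; have := congr1 Re (h a b).
have hIm : {ae mu, forall x, Im (u x) = 0}.
  apply: ae0_of_itv; first exact: mu_.2.
    by move=> a b; apply: itg => //; apply: integrable_Im.
  by move=> a b; rewrite -Re_cint_ind//; have := congr1 Im (h a b).
by apply: ae_mono (ae_and hRe hIm) => x [h1 h2]; apply: complexP.
Qed.

Lemma FT_test a u (b1 b2 : R) : L2f u ->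
  cintR (fun x => FT a u x * (ind b1 b2 x)%:C%C) =
  cintR (fun x => trunc a u x * (c0%:C%C * tf (-1) (fun y => (ind b1 b2 y)%:C%C) x)).
Proof.
move=> uL; have iu := cinteg_trunc a uL; have ii := cinteg_ind b1 b2.
have mk : cmeas setT (fun xy : R * R => cexpi ((-1) * (xy.2 * xy.1))).
  apply: cmeas_expi; apply: measurable_funM => //; apply: measurable_funM.
    exact: measurable_snd.
  exact: measurable_fst.
have H := @cint_swap R (fun xy : R * R => cexpi ((-1) * (xy.2 * xy.1))) _ _
  (cintegrableZ measurableT c0%:C%C ii) iu mk.
rewrite /FT /tf.
transitivity (cintR (fun x => c0%:C%C * (ind b1 b2 x)%:C%C * cintR (fun y => cexpi (-1 * (y * x)) * trunc a u y))).
  apply: eq_cint => x _; rewrite mulrAC; congr (_ * _); apply: eq_cint => y _; exact: mulrC.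
rewrite H; last by move=> xy; rewrite normc_expi.
apply: eq_cint => y _; congr (_ * _).
have iz : cinteg (fun x => (ind b1 b2 x)%:C%C * cexpi (-1 * (x * y))).
  clear H; by apply: cintegrable_mulb => //; [exact: measurable_expi1|move=> t; rewrite normc_expi].
rewrite -(cintZ measurableT c0%:C%C iz).
have mul3 (a' b c : C) : a' * (b * c) = b * (c * a') by ring.
by apply: eq_cint => x _; rewrite mul3 (mulrC y).
Qed.

(** The transform tested on an interval. For truncations it is Fubini ([FT_test]); both sides are
    L^2 continuous, and each contributes at most e / 2 to the error. [L + 1] avoids a division by
    zero. *)
Lemma isF_test u v (a b : R) : L2f u -> isF u v ->
  cintR (fun x => v x * (ind a b x)%:C%C) =
  cintR (fun x => u x * (c0%:C%C * tf (-1) (fun y => (ind a b y)%:C%C) x)).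
Proof.
move=> uL [vL hv]; have iL := L2f_ind a b; have ii := cinteg_ind a b.
have s1 : (-1) ^+ 2 = 1 :> R by rewrite sqrrN expr1n.
have [mi [L L0 iK]] := iL.
pose t x := c0%:C%C * tf (-1) (fun y => (ind a b y)%:C%C) x.
have mt : cmeasR t by apply: cmeasZ; exact: cmeas_tf.
have tK : L2le mu L (fun x => normc (t x)) by exact: L2le_ctf.
have tL : L2f t by split=> //; exists L.
apply/eqP; rewrite -subr_eq0 -normc_eq0 eq_le normc_ge0 andbT.
apply/ler_addgt0Pl => e e0; rewrite addr0.
have e1 : 0 < e / (2 * (L + 1)) by rewrite divr_gt0// mulr_gt0// ltr_wpDl.
have [A hA] := hv _ e1; have [B hB] := L2_tail uL e1.
pose c := Num.max A B%:R.
have hA' := hA c; have hB' := hB c.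
rewrite !le_max !lexx ?orbT in hA' hB'.
have {}hA := hA' isT; have {}hB := hB' isT.
have := FT_test c a b uL; rewrite -/t => test.
have FL : L2f (FT c u).
  split; first exact: cmeas_FT.
  have [mtr [K K0 tuK]] := L2f_trunc c uL.
  by exists K => //; apply: L2le_ctf => //; exact: cinteg_trunc.
have TL := L2f_trunc c uL.
rewrite (_ : cintR (fun x => v x * _) - _ =
  (cintR (fun x => (v x - FT c u x) * (ind a b x)%:C%C)) - cintR (fun x => (u x - trunc c u x) * t x)); last first.
  rewrite !cintMBl// test.
  by rewrite opprB addrA subrK.
rewrite (le_trans (le_normcB _ _))//.
have e10 := ltW e1.
have h1 := normc_cint_CS (cmeasB vL.1 FL.1) mi e10 L0 hA iK.
have h2 := normc_cint_CS (cmeasB uL.1 TL.1) mt e10 L0 hB tK.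
apply: le_trans (lerD h1 h2) _.
rewrite (_ : _ + _ = e * (L / (L + 1))); last by field; rewrite gt_eqF// ltr_wpDl.
by rewrite ler_piMr ?(ltW e0)// ler_pdivrMr ?mul1r ?ltr_wpDl// lerDl.
Qed.

Lemma L2f_ctf (s : R) g : s ^+ 2 = 1 -> cinteg g -> L2f g -> L2f (fun x => c0%:C%C * tf s g x).
Proof.
move=> s1 ig [mg [K K0 gK]]; split; first by apply: cmeasZ; exact: cmeas_tf.
by exists K => //; exact: L2le_ctf.
Qed.

Lemma L2f_tf (s : R) g : s ^+ 2 = 1 -> cinteg g -> L2f g -> L2f (tf s g).
Proof.
move=> s1 ig [mg [K K0 gK]]; split; first exact: cmeas_tf.
by exists (Num.sqrt (2 * pi) * K); [rewrite mulr_ge0// sqrtr_ge0|exact: bessel].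
Qed.

Lemma c0_sqr : c0 * c0 * (2 * pi) = 1.
Proof.
have h : 0 < Num.sqrt (2 * pi : R) by rewrite -invr_gt0 c0_gt0.
have e : Num.sqrt (2 * pi : R) * Num.sqrt (2 * pi) = 2 * pi by rewrite -expr2 sqr_sqrtr// mulr_ge0// pi_ge0.
by rewrite -[X in _ * X = _]e; field; rewrite gt_eqF.
Qed.

Lemma tf_pair_ind (s a b : R) g : s ^+ 2 = 1 -> cinteg g -> L2f g ->
  cintR (fun x => (c0%:C%C * tf s g x) * (c0%:C%C * tf (- s) (fun y => (ind a b y)%:C%C) x)) =
  cintR (fun x => g x * (ind a b x)%:C%C).
Proof.
move=> s1 ig gL; have [mg [K K0 gK]] := gL.
have s1' : (- s) ^+ 2 = 1 by rewrite sqrrN.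
pose t := tf (- s) (fun y => (ind a b y)%:C%C).
have H := cint_tf_ind a b s1 K0 ig gK.
have iH : cinteg (fun x => t x * tf s g x).
  apply: cintegrable_L2M; last exact: L2f_tf.
  by apply: L2f_tf => //; [exact: cinteg_ind|exact: L2f_ind].
have mul4 (p q r s' : C) : p * q * (r * s') = p * r * (s' * q) by ring.
have cc : (c0 * c0)%:C%C = c0%:C%C * c0%:C%C :> C by rewrite rmorphM.
transitivity (cintR (fun x => (c0 * c0)%:C%C * (t x * tf s g x))).
  by apply: eq_cint => x _; rewrite cc; exact: mul4.
rewrite (cintZ measurableT _ iH) H mulrA -rmorphM c0_sqr rmorph1 mul1r.
by [].
Qed.

Lemma L2f_IF g : cinteg g -> L2f g -> L2f (IF g).
Proof. by apply: L2f_ctf; rewrite expr1n. Qed.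

(** Some transform [v] of [IF g] exists; its integrals over intervals are those of [g] by [isF_test]
    and the Parseval formula [tf_pair_ind], so v = g almost everywhere. This ties pointwise inverse
    transforms to the L^2 notion. *)
Lemma isF_IF g : cinteg g -> L2f g -> isF (IF g) g.
Proof.
move=> ig gL; have uL := L2f_IF ig gL; have [v hv] := isF_exists uL.
have [vL _] := hv.
have vg : {ae mu, forall x, v x - g x = 0}.
  apply: L2f_ae0; first exact: L2fB.
  move=> a b; have iL := L2f_ind a b.
  rewrite cintMBl//.
  rewrite (isF_test a b uL hv); apply/eqP; rewrite subr_eq0; apply/eqP.
  by rewrite -(tf_pair_ind a b (expr1n _ 2) ig gL).
split=> // e e0; have [_ /(_ e e0)[A hA]] := hv; exists A => a /hA [mva hva].
split; first by apply: measurable_normc; apply: cmeasB; [exact: gL.1|exact: cmeas_FT].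
apply: le_trans hva; rewrite le_eqVlt; apply/orP; left; apply/eqP.
apply: ae_eq_integral => //.
- apply/measurable_EFinP; apply: measurable_funX; apply: measurable_normc.
  by apply: cmeasB; [exact: gL.1|exact: cmeas_FT].
- by apply/measurable_EFinP; exact: measurable_funX.
- by apply: ae_mono vg => x /eqP; rewrite subr_eq0 => /eqP ->.
Qed.

(* The integrals of [u] over intervals are limits of pairings of truncated transforms. *)
Lemma isF0_ae0 u : L2f u -> isF u (fun=> 0) -> {ae mu, forall x, u x = 0}.
Proof.
move=> uL [zL hz]; apply: L2f_ae0 => // a b.
have iL := L2f_ind a b; have ii := cinteg_ind a b.
have [mi [L L0 iK]] := iL.
have s1 : 1 ^+ 2 = 1 :> R by rewrite expr1n.
have s1' : (-1) ^+ 2 = 1 :> R by rewrite sqrrN expr1n.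
apply/eqP; rewrite -normc_eq0 eq_le normc_ge0 andbT.
apply/ler_addgt0Pl => e e0; rewrite addr0.
have e1 : 0 < e / (2 * (L + 1)) by rewrite divr_gt0// mulr_gt0// ltr_wpDl.
have [A hA] := hz _ e1; have [B hB] := L2_tail uL e1.
pose c := Num.max A B%:R.
have hA' := hA c; have hB' := hB c.
rewrite !le_max !lexx ?orbT in hA' hB'.
have {}hA := hA' isT; have {}hB := hB' isT.
have TL := L2f_trunc c uL; have iT := cinteg_trunc c uL.
have [mT [K K0 TK]] := TL.
have tst : cintR (fun x => trunc c u x * (ind a b x)%:C%C) =
    cintR (fun x => FT c u x * (c0%:C%C * tf 1 (fun y => (ind a b y)%:C%C) x)).
  by have := tf_pair_ind a b s1' iT TL; rewrite opprK => <-.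
pose t x := c0%:C%C * tf 1 (fun y => (ind a b y)%:C%C) x.
have mt : cmeasR t by apply: cmeasZ; exact: cmeas_tf.
have tK : L2le mu L (fun x => normc (t x)) by exact: L2le_ctf.
have e10 := ltW e1.
have hA2 : L2le mu (e / (2 * (L + 1))) (fun x => normc (FT c u x)).
  by apply: L2le_ext hA => x; rewrite sub0r normcN.
have h1 := normc_cint_CS (cmeas_FT c uL) mt e10 L0 hA2 tK.
have h2 := normc_cint_CS (cmeasB uL.1 TL.1) mi e10 L0 hB iK.
rewrite (_ : cintR _ = cintR (fun x => (u x - trunc c u x) * (ind a b x)%:C%C) +
   cintR (fun x => FT c u x * t x)); last first.
  rewrite -tst cintMBl//.
  by rewrite subrK.
apply: le_trans (le_normcD _ _) _; apply: le_trans (lerD h2 h1) _.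
rewrite (_ : _ + _ = e * (L / (L + 1))); last by field; rewrite gt_eqF// ltr_wpDl.
by rewrite ler_piMr ?(ltW e0)// ler_pdivrMr ?mul1r ?ltr_wpDl// lerDl.
Qed.

Lemma isFB u1 u2 v1 v2 : L2f u1 -> L2f u2 -> isF u1 v1 -> isF u2 v2 ->
  isF (fun x => u1 x - u2 x) (fun x => v1 x - v2 x).
Proof.
move=> L1 L2 [vL1 h1] [vL2 h2]; split; first exact: L2fB.
move=> e e0; have e20 : 0 < e / 2 by rewrite divr_gt0.
have [A hA] := h1 _ e20; have [B hB] := h2 _ e20.
exists (Num.max A B) => a; rewrite ge_max => /andP[Aa Ba].
rewrite (_ : e = e / 2 + e / 2); last by lra.
have FTB x : FT a (fun x => u1 x - u2 x) x = FT a u1 x - FT a u2 x.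
  rewrite /FT -mulrBr -tfB//; [|exact: cinteg_trunc|exact: cinteg_trunc].
  by congr (_ * _); apply: eq_cint => y _; rewrite /trunc mulrBr.
apply: L2le_le (L2leD (ltW e20) (ltW e20) (hA a Aa) (hB a Ba)).
  apply: measurable_normc; apply: cmeasB; first by have [] := L2fB vL1 vL2.
  by apply: cmeas_FT; exact: L2fB.
move=> x; rewrite ger0_norm ?normc_ge0// FTB.
rewrite (_ : _ - _ = (v1 x - FT a u1 x) - (v2 x - FT a u2 x)); last by ring.
exact: le_normcB.
Qed.

(** u - IF v has transform v - v = 0, and the transform is injective by [isF0_ae0]. *)
Lemma fourier_inversion u v : L2f u -> isF u v -> cinteg v -> {ae mu, forall x, u x = IF v x}.
Proof.
move=> uL hv iv; have vL := hv.1.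
have IL := L2f_IF iv vL.
have : {ae mu, forall x, u x - IF v x = 0}.
  apply: isF0_ae0; first exact: L2fB.
  have := isFB uL IL hv (isF_IF iv vL).
  by under [X in isF _ X -> _]eq_fun do rewrite subrr.
by apply: ae_mono => x /eqP; rewrite subr_eq0 => /eqP.
Qed.

End fourier_L2.

(** * Weighted spaces *)

Section weights.
Variable R : realType.
Local Notation C := R[i].
Local Notation mu := (@lebesgue_measure R).
Implicit Types (g h u v : R -> C) (rho p s K : R).
Local Notation cintR := (cint mu setT).
Local Notation cinteg := (cintegrable mu setT).
Local Notation cmeasR := (@cmeas _ (measurableTypeR R) R setT).
Local Notation c0 := (Num.sqrt (2 * pi : R))^-1.

Definition kk (xi : R) : R := 1 + `|xi|.

(** Equivalent to [gevrey_weight] ([gw_le], [wt_le]), but exactly multiplicative in both exponents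
    ([wtD]); the energy estimate, where no constant may be lost, uses the true weight. *)
Definition wt rho p (xi : R) : R := expR (rho * kk xi) * kk xi `^ p.

Lemma kk_ge1 xi : 1 <= kk xi. Proof. by rewrite lerDl. Qed.

Lemma kk_gt0 xi : 0 < kk xi. Proof. exact: lt_le_trans (kk_ge1 xi). Qed.

Lemma kkD x y : kk (x + y) <= kk x + kk y.
Proof. by rewrite /kk; have := ler_normD x y; lra. Qed.

Lemma wt_gt0 rho p xi : 0 < wt rho p xi.
Proof. by rewrite mulr_gt0 ?expR_gt0// powR_gt0// kk_gt0. Qed.

Lemma le_wt rho rho' p p' xi : rho <= rho' -> p <= p' -> wt rho p xi <= wt rho' p' xi.
Proof.
move=> rr pp; apply: ler_pM; rewrite ?expR_ge0 ?powR_ge0//.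
  by rewrite ler_expR ler_wpM2r// ltW// kk_gt0.
by rewrite ler_powR// kk_ge1.
Qed.

Lemma wt00 xi : wt 0 0 xi = 1.
Proof. by rewrite /wt mul0r expR0 powRr0 mulr1. Qed.

Lemma wt_ge1 rho p xi : 0 <= rho -> 0 <= p -> 1 <= wt rho p xi.
Proof. by move=> r0 p0; rewrite -(wt00 xi); exact: le_wt. Qed.

Lemma wt_expR rho xi : wt rho 0 xi = expR (rho * kk xi).
Proof. by rewrite /wt powRr0 mulr1. Qed.

Lemma wtD rho rho' p p' xi : wt (rho + rho') (p + p') xi = wt rho p xi * wt rho' p' xi.
Proof.
rewrite /wt mulrDl expRD (@powRD _ (kk xi) p p'); first by rewrite mulrACA.
by apply/implyP => _; rewrite gt_eqF// kk_gt0.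
Qed.

Lemma normr_wtM rho p xi (z : C) : `|wt rho p xi * normc z| = wt rho p xi * normc z.
Proof. by rewrite ger0_norm// mulr_ge0 ?normc_ge0// ltW// wt_gt0. Qed.

Lemma measurable_kk : measurable_fun [set: R] kk.
Proof. by apply: measurable_funD => //; exact: normr_measurable. Qed.

Lemma measurable_wt rho p : measurable_fun [set: R] (wt rho p).
Proof.
apply: measurable_funM.
  apply: measurableT_comp => //; apply: measurable_funM => //; exact: measurable_kk.
by apply: (measurableT_comp (measurable_powR p)); exact: measurable_kk.
Qed.

Lemma continuous_kk : continuous kk.
Proof. by move=> x; apply: cvgD; [exact: cvg_cst|exact: norm_continuous]. Qed.

Lemma continuous_kk_powR (a : R) : continuous (fun xi => kk xi `^ a).
Proof.
move=> x; apply: (@continuous_comp _ _ _ kk (fun y => y `^ a)); first exact: continuous_kk.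
apply/differentiable_continuous/derivable1_diffP.
by have [] := is_derive1_powR a (kk_gt0 x).
Qed.

Lemma integral_kk (p : R) : 1 / 2 < p -> (\int[mu]_xi (kk xi `^ (- (2 * p)))%:E < +oo)%E.
Proof.
move=> p2; pose b := 2 * p - 1; have b0 : 0 < b by rewrite /b; lra.
rewrite ge0_symfun_integralT; last 3 first.
- by move=> x; exact: powR_ge0.
- exact: continuous_kk_powR.
- by move=> x; rewrite /= /kk normrN.
pose F (x : R) : R := - b^-1 * (1 + x) `^ (- b).
have dF (x : R) : 0 < 1 + x -> is_derive x 1 F ((1 + x) `^ (- (2 * p))).
  move=> x0; have h : is_derive (x : R) 1 (fun x : R => (1 + x) `^ (- b)) (- b * (1 + x) `^ (- b - 1)).
    have := @is_derive1_comp R (fun y : R => y `^ (- b)) (fun x : R => 1 + x) x _ 1 (is_derive1_powR (- b) x0).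
    rewrite mulr1; apply; apply: is_derive_eq; rewrite /GRing.scale/=; ring.
  apply: is_derive_eq; rewrite /GRing.scale/= mulrA mulrNN mulVf ?gt_eqF// mul1r.
  by congr (_ `^ _); rewrite /b; ring.
have cF (x : R) : 0 < 1 + x -> {for x, continuous F}.
  by move=> x0; apply/differentiable_continuous/derivable1_diffP; have [] := dF x x0.
rewrite -set_itvcy (@ge0_continuous_FTC2y _ _ F 0 0).
- by rewrite -EFinB -EFinM ltry.
- by move=> x _; exact: powR_ge0.
- by apply: continuous_subspaceT; exact: continuous_kk_powR.
- rewrite -(mulr0 (- b^-1)); apply: cvgM; first exact: cvg_cst.
  have h : b * ln (1 + x) @[x --> +oo%R] --> +oo%R.
    apply/cvgryPge => A; exists (expR (A / b)); split; rewrite ?num_real// => x xA.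
    have x1 : expR (A / b) <= 1 + x by rewrite ltW// (lt_trans xA)// ltrDr.
    rewrite -ler_pdivrMl// mulrC -(@expRK R (A / b)) ler_ln// posrE ?expR_gt0//.
    by rewrite (lt_le_trans _ x1)// expR_gt0.
  have := cvg_comp _ (fun y : R => expR (- y)) h (@cvgr_expR R); apply: cvg_trans.
  apply: near_eq_cvg; near=> x; rewrite /= /powR ifF ?mulNr//.
  apply/negbTE; rewrite gt_eqF// addr_gt0//; near: x; exact: nbhs_pinfty_gt.
- by move=> x x0; have [|] // := dF x; rewrite addr_gt0.
- by apply: cvg_at_right_filter; apply: cF; rewrite addr0.
- move=> x; rewrite in_itv/= andbT => x0; rewrite derive1E.
  have x1 : 0 < 1 + x by rewrite addr_gt0.
  by have [_ ->] := dF x x1; rewrite /kk gtr0_norm.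
Unshelve. all: by end_near. Qed.

(** The L^2 norm of kk^(-p), finite for p > 1/2: the Sobolev constant that bounds the L^1 norm of a
    transform by its weighted L^2 norm ([wt_L1]). *)
Definition cS p : R := Num.sqrt (fine (\int[mu]_xi (kk xi `^ (- (2 * p)))%:E)).

Lemma cS_ge0 p : 0 <= cS p. Proof. exact: sqrtr_ge0. Qed.

Lemma L2le_kk p : 1 / 2 < p -> L2le mu (cS p) (fun xi => (kk xi `^ p)^-1).
Proof.
move=> p2; have mk : measurable_fun [set: R] (fun xi => (kk xi `^ p)^-1).
  apply: continuous_measurable_fun => x; apply: cvgV; last exact: continuous_kk_powR.
  by rewrite gt_eqF// powR_gt0// kk_gt0.
have i0 : (0 <= \int[mu]_xi (kk xi `^ (- (2 * p)))%:E)%E.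
  by apply: integral_ge0 => x _; rewrite lee_fin powR_ge0.
split; first exact: mk.
rewrite sqr_sqrtr ?fine_ge0// fineK ?ge0_fin_numE ?integral_kk//.
rewrite le_eqVlt; apply/orP; left; apply/eqP; apply: eq_integral => x _.
by rewrite powRN mulrC powRrM powR_mulrn ?powR_ge0// exprVn.
Qed.

Lemma wt_L1 rho p K g : 1 / 2 < p -> 0 <= K -> cmeasR g ->
  L2le mu K (fun xi => wt rho p xi * normc (g xi)) ->
  (\int[mu]_xi (wt rho 0 xi * normc (g xi))%:E <= (cS p * K)%:E)%E.
Proof.
move=> p2 K0 mg gK; apply: le_trans (L2le_CS (cS_ge0 p) K0 (L2le_kk p2) gK).
rewrite le_eqVlt; apply/orP; left; apply/eqP; apply: eq_integral => x _.
have kp : 0 < kk x `^ p by rewrite powR_gt0// kk_gt0.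
rewrite ger0_norm; last by rewrite !mulr_ge0 ?invr_ge0 ?normc_ge0 ?expR_ge0 ?powR_ge0.
by rewrite wt_expR /wt; congr _%:E; field; rewrite gt_eqF.
Qed.

Lemma measurable_wtM rho p g : cmeasR g ->
  measurable_fun [set: measurableTypeR R] (fun xi => wt rho p xi * normc (g xi)).
Proof.
by move=> mg; apply: measurable_funM; [exact: measurable_wt|exact: measurable_normc].
Qed.

Lemma wt_integ rho p K g : 1 / 2 < p -> 0 <= rho -> 0 <= K -> cmeasR g ->
  L2le mu K (fun xi => wt rho p xi * normc (g xi)) ->
  cinteg g /\ L2f g.
Proof.
move=> p2 r0 K0 mg gK; split.
  apply: (@le_cintegrable _ _ _ mu setT measurableT _ (fun xi => wt rho 0 xi * normc (g xi))) => //.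
  - exact: measurable_wtM.
  - by move=> x _; rewrite ler_peMl ?normc_ge0// wt_ge1.
  - by apply: le_lt_trans (wt_L1 p2 K0 mg gK) _; rewrite ltry.
split=> //; exists K => //; apply: L2le_le gK; first exact: measurable_normc.
by move=> x; rewrite ger0_norm ?normc_ge0// ler_peMl ?normc_ge0// wt_ge1//; lra.
Qed.

(** The exponential is submultiplicative because [kk] is subadditive; for the power, the sum is at
    most twice the larger of the two, so that one factor sheds its whole polynomial weight. *)
Lemma wt_conv rho p x y : 0 <= rho -> 0 <= p ->
  wt rho p (x + y) <= 2 `^ p * (wt rho p x * wt rho 0 y + wt rho 0 x * wt rho p y).
Proof.
move=> r0 p0; rewrite !wt_expR /wt.
have h1 : expR (rho * kk (x + y)) <= expR (rho * kk x) * expR (rho * kk y).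
  by rewrite -expRD ler_expR -mulrDr ler_wpM2l// kkD.
have h2 : kk (x + y) `^ p <= 2 `^ p * (kk x `^ p + kk y `^ p).
  wlog xy : x y {h1} / kk x <= kk y.
    move=> h; have [/h//|/ltW/h] := leP (kk x) (kk y).
    by rewrite addrC [X in _ * X]addrC.
  apply: (@le_trans _ _ ((2 * kk y) `^ p)).
    have ky := kk_gt0 y; have kxy := kk_gt0 (x + y).
    apply: ge0_ler_powR => //; rewrite ?nnegrE; [exact: ltW|by rewrite mulr_ge0// ltW|].
    by have := kkD x y; lra.
  rewrite powRM//; last by rewrite ltW// kk_gt0.
  by rewrite ler_wpM2l ?powR_ge0// lerDr powR_ge0.
apply: le_trans (ler_pM (expR_ge0 _) (powR_ge0 _ _) h1 h2) _.
by rewrite le_eqVlt; apply/orP; left; apply/eqP; ring.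
Qed.

(** The degenerate mass [a = 0] in Young's inequality is included by letting a + d tend to a; [q]
    makes the excess at most d q. *)
Lemma young0 (G H : R -> R) (a K : R) : 0 <= a -> 0 <= K ->
  measurable_fun setT G -> (forall x, 0 <= G x) -> (forall x, 0 <= H x) ->
  (\int[mu]_x (G x)%:E <= a%:E)%E -> L2le mu K H ->
  (\int[mu]_x (\int[mu]_z (G z * H (x - z))%:E) ^+ 2 <= ((a * K) ^+ 2)%:E)%E.
Proof.
move=> a0 K0 mG G0 H0 Ga HK; apply/lee_addgt0Pr => e e0.
pose q := 2 * a * K ^+ 2 + K ^+ 2 + 1.
have q1 : 1 <= q by rewrite /q lerDr addr_ge0 ?sqr_ge0// !mulr_ge0 ?sqr_ge0.
have q0 : 0 < q by exact: lt_le_trans q1.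
pose d := Num.min 1 (e / q); have d0 : 0 < d by rewrite lt_min ltr01 divr_gt0.
have d1 : d <= 1 by rewrite ge_min lexx.
have de : d <= e / q by rewrite ge_min lexx orbT.
have Gd : (\int[mu]_x (G x)%:E <= (a + d)%:E)%E.
  by apply: le_trans Ga _; rewrite lee_fin lerDl ltW.
apply: le_trans (young_L1_L2 (ltr_wpDl a0 d0) K0 mG G0 H0 Gd HK) _.
rewrite -EFinD lee_fin !exprMn sqrrD !mulrDl -addrA lerD2l.
have h : d * q <= e by rewrite -ler_pdivlMr.
apply: le_trans h; rewrite /q.
have K2 := sqr_ge0 K.
have : d ^+ 2 * K ^+ 2 <= d * K ^+ 2.
  by rewrite ler_wpM2r// expr2 ler_piMl// ltW.
move=> h2; have -> : d * (2 * a * K ^+ 2 + K ^+ 2 + 1) =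
  a * d * K ^+ 2 + a * d * K ^+ 2 + d * K ^+ 2 + d by ring.
lra.
Qed.

Definition cconv g h xi := cintR (fun z => g (xi - z) * h z).

Lemma cmeas_conv_kernel g h : cmeasR g -> cmeasR h ->
  cmeas setT (fun xz : R * R => g (xz.1 - xz.2) * h xz.2).
Proof.
move=> mg mh; apply: cmeasM; last exact: (cmeas_comp mh measurable_snd).
by apply: (cmeas_comp mg); apply: measurable_funB; [exact: measurable_fst|exact: measurable_snd].
Qed.

Lemma conv_finite g h : cinteg g -> cinteg h ->
  (\int[mu]_x \int[mu]_z (normc (g (x - z) * h z))%:E < +oo)%E.
Proof.
move=> [mg goo] [mh hoo].
have mgh : measurable_fun setT (fun xz : R * R => (normc (g (xz.1 - xz.2) * h xz.2))%:E).
  by apply/measurable_EFinP; apply: measurable_normc; exact: cmeas_conv_kernel.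
rewrite (@fubini_tonelli _ _ _ _ _ mu mu (fun xz : R * R => (normc (g (xz.1 - xz.2) * h xz.2))%:E) mgh); last first.
  by move=> xz; rewrite lee_fin normc_ge0.
rewrite (_ : (\int[mu]_z _)%E = (\int[mu]_z ((normc (h z))%:E * \int[mu]_x (normc (g x))%:E))%E); last first.
  apply: eq_integral => z _; rewrite /=.
  under eq_integral do rewrite normcM mulrC.
  have mgz : measurable_fun setT (fun x : R => normc (g (x - z))).
    by apply: (measurableT_comp (measurable_normc mg)); exact: measurable_funB.
  rewrite (integral_finZ mu mgz (normc_ge0 _)); last by move=> x; exact: normc_ge0.
  rewrite (@integral_translation _ (- z) (fun x : R => (normc (g x))%:E))//.
  by apply/measurable_EFinP; exact: measurable_normc.
rewrite ge0_integralZr//; last 3 first.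
- by apply/measurable_EFinP; exact: measurable_normc.
- by move=> z _; rewrite lee_fin normc_ge0.
- by apply: integral_ge0 => z _; rewrite lee_fin normc_ge0.
by rewrite lte_mul_pinfty ?ge0_fin_numE//; apply: integral_ge0 => z _; rewrite lee_fin normc_ge0.
Qed.

Lemma cmeas_cconv g h : cinteg g -> cinteg h -> cmeasR (cconv g h).
Proof.
move=> ig ih; exact: (@cmeas_cint _ _ (measurableTypeR R) (measurableTypeR R) R mu mu
  (fun xz : R * R => g (xz.1 - xz.2) * h xz.2) (cmeas_conv_kernel ig.1 ih.1) (conv_finite ig ih)).
Qed.

Lemma L2f_sub g x : L2f g -> L2f (fun z => g (x - z)).
Proof.
move=> [mg [K K0 [_ gK]]].
have ms : measurable_fun [set: R] (fun z : R => x - z) by exact: measurable_funB.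
have m : cmeasR (fun z => g (x - z)) by exact: (cmeas_comp mg ms).
split=> //; exists K => //; split; first exact: measurable_normc.
rewrite (@lebesgue_integral_sub _ x (fun z => (normc (g z) ^+ 2)%:E))//.
by apply/measurable_EFinP; apply: measurable_funX; exact: measurable_normc.
Qed.

Lemma cinteg_conv g h x : L2f g -> L2f h -> cinteg (fun z => g (x - z) * h z).
Proof. by move=> gL hL; apply: cintegrable_L2M => //; exact: L2f_sub. Qed.

Lemma cinteg_cconv g h : cinteg g -> cinteg h -> L2f g -> L2f h -> cinteg (cconv g h).
Proof.
move=> ig ih gL hL; split; first exact: cmeas_cconv.
apply: le_lt_trans (conv_finite ig ih); apply: ge0_le_integral => //.
- by move=> y _; rewrite lee_fin normc_ge0.
- by apply/measurable_EFinP; apply: measurable_normc; exact: cmeas_cconv.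
- apply: (@measurable_fun_fubini_tonelli_F _ _ _ _ _ mu (fun xz : R * R => (normc (g (xz.1 - xz.2) * h xz.2))%:E)).
    apply/measurable_EFinP; apply: measurable_normc.
    by apply: cmeas_conv_kernel; [exact: ig.1|exact: ih.1].
  by move=> xz; rewrite lee_fin normc_ge0.
- move=> y _; apply: normc_cint_le => //.
  exact: (cinteg_conv y gL hL).1.
Qed.

(** The convolution theorem: Fubini and a translation in the inner integral. A [c0] is left on the
    convolution because each of the two inverse transforms on the right carries its own. *)
Lemma IF_cconv g h x : cinteg g -> cinteg h -> L2f g -> L2f h ->
  IF (fun xi => c0%:C%C * cconv g h xi) x = IF g x * IF h x.
Proof.
move=> ig ih gL hL; rewrite /IF /tf.
pose e (t : R) := cexpi (1 * (t * x)).
have me : cmeasR e by exact: measurable_expi1.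
have ne t : normc (e t) <= 1 by rewrite normc_expi.
pose G (xz : R * R) := g (xz.1 - xz.2) * h xz.2 * e xz.1.
have mG : cmeas setT G.
  apply: cmeasM; first by apply: cmeas_conv_kernel; [exact: ig.1|exact: ih.1].
  exact: (cmeas_comp me measurable_fst).
have Goo : (\int[mu]_y \int[mu]_z (normc (G (y, z)))%:E < +oo)%E.
  rewrite (_ : (\int[mu]_y _)%E = (\int[mu]_x \int[mu]_z (normc (g (x - z) * h z))%:E)%E); last first.
    by apply: eq_integral => y _; apply: eq_integral => z _; rewrite /G normcM (normc_expi (1 * (y * x))) mulr1.
  exact: conv_finite.
have ihx : cinteg (fun z => h z * e z) by exact: cintegrable_mulb.
have igx : cinteg (fun z => g z * e z) by exact: cintegrable_mulb.
pose A := cintR (fun z => g z * e z).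
have inner z : cintR (fun y => G (y, z)) = A * (h z * e z).
  have mPhi : cmeasR (fun t => (h z * e z) * (g t * e t)) by apply: cmeasZ; exact: igx.1.
  rewrite mulrC -(cintZ measurableT _ igx) -(cint_translation (- z) mPhi).
  apply: eq_cint => y _; rewrite /G/=.
  have -> : e y = e (y - z) * e z by rewrite /e -cexpiD; congr cexpi; ring.
  have mul3 (a b c d : C) : a * b * (c * d) = b * d * (a * c) by ring.
  exact: mul3.
have iG : cinteg (fun y => cconv g h y * e y) := cintegrable_mulb (cinteg_cconv ig ih gL hL) me ne.
have fub := @cint_fubini _ _ (measurableTypeR R) (measurableTypeR R) R mu mu G mG Goo.
have outer : cintR (fun y => cconv g h y * e y) = A * cintR (fun z => h z * e z).
  rewrite -(cintZ measurableT _ ihx).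
  transitivity (cintR (fun y => cintR (fun z => G (y, z)))).
    apply: eq_cint => y _; rewrite /cconv [RHS](_ : _ = cintR (fun z => e y * (g (y - z) * h z))); last first.
      by apply: eq_cint => z _; rewrite /G mulrC.
    by rewrite (cintZ measurableT _ (cinteg_conv y gL hL)) mulrC.
  by rewrite fub; apply: eq_cint => z _; exact: inner.
transitivity (c0%:C%C * (c0%:C%C * cintR (fun y => cconv g h y * e y))).
  have mul3 (a b c : C) : a * b * c = a * (b * c) by rewrite mulrA.
  by rewrite -(cintZ measurableT _ iG); congr (_ * _); apply: eq_cint => y _; exact: mul3.
by rewrite outer /A; ring.
Qed.

Lemma ge0_sqrD_le (n : R) (a b : \bar R) : 0 <= n -> (0 <= a)%E -> (0 <= b)%E ->
  (n%:E <= a + b)%E -> ((n ^+ 2)%:E <= 2%:E * (a ^+ 2 + b ^+ 2))%E.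
Proof.
move=> n0; case: a => [a| |] //; case: b => [b| |] //; rewrite ?lee_fin.
- move=> a0 b0 nab; rewrite -!expr2.
  apply: (@le_trans _ _ ((a + b) ^+ 2)); first by rewrite ler_pXn2r ?nnegrE// addr_ge0.
  by rewrite -subr_ge0 (_ : _ - _ = (a - b) ^+ 2) ?sqr_ge0//; ring.
all: move=> *; rewrite ?mulyy ?addye ?addey// ?gt0_muley ?leey ?lte_fin//.
Qed.

(** [c0] comes from the convolution theorem, [2^p] from [wt_conv], the two Sobolev constants from
    the L^1 factors of its two terms, and the leading 2 absorbs the squaring of their sum. *)
Definition cP s p : R := 2 * (c0 * 2 `^ p) * (cS p + cS s).

Lemma cP_ge0 s p : 0 <= cP s p.
Proof.
by rewrite !mulr_ge0 ?addr_ge0 ?cS_ge0 ?powR_ge0// ltW// c0_gt0.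
Qed.

Lemma cP_sqr (c x y K1 K2 : R) : 0 <= x -> 0 <= y ->
  c ^+ 2 * (2 * ((x * K2 * K1) ^+ 2 + (y * K1 * K2) ^+ 2)) <= (2 * c * (x + y) * K1 * K2) ^+ 2.
Proof.
move=> x0 y0; rewrite -subr_ge0.
rewrite (_ : _ - _ = 2 * (c * K1 * K2) ^+ 2 * (x ^+ 2 + 4 * (x * y) + y ^+ 2)); last by ring.
have := sqr_ge0 x; have := sqr_ge0 y; have := mulr_ge0 x0 y0; have := sqr_ge0 (c * K1 * K2).
by move=> h1 h2 h3 h4; rewrite mulr_ge0//; lra.
Qed.

(** [wt_conv] splits the weighted convolution into [E1], with [h] in L^1 and [g] in weighted L^2,
    and [E2], with the roles exchanged; Young's inequality bounds each. The multiplier may have a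
    larger exponent than the result, since the energy estimate multiplies functions controlled with
    exponent s - 1/2. *)
Lemma L2le_cconv rho s p K1 K2 g h : 0 <= rho -> 1 / 2 < p -> p <= s -> 0 <= K1 -> 0 <= K2 ->
  cmeasR g -> cmeasR h -> L2le mu K1 (fun xi => wt rho s xi * normc (g xi)) ->
  L2le mu K2 (fun xi => wt rho p xi * normc (h xi)) ->
  L2le mu (cP s p * K1 * K2) (fun xi => wt rho p xi * normc (c0%:C%C * cconv g h xi)).
Proof.
move=> r0 p2 ps K10 K20 mg mh gK hK; have s2 : 1 / 2 < s by exact: lt_le_trans ps.
have p0 : 0 <= p by lra.
have [ig gL] := wt_integ s2 r0 K10 mg gK; have [ih hL] := wt_integ p2 r0 K20 mh hK.
have mc : cmeasR (fun xi => c0%:C%C * cconv g h xi) by apply: cmeasZ; exact: cmeas_cconv.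
pose G1 x := wt rho 0 x * normc (g x); pose G2 x := wt rho 0 x * normc (h x).
pose H1 x := wt rho p x * normc (g x); pose H2 x := wt rho p x * normc (h x).
have mG1 : measurable_fun setT G1 by exact: measurable_wtM.
have mG2 : measurable_fun setT G2 by exact: measurable_wtM.
have mH1 : measurable_fun setT H1 by exact: measurable_wtM.
have mH2 : measurable_fun setT H2 by exact: measurable_wtM.
have G10 x : 0 <= G1 x by rewrite mulr_ge0 ?normc_ge0// ltW// wt_gt0.
have G20 x : 0 <= G2 x by rewrite mulr_ge0 ?normc_ge0// ltW// wt_gt0.
have H10 x : 0 <= H1 x by rewrite mulr_ge0 ?normc_ge0// ltW// wt_gt0.
have H20 x : 0 <= H2 x by rewrite mulr_ge0 ?normc_ge0// ltW// wt_gt0.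
have H1K : L2le mu K1 H1.
  apply: L2le_le gK => // x; rewrite ger0_norm// ler_wpM2r ?normc_ge0//.
  exact: le_wt.
pose E1 x := (\int[mu]_z (G2 z * H1 (x - z))%:E)%E.
pose E2 x := (\int[mu]_z (G1 z * H2 (x - z))%:E)%E.
have E10 x : (0 <= E1 x)%E by apply: integral_ge0 => z _; rewrite lee_fin mulr_ge0.
have E20 x : (0 <= E2 x)%E by apply: integral_ge0 => z _; rewrite lee_fin mulr_ge0.
have mE1 : measurable_fun setT E1.
  apply: (@measurable_fun_fubini_tonelli_F _ _ _ _ _ mu (fun xz : R * R => (G2 xz.2 * H1 (xz.1 - xz.2))%:E)).
    exact: measurable_conv_kernel.
  by move=> x; rewrite lee_fin mulr_ge0.
have mE2 : measurable_fun setT E2.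
  apply: (@measurable_fun_fubini_tonelli_F _ _ _ _ _ mu (fun xz : R * R => (G1 xz.2 * H2 (xz.1 - xz.2))%:E)).
    exact: measurable_conv_kernel.
  by move=> x; rewrite lee_fin mulr_ge0.
have Y1 := young0 (mulr_ge0 (cS_ge0 p) K20) K10 mG2 G20 H10 (wt_L1 p2 K20 mh hK) H1K.
have Y2 := young0 (mulr_ge0 (cS_ge0 s) K10) K20 mG1 G10 H20 (wt_L1 s2 K10 mg gK) hK.
pose c := c0 * 2 `^ p; have c_0 : 0 <= c by rewrite mulr_ge0 ?powR_ge0// ltW// c0_gt0.
pose N x := wt rho p x * normc (cconv g h x) / 2 `^ p.
have N0 x : 0 <= N x by rewrite !mulr_ge0 ?invr_ge0 ?normc_ge0 ?powR_ge0// ltW// wt_gt0.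
have pp : 0 < 2 `^ p :> R by exact: powR_gt0.
have NE x : wt rho p x * normc (c0%:C%C * cconv g h x) = c * N x.
  rewrite normcM normc_real gtr0_norm ?c0_gt0// /c /N.
  have ring1 (w n k q : R) : q != 0 -> w * (k * n) = k * q * (w * n / q) by move=> q0; field.
  by apply: ring1; rewrite gt_eqF.
have NE12 x : ((N x)%:E <= E1 x + E2 x)%E.
  have mgx : measurable_fun setT (fun z : R => normc (g (x - z))).
    by apply: measurable_normc; have [] := L2f_sub x gL.
  have mx (F : R -> R) : measurable_fun setT F -> measurable_fun setT (fun z : R => F (x - z)).
    by move=> mF; apply: (measurableT_comp mF); exact: measurable_funB.
  have -> : E2 x = (\int[mu]_z (G1 (x - z) * H2 z)%:E)%E.
    rewrite /E2 -(lebesgue_integral_sub x); last first.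
      apply/measurable_EFinP; apply: measurable_funM => //; exact: mx.
    by apply: eq_integral => z _; rewrite opprB addrCA subrr addr0.
  rewrite /E1 -integral_finD; last 4 first.
  - by apply: measurable_funM => //; exact: mx.
  - by apply: measurable_funM => //; exact: mx.
  - by move=> z; rewrite mulr_ge0.
  - by move=> z; rewrite mulr_ge0.
  have igh := cinteg_conv x gL hL.
  have wp : 0 <= wt rho p x / 2 `^ p by rewrite divr_ge0 ?powR_ge0// ltW// wt_gt0.
  apply: (@le_trans _ _ (\int[mu]_z (wt rho p x / 2 `^ p * normc (g (x - z) * h z))%:E)%E).
    rewrite (integral_finZ mu (measurable_normc igh.1) wp); last by move=> z; exact: normc_ge0.
    rewrite /N mulrAC EFinM; apply: lee_wpmul2l; first by rewrite lee_fin.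
    by apply: normc_cint_le => //; exact: igh.1.
  apply: le_integral_fin.
  - by apply: measurable_funM => //; apply: measurable_normc; exact: igh.1.
  - by apply: measurable_funD; apply: measurable_funM => //; exact: mx.
  - by move=> z; rewrite mulr_ge0// normc_ge0.
  - move=> z; have := wt_conv (x - z) z r0 p0; rewrite subrK => w.
    rewrite normcM mulrAC ler_pdivrMr//.
    apply: le_trans (ler_wpM2r (mulr_ge0 (normc_ge0 _) (normc_ge0 _)) w) _.
    rewrite le_eqVlt; apply/orP; left; apply/eqP; rewrite /G1 /G2 /H1 /H2; ring.
have mN : measurable_fun setT N.
  by apply: measurable_funM => //; apply: measurable_wtM; exact: cmeas_cconv.
split; first exact: measurable_wtM.
under eq_integral do rewrite NE exprMn.
rewrite integral_finZ ?sqr_ge0//; [|exact: measurable_funX|by move=> x; exact: sqr_ge0].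
have NI : (\int[mu]_x (N x ^+ 2)%:E <= 2%:E * ((cS p * K2 * K1) ^+ 2 + (cS s * K1 * K2) ^+ 2)%:E)%E.
  apply: (@le_trans _ _ (\int[mu]_x (2%:E * (E1 x ^+ 2 + E2 x ^+ 2)))%E).
    have mE12 : measurable_fun setT (fun x => E1 x ^+ 2 + E2 x ^+ 2)%E.
      by apply: emeasurable_funD; exact: emeasurable_funM.
    apply: ge0_le_integral => //.
    - by move=> x _; rewrite lee_fin sqr_ge0.
    - by apply/measurable_EFinP; exact: measurable_funX.
    - exact: emeasurable_funM.
    - by move=> x _; exact: ge0_sqrD_le.
  have sq0 (y : \bar R) : (0 <= y)%E -> (0 <= y ^+ 2)%E by move=> y0; exact: expe_ge0.
  rewrite ge0_integralZl//; last 2 first.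
  - by apply: emeasurable_funD; exact: emeasurable_funM.
  - by move=> x _; rewrite adde_ge0// sq0.
  apply: lee_wpmul2l => //; rewrite ge0_integralD//; last 4 first.
  - by move=> x _; exact: sq0.
  - exact: emeasurable_funM.
  - by move=> x _; exact: sq0.
  - exact: emeasurable_funM.
  by rewrite EFinD; exact: leeD.
apply: (@le_trans _ _ ((c ^+ 2)%:E * (2%:E * ((cS p * K2 * K1) ^+ 2 + (cS s * K1 * K2) ^+ 2)%:E))%E).
  by apply: lee_wpmul2l => //; rewrite lee_fin sqr_ge0.
rewrite -!EFinM lee_fin /cP -/c.
by apply: cP_sqr; rewrite ?cS_ge0.
Qed.

(** A ball of the weighted space, made of functions that equal the inverse transform at every point
    and not merely almost everywhere. *)
Definition B rho p K (f : R -> C) : Prop := 0 <= K /\ exists g, [/\ cmeasR g,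
  L2le mu K (fun xi => wt rho p xi * normc (g xi)) & forall x, f x = IF g x].

Lemma B_ge0 rho p K f : B rho p K f -> 0 <= K. Proof. by case. Qed.

Lemma B_ext rho p K f f' : (forall x, f x = f' x) -> B rho p K f -> B rho p K f'.
Proof. by move=> /funext ->. Qed.

Lemma B_le rho rho' p p' K K' f : rho' <= rho -> p' <= p -> K <= K' ->
  B rho p K f -> B rho' p' K' f.
Proof.
move=> rr pp KK [K0 [g [mg gK gE]]]; have K0' : 0 <= K' by exact: le_trans KK.
split=> //; exists g; split=> //; apply: (@L2le_leK _ _ _ _ K); first by rewrite K0.
apply: L2le_le gK; first exact: measurable_wtM.
by move=> x; rewrite normr_wtM ler_wpM2r ?normc_ge0// le_wt.
Qed.

Lemma IFD g h x : cinteg g -> cinteg h -> IF (fun xi => g xi + h xi) x = IF g x + IF h x.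
Proof.
move=> ig ih; rewrite /IF -mulrDr /tf -cintD//.
- by congr (_ * _); apply: eq_cint => t _; rewrite mulrDl.
- by apply: cintegrable_mulb => //; [exact: measurable_expi1|move=> t; rewrite normc_expi].
- by apply: cintegrable_mulb => //; [exact: measurable_expi1|move=> t; rewrite normc_expi].
Qed.

Lemma IFZ (c : C) g x : cinteg g -> IF (fun xi => c * g xi) x = c * IF g x.
Proof.
have mul3 (a b d : C) : a * b * d = a * (b * d) by rewrite mulrA.
move=> ig; rewrite /IF mulrCA; congr (_ * _); rewrite /tf -cintZ//.
  by apply: eq_cint => t _; exact: mul3.
by apply: cintegrable_mulb => //; [exact: measurable_expi1|move=> t; rewrite normc_expi].
Qed.

Lemma B_add rho p K1 K2 f1 f2 : 0 <= rho -> 1 / 2 < p ->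
  B rho p K1 f1 -> B rho p K2 f2 -> B rho p (K1 + K2) (fun x => f1 x + f2 x).
Proof.
move=> r0 p2 [K10 [g1 [m1 h1 e1]]] [K20 [g2 [m2 h2 e2]]]; split; first exact: addr_ge0.
have [i1 _] := wt_integ p2 r0 K10 m1 h1; have [i2 _] := wt_integ p2 r0 K20 m2 h2.
exists (fun xi => g1 xi + g2 xi); split; first exact: cmeasD.
  apply: L2le_le (L2leD K10 K20 h1 h2); first by apply: measurable_wtM; exact: cmeasD.
  move=> x; have w := ltW (wt_gt0 rho p x).
  by rewrite normr_wtM -mulrDr ler_wpM2l// le_normcD.
by move=> x; rewrite IFD// e1 e2.
Qed.

Lemma B_scale rho p K (c : C) f : 0 <= rho -> 1 / 2 < p ->
  B rho p K f -> B rho p (normc c * K) (fun x => c * f x).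
Proof.
move=> r0 p2 [K0 [g [m h e]]]; split; first by rewrite mulr_ge0// normc_ge0.
have [i _] := wt_integ p2 r0 K0 m h.
exists (fun xi => c * g xi); split; first exact: cmeasZ.
  have := L2leZ (normc c) h; rewrite ger0_norm ?normc_ge0//; apply: L2le_ext => x.
  by rewrite normcM mulrCA.
by move=> x; rewrite IFZ// e.
Qed.

Lemma B_mul rho s p K1 K2 f1 f2 : 0 <= rho -> 1 / 2 < p -> p <= s ->
  B rho s K1 f1 -> B rho p K2 f2 -> B rho p (cP s p * K1 * K2) (fun x => f1 x * f2 x).
Proof.
move=> r0 p2 ps [K10 [g1 [m1 h1 e1]]] [K20 [g2 [m2 h2 e2]]].
have s2 : 1 / 2 < s by exact: lt_le_trans ps.
have [i1 l1] := wt_integ s2 r0 K10 m1 h1; have [i2 l2] := wt_integ p2 r0 K20 m2 h2.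
split; first exact: mulr_ge0 (mulr_ge0 (cP_ge0 s p) K10) K20.
exists (fun xi => c0%:C%C * cconv g1 g2 xi); split.
- by apply: cmeasZ; exact: cmeas_cconv.
- exact: L2le_cconv.
- by move=> x; rewrite IF_cconv// e1 e2.
Qed.

Lemma B_sup rho p K f x : 0 <= rho -> 1 / 2 < p -> B rho p K f ->
  normc (f x) <= c0 * (cS p * K).
Proof.
move=> r0 p2 [K0 [g [m h e]]]; have [i _] := wt_integ p2 r0 K0 m h.
rewrite e /IF normcM normc_real gtr0_norm ?c0_gt0// ler_pM2l ?c0_gt0//.
rewrite -lee_fin; apply: le_trans (normc_tf 1 x i) _; apply: le_trans (wt_L1 p2 K0 m h).
apply: le_integral_fin; [exact: measurable_normc|exact: measurable_wtM|by move=> y; exact: normc_ge0|].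
by move=> y; rewrite ler_peMl ?normc_ge0// wt_ge1.
Qed.

Lemma L2_series_le (f_ : nat -> R -> C) (f : R -> C) (h : R -> R) (A : set R) x :
  [/\ 0 <= h x, x \notin A -> f x = 0,
      x \in A -> forall N, \sum_(n < N) normc (f_ n x) <= h x &
      x \in A -> normc (\sum_(n < N) f_ n x - f x) @[N --> \oo] --> 0] ->
  normc (f x) <= h x.
Proof.
move=> [h0 fD hD cv]; have [xD|xD] := boolP (x \in A); last by rewrite fD// normc0.
have cvh : normc (\sum_(n < N) f_ n x - f x) + h x @[N --> \oo] --> 0 + h x.
  by apply: cvgD; [exact: cv|exact: cvg_cst].
rewrite add0r in cvh; apply: le_cvg cvh => N; set S := \sum_(n < N) _.
have := le_normcB S (S - f x); rewrite subKr addrC => /le_trans; apply.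
by rewrite lerD2l (le_trans (normc_sum _ _ _))// hD.
Qed.

(** [L2_series] sums the weighted transforms; the inverse transforms converge at every point by
    dominated convergence, the majorant being integrable by Cauchy-Schwarz against 1 / wt. *)
Lemma B_series rho p (K_ : nat -> R) K (f_ : nat -> R -> C) : 0 <= rho -> 1 / 2 < p ->
  (forall n, B rho p (K_ n) (f_ n)) -> (forall N, \sum_(n < N) K_ n <= K) ->
  exists2 f, B rho p K f & forall x, normc (\sum_(n < N) f_ n x - f x) @[N --> \oo] --> 0.
Proof.
move=> r0 p2 fB sK; have K_0 n : 0 <= K_ n := B_ge0 (fB n).
have K0 : 0 <= K by have := sK 0%N; rewrite big_ord0.
have /choice[g_ hg] n := (fB n).2.
have mg n : cmeasR (g_ n) by have [] := hg n.
have gK n : L2le mu (K_ n) (fun xi => wt rho p xi * normc (g_ n xi)) by have [] := hg n.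
have gE n x : f_ n x = IF (g_ n) x by have [] := hg n.
pose G n xi : C := (wt rho p xi)%:C%C * g_ n xi.
have w0 xi : 0 <= wt rho p xi by exact: ltW (wt_gt0 _ _ _).
have nG n xi : normc (G n xi) = wt rho p xi * normc (g_ n xi).
  by rewrite normcM normc_real ger0_norm.
have mG n : cmeasR (G n) by apply: cmeasM => //; apply: cmeas_real; exact: measurable_wt.
have GK n : L2le mu (K_ n) (fun xi => normc (G n xi)).
  by apply: L2le_ext (gK n) => xi; rewrite nG.
have [A [F [h [mA A0 mF hK hF]]]] := L2_series mG K_0 GK sK.
have Fh x : normc (F x) <= h x by apply: L2_series_le (hF x).
have h0 x : 0 <= h x by have [] := hF x.
pose g xi : C := (wt rho p xi)^-1%:C%C * F xi.
have mwi : measurable_fun [set: R] (fun xi => (wt rho p xi)^-1).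
  rewrite (_ : (fun xi => _) = wt (- rho) (- p)); first exact: measurable_wt.
  by apply/funext => xi; rewrite /wt mulNr expRN powRN invfM.
have mg0 : cmeasR g by apply: cmeasM => //; exact: cmeas_real.
have ng xi : wt rho p xi * normc (g xi) = normc (F xi).
  by rewrite normcM normc_real ger0_norm ?invr_ge0// mulrA divff ?mul1r// gt_eqF// wt_gt0.
have gK0 : L2le mu K (fun xi => wt rho p xi * normc (g xi)).
  apply: L2le_le hK; first exact: measurable_wtM.
  by move=> xi; rewrite ng ger0_norm ?normc_ge0.
exists (IF g); first by split=> //; exists g.
move=> x.
pose e (t : R) := cexpi (1 * (t * x)).
have me : cmeasR e by exact: measurable_expi1.
have ne t : normc (e t) = 1 by rewrite normc_expi.
have [mh hK2] := hK.
pose hd xi := (wt rho p xi)^-1 * h xi.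
have mhd : measurable_fun [set: R] hd by exact: measurable_funM.
have ihd : mu.-integrable setT (EFin \o hd).
  apply/integrableP; split; first exact/measurable_EFinP.
  have hL : L2le mu (cS p) (fun xi => (wt rho p xi)^-1).
    apply: L2le_le (L2le_kk p2) => // xi; rewrite ger0_norm ?invr_ge0//.
    rewrite lef_pV2 ?posrE ?wt_gt0 ?powR_gt0 ?kk_gt0//.
    by rewrite ler_peMl ?powR_ge0// -expR0 ler_expR mulr_ge0// ltW// kk_gt0.
  apply: le_lt_trans (L2le_CS (cS_ge0 p) K0 hL (conj mh hK2)) _; exact: ltry.
have ig n : cinteg (g_ n) by have [] := wt_integ p2 r0 (K_0 n) (mg n) (gK n).
have dct : normc (cintR (fun xi => (\sum_(n < N) g_ n xi) * e xi) - cintR (fun xi => g xi * e xi)) @[N --> \oo] --> 0.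
  (* The majorant controls the partial sums only on [A]; inserting its indicator changes no
     integral. *)
  pose D xi : C := (\1_A xi : R)%:C%C.
  have nD xi : normc (D xi) <= 1.
    by rewrite /D indicE; case: (_ \in _); rewrite ?normc1 ?normc0.
  have aeA : {ae mu, forall x, x \in A}.
    by exists (~` A); split; [exact: measurableC|exact: A0|apply: subsetC => y /mem_set].
  have eqA N : cintR (fun xi => (\sum_(n < N) g_ n xi) * e xi) = cintR (fun xi => D xi * (\sum_(n < N) g_ n xi) * e xi).
    have mS : cmeasR (fun xi => (\sum_(n < N) g_ n xi) * e xi).
      by apply: cmeasM => //; exact: cmeas_sum.
    have mD : cmeasR D by apply: cmeas_real; exact: measurable_indic.
    have mS' : cmeasR (fun xi => D xi * (\sum_(n < N) g_ n xi) * e xi).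
      by apply: cmeasM => //; apply: cmeasM => //; exact: cmeas_sum.
    have DE xi : xi \in A -> D xi = 1 by move=> xA; rewrite /D indicE xA.
    congr Complex; congr fine; apply: ae_eq_integral => //.
    - by apply/measurable_EFinP; exact: mS.1.
    - by apply/measurable_EFinP; exact: mS'.1.
    - by apply: ae_mono aeA => xi xA _; rewrite DE ?mul1r.
    - by apply/measurable_EFinP; exact: mS.2.
    - by apply/measurable_EFinP; exact: mS'.2.
    - by apply: ae_mono aeA => xi xA _; rewrite DE ?mul1r.
  under eq_fun do rewrite eqA.
  have wS N xi : (wt rho p xi)%:C%C * \sum_(n < N) g_ n xi = \sum_(n < N) G n xi.
    by rewrite mulr_sumr.
  apply: (cint_dct measurableT _ _ ihd).
  - move=> N; apply: cmeasM => //; apply: cmeasM; last exact: cmeas_sum.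
    by apply: cmeas_real; exact: measurable_indic.
  - exact: cmeasM.
  - apply: ae_mono aeA => xi xA _.
    have [_ _ _ /(_ xA) cv] := hF xi.
    rewrite (_ : (fun N => _) = fun N => (wt rho p xi)^-1 * normc (\sum_(n < N) G n xi - F xi)).
      exact: cvg0Z.
    apply/funext => N; rewrite /D indicE xA mul1r -mulrBl normcM ne mulr1.
    have wn : 0 < wt rho p xi by exact: wt_gt0.
    rewrite -wS; have -> : F xi = (wt rho p xi)%:C%C * g xi.
      by rewrite /g mulrA -rmorphM divff ?mul1r// gt_eqF.
    by rewrite -mulrBr normcM normc_real gtr0_norm// mulrA mulVf ?mul1r// gt_eqF.
  - move=> N xi _; rewrite normcM ne mulr1 normcM.
    have [xA|xA] := boolP (xi \in A); last first.
      by rewrite /D indicE (negbTE xA) normc0 mul0r mulr_ge0 ?invr_ge0.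
    have [_ _ /(_ xA N) hS _] := hF xi.
    apply: (@le_trans _ _ (normc (\sum_(n < N) g_ n xi))); first by rewrite ler_piMl ?normc_ge0.
    have wn : 0 < wt rho p xi by exact: wt_gt0.
    rewrite -[X in X <= _](mulKf (lt0r_neq0 wn)) ler_pM2l ?invr_gt0//.
    have := congr1 (@normc R) (wS N xi); rewrite normcM normc_real gtr0_norm// => ->.
    exact: le_trans (normc_sum _ _ _) hS.
have SE N : \sum_(n < N) f_ n x = c0%:C%C * cintR (fun xi => (\sum_(n < N) g_ n xi) * e xi).
  under eq_bigr do rewrite gE.
  elim: N => [|N ih].
    have c00 : cintR (fun xi => (\sum_(n < 0) g_ n xi) * e xi) = 0.
      transitivity (cintR (fun=> 0)); last exact: cint0.
      by apply: eq_cint => y _; rewrite big_ord0 mul0r.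
    by rewrite big_ord0 c00 mulr0.
  rewrite big_ord_recr/= ih /IF /tf -mulrDr -cintD//.
  - by congr (_ * _); apply: eq_cint => y _; rewrite big_ord_recr/= mulrDl.
  - apply: (cintegrable_mulb _ me) => [|t]; last by rewrite ne.
    exact: cintegrable_sum.
  - by apply: (cintegrable_mulb _ me) => // t; rewrite ne.
under eq_fun do rewrite SE /IF /tf -mulrBr normcM.
exact: cvg0Z.
Qed.

(** The derivative with a quadratic remainder valid for all [h]. Two integrable moments of the
    transform provide it, and it passes to sums and multiples without epsilons. *)
Definition cdiff (f : R -> C) (x : R) (l : C) : Prop :=
  exists c : R, forall h : R, normc (f (x + h) - f x - h%:C%C * l) <= c * h ^+ 2.

Lemma cdiff_unique f x l l' : cdiff f x l -> cdiff f x l' -> l = l'.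
Proof.
move=> [c h] [c' h']; apply/eqP; rewrite -subr_eq0 -normc_eq0 eq_le normc_ge0 andbT.
apply/ler_addgt0Pl => e e0; rewrite addr0.
pose d := `|c| + `|c'| + 1; have d0 : 0 < d by rewrite ltr_wpDl// addr_ge0.
pose t := e / d; have t0 : 0 < t by rewrite divr_gt0.
have H : t * normc (l - l') <= (c + c') * t ^+ 2.
  rewrite -(gtr0_norm t0) -normc_real -normcM.
  rewrite (_ : _ * _ = (f (x + t) - f x - t%:C%C * l') - (f (x + t) - f x - t%:C%C * l)); last by ring.
  apply: le_trans (le_normcB _ _) _; rewrite mulrDl addrC normc_real gtr0_norm// lerD//.
rewrite expr2 mulrA [_ * t * t]mulrC ler_pM2l// in H.
apply: le_trans H _; rewrite /t mulrA ler_pdivrMr// mulrC ler_pM2l//.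
by have := ler_norm c; have := ler_norm c'; rewrite /d; lra.
Qed.

Definition Dx (f : R -> C) (x : R) : C := xget 0 [set l | cdiff f x l].

Lemma DxE f x l : cdiff f x l -> Dx f x = l.
Proof.
by move=> h; rewrite /Dx; case: xgetP => [_ -> /cdiff_unique/(_ h)//|/(_ l)].
Qed.

Definition imul (g : R -> C) (xi : R) : C := Complex 0 xi * g xi.

Lemma cmeas_imul g : cmeasR g -> cmeasR (imul g).
Proof. by move=> mg; apply: cmeasM => //; split => //=; exact: measurable_cst. Qed.

Lemma normc_imul g xi : normc (imul g xi) = `|xi| * normc (g xi).
Proof. by rewrite normcM /= expr0n add0r sqrtr_sqr. Qed.

(** Differentiation under the integral in quantitative form: |e^{iht} - 1 - iht| <= (ht)^2, and kk^2
    |g| is integrable. *)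
Lemma cdiff_IF g x : cinteg (fun xi => (kk xi ^+ 2)%:C%C * g xi) -> cmeasR g ->
  cdiff (IF g) x (IF (imul g) x).
Proof.
move=> i2 mg.
have kle (v : R -> C) : cmeasR v -> (forall xi, normc (v xi) <= kk xi ^+ 2 * normc (g xi)) -> cinteg v.
  move=> mv vle; apply: (@le_cintegrable _ _ _ mu setT measurableT _ (fun xi => normc ((kk xi ^+ 2)%:C%C * g xi))) => //.
  - by apply: measurable_normc; exact: i2.1.
  - by move=> xi _; rewrite normcM normc_real ger0_norm ?sqr_ge0.
  - exact: i2.2.
have ig : cinteg g.
  by apply: kle => // xi; rewrite ler_peMl ?normc_ge0// exprn_ege1// kk_ge1.
have iig : cinteg (imul g).
  apply: kle; first exact: cmeas_imul.
  move=> xi; rewrite normc_imul ler_wpM2r ?normc_ge0//.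
  have k1 := kk_ge1 xi; apply: (@le_trans _ _ (kk xi)); first by rewrite lerDr.
  by rewrite expr2 ler_peMl// ltW// kk_gt0.
pose N := fine (\int[mu]_xi (normc ((kk xi ^+ 2)%:C%C * g xi))%:E).
have N0 : 0 <= N by rewrite fine_ge0// integral_ge0// => y _; rewrite lee_fin normc_ge0.
exists (c0 * N) => h.
pose e (y t : R) := cexpi (1 * (t * y)).
have ne y t : normc (e y t) <= 1 by rewrite normc_expi.
have me y : cmeasR (e y) by exact: measurable_expi1.
pose r t := cexpi (h * t) - 1 - Complex 0 (h * t).
have E : IF g (x + h) - IF g x - h%:C%C * IF (imul g) x = c0%:C%C * cintR (fun t => g t * e x t * r t).
  rewrite /IF /tf mulrCA -!mulrBr; congr (_ * _).
  have iz : cinteg (fun t => imul g t * e x t) by exact: cintegrable_mulb.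
  have i1 y : cinteg (fun t => g t * e y t) by exact: cintegrable_mulb.
  have i2' := cintegrableB measurableT (i1 (x + h)) (i1 x).
  have -> : cintR (fun t => g t * cexpi (1 * (t * (x + h)))) - cintR (fun t => g t * cexpi (1 * (t * x))) =
      cintR (fun t => g t * e (x + h) t - g t * e x t).
    by rewrite (cintB measurableT (i1 (x + h)) (i1 x)).
  rewrite -(cintZ measurableT h%:C%C iz) -(cintB measurableT i2' (cintegrableZ measurableT h%:C%C iz)).
  apply: eq_cint => t _; rewrite /r.
  have -> : e (x + h) t = e x t * cexpi (h * t) by rewrite /e -cexpiD; congr cexpi; ring.
  have -> : imul g t = Complex 0 t * g t by [].
  have -> : Complex 0 (h * t) = h%:C%C * Complex 0 t by apply: complexP => /=; ring.
  rewrite /e; move: (cexpi _) (cexpi _) (g t) (h%:C%C) (Complex 0 t) => a b c d f; ring.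
rewrite E normcM normc_real gtr0_norm ?c0_gt0// -mulrA ler_pM2l ?c0_gt0//.
have mr : cmeasR r.
  apply: cmeasB; first by apply: cmeasB; [apply: cmeas_expi; exact: measurable_funM|exact: cmeas_cst].
  by split => /=; [exact: measurable_cst|exact: measurable_funM].
have mi : cmeasR (fun t => g t * e x t * r t) by apply: cmeasM => //; exact: cmeasM.
rewrite -lee_fin; apply: le_trans; first by apply: normc_cint_le => //; exact: mi.
rewrite mulrC EFinM /N fineK; last first.
  by rewrite ge0_fin_numE; [exact: i2.2|apply: integral_ge0 => y _; rewrite lee_fin normc_ge0].
rewrite -integral_finZ ?sqr_ge0//; last 2 first.
- by apply: measurable_normc; exact: i2.1.
- by move=> t; exact: normc_ge0.
apply: le_integral_fin.
- exact: measurable_normc.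
- by apply: measurable_funM => //; apply: measurable_normc; exact: i2.1.
- by move=> t; exact: normc_ge0.
- move=> t; rewrite !normcM (normc_expi (1 * (t * x))) mulr1 mulrC normc_real ger0_norm ?sqr_ge0// mulrA ler_wpM2r ?normc_ge0//.
  apply: le_trans (cexpi_sub1_lin _) _; rewrite exprMn ler_wpM2l ?sqr_ge0//.
  have k0 := ltW (kk_gt0 t); rewrite -real_normK ?num_real//.
  rewrite ler_pXn2r ?nnegrE//; by rewrite /kk lerDr.
Qed.

(** x <= e^x for x = d kk: the source of the factor 1 / (rho' - rho) lost by a derivative. *)
Lemma kk_le_wt (d xi : R) : 0 < d -> kk xi <= d^-1 * wt d 0 xi.
Proof.
move=> d0; rewrite wt_expR mulrC ler_pdivlMr// mulrC.
by apply: le_trans (expR_ge1Dx _); rewrite lerDr.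
Qed.

Lemma kk2_le_wt (d xi : R) : 0 < d -> kk xi ^+ 2 <= (2 / d) ^+ 2 * wt d 0 xi.
Proof.
move=> d0; have d20 : 0 < d / 2 by rewrite divr_gt0.
have := kk_le_wt xi d20; rewrite invf_div => h.
have -> : wt d 0 xi = wt (d / 2) 0 xi ^+ 2.
  by rewrite !wt_expR expr2 -expRD; congr expR; field.
rewrite -exprMn ler_pXn2r ?nnegrE//; first by rewrite ltW// kk_gt0.
by rewrite mulr_ge0 ?divr_ge0// ltW// ?wt_gt0.
Qed.

Lemma wt_kk2_integ rho p K g : 0 < rho -> 1 / 2 < p -> 0 <= K -> cmeasR g ->
  L2le mu K (fun xi => wt rho p xi * normc (g xi)) -> cinteg (fun xi => (kk xi ^+ 2)%:C%C * g xi).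
Proof.
move=> rp p2 K0 mg gK.
apply: (@le_cintegrable _ _ _ mu setT measurableT _ (fun xi => (2 / rho) ^+ 2 * (wt rho 0 xi * normc (g xi)))).
- apply: cmeasM => //; apply: cmeas_real; apply: measurable_funX; exact: measurable_kk.
- by apply: measurable_funM => //; exact: measurable_wtM.
- move=> xi _; rewrite normcM normc_real ger0_norm ?sqr_ge0// mulrA ler_wpM2r ?normc_ge0//.
  exact: kk2_le_wt.
- have wg0 xi : 0 <= wt rho 0 xi * normc (g xi).
    by rewrite mulr_ge0 ?normc_ge0// ltW// wt_gt0.
  rewrite (integral_finZ mu (measurable_wtM rho 0 mg) (sqr_ge0 _) wg0).
  by apply: le_lt_trans (lee_wpmul2l _ (wt_L1 p2 K0 mg gK)) _; rewrite ?lee_fin ?sqr_ge0// -EFinM ltry.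
Qed.

Lemma L2le_imul rho rho' p K g : rho < rho' -> cmeasR g ->
  L2le mu K (fun xi => wt rho' p xi * normc (g xi)) ->
  L2le mu (K / (rho' - rho)) (fun xi => wt rho p xi * normc (imul g xi)).
Proof.
move=> rr mg gK; have d0 : 0 < rho' - rho by rewrite subr_gt0.
have := L2leZ (rho' - rho)^-1 gK; rewrite gtr0_norm ?invr_gt0// mulrC.
apply: L2le_le; first by apply: measurable_wtM; exact: cmeas_imul.
move=> xi; rewrite normr_wtM.
have -> : wt rho' p xi = wt rho p xi * wt (rho' - rho) 0 xi.
  have rE : rho + (rho' - rho) = rho' by rewrite addrC subrK.
  by rewrite -wtD addr0 rE.
have h : `|xi| <= (rho' - rho)^-1 * wt (rho' - rho) 0 xi.
  by apply: le_trans (kk_le_wt xi d0); rewrite lerDr.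
have w0 : 0 <= wt rho p xi * normc (g xi) by rewrite mulr_ge0 ?normc_ge0// ltW// wt_gt0.
have := ler_wpM2l w0 h; rewrite normc_imul.
have E1 (a b c : R) : a * b * c = a * (c * b) by ring.
have E2 (a b c d : R) : a * b * (c * d) = c * (a * d * b) by ring.
by rewrite (E1 _ (normc (g xi)) `|xi|) (E2 _ (normc (g xi))).
Qed.

Lemma B_deriv rho rho' p K f : 0 <= rho -> rho < rho' -> 1 / 2 < p -> B rho' p K f ->
  B rho p (K / (rho' - rho)) (Dx f) /\ forall x, cdiff f x (Dx f x).
Proof.
move=> r0 rr p2 [K0 [g [mg gK gE]]].
have rp : 0 < rho' by exact: le_lt_trans rr.
have i2 := wt_kk2_integ rp p2 K0 mg gK.
have dE x : cdiff f x (IF (imul g) x).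
  by have := @cdiff_IF g x i2 mg; rewrite (_ : IF g = f)//; apply/funext => y; rewrite gE.
split; last by move=> x; rewrite (DxE (dE x)).
split; first by rewrite divr_ge0// subr_ge0 ltW.
by exists (imul g); split; [exact: cmeas_imul|exact: L2le_imul|move=> x; rewrite (DxE (dE x))].
Qed.

End weights.

(** * Cauchy's integral formula *)

Section interval_integrals.
Variable R : realType.
Local Notation C := R[i].
Local Notation mu := (@lebesgue_measure R).
Local Notation Re := (@complex.Re R).
Local Notation Im := (@complex.Im R).
Implicit Types (f g h : R -> C).

Definition ccont g := continuous (fun x => Re (g x)) /\ continuous (fun x => Im (g x)).

Lemma ccont_cst (c : C) : ccont (fun=> c).
Proof. by split=> x; exact: cvg_cst. Qed.

Lemma ccontD g h : ccont g -> ccont h -> ccont (fun x => g x + h x).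
Proof.
move=> [g1 g2] [h1 h2]; split.
  by under eq_fun do rewrite ReDc; move=> x; apply: cvgD; [exact: g1|exact: h1].
by under eq_fun do rewrite ImDc; move=> x; apply: cvgD; [exact: g2|exact: h2].
Qed.

Lemma ccontM g h : ccont g -> ccont h -> ccont (fun x => g x * h x).
Proof.
move=> [g1 g2] [h1 h2]; split.
  under eq_fun do rewrite ReMc; move=> x; apply: cvgB; apply: cvgM;
    [exact: g1|exact: h1|exact: g2|exact: h2].
under eq_fun do rewrite ImMc; move=> x; apply: cvgD; apply: cvgM;
  [exact: g1|exact: h2|exact: g2|exact: h1].
Qed.

Lemma ccontB g h : ccont g -> ccont h -> ccont (fun x => g x - h x).
Proof.
move=> cg ch; under eq_fun do rewrite -mulN1r.
by apply: ccontD => //; apply: ccontM => //; exact: ccont_cst.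
Qed.

Lemma ccont_real (f : R -> R) : continuous f -> ccont (fun x => (f x)%:C%C).
Proof. by move=> cf; split => //= x; exact: cvg_cst. Qed.

Lemma ccont_near g x (e : R) : ccont g -> 0 < e -> \forall y \near x, normc (g y - g x) < e.
Proof.
move=> [c1 c2] e0; have e20 : 0 < e / 2 by rewrite divr_gt0.
have := c1 x; move=> /cvgrPdist_lt/(_ _ e20) h1.
have := c2 x; move=> /cvgrPdist_lt/(_ _ e20) h2.
near=> y; apply: le_lt_trans (normc_le_ReIm _) _.
rewrite ReDc ImDc ReNc ImNc (_ : e = e / 2 + e / 2); last by lra.
by apply: ltrD; rewrite distrC; near: y.
Unshelve. all: by end_near. Qed.

Lemma near_ccont g : (forall x (e : R), 0 < e -> \forall y \near x, normc (g y - g x) <= e) -> ccont g.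
Proof.
move=> h; split=> x; apply/cvgrPdist_le => e e0; have := h x e e0; apply: filterS => y.
  by apply: le_trans; rewrite distrC -ReNc -ReDc normc_Re.
by apply: le_trans; rewrite distrC -ImNc -ImDc normc_Im.
Qed.

Lemma ccont_lip g (L : R) : (forall x y, normc (g y - g x) <= L * `|y - x|) -> ccont g.
Proof.
move=> gL; apply: near_ccont => x e e0.
have d0 : 0 < e / (`|L| + 1) by rewrite divr_gt0// ltr_wpDl.
exists (e / (`|L| + 1)) => //= y /=; rewrite distrC => yx; apply: le_trans (gL x y) _.
have h : L * `|y - x| <= (`|L| + 1) * `|y - x|.
  by rewrite ler_wpM2r//; have := ler_norm L; lra.
apply: le_trans h _; rewrite mulrC -ler_pdivlMr ?ltr_wpDl//.
exact: ltW.
Qed.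

Lemma ccont_comp (F : C -> C) g :
  (forall z (e : R), 0 < e -> exists2 d : R, 0 < d & forall w, normc (w - z) < d -> normc (F w - F z) <= e) ->
  ccont g -> ccont (fun x => F (g x)).
Proof.
move=> cF cg; apply: near_ccont => x e e0; have [d d0 hd] := cF (g x) e e0.
by apply: filterS (ccont_near x cg d0) => y /hd.
Qed.

Lemma ccont_expi (c : R) : ccont (fun t => cexpi (c * t)).
Proof.
apply: (@ccont_lip _ `|c|) => x y.
have -> : cexpi (c * y) = cexpi (c * x) * cexpi (c * (y - x)).
  by rewrite -cexpiD; congr cexpi; ring.
rewrite -[X in _ - X]mulr1 -mulrBr normcM normc_expi mul1r (le_trans (cexpi_sub1 _))//.
by rewrite normrM.
Qed.

Lemma ccont_cexpi : ccont (@cexpi R).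
Proof.
have -> : @cexpi R = fun t => cexpi (1 * t) by apply/funext => t; rewrite mul1r.
exact: ccont_expi.
Qed.

Lemma cmeas_ccont g : ccont g -> @cmeas _ (measurableTypeR R) R setT g.
Proof. by move=> [c1 c2]; split; exact: continuous_measurable_fun. Qed.

Definition ii (a b : R) g := cint mu `[a, b] g.

Lemma ii_integrable (a b : R) g : ccont g -> cintegrable mu `[a, b] g.
Proof.
move=> [c1 c2]; apply: cintegrable_ReIm; first exact: measurable_itv.
  apply: continuous_compact_integrable; first exact: segment_compact.
  exact: continuous_subspaceT.
apply: continuous_compact_integrable; first exact: segment_compact.
exact: continuous_subspaceT.
Qed.

Lemma ii_add (a b c : R) g : a <= b -> b <= c -> ccont g -> ii a c g = ii a b g + ii b c g.
Proof.
move=> ab bc cg; have ig := ii_integrable _ _ cg.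
have aux (P : C -> R) :
    (forall x y : R, mu.-integrable `[x, y] (EFin \o (fun t => P (g t)))) ->
    \int[mu]_(t in `[a, c]) P (g t) = \int[mu]_(t in `[a, b]) P (g t) + \int[mu]_(t in `[b, c]) P (g t).
  move=> iP; have := @Rintegral_itvB R (fun t => P (g t)) (BLeft a) (BRight c) b (iP a c).
  rewrite !bnd_simp => /(_ ab bc); rewrite Rintegral_itv_obnd_cbnd; last first.
    have m1 : measurable (`[b, c]%classic : set (measurableTypeR R)) by exact: measurable_itv.
    have m2 : measurable (`]b, c]%classic : set (measurableTypeR R)) by exact: measurable_itv.
    apply: (integrableS m1 m2 _ (iP b c)) => t /=; rewrite !in_itv/= => /andP[h ->].
    by rewrite ltW.
  by move=> <-; rewrite addrC subrK.
have m x y : measurable (`[x, y]%classic : set R) by exact: measurable_itv.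
by apply: complexP => /=; apply: aux => x y; [apply: integrable_Re|apply: integrable_Im].
Qed.

Lemma ii_norm_meas (a b K : R) g : a <= b -> cmeas (`[a, b] : set (measurableTypeR R)) g ->
  (forall x, a <= x <= b -> normc (g x) <= K) -> normc (ii a b g) <= K * (b - a).
Proof.
move=> ab mg gK.
have mab : measurable (`[a, b]%classic : set R) by exact: measurable_itv.
rewrite -lee_fin; apply: le_trans; first exact: normc_cint_le.
have foo : lebesgue_measure (`[a, b]%classic : set R) = (b - a)%:E.
  rewrite lebesgue_measure_itv/= lte_fin; case: ltP => ab'; first by rewrite -EFinB.
  by rewrite (_ : b = a) ?subrr//; apply/eqP; rewrite eq_le ab ab'.
have -> : (K * (b - a))%:E = (\int[mu]_(x in `[a, b]) (K%:E))%E.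
  by rewrite integral_cst// EFinM; congr (_ * _)%E; rewrite -foo.
apply: ge0_le_integral => //.
- by move=> x _; rewrite lee_fin normc_ge0.
- by apply/measurable_EFinP; exact: measurable_normc.
Qed.

Lemma ii_norm (a b K : R) g : a <= b -> ccont g ->
  (forall x, a <= x <= b -> normc (g x) <= K) -> normc (ii a b g) <= K * (b - a).
Proof. by move=> ab cg; apply: ii_norm_meas => //; have [] := ii_integrable a b cg. Qed.

Lemma cmeasS_itv (a b : R) g : @cmeas _ (measurableTypeR R) R setT g ->
  cmeas (`[a, b] : set (measurableTypeR R)) g.
Proof. by move=> [m1 m2]; split; apply: measurable_funTS. Qed.

Lemma ii_integrable_bounded (a b K : R) g : @cmeas _ (measurableTypeR R) R setT g ->
  (forall x, normc (g x) <= K) -> cintegrable mu `[a, b] g.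
Proof.
move=> mg gK; have mab : measurable (`[a, b]%classic : set (measurableTypeR R)) by exact: measurable_itv.
apply: (le_cintegrable mab (cmeasS_itv a b mg) (measurable_cst K)) => [x _|]; first exact: gK.
have F : (\int[mu]_(x in `[a, b]) K%:E = K%:E * mu (`[a, b]%classic : set R))%E by rewrite integral_cst.
by rewrite F lebesgue_measure_itv/=; case: ifP => _; rewrite ?mule0 ?ltry// -EFinB -EFinM ltry.
Qed.

Lemma iiB (a b : R) g h : ccont g -> ccont h -> ii a b (fun x => g x - h x) = ii a b g - ii a b h.
Proof.
move=> cg ch; have m : measurable (`[a, b]%classic : set (measurableTypeR R)) by exact: measurable_itv.
exact: (cintB m (ii_integrable a b cg) (ii_integrable a b ch)).
Qed.

Lemma iiD (a b : R) g h : ccont g -> ccont h -> ii a b (fun x => g x + h x) = ii a b g + ii a b h.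
Proof.
move=> cg ch; have m : measurable (`[a, b]%classic : set (measurableTypeR R)) by exact: measurable_itv.
exact: (cintD m (ii_integrable a b cg) (ii_integrable a b ch)).
Qed.

Lemma iiZ (a b : R) (c : C) g : ccont g -> ii a b (fun x => c * g x) = c * ii a b g.
Proof. move=> cg; have m : measurable (`[a, b]%classic : set (measurableTypeR R)) by exact: measurable_itv.
exact: (cintZ m c (ii_integrable a b cg)). Qed.

Lemma eq_ii (a b : R) g h : (forall x, g x = h x) -> ii a b g = ii a b h.
Proof. by move=> /funext ->. Qed.

Lemma ii_FTC (a b : R) f f' : a < b -> ccont f' -> (forall t, is_cderive f t (f' t)) ->
  ii a b f' = f b - f a.
Proof.
move=> ab [c1 c2] df.
have aux (p q : R -> R) : continuous q -> (forall t : R, is_derive t 1 p (q t)) ->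
    \int[mu]_(t in `[a, b]) q t = p b - p a.
  move=> cq dp; have cp : continuous p.
    by move=> x; apply/differentiable_continuous/derivable1_diffP; have [] := dp x.
  rewrite /Rintegral (@continuous_FTC2 _ q p)//.
  - exact: continuous_subspaceT.
  - split; [by move=> x _; have [] := dp x| |].
      by apply: cvg_at_right_filter; exact: cp.
    by apply: cvg_at_left_filter; exact: cp.
  - by move=> x _; rewrite derive1E; have [_ ->] := dp x.
by apply: complexP; rewrite ?ReDc ?ImDc ?ReNc ?ImNc /=;
  [apply: (aux (Re \o f))|apply: (aux (Im \o f))] => // t; have [] := df t.
Qed.

End interval_integrals.

Section goursat.
Variable R : realType.
Local Notation C := R[i].
Variables (k : R -> C) (ck : ccont k).
Implicit Types (H : R -> R -> C) (x y l : R).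

(* The integral of [H(x, y) (dx + k(y) dy)] over the boundary of a square. *)
Definition boundary H x y l : C :=
  ii x (x + l) (fun t => H t y - H t (y + l)) +
  ii y (y + l) (fun t => (H (x + l) t - H x t) * k t).

Definition ccont2 H := (forall y, ccont (H ^~ y)) /\ (forall x, ccont (H x)).

Lemma boundaryE H x y l : ccont2 H ->
  boundary H x y l = ii x (x + l) (H ^~ y) - ii x (x + l) (H ^~ (y + l)) +
    (ii y (y + l) (fun t => H (x + l) t * k t) - ii y (y + l) (fun t => H x t * k t)).
Proof.
move=> [c1 c2]; rewrite /boundary iiB//; congr (_ + _).
rewrite -iiB; [|exact: ccontM|exact: ccontM].
by apply: eq_ii => t; rewrite mulrBl.
Qed.

Lemma boundary_split H x y m : 0 <= m -> ccont2 H ->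
  boundary H x y (m + m) = boundary H x y m + boundary H (x + m) y m +
    (boundary H x (y + m) m + boundary H (x + m) (y + m) m).
Proof.
move=> m0 cH; have [c1 c2] := cH; rewrite !boundaryE// !addrA.
have ax z : z <= z + m by rewrite lerDl.
have sx z : ii x (x + m + m) (H ^~ z) = ii x (x + m) (H ^~ z) + ii (x + m) (x + m + m) (H ^~ z).
  exact: ii_add.
have sy z : ii y (y + m + m) (fun t => H z t * k t) =
    ii y (y + m) (fun t => H z t * k t) + ii (y + m) (y + m + m) (fun t => H z t * k t).
  by apply: ii_add => //; exact: ccontM.
rewrite !sx !sy.
move: (ii _ _ _) (ii _ _ _) (ii _ _ _) (ii _ _ _) (ii _ _ _) (ii _ _ _) (ii _ _ _) (ii _ _ _) (ii _ _ _) (ii _ _ _) (ii _ _ _) (ii _ _ _).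
by move=> *; ring.
Qed.

(** Goursat's bisection: if a square violates the bound e l^2, so does one of its quarters; the
    nested squares shrink to a point (p, q), near which the local bound is contradicted. *)
Lemma boundary0 H x0 y0 l0 : 0 < l0 -> ccont2 H ->
  (forall p q (e : R), 0 < e -> exists2 d : R, 0 < d & forall x y l, 0 < l < d ->
     x <= p <= x + l -> y <= q <= y + l -> normc (boundary H x y l) <= e * l ^+ 2) ->
  boundary H x0 y0 l0 = 0.
Proof.
move=> l0_gt0 cH loc; apply/eqP; rewrite -normc_eq0; apply: contraT => nz.
have nz0 : 0 < normc (boundary H x0 y0 l0) by rewrite lt_neqAle eq_sym nz normc_ge0.
(* Half the ratio of the integral to the area, so that the initial square is [bad] with strict
   inequality. *)
pose e := normc (boundary H x0 y0 l0) / (2 * l0 ^+ 2).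
have e0 : 0 < e by rewrite divr_gt0// mulr_gt0// exprn_gt0.
pose l n := l0 / 2 ^+ n.
have l_gt0 n : 0 < l n by rewrite divr_gt0// exprn_gt0.
have lS n : l n = l n.+1 + l n.+1 by rewrite /l exprS; field; rewrite gt_eqF// exprn_gt0.
pose bad (P : R * R) n := e * l n ^+ 2 < normc (boundary H P.1 P.2 (l n)).
have step (P : R * R) n : exists P' : R * R, bad P n ->
    [/\ bad P' n.+1, P.1 <= P'.1 <= P.1 + l n.+1 & P.2 <= P'.2 <= P.2 + l n.+1].
  have l0' := ltW (l_gt0 n.+1); case: P => x y.
  have [bP|nbP] := pselect (bad (x, y) n); last by exists (x, y).
  have {}bP : e * (l n.+1 + l n.+1) ^+ 2 < normc (boundary H x y (l n.+1 + l n.+1)) by rewrite -lS.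
  rewrite (boundary_split x y l0' cH) in bP.
  have b1 z : z <= z <= z + l n.+1 by rewrite lexx lerDl.
  have b2 z : z <= z + l n.+1 <= z + l n.+1 by rewrite lexx lerDl l0'.
  have [h1|h1] := ltP (e * l n.+1 ^+ 2) (normc (boundary H x y (l n.+1))); first by exists (x, y); rewrite /bad.
  have [h2|h2] := ltP (e * l n.+1 ^+ 2) (normc (boundary H (x + l n.+1) y (l n.+1))); first by exists (x + l n.+1, y).
  have [h3|h3] := ltP (e * l n.+1 ^+ 2) (normc (boundary H x (y + l n.+1) (l n.+1))); first by exists (x, y + l n.+1).
  have [h4|h4] := ltP (e * l n.+1 ^+ 2) (normc (boundary H (x + l n.+1) (y + l n.+1) (l n.+1))); first by exists (x + l n.+1, y + l n.+1).
  exfalso; move: bP; rewrite ltNge => /negP; apply.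
  apply: le_trans (le_normcD _ _) _.
  apply: le_trans (lerD (le_normcD _ _) (le_normcD _ _)) _.
  apply: le_trans (lerD (lerD h1 h2) (lerD h3 h4)) _.
  by rewrite le_eqVlt; apply/orP; left; apply/eqP; ring.
have /choice[nxt hnxt] (Pn : (R * R) * nat) := step Pn.1 Pn.2.
pose P_ := fix P_ n := if n is n'.+1 then nxt (P_ n', n') else (x0, y0).
have badP n : bad (P_ n) n.
  elim: n => [|n ih]; last by have [] := hnxt (P_ n, n) ih.
  rewrite /bad /l/= expr0 divr1 /e.
  rewrite (_ : _ * _ = normc (boundary H x0 y0 l0) / 2); last first.
    by field; rewrite gt_eqF.
  by rewrite ltr_pdivrMr// ltr_pMr// ltr1n.
have stepP n : (P_ n).1 <= (P_ n.+1).1 <= (P_ n).1 + l n.+1 /\ (P_ n).2 <= (P_ n.+1).2 <= (P_ n).2 + l n.+1.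
  by have [] := hnxt (P_ n, n) (badP n).
(* Left ends increase and stay below every right end; their supremum lies in all intervals. *)
have nest (u : nat -> R) : (forall n, u n <= u n.+1 <= u n + l n.+1) ->
    exists p, forall n, u n <= p <= u n + l n.
  move=> hu; have nd : nondecreasing_seq u by apply/nondecreasing_seqP => n; have /andP[] := hu n.
  have ub n m : u m <= u n + l n.
    suff H1 j : u (n + j)%N <= u n + l n.
      by apply: le_trans (H1 m); apply: nd; exact: leq_addl.
    have : u (n + j)%N + l (n + j)%N <= u n + l n.
      elim: j => [|j ih]; first by rewrite addn0.
      apply: le_trans ih; rewrite addnS; have /andP[_ ] := hu (n + j)%N.
      by rewrite (lS (n + j)%N) => h; lra.
    by have := l_gt0 (n + j)%N; lra.
  have bnd : has_ubound (range u) by exists (u 0%N + l 0%N) => _ [m _ <-]; exact: ub.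
  exists (sup (range u)) => n; apply/andP; split.
    by apply: ub_le_sup => //; exists n.
  by apply: ge_sup; [exists (u 0%N); exists 0%N|move=> _ [m _ <-]; exact: ub].
have [p hp] := nest (fun n => (P_ n).1) (fun n => (stepP n).1).
have [q hq] := nest (fun n => (P_ n).2) (fun n => (stepP n).2).
have [d d0 hd] := loc p q e e0.
have [n ln] : exists n, l n < d.
  have := @cvg_expr R 2^-1; rewrite ger0_norm ?invr_ge0// => /(_ _)/cvgrPdist_lt H1.
  have dl : 0 < d / l0 by rewrite divr_gt0.
  have [|n _ /(_ n (leqnn _))/= ] := H1 _ _ dl; first by lra.
  rewrite sub0r normrN ger0_norm ?exprn_ge0 ?invr_ge0// => hn; exists n.
  by rewrite /l mulrC -ltr_pdivlMr// -exprVn.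
have := badP n; rewrite /bad ltNge hd//; first by rewrite l_gt0.
Qed.

End goursat.

Section cauchy.
Variable R : realType.
Local Notation C := R[i].
Local Notation mu := (@lebesgue_measure R).
Local Notation Re := (@complex.Re R).
Local Notation Im := (@complex.Im R).

Definition cholo (F : C -> C) := forall z, exists l : C, forall e : R, 0 < e ->
  exists2 d : R, 0 < d & forall h, normc h < d -> normc (F (z + h) - F z - l * h) <= e * normc h.

Lemma cholo_cont (F : C -> C) : cholo F -> forall z (e : R), 0 < e ->
  exists2 d : R, 0 < d & forall w, normc (w - z) < d -> normc (F w - F z) <= e.
Proof.
move=> hF z e e0; have [l hl] := hF z; have [d d0 hd] := hl 1 ltr01.
have L0 : 0 < normc l + 1 by rewrite ltr_wpDl// normc_ge0.
exists (Num.min d (e / (normc l + 1))); first by rewrite lt_min d0 divr_gt0.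
move=> w; rewrite lt_min => /andP[wd we].
have := hd _ wd; rewrite mul1r [z + _]addrC subrK => h.
rewrite -(subrK (l * (w - z)) (F w - F z)) (le_trans (le_normcD _ _))//.
rewrite normcM; apply: (@le_trans _ _ ((normc l + 1) * normc (w - z))).
  by rewrite mulrDl mul1r addrC lerD2l.
by rewrite mulrC -ler_pdivlMr// ltW.
Qed.

Section kernel.
Variables (r : R) (a : C).
Hypotheses (r0 : 0 < r) (ar : normc a <= r / 2).

Let q : C := a / r%:C%C.

Let q2 : normc q <= 1 / 2.
Proof.
rewrite /q normcM -(fmorphV (real_complex R)) normc_real ger0_norm ?invr_ge0 ?(ltW r0)//.
by rewrite ler_pdivrMr// mulrC mulrA mulr1.
Qed.

(** zeta / (zeta - a) at zeta = r e^{it}: the Cauchy kernel against the normalized angle dt / (2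
    pi). *)
Definition ckern (t : R) : C := (1 - a / r%:C%C * cexpi (- t))^-1.

Let den t : 1 / 2 <= normc (1 - q * cexpi (- t)).
Proof.
have := ler_dist_normc 1 (q * cexpi (- t)); rewrite normc1 normcM normc_expi mulr1.
by move=> /(le_trans (ler_norm _)); have := q2; lra.
Qed.

Lemma ckern_neq0 t : 1 - a / r%:C%C * cexpi (- t) != 0.
Proof. by rewrite -normc_eq0 gt_eqF//; have := den t; rewrite /q; lra. Qed.

Lemma normcV (z : C) : normc z^-1 = (normc z)^-1.
Proof.
have [->|z0] := eqVneq z 0; first by rewrite invr0 normc0 invr0.
have nz : normc z != 0 by rewrite normc_eq0.
by apply: (mulfI nz); rewrite -normcM divff// divff// normc1.
Qed.

Lemma normc_ckern t : normc (ckern t) <= 2.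
Proof.
have d := den t; rewrite /ckern normcV -[2]invrK lef_pV2 ?posrE ?invr_gt0//.
  by rewrite -/q; have := d; lra.
by rewrite -/q; have := d; lra.
Qed.

Lemma ccont_ckern : ccont ckern.
Proof.
apply: (@ccont_lip _ _ 2) => x y.
have -> : ckern y - ckern x = ckern y * ckern x * (q * (cexpi (- y) - cexpi (- x))).
  rewrite /ckern -/q; have := ckern_neq0 x; have := ckern_neq0 y; rewrite -/q.
  move: (cexpi _) (cexpi _) q => u v w hu hv; field; by rewrite hu hv.
rewrite normcM [normc (ckern y * _)]normcM [normc (q * _)]normcM.
have h1 : normc (cexpi (- y) - cexpi (- x)) <= `|y - x|.
  have -> : cexpi (- y) = cexpi (- x) * cexpi (x - y) by rewrite -cexpiD; congr cexpi; ring.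
  by rewrite -[X in _ - X]mulr1 -mulrBr normcM normc_expi mul1r distrC cexpi_sub1.
have k1 := normc_ckern y; have k2 := normc_ckern x.
have h2 : normc (ckern y) * normc (ckern x) <= 4.
  by apply: le_trans (ler_pM (normc_ge0 _) (normc_ge0 _) k1 k2) _; lra.
have h3 : normc q * normc (cexpi (- y) - cexpi (- x)) <= 1 / 2 * `|y - x|.
  exact: ler_pM (normc_ge0 _) (normc_ge0 _) q2 h1.
by apply: le_trans (ler_pM _ _ h2 h3) _; rewrite ?mulr_ge0 ?normc_ge0//; lra.
Qed.

(* The curves [a + e^x (r e^{it} - a)] contract the circle of radius [r] to [a]. *)
Let c (t : R) : C := r%:C%C * cexpi t - a.

Let zeta (x t : R) : C := a + (expR x)%:C%C * c t.

Let kz (t : R) : C := Complex 0 1 * ckern t.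

(** [kz] is c' / c, so the form dx + kz(t) dt is d zeta / (zeta - a), and [boundary] integrates
    F(zeta) / (zeta - a). *)
Let kzE t : c t * kz t = Complex 0 r * cexpi t.
Proof.
have rC : r%:C%C != 0 :> C by rewrite -normc_eq0 normc_real normr_eq0 gt_eqF.
have e1 : cexpi t * cexpi (- t) = 1 by rewrite -cexpiD subrr cexpi0.
have n0 := ckern_neq0 t.
have cE : c t = r%:C%C * cexpi t * (1 - a / r%:C%C * cexpi (- t)).
  rewrite mulrBr mulr1 /c; congr (_ - _).
  have -> : r%:C%C * cexpi t * (a / r%:C%C * cexpi (- t)) = (r%:C%C / r%:C%C) * a * (cexpi t * cexpi (- t)) by ring.
  by rewrite e1 divff// mul1r mulr1.
have -> : Complex 0 r = Complex 0 1 * r%:C%C by apply: complexP => /=; ring.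
rewrite cE /kz /ckern.
have E (u v w z : C) : z != 0 -> v * w * z * (u * z^-1) = u * v * w by move=> z0; field.
exact: E.
Qed.

Let normc_c t : normc (c t) <= 2 * r.
Proof.
have h1 : normc (r%:C%C * cexpi t) = r by rewrite normcM normc_expi mulr1 normc_real gtr0_norm.
have h2 : normc (c t) <= r + normc a by rewrite -[X in X + _]h1; exact: le_normcB.
by apply: le_trans h2 _; have h3 := ar; have h4 := r0; lra.
Qed.

Let c_lip s t : normc (c t - c s) <= r * `|t - s|.
Proof.
have -> : c t - c s = r%:C%C * (cexpi s * (cexpi (t - s) - 1)).
  rewrite mulrBr -cexpiD mulr1 (_ : s + (t - s) = t) /c; last by ring.
  by rewrite mulrBr; ring.
by rewrite !normcM normc_expi mul1r normc_real gtr0_norm// ler_pM2l// cexpi_sub1.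
Qed.

Let exp_lip (p x y : R) : x <= p + 1 -> y <= p + 1 ->
  `|expR x - expR y| <= expR (p + 1) * `|x - y|.
Proof.
wlog xy : x y / y <= x.
  move=> h xp yp; have [/h|/ltW/h] := leP y x; first exact.
  by rewrite distrC [`|x - y|]distrC; exact.
move=> xp yp; rewrite !ger0_norm ?subr_ge0 ?ler_expR//.
apply: (@le_trans _ _ (expR x * (x - y))).
  have -> : expR y = expR x * expR (y - x) by rewrite -expRD; congr expR; ring.
  rewrite -[X in X - _]mulr1 -mulrBr ler_pM2l ?expR_gt0//.
  by have := expR_ge1Dx (y - x); lra.
by rewrite ler_wpM2r ?subr_ge0// ler_expR.
Qed.

Let zeta_lip (p x y s t l : R) : x <= p + 1 -> y <= p + 1 -> `|x - y| <= l -> `|t - s| <= l ->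
  normc (zeta x t - zeta y s) <= expR (p + 1) * (3 * r) * l.
Proof.
move=> xp yp xy ts; have -> : zeta x t - zeta y s =
    (expR x - expR y)%:C%C * c t + (expR y)%:C%C * (c t - c s).
  by rewrite /zeta rmorphB; ring.
apply: le_trans (le_normcD _ _) _; rewrite !normcM !normc_real [`|expR y|]gtr0_norm ?expR_gt0//.
have E0 := expR_gt0 (p + 1).
have h1 : `|expR x - expR y| * normc (c t) <= expR (p + 1) * l * (2 * r).
  apply: ler_pM; [exact: normr_ge0|exact: normc_ge0| |exact: normc_c].
  by apply: le_trans (exp_lip xp yp) _; rewrite ler_pM2l.
have h2 : expR y * normc (c t - c s) <= expR (p + 1) * (r * l).
  apply: ler_pM; rewrite ?expR_ge0 ?normc_ge0 ?ler_expR//.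
  by apply: le_trans (c_lip _ _) _; rewrite ler_pM2l.
by apply: le_trans (lerD h1 h2) _; rewrite le_eqVlt; apply/orP; left; apply/eqP; ring.
Qed.

Let ccont_zeta : (forall t, ccont (zeta ^~ t)) /\ (forall x, ccont (zeta x)).
Proof.
split=> [t|x]; rewrite /zeta.
  apply: ccontD; first exact: ccont_cst.
  by apply: ccontM; [apply: ccont_real; exact: continuous_expR|exact: ccont_cst].
apply: ccontD; first exact: ccont_cst.
apply: ccontM; first exact: ccont_cst.
apply: ccontB; last exact: ccont_cst.
apply: ccontM; first exact: ccont_cst.
exact: ccont_cexpi.
Qed.

Let ccont_kk : ccont kz.
Proof. by apply: ccontM; [exact: ccont_cst|exact: ccont_ckern]. Qed.

Let normc_i : normc (Complex 0 1 : C) = 1.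
Proof. by rewrite /= expr0n expr1n add0r sqrtr1. Qed.

(** Constants cancel between opposite sides, and what remains, D e^x c(t) (dx + kz dt), is the
    differential of D e^x c(t). *)
Let boundary_affine (A D : C) x y l : 0 < l ->
  boundary kz (fun x t => A + D * zeta x t) x y l = 0.
Proof.
move=> l0; rewrite /boundary.
have cexp : ccont (fun t : R => (expR t)%:C%C : C) by apply: ccont_real; exact: continuous_expR.
have ccexp : ccont (fun t => Complex 0 r * cexpi t).
  apply: ccontM; first exact: ccont_cst.
  exact: ccont_cexpi.
have xl (z : R) : z < z + l by rewrite ltrDl.
rewrite (eq_ii _ _ (_ : forall t, _ = (D * (c y - c (y + l))) * (expR t)%:C%C)); last first.
  by move=> t; rewrite /zeta; ring.
rewrite (iiZ _ _ _ cexp) (@ii_FTC _ _ _ (fun t => (expR t)%:C%C) _ (xl x) cexp); last first.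
  by move=> t; split; [exact: is_derive_expR|exact: is_derive_cst].
rewrite (eq_ii _ _ (_ : forall t, _ = (D * ((expR (x + l))%:C%C - (expR x)%:C%C)) * (Complex 0 r * cexpi t))); last first.
  by move=> t; rewrite -kzE /zeta; ring.
rewrite (iiZ _ _ _ ccexp) (@ii_FTC _ _ _ c _ (xl y) ccexp); first by ring.
move=> t; have hc : is_derive t 1 (@cos R) (- sin t) by exact: is_derive_cos.
have hs : is_derive t 1 (@sin R) (cos t) by exact: is_derive_sin.
split.
  rewrite (_ : _ \o c = fun t => r * cos t - Re a); last first.
    by apply/funext => y'; rewrite /comp /c ReDc ReNc ReMc /=; ring.
  by apply: is_derive_eq; rewrite ReMc /GRing.scale/=; ring.
rewrite (_ : _ \o c = fun t => r * sin t - Im a); last first.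
  by apply/funext => y'; rewrite /comp /c ImDc ImNc ImMc /=; ring.
by apply: is_derive_eq; rewrite ImMc /GRing.scale/=; ring.
Qed.

Variables (F : C -> C) (hF : cholo F).

Let H x t := F (zeta x t).

Let ccont2_H : ccont2 H.
Proof.
have [c1 c2] := ccont_zeta.
by split=> z; apply: (ccont_comp (cholo_cont hF)).
Qed.

Let boundary_small (p q' e : R) : 0 < e -> exists2 d : R, 0 < d & forall x y l, 0 < l < d ->
  x <= p <= x + l -> y <= q' <= y + l -> normc (boundary kz H x y l) <= e * l ^+ 2.
Proof.
move=> e0; pose L := expR (p + 1) * (3 * r).
have L0 : 0 < L by rewrite !mulr_gt0// expR_gt0.
pose z0 := zeta p q'; have [D hD] := hF z0.
(* 6 = 2 + 4: each pair of opposite sides contributes two errors, and on the second pair [kz] brings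
   a factor at most 2. *)
have e1 : 0 < e / (6 * L) by rewrite divr_gt0// mulr_gt0.
have [d d0 hd] := hD _ e1.
exists (Num.min 1 (d / L)); first by rewrite lt_min ltr01 divr_gt0.
move=> x y l /andP[l0]; rewrite lt_min => /andP[l1 ld] /andP[xp px] /andP[yq qy].
pose G u t := F z0 - D * z0 + D * zeta u t.
pose E u t := H u t - G u t.
have [cz1 cz2] := ccont_zeta.
have cG : ccont2 G.
  split=> z; apply: ccontD; try exact: ccont_cst.
    by apply: ccontM; [exact: ccont_cst|exact: cz1].
  by apply: ccontM; [exact: ccont_cst|exact: cz2].
have cE : ccont2 E.
  by split=> z; apply: ccontB; [exact: ccont2_H.1|exact: cG.1|exact: ccont2_H.2|exact: cG.2].
have -> : boundary kz H x y l = boundary kz E x y l + boundary kz G x y l.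
  rewrite !(boundaryE ccont_kk)//.
  have s1 u : ii x (x + l) (H ^~ u) = ii x (x + l) (E ^~ u) + ii x (x + l) (G ^~ u).
    rewrite -iiD; [|exact: cE.1|exact: cG.1].
    by apply: eq_ii => t; rewrite /E subrK.
  have s2 u : ii y (y + l) (fun t => H u t * kz t) =
      ii y (y + l) (fun t => E u t * kz t) + ii y (y + l) (fun t => G u t * kz t).
    rewrite -iiD; [|by apply: ccontM => //; exact: cE.2|by apply: ccontM => //; exact: cG.2].
    by apply: eq_ii => t; rewrite -mulrDl /E subrK.
  have rg (a1 a2 b1 b2 c1 c2 d1 d2 : C) : (a1 + a2) - (b1 + b2) + ((c1 + c2) - (d1 + d2)) =
      a1 - b1 + (c1 - d1) + (a2 - b2 + (c2 - d2)) by ring.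
  by rewrite !s1 !s2; exact: rg.
rewrite /G boundary_affine// addr0.
have Ele u t : x <= u <= x + l -> y <= t <= y + l -> normc (E u t) <= e / 6 * l.
  move=> /andP[xu ux] /andP[yt ty].
  have h1 : `|u - p| <= l by rewrite ler_norml; lra.
  have h2 : `|t - q'| <= l by rewrite ler_norml; lra.
  have pu : u <= p + 1 by lra.
  have pp : p <= p + 1 by lra.
  have zl := zeta_lip pu pp h1 h2; rewrite -/L -/z0 in zl.
  have zd : normc (zeta u t - z0) < d.
    by apply: le_lt_trans zl _; rewrite mulrC -ltr_pdivlMr.
  have := hd _ zd; rewrite [z0 + _]addrC subrK => h3.
  have -> : E u t = F (zeta u t) - F z0 - D * (zeta u t - z0) by rewrite /E /H /G; ring.
  apply: le_trans h3 _; apply: le_trans (ler_wpM2l (ltW e1) zl) _.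
  by rewrite le_eqVlt; apply/orP; left; apply/eqP; field; rewrite gt_eqF.
have xl : x <= x + l by rewrite lerDl ltW.
have yl : y <= y + l by rewrite lerDl ltW.
have el0 : 0 <= e / 6 * l by rewrite mulr_ge0 ?divr_ge0// ltW.
apply: le_trans (le_normcD _ _) _.
have b1 : normc (ii x (x + l) (fun t => E t y - E t (y + l))) <= (e / 6 * l + e / 6 * l) * (x + l - x).
  apply: ii_norm => //; first by apply: ccontB; exact: cE.1.
  move=> u xu; apply: le_trans (le_normcB _ _) _.
  by apply: lerD; apply: Ele => //; rewrite ?lexx ?yl.
have b2 : normc (ii y (y + l) (fun t => (E (x + l) t - E x t) * kz t)) <= (e / 6 * l + e / 6 * l) * 2 * (y + l - y).
  apply: ii_norm => //; first by apply: ccontM => //; apply: ccontB; exact: cE.2.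
  move=> t yt; rewrite normcM; apply: ler_pM; rewrite ?normc_ge0//.
    apply: le_trans (le_normcB _ _) _.
    by apply: lerD; apply: Ele => //; rewrite ?lexx ?xl.
  by rewrite normcM normc_i mul1r normc_ckern.
by apply: le_trans (lerD b1 b2) _; rewrite le_eqVlt; apply/orP; left; apply/eqP; field.
Qed.

Definition cmean (g : R -> C) : C := (2 * pi)^-1%:C%C * ii 0 (2 * pi) g.

Let pi2 : 0 < 2 * pi :> R. Proof. by rewrite mulr_gt0// pi_gt0. Qed.

Let J x := ii 0 (2 * pi) (fun t => H x t * kz t).

(** The square has side 2 pi also in [t], so its two sides t = 0 and t = 2 pi cancel by
    periodicity. *)
Let J_shift x : J (x + 2 * pi) = J x.
Proof.
have := @boundary0 R kz ccont_kk H x 0 _ pi2 ccont2_H boundary_small.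
rewrite (boundaryE ccont_kk x 0 (2 * pi) ccont2_H) add0r.
have -> : (H ^~ (2 * pi)) = (H ^~ 0).
  apply/funext => t; rewrite /H /zeta /c; congr (F (_ + _ * (_ * _ - _))).
  by apply: complexP; rewrite /= ?cos0 ?sin0 mulrC mulr_natr ?cos2pi ?sin2pi.
by rewrite subrr add0r => /eqP; rewrite subr_eq0 => /eqP.
Qed.

(** By [J_shift] the circle may be contracted by any power of e^{-2 pi}; in the limit [F] is
    constantly F(a) on it. *)
Let J_limit : J 0 = F a * ii 0 (2 * pi) kz.
Proof.
have Jn n : J 0 = J (- (n%:R * (2 * pi))).
  elim: n => [|n ih]; first by rewrite mul0r oppr0.
  rewrite ih; have -> : - (n%:R * (2 * pi)) = - (n.+1%:R * (2 * pi)) + 2 * pi :> R by rewrite -natr1; ring.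
  exact: J_shift.
apply/eqP; rewrite -subr_eq0 -normc_eq0 eq_le normc_ge0 andbT.
apply/ler_addgt0Pl => e e0; rewrite addr0.
have e1 : 0 < e / (4 * pi) by rewrite divr_gt0// mulr_gt0// pi_gt0.
have [d d0 hd] := cholo_cont hF a e1.
pose n := Num.bound (2 * r / d).
have nd : expR (- (n%:R * (2 * pi))) * (2 * r) < d.
  rewrite expRN [_ * (2 * r)]mulrC ltr_pdivrMr ?expR_gt0// [d * _]mulrC -ltr_pdivrMr//.
  have hn : 2 * r / d < n%:R.
    by apply: le_lt_trans (archi_boundP _); rewrite ?divr_ge0 ?mulr_ge0// ltW.
  apply: lt_le_trans hn _; apply: le_trans (expR_ge1Dx _).
  have p1 : 1 <= 2 * pi :> R by have := pi_ge2 R; lra.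
  have n0 : 0 <= n%:R :> R by [].
  by nra.
have cH2 := ccont2_H.2 (- (n%:R * (2 * pi))).
rewrite (Jn n) /J -iiZ// -iiB//; last 2 first.
- exact: ccontM.
- by apply: ccontM => //; exact: ccont_cst.
apply: le_trans (@ii_norm R 0 (2 * pi) (e / (4 * pi) * 2) _ (ltW pi2) _ _) _.
- by apply: ccontB; apply: ccontM => //; exact: ccont_cst.
- move=> t _; rewrite -mulrBl normcM; apply: ler_pM; rewrite ?normc_ge0//.
    apply: hd; rewrite /zeta addrC addKr normcM normc_real gtr0_norm ?expR_gt0//.
    by apply: le_lt_trans nd; rewrite ler_pM2l ?expR_gt0// normc_c.
  by rewrite normcM normc_i mul1r normc_ckern.
- have pin : pi != 0 :> R by rewrite gt_eqF// pi_gt0.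
  have pin4 : 4 * pi != 0 :> R by rewrite mulf_neq0.
  rewrite subr0 (_ : e / (4 * pi) * 2 * (2 * pi) = e / (4 * pi) * (4 * pi)); last by ring.
  by rewrite divfK.
Qed.

Lemma cexpiX (t : R) n : cexpi t ^+ n = cexpi (n%:R * t).
Proof.
elim: n => [|n ih]; first by rewrite mul0r cexpi0 expr0.
by rewrite exprS ih -cexpiD; congr cexpi; rewrite -natr1; ring.
Qed.

Lemma ckern_geo N t : ckern t = \sum_(n < N) q ^+ n * cexpi (- t) ^+ n + (q * cexpi (- t)) ^+ N * ckern t.
Proof.
have n0 := ckern_neq0 t; rewrite /ckern -/q in n0 *.
set w := q * cexpi (- t) in n0 *.
have E : (1 - w) * \sum_(n < N) q ^+ n * cexpi (- t) ^+ n = 1 - w ^+ N.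
  elim: N => [|N ih]; first by rewrite big_ord0 mulr0 expr0 subrr.
  by rewrite big_ord_recr/= mulrDr ih -exprMn -/w exprS; ring.
apply: (mulfI n0); rewrite mulrDr E mulrCA divff// mulr1; ring.
Qed.

Lemma ii_expi n : (0 < n)%N -> ii 0 (2 * pi) (fun t : R => cexpi (- t) ^+ n) = 0.
Proof.
move=> n0; pose f (t : R) := (Complex 0 (n%:R : R)^-1) * cexpi (- (n%:R * t)).
have nn : n%:R != 0 :> R by rewrite pnatr_eq0 -lt0n.
have cexp : ccont (fun t : R => cexpi (- t) ^+ n).
  under eq_fun do rewrite cexpiX mulrN -mulNr; exact: ccont_expi.
rewrite (@ii_FTC _ _ _ f _ pi2 cexp); last first.
  move=> t; rewrite cexpiX mulrN.
  have hc : is_derive t 1 (fun t : R => cos (- (n%:R * t))) (- sin (- (n%:R * t)) * - n%:R).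
    apply: (@is_derive1_comp _ cos (fun t : R => - (n%:R * t))).
    by apply: is_derive_eq; rewrite /GRing.scale/=; ring.
  have hs : is_derive t 1 (fun t : R => sin (- (n%:R * t))) (cos (- (n%:R * t)) * - n%:R).
    apply: (@is_derive1_comp _ sin (fun t : R => - (n%:R * t))).
    by apply: is_derive_eq; rewrite /GRing.scale/=; ring.
  split.
    rewrite (_ : _ \o f = fun t => - (n%:R^-1 * sin (- (n%:R * t)))); last first.
      by apply/funext => y; rewrite /comp /f ReMc/=; ring.
    by apply: is_derive_eq; rewrite /GRing.scale/=; field.
  rewrite (_ : _ \o f = fun t => n%:R^-1 * cos (- (n%:R * t))); last first.
    by apply/funext => y; rewrite /comp /f ImMc/=; ring.
  by apply: is_derive_eq; rewrite /GRing.scale/=; field.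
rewrite /f -mulrBr mulr0 oppr0 cexpi0.
have -> : cexpi (- (n%:R * (2 * pi))) = (1 : C).
  rewrite -mulrN -cexpiX (_ : cexpi (- (2 * pi)) = 1) ?expr1n//.
  by apply: complexP; rewrite /= ?cosN ?sinN mulrC mulr_natr ?cos2pi ?sin2pi ?oppr0.
by rewrite subrr mulr0.
Qed.

Lemma cexpiNX_cont n : ccont (fun t : R => cexpi (- t) ^+ n).
Proof. under eq_fun do rewrite cexpiX mulrN -mulNr; exact: ccont_expi. Qed.

(** The geometric series of the kernel, of ratio at most 1/2, integrated termwise. It is stated for
    measurable bounded [g], since no continuity is recorded for iterated coefficient functions. *)
Lemma cmeanM_ckern_series (K : R) (g : R -> C) : @cmeas _ (measurableTypeR R) R setT g ->
  (forall t, normc (g t) <= K) ->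
  normc (\sum_(n < N) q ^+ n * cmean (fun t => g t * cexpi (- t) ^+ n) - cmean (fun t => g t * ckern t)) @[N --> \oo] --> 0.
Proof.
move=> mg gK; have K0 : 0 <= K by apply: le_trans (gK 0); exact: normc_ge0.
have mab : measurable (`[0, 2 * pi]%classic : set (measurableTypeR R)) by exact: measurable_itv.
have me n : @cmeas _ (measurableTypeR R) R setT (fun t : R => cexpi (- t) ^+ n).
  exact: cmeas_ccont (cexpiNX_cont n).
have mr N : @cmeas _ (measurableTypeR R) R setT (fun t => g t * ((q * cexpi (- t)) ^+ N * ckern t)).
  apply: cmeasM => //; apply: cmeasM; last exact: cmeas_ccont ccont_ckern.
  by under eq_fun do rewrite exprMn; exact: cmeasZ (me N).
have rK N t : normc (g t * ((q * cexpi (- t)) ^+ N * ckern t)) <= K * 2 * (1 / 2) ^+ N.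
  rewrite normcM -mulrA; apply: ler_pM => //; rewrite ?normc_ge0//.
  rewrite normcM mulrC; apply: ler_pM; rewrite ?normc_ge0 ?normc_ckern//.
  rewrite normcX normcM normc_expi mulr1; have q0 := normc_ge0 q; have h := q2.
  by apply: lerXn2r; rewrite ?nnegrE//; lra.
have ie n : cintegrable mu `[0, 2 * pi] (fun t => g t * cexpi (- t) ^+ n).
  apply: (@ii_integrable_bounded _ _ _ K); first exact: cmeasM.
  by move=> t; rewrite normcM normcX normc_expi expr1n mulr1.
have ir N : cintegrable mu `[0, 2 * pi] (fun t => g t * ((q * cexpi (- t)) ^+ N * ckern t)).
  exact: ii_integrable_bounded (mr N) (rK N).
have E N : \sum_(n < N) q ^+ n * cmean (fun t => g t * cexpi (- t) ^+ n) - cmean (fun t => g t * ckern t) =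
    - cmean (fun t => g t * ((q * cexpi (- t)) ^+ N * ckern t)).
  have -> : cmean (fun t => g t * ckern t) =
     \sum_(n < N) q ^+ n * cmean (fun t => g t * cexpi (- t) ^+ n) + cmean (fun t => g t * ((q * cexpi (- t)) ^+ N * ckern t)).
    elim: N => [|N ih].
      by rewrite big_ord0 add0r; congr (_ * _); apply: eq_ii => t; rewrite expr0 mul1r.
    rewrite ih big_ord_recr/= -addrA; congr (_ + _).
    have H1 := cintegrableZ mab (q ^+ N) (ie N); have H2 := ir N.+1.
    rewrite /cmean mulrCA -mulrDr /ii -(cintZ mab (q ^+ N) (ie N)) -(cintD mab H1 H2).
    congr (_ * _); apply: eq_ii => t; have := ckern_geo 1 t.
    rewrite big_ord_recr big_ord0/= add0r !expr0 mul1r expr1 => {1}->.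
    by rewrite exprSr exprMn; ring.
  by rewrite opprD addrA subrr sub0r.
apply: (@squeeze0 _ _ (fun N => (K * 2) * (1 / 2) ^+ N)) => [N|]; last first.
  apply: cvg0Z; apply: cvg_expr; rewrite ger0_norm; lra.
rewrite normc_ge0 E normcN normcM normc_real ger0_norm ?invr_ge0 ?(ltW pi2)// andTb.
rewrite ler_pdivrMl//; apply: le_trans (@ii_norm_meas R 0 (2 * pi) (K * 2 * (1 / 2) ^+ N) _ (ltW pi2) _ _) _.
- exact: cmeasS_itv (mr N).
- by move=> t _; exact: rK.
- by rewrite subr0 mulrC.
Qed.

(** The series with g = 1: all Fourier modes except n = 0 have mean zero. *)
Lemma cmean_ckern1 : cmean ckern = 1.
Proof.
have cg : @cmeas _ (measurableTypeR R) R setT (fun _ : R => 1 : C) by exact: cmeas_cst.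
have g1 : forall t : R, normc (1 : C) <= 1 by move=> t; rewrite normc1.
have h := cmeanM_ckern_series cg g1.
have E N : \sum_(n < N.+1) q ^+ n * cmean (fun t => 1 * cexpi (- t) ^+ n) = 1.
  rewrite big_ord_recl/= big1 => [|n _]; last first.
    by rewrite /cmean (eq_ii _ _ (fun t => mul1r _)) ii_expi// !mulr0.
  rewrite addr0 expr0 mul1r /cmean (@ii_FTC _ _ _ (fun t : R => t%:C%C) _ pi2).
  - rewrite -rmorphB subr0 -rmorphM mulVf// gt_eqF//.
  - by apply: ccontM; [exact: ccont_cst|exact: cexpiNX_cont].
  - move=> t; rewrite expr0 mulr1; split; first exact: is_derive_id.
    exact: is_derive_cst.
have M1 : cmean (fun t => 1 * ckern t) = cmean ckern by congr (_ * _); apply: eq_ii => t; rewrite mul1r.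
rewrite M1 in h; apply/eqP; rewrite -subr_eq0 -normc_eq0 normcB eq_le normc_ge0 andbT.
rewrite -(cvg_shiftS (fun N => normc (\sum_(n < N) q ^+ n * cmean (fun t => 1 * cexpi (- t) ^+ n) - cmean ckern))) /= in h.
by apply: le_cvg h => N; rewrite E.
Qed.

Lemma cauchy_formula : cmean (fun t => F (r%:C%C * cexpi t) * ckern t) = F a.
Proof.
have := J_limit; rewrite /J.
have ckk := ccont_ckern.
have cF : ccont (fun t => F (r%:C%C * cexpi t)).
  apply: (ccont_comp (cholo_cont hF)); apply: ccontM; [exact: ccont_cst|exact: ccont_cexpi].
rewrite (eq_ii _ _ (_ : forall t, _ = Complex 0 1 * (F (r%:C%C * cexpi t) * ckern t))); last first.
  move=> t; rewrite /H /zeta expR0 mul1r /c addrC subrK /kz.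
  by move: (F _) (ckern t) => u v; ring.
rewrite iiZ; last exact: ccontM.
rewrite /kz iiZ// => h.
have i0 : Complex 0 1 != 0 :> C by rewrite -normc_eq0 normc_i oner_eq0.
have {}h : ii 0 (2 * pi) (fun t => F (r%:C%C * cexpi t) * ckern t) = F a * ii 0 (2 * pi) ckern.
  by apply: (mulfI i0); rewrite h mulrCA.
by rewrite /cmean h mulrCA -/(cmean ckern) cmean_ckern1 mulr1.
Qed.

End kernel.
End cauchy.

(** * Power series of entire functions *)

Section cmean_fubini.
Variable R : realType.
Local Notation C := R[i].
Local Notation mu := (@lebesgue_measure R).
Local Notation ind a b := (\1_`[a, b]%classic : R -> R).

Lemma cint_ind (a b : R) (g : R -> C) : cint mu `[a, b] g = cint mu setT (fun t => (ind a b t)%:C%C * g t).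
Proof.
have E (f : R -> R) : f \_ `[a, b] = (fun t => ind a b t * f t).
  by apply/funext => t; rewrite patchE indicE; case: (t \in _); rewrite /= ?mul1r ?mul0r.
by apply: complexP => /=; rewrite Rintegral_mkcond E; apply: eq_Rintegral => t _;
  rewrite ?ReMc ?ImMc/= mul0r ?subr0 ?addr0.
Qed.

Lemma cmeanE (g : R -> C) : cmean g = cint mu setT (fun t => (ind 0 (2 * pi) t)%:C%C * g t) * (2 * pi)^-1%:C%C.
Proof. by rewrite mulrC /cmean /ii cint_ind. Qed.

Lemma cmeas_cmean d (T : measurableType d) (G : T * measurableTypeR R -> C) : cmeas setT G ->
  cmeas setT (fun x => cmean (fun t => G (x, t))).
Proof.
move=> mG; under eq_fun do rewrite cmeanE mulrC.
apply: cmeasZ.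
(* Measurability in [x] has nothing to do with a measure on [T]; the zero measure makes the
   finiteness required by Fubini trivial. *)
apply: (@cmeas_cint _ _ T _ R (@mzero _ T R) mu (fun xt => (ind 0 (2 * pi) xt.2)%:C%C * G xt)).
  apply: cmeasM => //; apply: cmeas_real.
  apply: (measurableT_comp (measurable_ind 0 (2 * pi))); exact: measurable_snd.
by rewrite integral_measure_zero.
Qed.

Lemma cmeanZ (c : C) (K : R) g : @cmeas _ (measurableTypeR R) R setT g ->
  (forall t, normc (g t) <= K) -> cmean (fun t => c * g t) = c * cmean g.
Proof.
move=> mg gK; have mab : measurable (`[0, 2 * pi]%classic : set (measurableTypeR R)) by exact: measurable_itv.
by rewrite /cmean /ii (cintZ mab c (ii_integrable_bounded 0 (2 * pi) mg gK)) mulrCA.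
Qed.

Lemma normc_cmean (K : R) g : @cmeas _ (measurableTypeR R) R setT g ->
  (forall t, normc (g t) <= K) -> normc (cmean g) <= K.
Proof.
move=> mg gK; have p0 : 0 < 2 * pi :> R by rewrite mulr_gt0// pi_gt0.
rewrite normcM normc_real ger0_norm ?invr_ge0 ?(ltW p0)// ler_pdivrMl//.
apply: le_trans (ii_norm_meas (ltW p0) (cmeasS_itv 0 (2 * pi) mg) (fun t _ => gK t)) _.
by rewrite subr0 mulrC.
Qed.

Let cmean_swap1 (G : R * R -> C) : cmeas setT (G : measurableTypeR R * measurableTypeR R -> C) ->
  (forall xy, normc (G xy) <= 1) ->
  cmean (fun x => cmean (fun y => G (x, y))) = cmean (fun y => cmean (fun x => G (x, y))).
Proof.
move=> mG GK; set c := (2 * pi)^-1%:C%C : C.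
have inti := cinteg_ind (0 : R) (2 * pi).
have mulAC3 (a b e : C) : a * (b * e) = b * (e * a) by ring.
have mulAC4 (a b e : C) : a * b * e = a * (e * b) by ring.
have e1 x : cmean (fun y => G (x, y)) = c * cint mu setT (fun y => G (x, y) * (ind 0 (2 * pi) y)%:C%C).
  rewrite cmeanE -/c mulrC; congr (_ * _); apply: eq_cint => t _; exact: mulrC.
have e2 y : cmean (fun x => G (x, y)) = c * cint mu setT (fun x => G (x, y) * (ind 0 (2 * pi) x)%:C%C).
  rewrite cmeanE -/c mulrC; congr (_ * _); apply: eq_cint => t _; exact: mulrC.
have ci : cintegrable mu setT (fun t => c * (ind 0 (2 * pi) t)%:C%C) by exact: (cintegrableZ measurableT).
have ig x : cintegrable mu setT (fun y => G (x, y) * (ind 0 (2 * pi) y)%:C%C).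
  have := @cintegrable_mulb _ _ (fun y => G (x, y)) inti (cmeas_comp mG (measurable_pair1 x)) (fun y => GK (x, y)).
  by under eq_fun do rewrite mulrC.
have h2 := cint_swap inti ci mG GK.
have s1 : cmean (fun x => cmean (fun y => G (x, y))) =
    cint mu setT (fun x => (ind 0 (2 * pi) x)%:C%C * cint mu setT (fun y => G (x, y) * (c * (ind 0 (2 * pi) y)%:C%C))) * c.
  rewrite [LHS]cmeanE -/c; congr (_ * _); apply: eq_cint => x _; congr (_ * _).
  rewrite e1 -(cintZ measurableT c (ig x)); apply: eq_cint => y _; exact: mulrCA.
have s2 : cmean (fun y => cmean (fun x => G (x, y))) =
    cint mu setT (fun y => c * (ind 0 (2 * pi) y)%:C%C * cint mu setT (fun x => G (x, y) * (ind 0 (2 * pi) x)%:C%C)) * c.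
  rewrite [LHS]cmeanE -/c; congr (_ * _); apply: eq_cint => y _.
  by rewrite e2 mulAC3 mulAC4.
exact: (etrans s1 (etrans (congr1 ( *%R^~ c) h2) (esym s2))).
Qed.

Lemma cmean_swap (G : R * R -> C) (K : R) : cmeas setT (G : measurableTypeR R * measurableTypeR R -> C) ->
  (forall xy, normc (G xy) <= K) ->
  cmean (fun x => cmean (fun y => G (x, y))) = cmean (fun y => cmean (fun x => G (x, y))).
Proof.
move=> mG GK; have K0 : 0 <= K by apply: le_trans (GK (0, 0)); exact: normc_ge0.
have K1 : 0 < K + 1 by lra.
pose H xy := (K + 1)^-1%:C%C * G xy.
have mH : cmeas setT (H : measurableTypeR R * measurableTypeR R -> C) by exact: cmeasZ.
have HK xy : normc (H xy) <= 1.
  rewrite /H normcM normc_real ger0_norm ?invr_ge0 ?(ltW K1)// ler_pdivrMl// mulr1.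
  by apply: le_trans (GK xy) _; lra.
have mH' : cmeas setT (fun xy : measurableTypeR R * measurableTypeR R => H (xy.2, xy.1)).
  apply: cmeas_comp mH _; exact: measurable_swap.
have E xy : G xy = (K + 1)%:C%C * H xy by rewrite /H mulrA -rmorphM divff ?gt_eqF// rmorph1 mul1r.
have m1 x : @cmeas _ (measurableTypeR R) R setT (fun y => H (x, y)) by exact: (cmeas_comp mH (measurable_pair1 x)).
have m2 y : @cmeas _ (measurableTypeR R) R setT (fun x => H (x, y)) by exact: (cmeas_comp mH (measurable_pair2 y)).
rewrite (_ : (fun x => cmean (fun y => G (x, y))) = fun x => (K + 1)%:C%C * cmean (fun y => H (x, y))); last first.
  by apply/funext => x; rewrite -(cmeanZ _ (m1 x) (fun y => HK (x, y))); congr cmean; apply/funext => y.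
rewrite (_ : (fun y => cmean (fun x => G (x, y))) = fun y => (K + 1)%:C%C * cmean (fun x => H (x, y))); last first.
  by apply/funext => y; rewrite -(cmeanZ _ (m2 y) (fun x => HK (x, y))); congr cmean; apply/funext => x.
rewrite (cmeanZ _ (cmeas_cmean mH) (fun x => normc_cmean (m1 x) (fun y => HK (x, y)))).
rewrite (cmeanZ _ (cmeas_cmean mH') (fun y => normc_cmean (m2 y) (fun x => HK (x, y)))).
by rewrite cmean_swap1.
Qed.

End cmean_fubini.

Section power_series.
Variables (R : realType) (d : nat).
Local Notation C := R[i].
Local Notation Z := ('I_d -> C).

(* [PS rho K Phi]: Phi is a countable sum of monomials, with coefficients c_a such that the sum of
   the |c_a| rho^|a| is at most K. *)
Inductive PS (rho : R) : R -> (Z -> C) -> Prop :=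
| PS_cst K c : normc c <= K -> PS rho K (fun=> c)
| PS_var K Phi j : PS rho K Phi -> PS rho (rho * K) (fun z => z j * Phi z)
| PS_sum (K_ : nat -> R) (Phi_ : nat -> Z -> C) K Phi :
    (forall n, PS rho (K_ n) (Phi_ n)) -> (forall N, \sum_(n < N) K_ n <= K) ->
    (forall z : Z, (forall i, normc (z i) <= rho) ->
       normc (\sum_(n < N) Phi_ n z - Phi z) @[N --> \oo] --> 0) ->
    PS rho K Phi.

Lemma PS_ge0 rho K Phi : 0 <= rho -> PS rho K Phi -> 0 <= K.
Proof.
move=> r0; elim=> [{}K c cK|{}K {}Phi j _ K0|K_ Phi_ {}K {}Phi _ _ sK _].
- by apply: le_trans cK; exact: normc_ge0.
- exact: mulr_ge0.
- by have := sK 0%N; rewrite big_ord0.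
Qed.

Lemma PS_scale rho K Phi c : PS rho K Phi -> PS rho (normc c * K) (fun z => c * Phi z).
Proof.
elim=> [{}K c' cK|{}K {}Phi j _ ih|K_ Phi_ {}K {}Phi _ ih sK h].
- by apply: PS_cst; rewrite normcM ler_wpM2l ?normc_ge0.
- rewrite mulrCA (_ : (fun z : Z => _) = (fun z => z j * (c * Phi z))); first exact: PS_var.
  by apply/funext => z; exact: mulrCA.
- apply: (PS_sum (K_ := fun n => normc c * K_ n) ih) => [N|z hz].
    by rewrite -mulr_sumr ler_wpM2l ?normc_ge0.
  rewrite (_ : (fun N => _) = (fun N => normc c * normc (\sum_(n < N) Phi_ n z - Phi z))).
    by apply: cvg0Z; exact: h.
  by apply/funext => N; rewrite -mulr_sumr -mulrBr normcM.
Qed.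

Definition upd (z : Z) (j : 'I_d) (a : C) : Z := fun i => if i == j then a else z i.

Lemma upd_bound r z j a : (forall i, normc (z i) <= r) -> normc a <= r -> forall i, normc (upd z j a i) <= r.
Proof. by move=> hz ha i; rewrite /upd; case: ifP. Qed.

Lemma updC z i j a b : i != j -> upd (upd z i a) j b = upd (upd z j b) i a.
Proof.
move=> ij; apply/funext => k; rewrite /upd; case: (altP (k =P j)) => [->|//].
by rewrite eq_sym (negbTE ij).
Qed.

Lemma updK z j : upd z j (z j) = z.
Proof. by apply/funext => k; rewrite /upd; case: (altP (k =P j)) => [->|]. Qed.

Definition zmeas dd (T : measurableType dd) (phi : T -> Z) := forall i, cmeas setT (fun x => phi x i).

Lemma zmeas_upd dd (T : measurableType dd) (phi : T -> Z) j g :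
  zmeas phi -> cmeas setT g -> zmeas (fun x => upd (phi x) j (g x)).
Proof. by move=> hp hg i; rewrite /upd; case: (i == j). Qed.

Section cauchy_class.
Variables (r K : R).
Hypothesis r0 : 0 < r.

Definition circ (t : R) : C := r%:C%C * cexpi t.

Lemma normc_circ t : normc (circ t) = r.
Proof. by rewrite normcM normc_real normc_expi mulr1 gtr0_norm. Qed.

Lemma cmeas_circ : @cmeas _ (measurableTypeR R) R setT circ.
Proof. by apply: cmeasZ; exact: cmeas_ccont (@ccont_cexpi R). Qed.

(* Functions reproduced by the Cauchy kernel in the variables of [s], on which alone they depend. *)
Record cauchy_class (s : seq 'I_d) (f : Z -> C) : Prop := CauchyClass {
  cc_meas : forall dd (T : measurableType dd) (phi : T -> Z), zmeas phi -> cmeas setT (fun x => f (phi x));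
  cc_bound : forall z : Z, (forall i, normc (z i) <= r) -> normc (f z) <= K;
  cc_cauchy : forall j (z : Z) a, j \in s -> (forall i, normc (z i) <= r) -> normc a <= r / 2 ->
    f (upd z j a) = cmean (fun t => f (upd z j (circ t)) * ckern r a t);
  cc_indep : forall z z' : Z, (forall i, i \in s -> z i = z' i) -> f z = f z' }.

(** r^n times the n-th Taylor coefficient in the j-th variable, as a function of the others. *)
Definition Lcoef (j : 'I_d) (n : nat) (f : Z -> C) : Z -> C :=
  fun z => cmean (fun t => f (upd z j (circ t)) * cexpi (- t) ^+ n).

Let cmeas_en n : @cmeas _ (measurableTypeR R) R setT (fun t : R => cexpi (- t) ^+ n).
Proof. apply: cmeas_ccont; exact: cexpiNX_cont. Qed.

Lemma cc_circ_meas s f j z : cauchy_class s f -> @cmeas _ (measurableTypeR R) R setT (fun t => f (upd z j (circ t))).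
Proof.
move=> cf; apply: (cc_meas cf) => i; rewrite /upd; case: (i == j); [exact: cmeas_circ|exact: cmeas_cst].
Qed.

Lemma cc_circ_bound s f j z t : cauchy_class s f -> (forall i, normc (z i) <= r) -> normc (f (upd z j (circ t))) <= K.
Proof. by move=> cf hz; apply: (cc_bound cf); apply: upd_bound => //; rewrite normc_circ. Qed.

(** Taking a coefficient removes one variable: the Cauchy formula in the others survives by
    exchanging two circle means, and the bound survives because the factor e^{-int} has modulus
    1. *)
Lemma cauchy_class_Lcoef j s n f : j \notin s -> cauchy_class (j :: s) f -> cauchy_class s (Lcoef j n f).
Proof.
move=> js cf; split.
- move=> dd T phi hphi; rewrite /Lcoef.
  have := @cmeas_cmean R _ T (fun xt => f (upd (phi xt.1) j (circ xt.2)) * cexpi (- xt.2) ^+ n); apply.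
  apply: cmeasM; last exact: cmeas_comp (cmeas_en n) measurable_snd.
  apply: (cc_meas cf); apply: zmeas_upd; last exact: cmeas_comp cmeas_circ measurable_snd.
  by move=> i; exact: cmeas_comp (hphi i) measurable_fst.
- move=> z hz; apply: normc_cmean; first by apply: cmeasM => //; exact: (cc_circ_meas _ _ cf).
  by move=> t; rewrite normcM normcX normc_expi expr1n mulr1; exact: cc_circ_bound cf hz.
- move=> i z a iS hz ha.
  have ij : i != j by apply: contra js => /eqP <-.
  have mk : @cmeas _ (measurableTypeR R) R setT (ckern r a) by exact: cmeas_ccont (ccont_ckern r0 ha).
  have ar : normc a <= r by apply: le_trans ha _; rewrite ler_pdivrMr// ler_peMr ?(ltW r0)// ler1n.
  have K0 : 0 <= K by apply: le_trans (cc_bound cf hz); exact: normc_ge0.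
  have mG : cmeas setT (fun tu : measurableTypeR R * measurableTypeR R => f (upd (upd z j (circ tu.1)) i (circ tu.2))).
    apply: (cc_meas cf); apply: zmeas_upd; last exact: cmeas_comp cmeas_circ measurable_snd.
    apply: (@zmeas_upd _ _ (fun=> z)); last exact: cmeas_comp cmeas_circ measurable_fst.
    by move=> k; exact: cmeas_cst.
  have bG t u : normc (f (upd (upd z j (circ t)) i (circ u))) <= K.
    by apply: (cc_circ_bound _ _ cf); apply: upd_bound; rewrite ?normc_circ.
  rewrite /Lcoef.
  transitivity (cmean (fun t => cmean (fun u =>
      (cexpi (- t) ^+ n) * (f (upd (upd z j (circ t)) i (circ u)) * ckern r a u)))).
    congr cmean; apply/funext => t; rewrite (updC _ _ _ ij) (cc_cauchy cf (j := i)) ?inE ?iS ?orbT//; last first.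
      by apply: upd_bound => //; rewrite normc_circ.
    rewrite mulrC; apply/esym; apply: (@cmeanZ R _ (K * 2)).
      by apply: cmeasM mk; exact: cmeas_comp mG (measurable_pair1 (t : measurableTypeR R)).
    by move=> u; rewrite normcM; apply: ler_pM; rewrite ?normc_ge0// normc_ckern.
  rewrite (@cmean_swap R (fun tu => (cexpi (- tu.1) ^+ n) * (f (upd (upd z j (circ tu.1)) i (circ tu.2)) * ckern r a tu.2)) (K * 2)).
  - congr cmean; apply/funext => u; rewrite mulrC -(@cmeanZ R _ K).
    + congr cmean; apply/funext => t; rewrite (updC _ _ _ ij)/=.
      by move: (cexpi _ ^+ n) (f _) (ckern _ _ _) => x y w; ring.
    + apply: cmeasM => //; apply: (cc_meas cf); apply: (@zmeas_upd _ _ (fun=> _)); last exact: cmeas_circ.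
      by move=> k; exact: cmeas_cst.
    + move=> t; rewrite normcM normcX normc_expi expr1n mulr1 (updC _ _ _ ij); exact: bG.
  - apply: cmeasM; first exact: cmeas_comp (cmeas_en n) measurable_fst.
    by apply: cmeasM => //; exact: cmeas_comp mk measurable_snd.
  - move=> tu; rewrite normcM normcX normc_expi expr1n mul1r normcM.
    by apply: ler_pM; rewrite ?normc_ge0// normc_ckern.
- move=> z z' zz; congr cmean; apply/funext => t; congr (_ * _); apply: (cc_indep cf) => i.
  by rewrite inE /upd; case: eqP => //= _; exact: zz.
Qed.

Lemma PS_pow rho K' Phi j n : PS rho K' Phi -> PS rho (rho ^+ n * K') (fun z => z j ^+ n * Phi z).
Proof.
move=> h; elim: n => [|n ih].
  by rewrite mul1r (_ : (fun z : Z => _) = Phi)//; apply/funext => z; rewrite mul1r.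
rewrite exprS -mulrA (_ : (fun z : Z => _) = (fun z => z j * (z j ^+ n * Phi z))); first exact: PS_var.
by apply/funext => z; rewrite exprS mulrA.
Qed.

(** Expansion in one variable after the other. On the polydisc of half the radius each expansion is
    dominated by a geometric series of ratio 1/2, hence a factor 2 per variable. *)
Lemma cauchy_class_PS s f : uniq s -> cauchy_class s f -> PS (r / 2) (2 ^+ size s * K) f.
Proof.
elim: s f => [|j s ih] f /=.
  move=> _ cf; rewrite expr0 mul1r (_ : f = fun=> f (fun=> 0)); last first.
    by apply/funext => z; apply: (cc_indep cf).
  by apply: PS_cst; apply: (cc_bound cf) => i; rewrite normc0 ltW.
move=> /andP[js us] cf; have h n := ih _ us (cauchy_class_Lcoef n js cf).
set K' := 2 ^+ size s * K in h *.
have rn0 : r != 0 by rewrite gt_eqF.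
have rc0 : r%:C%C != 0 :> C by rewrite -normc_eq0 normc_real normr_eq0.
have K'0 : 0 <= K' by apply: (PS_ge0 _ (h 0%N)); rewrite divr_ge0// ltW.
apply: (PS_sum (Phi_ := fun n z => (r%:C%C^-1 ^+ n) * (z j ^+ n * Lcoef j n f z))
   (fun n => PS_scale (r%:C%C^-1 ^+ n) (PS_pow j n (h n)))) => [N|z hz].
  have E n : normc (r%:C%C^-1 ^+ n : C) * ((r / 2) ^+ n * K') = (1 / 2) ^+ n * K'.
    rewrite normcX normcV normc_real gtr0_norm// mulrA -exprMn; congr (_ ^+ n * _).
    by rewrite mulrA mulVf.
  under eq_bigr do rewrite E.
  rewrite -mulr_suml exprS -mulrA ler_wpM2r//.
  have : \sum_(n < N) (1 / 2 : R) ^+ n = 2 - 2 * (1 / 2) ^+ N.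
    by elim: N => [|N ihN]; rewrite ?big_ord0 ?expr0 ?mulr1 ?subrr// big_ord_recr/= ihN exprS; lra.
  move=> ->; have hN : 0 <= (1 / 2 : R) ^+ N by apply: exprn_ge0; lra.
  by lra.
have hz' i : normc (z i) <= r.
  by apply: le_trans (hz i) _; rewrite ler_pdivrMr// ler_peMr ?(ltW r0)// ler1n.
have := cmeanM_ckern_series r0 (hz j) (cc_circ_meas j z cf) (fun t => cc_circ_bound j t cf hz').
rewrite -(cc_cauchy cf (mem_head j s) hz' (hz j)) updK.
under eq_fun => N do under eq_bigr => n _ do rewrite exprMn [_ ^+ n * _ ^+ n]mulrC -mulrA.
by [].
Qed.

End cauchy_class.
End power_series.

(** * Neighbourhoods in terms of the real modulus *)

Section complex_topology.
Variable R : realType.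
Local Notation C := R[i].
Local Notation Re := (@complex.Re R).

Lemma nbhs_cplx (z : C) (P : set C) :
  nbhs z P <-> exists2 e : R, 0 < e & forall w, normc (w - z) < e -> P w.
Proof.
split.
  move=> /nbhs_ballP[e /= e0 h]; have [er e0'] : e = (Re e)%:C%C /\ 0 < Re e.
    by move: e0; case: (e) => a b; rewrite ltcE/= => /andP[/eqP -> ?].
  exists (Re e) => // w hw; apply: h; rewrite -ball_normE/= er normc_norm ltcR.
  by rewrite normcB.
move=> [e e0 h]; apply/nbhs_ballP; exists e%:C%C => /=; first by rewrite ltcR.
by move=> w; rewrite -ball_normE/= normc_norm ltcR => hw; apply: h; rewrite normcB.
Qed.

Lemma nbhs_cmx m n (z : 'M[C]_(m, n)) (P : set 'M[C]_(m, n)) :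
  nbhs z P <-> exists2 e : R, 0 < e & forall w : 'M[C]_(m, n), (forall i j, normc (w i j - z i j) < e) -> P w.
Proof.
split.
  move=> /nbhs_ballP[e /= e0 h]; have [er e0'] : e = (Re e)%:C%C /\ 0 < Re e.
    by move: e0; case: (e) => a b; rewrite ltcE/= => /andP[/eqP -> ?].
  exists (Re e) => // w hw; apply: h; split=> // i j; rewrite -ball_normE/= er normc_norm ltcR.
  by rewrite normcB.
move=> [e e0 h]; apply/nbhs_ballP; exists e%:C%C => /=; first by rewrite ltcR.
move=> w [_ hw]; apply: h => i j; have := hw i j.
by rewrite -ball_normE/= normc_norm ltcR normcB.
Qed.

End complex_topology.

Section entire_functions.
Variables (R : realType) (d : nat).
Local Notation C := R[i].
Local Notation Z := ('I_d -> C).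
Variables (M : 'cV[C]_d -> 'M[C]_d) (hM : entire M).

Definition colv (z : Z) : 'cV[C]_d := \col_i z i.

Lemma entire_cont (z : 'cV[C]_d) i j (e : R) : 0 < e -> exists2 dl : R, 0 < dl &
  forall w : 'cV[C]_d, (forall k, normc (w k 0 - z k 0) < dl) -> normc (M w i j - M z i j) < e.
Proof.
move=> e0; have /nbhs_cmx[dl dl0 h] : nbhs z (M @^-1` [set w | normc (w i j - M z i j) < e]).
  apply: (differentiable_continuous (hM z)).
  by apply/nbhs_cmx; exists e => // w; apply.
by exists dl => // w hw; apply: h => k l; rewrite ord1.
Qed.

Lemma entire_cholo z i j k : cholo (fun a => M (colv (upd z k a)) i j).
Proof.
move=> a; have hd := hM (colv (upd z k a)).
have [D hD] : exists D : 'M[C]_d, (fun h : C => h^-1 *: (M (h *: delta_mx k 0 + colv (upd z k a)) - M (colv (upd z k a)))) @ 0^' --> D.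
  by have /cvg_ex := @diff_derivable _ _ _ _ _ (delta_mx k 0) hd.
exists (D i j) => e e0.
have : nbhs D [set w : 'M[C]_d | normc (w i j - D i j) <= e].
  by apply/nbhs_cmx; exists e => // w hw; apply/ltW; exact: hw.
move=> /hD; rewrite /nbhs/= /dnbhs /within/=.
move=> /nbhs_cplx [dl dl0 h]; exists dl => // t ht.
have [->|t0] := eqVneq t 0.
  by rewrite addr0 subrr mulr0 subr0 normc0 mulr0.
have := h t; rewrite subr0 => /(_ ht t0) /=.
have E : t *: delta_mx k 0 + colv (upd z k a) = colv (upd z k (a + t)).
  apply/matrixP => l m; rewrite ord1 !mxE eqxx andbT /upd.
  by case: eqP => _; rewrite ?mulr1 ?mulr0 ?add0r// addrC.
rewrite E !mxE; move: (M _ i j) (M _ i j) (D i j) => x y l hl.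
have -> : y - x - l * t = t * (t^-1 * (y - x) - l).
  by rewrite mulrBr mulrA divff// mul1r; congr (_ - _); exact: mulrC.
by rewrite normcM mulrC ler_wpM2r ?normc_ge0.
Qed.

Lemma measurable_countable dd (T : measurableType dd) (U : countType) (code : T -> U) (H : U -> R) :
  (forall u, measurable (code @^-1` [set u])) -> measurable_fun setT (fun x => H (code x)).
Proof.
move=> mc _ Y mY; rewrite setTI.
have -> : (fun x => H (code x)) @^-1` Y = \bigcup_u (if `[< Y (H u) >] then code @^-1` [set u] else set0).
  apply/seteqP; split => [x hx|x [u _]]; first by exists (code x) => //; case: asboolP.
  by case: asboolP => // h xu; rewrite /= xu.
apply: countable_bigcupT_measurable => [|u]; first exact: countableP.
by case: asboolP => // _; exact: measurable0.
Qed.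

Definition rnd (n : nat) (x : R) : int := Num.floor (n.+1%:R * x).

Lemma rnd_close n x : `|(rnd n x)%:~R / n.+1%:R - x| <= n.+1%:R^-1.
Proof.
have n0 : 0 < n.+1%:R :> R by [].
have -> : (rnd n x)%:~R / n.+1%:R - x = ((rnd n x)%:~R - n.+1%:R * x) / n.+1%:R.
  by rewrite mulrBl [n.+1%:R * x]mulrC mulfK// gt_eqF.
rewrite normrM [`|n.+1%:R^-1|]gtr0_norm ?invr_gt0// ler_piMl ?invr_ge0//.
have /andP[h1 h2] := floor_itv (n.+1%:R * x); rewrite -/(rnd n x) in h1 h2.
by rewrite ler_norml; apply/andP; split; [rewrite intrD in h2|]; lra.
Qed.

Lemma measurable_rnd dd (T : measurableType dd) (f : T -> R) n m :
  measurable_fun setT f -> measurable [set x | rnd n (f x) = m].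
Proof.
move=> mf; have mg : measurable_fun setT (fun x => n.+1%:R * f x) by exact: measurable_funM.
rewrite (_ : [set x | _] = setT `&` (fun x => n.+1%:R * f x) @^-1` `[m%:~R, (m + 1)%:~R[%classic); last first.
  apply/seteqP; split => x /=.
    by move=> <-; split=> //; rewrite in_itv/=; exact: floor_itv.
  by move=> [_]; rewrite in_itv/= => h; exact: floor_def.
by apply: mg => //; exact: measurable_itv.
Qed.

(** The arguments are rounded to a grid of mesh 1 / (n + 1): the rounded maps take countably many
    values, hence their composition with [M] is measurable, and continuity of [M] gives the
    limit. *)
Lemma entire_meas dd (T : measurableType dd) (phi : T -> Z) i j :
  zmeas phi -> cmeas setT (fun x => M (colv (phi x)) i j).
Proof.
move=> hp; pose code n (x : T) : {ffun 'I_d -> int * int} := [ffun k => (rnd n (complex.Re (phi x k)), rnd n (complex.Im (phi x k)))].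
pose dec n (u : {ffun 'I_d -> int * int}) : Z := fun k => Complex ((u k).1%:~R / n.+1%:R) ((u k).2%:~R / n.+1%:R).
have mcode n u : measurable (code n @^-1` [set u]).
  rewrite (_ : _ @^-1` _ = \bigcap_(k in [set: 'I_d]) ([set x | rnd n (complex.Re (phi x k)) = (u k).1] `&`
      [set x | rnd n (complex.Im (phi x k)) = (u k).2])); last first.
    apply/seteqP; split => x /=.
      by move=> <- k _; rewrite /code ffunE.
    by move=> h; apply/ffunP => k; rewrite ffunE; have [-> ->] := h k I; case: (u k).
  apply: fin_bigcap_measurable; first exact: finite_finset.
  by move=> k _; apply: measurableI; apply: measurable_rnd; have [] := hp k.
have close n x k : normc (dec n (code n x) k - phi x k) <= 2 * n.+1%:R^-1.
  apply: le_trans (normc_le_ReIm _) _; rewrite ReDc ImDc ReNc ImNc /= ffunE /=.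
  by rewrite mulr_natl mulr2n lerD// rnd_close.
have lim x : normc (M (colv (dec n (code n x))) i j - M (colv (phi x)) i j) @[n --> \oo] --> (0 : R).
  apply/cvgrPdist_lt => e e0; have [dl dl0 h] := entire_cont (colv (phi x)) i j e0.
  have [N _ hN] : \forall n \near \oo, 2 * n.+1%:R^-1 < dl :> R.
    have hh : 2 * n.+1%:R^-1 @[n --> \oo] --> (0 : R) by apply: cvg0Z; exact: cvg_harmonic.
    move/cvgrPdist_lt: hh => /(_ _ dl0); apply: filterS => n; rewrite sub0r normrN ger0_norm//.
  near=> n; rewrite sub0r normrN ger0_norm ?normc_ge0//; apply: h => k; rewrite !mxE.
  by apply: le_lt_trans (close n x k) _; apply: hN; near: n; exists N.
split.
- apply: (measurable_fun_cvg (h := fun n x => complex.Re (M (colv (dec n (code n x))) i j))).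
    move=> n; exact: (measurable_countable (fun u => complex.Re (M (colv (dec n u)) i j)) (mcode n)).
  move=> x _; apply/cvgrPdist_lt => e e0; near=> n; rewrite distrC.
  apply: (@le_lt_trans _ _ (normc (M (colv (dec n (code n x))) i j - M (colv (phi x)) i j))).
    by rewrite -ReNc -ReDc normc_Re.
  rewrite -[ltLHS]ger0_norm ?normc_ge0//; near: n; exact: cvgr0_norm_lt (lim x) _ e0.
- apply: (measurable_fun_cvg (h := fun n x => complex.Im (M (colv (dec n (code n x))) i j))).
    move=> n; exact: (measurable_countable (fun u => complex.Im (M (colv (dec n u)) i j)) (mcode n)).
  move=> x _; apply/cvgrPdist_lt => e e0; near=> n; rewrite distrC.
  apply: (@le_lt_trans _ _ (normc (M (colv (dec n (code n x))) i j - M (colv (phi x)) i j))).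
    by rewrite -ImNc -ImDc normc_Im.
  rewrite -[ltLHS]ger0_norm ?normc_ge0//; near: n; exact: cvgr0_norm_lt (lim x) _ e0.
Unshelve. all: by end_near.
Qed.

(** The polydisc lies in a compact cube of R^{2d}, on which the continuous modulus attains a
    maximum. For r < 0 no [z] qualifies, because an index exists. *)
Lemma entire_bounded (r : R) i j : exists K, forall z : Z, (forall k, normc (z k) <= r) -> normc (M (colv z) i j) <= K.
Proof.
have [r0|r0] := ltP r 0.
  have [k _|none] := pickP 'I_d; last by have := none i.
  exists 0 => z /(_ k) h; have := normc_ge0 (z k); lra.
pose Psi (v : 'rV[R]_(d + d)) : 'cV[C]_d := \col_k Complex (v 0 (lshift d k)) (v 0 (rshift d k)).
pose A := [set v : 'rV[R]_(d + d) | forall k, v ord0 k \in `[- r, r]].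
have cA : compact A by apply: (@rV_compact _ _ (fun _ => `[- r, r]%classic)) => k; exact: segment_compact.
have cf : continuous (fun v => normc (M (Psi v) i j)).
  move=> v U /nbhs_ballP[e /= e0 hU]; have [dl dl0 h] := entire_cont (Psi v) i j e0.
  have d2 : 0 < dl / 2 by rewrite divr_gt0.
  exists (fun a b => ball (v a b) (dl / 2)) => [a b|w hw]; first exact: nbhsx_ballx.
  apply: hU; rewrite /ball/= distrC; apply: le_lt_trans (ler_dist_normc _ _) _; apply: h => k; rewrite !mxE.
  apply: le_lt_trans (normc_le_ReIm _) _; rewrite ReDc ImDc ReNc ImNc /=.
  by rewrite [dl]splitr; apply: ltrD; rewrite distrC; exact: hw.
have [c _ hc] : exists2 c : 'rV_(d + d), c \in A & forall t : 'rV_(d + d), t \in A -> normc (M (Psi t) i j) <= normc (M (Psi c) i j).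
  apply: EVT_max_rV cA _; last exact: continuous_subspaceT.
  by exists 0 => k; rewrite mxE in_itv/= oppr_le0 r0.
exists (normc (M (Psi c) i j)) => z hz.
pose v : 'rV[R]_(d + d) := \row_k match fintype.split k with inl a => complex.Re (z a) | inr b => complex.Im (z b) end.
have -> : colv z = Psi v.
  by apply/matrixP => k l; rewrite !mxE (unsplitK (inl k)) (unsplitK (inr k)); case: (z k).
apply: hc; rewrite inE => k; rewrite mxE in_itv/= -ler_norml.
by case: fintype.split => m; apply: le_trans (hz m); [exact: normc_Re|exact: normc_Im].
Unshelve. all: by end_near.
Qed.

Theorem entire_PS (rho : R) i j : 0 < rho -> exists K, PS rho K (fun z => M (colv z) i j).
Proof.
move=> rho0; have [K hK] := entire_bounded (2 * rho) i j.
have r0 : 0 < 2 * rho by rewrite mulr_gt0.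
exists (2 ^+ size (enum 'I_d) * K); rewrite -[rho in PS rho](_ : 2 * rho / 2 = rho); last by rewrite mulrC mulKf.
apply: cauchy_class_PS => //; first exact: enum_uniq.
split.
- by move=> dd T phi; exact: entire_meas.
- exact: hK.
- move=> k z a _ hz ha; exact: (esym (cauchy_formula r0 ha (entire_cholo z i j k))).
- move=> z z' zz; congr (M _ i j); apply/matrixP => k l; rewrite !mxE; apply: zz; exact: mem_enum.
Qed.

End entire_functions.

(** * Substitution into power series *)

Section complex_series.
Variable R : realType.
Local Notation C := R[i].
Local Notation Re := (@complex.Re R).
Local Notation Im := (@complex.Im R).
Implicit Types x y : nat -> C.

Definition ctends (u : nat -> C) (l : C) := normc (u N - l) @[N --> \oo] --> (0 : R).

Lemma ctends_unique u l l' : ctends u l -> ctends u l' -> l = l'.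
Proof.
move=> h h'; apply/eqP; rewrite -subr_eq0 -normc_eq0 eq_le normc_ge0 andbT.
apply: le_cvg (cvg0D h h') => n.
rewrite (_ : l - l' = (u n - l') - (u n - l)); last by ring.
by apply: le_trans (le_normcB _ _) _; rewrite addrC.
Qed.

Lemma ctends_cst (l : C) : ctends (fun=> l) l.
Proof. by rewrite /ctends; under eq_fun do rewrite subrr normc0; exact: cvg_cst. Qed.

Lemma ctends_ext u v l : (forall n, u n = v n) -> ctends u l -> ctends v l.
Proof. by move=> /funext ->. Qed.

Lemma ctendsD u v l m : ctends u l -> ctends v m -> ctends (fun n => u n + v n) (l + m).
Proof.
move=> h1 h2; apply: (squeeze0 _ (cvg0D h1 h2)) => n; rewrite normc_ge0/=.
rewrite (_ : _ - _ = (u n - l) + (v n - m)); last by ring.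
exact: le_normcD.
Qed.

Lemma ctendsZ c u l : ctends u l -> ctends (fun n => c * u n) (c * l).
Proof. by move=> h; rewrite /ctends; under eq_fun do rewrite -mulrBr normcM; exact: cvg0Z. Qed.

Lemma ctends_sum (I : Type) (s : seq I) (u_ : I -> nat -> C) (l_ : I -> C) :
  (forall i, ctends (u_ i) (l_ i)) -> ctends (fun n => \sum_(i <- s) u_ i n) (\sum_(i <- s) l_ i).
Proof.
move=> h; elim: s => [|i s ih]; first by rewrite /ctends; under eq_fun do rewrite !big_nil subrr normc0; exact: cvg_cst.
by rewrite big_cons; under eq_fun do rewrite big_cons; exact: ctendsD.
Qed.

Lemma ctends_shift u l k : ctends u l -> ctends (fun n => u (n + k)%N) l.
Proof. by move=> h; have := h; rewrite /ctends -(cvg_shiftn k). Qed.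

Lemma ctends_bound u l (K : R) : (forall n, normc (u n) <= K) -> ctends u l -> normc l <= K.
Proof.
move=> uK h; rewrite -subr_le0; apply: le_cvg h => n; rewrite lerBlDl.
apply: le_trans (_ : normc (u n) + normc (u n - l) <= _); last by rewrite lerD2r.
by rewrite [leLHS](_ : _ = normc (u n - (u n - l))) ?le_normcB//; congr normc; ring.
Qed.

Definition csum x : C := xget 0 [set l | ctends (fun N => \sum_(n < N) x n) l].

Lemma csumE x l : ctends (fun N => \sum_(n < N) x n) l -> csum x = l.
Proof.
move=> h; rewrite /csum; case: xgetP => [l' _ h'|/(_ l)//].
exact: ctends_unique h' h.
Qed.

Lemma csum_cvg x (M : nat -> R) S : (forall n, normc (x n) <= M n) -> (forall N, \sum_(n < N) M n <= S) ->
  ctends (fun N => \sum_(n < N) x n) (csum x).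
Proof.
move=> xM MS; have M0 n : 0 <= M n by apply: le_trans (xM n); exact: normc_ge0.
have cv (P : C -> R) : (forall z, `|P z| <= normc z) -> cvgn (fun N => \sum_(n < N) P (x n)).
  move=> Pn; under eq_fun do rewrite -(big_mkord xpredT (fun n => P (x n))).
  apply: normed_cvg; apply: (@series_le_cvg _ _ M) => //.
  - by move=> n /=.
  - by move=> n; exact: le_trans (Pn _) (xM n).
  apply: nondecreasing_is_cvgn.
    by apply: nondecreasing_series.
  by exists S => _ [N _ <-]; rewrite /series/= big_mkord.
have c1 := cv Re (@normc_Re R); have c2 := cv Im (@normc_Im R).
have h : ctends (fun N => \sum_(n < N) x n) (Complex (limn (fun N => \sum_(n < N) Re (x n))) (limn (fun N => \sum_(n < N) Im (x n)))).
  set l1 := limn _; set l2 := limn _.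
  apply: (squeeze0 (v := fun N => `|\sum_(n < N) Re (x n) - l1| + `|\sum_(n < N) Im (x n) - l2|)) => [N|].
    by rewrite normc_ge0 /=; apply: le_trans (normc_le_ReIm _) _; rewrite ReDc ImDc ReNc ImNc Re_sum Im_sum.
  have aux (v : nat -> R) (l : R) : v n @[n --> \oo] --> l -> `|v n - l| @[n --> \oo] --> (0 : R).
    move=> /cvgrPdist_le hv; apply/cvgrPdist_le => e e0; apply: filterS (hv e e0) => n.
    by rewrite sub0r normrN normr_id distrC.
  by apply: cvg0D; apply: aux.
by rewrite (csumE h).
Qed.

Lemma normc_csum x (M : nat -> R) S : (forall n, normc (x n) <= M n) -> (forall N, \sum_(n < N) M n <= S) ->
  normc (csum x) <= S.
Proof.
move=> xM MS; apply: ctends_bound (csum_cvg xM MS) => N.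
by apply: le_trans (normc_sum _ _ _) _; apply: le_trans (MS N); apply: ler_sum.
Qed.

(** Divergent series are covered: for c nonzero both sides are then the default 0. The homogeneity
    law [op_hom], free of convergence assumptions, relies on this. *)
Lemma csumZ c x : csum (fun n => c * x n) = c * csum x.
Proof.
have [->|c0] := eqVneq c 0.
  rewrite mul0r; apply: csumE; apply: ctends_ext (ctends_cst 0) => N.
  by rewrite big1// => n _; rewrite mul0r.
have [[l hl]|none] := pselect (exists l, ctends (fun N => \sum_(n < N) x n) l).
  rewrite (csumE hl); apply: csumE; apply: ctends_ext (ctendsZ c hl) => N.
  by rewrite mulr_sumr.
rewrite /csum; case: xgetP => [l _ hl|_]; case: xgetP => [l' _ hl'|_]; rewrite ?mulr0//.
- by exfalso; apply: none; exists l'.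
- exfalso; apply: none; exists (c^-1 * l); apply: ctends_ext (ctendsZ c^-1 hl) => N.
  by rewrite mulr_sumr; apply: eq_bigr => n _; rewrite mulKf.
- by exfalso; apply: none; exists l'.
Qed.

Lemma sum_tail (M : nat -> R) S (e : R) : (forall n, 0 <= M n) -> (forall N, \sum_(n < N) M n <= S) -> 0 < e ->
  exists m, forall N, (m <= N)%N -> \sum_(n < N) M n <= \sum_(n < m) M n + e.
Proof.
move=> M0 MS e0.
have cv : cvgn (fun N => \sum_(n < N) M n).
  under eq_fun do rewrite -(big_mkord xpredT M).
  apply: nondecreasing_is_cvgn; first by apply: nondecreasing_series.
  by exists S => _ [N _ <-]; rewrite big_mkord.
have /cvgrPdist_le/(_ e e0) [m _ hm] := cv.
exists m => N mN; have := hm m (leqnn m); rewrite /= ler_norml => /andP[_ h].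
rewrite -lerBlDl; apply: le_trans h; rewrite lerD2r.
have nd : nondecreasing_seq (fun N => \sum_(n < N) M n).
  move=> a b ab; rewrite -!(big_mkord xpredT M); exact: (@nondecreasing_series _ M xpredT 0 (fun n _ _ => M0 n)).
exact: nondecreasing_cvgn_le nd cv N.
Qed.

(** Dominated convergence for sums whose terms and length both depend on [N]: beyond a fixed [m] the
    majorant leaves at most 2 e / 4, and the first [m] terms converge. *)
Lemma tannery (x : nat -> nat -> C) y (M : nat -> R) S :
  (forall N k, normc (x N k) <= M k) -> (forall k, ctends (fun N => x N k) (y k)) ->
  (forall N, \sum_(k < N) M k <= S) -> ctends (fun N => \sum_(k < N) (x N k - y k)) 0.
Proof.
move=> xM xy MS; have M0 n : 0 <= M n by apply: le_trans (xM 0%N n); exact: normc_ge0.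
have yM k : normc (y k) <= M k by apply: ctends_bound (xy k) => N.
rewrite /ctends; apply/cvgrPdist_le => e e0; have e4 : 0 < e / 4 by rewrite divr_gt0.
have [m hm] := sum_tail M0 MS e4.
have fin : \sum_(k < m) normc (x N k - y k) @[N --> \oo] --> (0 : R).
  elim: m {hm} => [|m ih]; first by under eq_fun do rewrite big_ord0; exact: cvg_cst.
  under eq_fun do rewrite big_ord_recr/=; apply: cvg0D => //; exact: xy.
move/cvgrPdist_le: fin => /(_ _ e4) [m' _ hm'].
exists (maxn m m') => // N /=; rewrite geq_max => /andP[mN mN'].
rewrite sub0r normrN subr0 ger0_norm ?normc_ge0//; apply: le_trans (normc_sum _ _ _) _.
have := hm' N mN'; rewrite /= sub0r normrN ger0_norm; last by apply: sumr_ge0 => *; exact: normc_ge0.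
move=> h1; have h2 := hm N mN.
have -> : \sum_(k < N) normc (x N k - y k) = \sum_(k < m) normc (x N k - y k) + \sum_(m <= k < N) normc (x N k - y k).
  by rewrite -!(big_mkord xpredT (fun k => normc (x N k - y k))) (big_cat_nat (n := m)).
have h3 : \sum_(m <= k < N) normc (x N k - y k) <= 2 * \sum_(m <= k < N) M k.
  rewrite mulr_sumr; apply: ler_sum => k _; apply: le_trans (le_normcB _ _) _.
  by rewrite mulr_natl mulr2n lerD.
have h4 : \sum_(k < N) M k = \sum_(k < m) M k + \sum_(m <= k < N) M k.
  by rewrite -!(big_mkord xpredT M) (big_cat_nat (n := m)).
by rewrite h4 in h2; lra.
Qed.

(** Partial sums of the product are sums of p_i times partial sums of q of length N - i, to which
    [tannery] applies. *)
Lemma cauchy_product (p q : nat -> C) P Q (Mp Mq : nat -> R) Sp Sq :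
  (forall n, normc (p n) <= Mp n) -> (forall N, \sum_(n < N) Mp n <= Sp) ->
  (forall n, normc (q n) <= Mq n) -> (forall N, \sum_(n < N) Mq n <= Sq) ->
  ctends (fun N => \sum_(n < N) p n) P -> ctends (fun N => \sum_(n < N) q n) Q ->
  ctends (fun N => \sum_(n < N) \sum_(i < n.+1) p i * q (n - i)%N) (P * Q).
Proof.
move=> pM MSp qM MSq cP cQ.
have Sq0 : 0 <= Sq by have := MSq 0%N; rewrite big_ord0.
have QM N : normc (\sum_(n < N) q n) <= Sq.
  by apply: le_trans (normc_sum _ _ _) _; apply: le_trans (MSq N); apply: ler_sum.
have E N : \sum_(n < N) \sum_(i < n.+1) p i * q (n - i)%N = \sum_(i < N) p i * \sum_(j < N - i) q j.
  elim: N => [|N ih]; first by rewrite !big_ord0.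
  rewrite big_ord_recr/= ih.
  have -> : \sum_(i < N) p i * \sum_(j < N - i) q j = \sum_(i < N.+1) p i * \sum_(j < N - i) q j.
    by rewrite [RHS]big_ord_recr/= subnn big_ord0 mulr0 addr0.
  rewrite -big_split/=; apply: eq_bigr => i _; rewrite subSn; last by rewrite -ltnS.
  by rewrite big_ord_recr/= mulrDr.
have t := @tannery (fun N i => p i * \sum_(j < N - i) q j) (fun i => p i * Q) (fun i => Mp i * Sq) (Sp * Sq).
have {}t : ctends (fun N => \sum_(k < N) (p k * \sum_(j < N - k) q j - p k * Q)) 0.
  apply: t => [N k|k|N].
  - by rewrite normcM; apply: ler_pM; rewrite ?normc_ge0.
  - apply: ctendsZ; rewrite /ctends -(cvg_shiftn k); under eq_fun do rewrite addnK; exact: cQ.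
  - by rewrite -mulr_suml ler_wpM2r.
have := ctendsD t (ctendsZ Q cP); rewrite add0r [Q * P]mulrC; apply: ctends_ext => N.
by rewrite E mulr_sumr -big_split/=; apply: eq_bigr => i _; rewrite [Q * _]mulrC subrK.
Qed.

End complex_series.

(** * Abstract scales of norms *)

Section scales.
Variable R : realType.
Local Notation C := R[i].

(* [sU] bounds multipliers and [sP] the functions they act on. *)
Record scale (X : Type) := Scale {
  sU : R -> (X -> C) -> Prop;
  sP : R -> (X -> C) -> Prop;
  sP_le : forall K K' f, K <= K' -> sP K f -> sP K' f;
  sP_ext : forall K f f', (forall x, f x = f' x) -> sP K f -> sP K f';
  sP_scale : forall K c f, sP K f -> sP (normc c * K) (fun x => c * f x);
  sP_add : forall K K' f f', sP K f -> sP K' f' -> sP (K + K') (fun x => f x + f' x);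
  sP0 : sP 0 (fun=> 0);
  sP_mul : forall K K' f f', sU K f -> sP K' f' -> sP (K * K') (fun x => f x * f' x);
  sP_series : forall (K_ : nat -> R) K (f_ : nat -> X -> C), (forall n, sP (K_ n) (f_ n)) ->
    (forall N, \sum_(n < N) K_ n <= K) ->
    exists2 f, sP K f & forall x, ctends (fun N => \sum_(n < N) f_ n x) (f x) }.

Lemma sP_sum X (S : scale X) (n : nat) (K_ : 'I_n -> R) (f_ : 'I_n -> X -> C) :
  (forall i, sP S (K_ i) (f_ i)) -> sP S (\sum_i K_ i) (fun x => \sum_i f_ i x).
Proof.
elim: n K_ f_ => [|n ih] K_ f_ h.
  by rewrite big_ord0; apply: sP_ext (sP0 S) => x; rewrite big_ord0.
rewrite big_ord_recr/=; apply: sP_ext (sP_add (ih _ _ (fun i => h (widen_ord (leqnSn n) i))) (h ord_max)) => x.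
by rewrite big_ord_recr.
Qed.

Lemma num_scale_series (K_ : nat -> R) K (f_ : nat -> unit -> C) : (forall n, normc (f_ n tt) <= K_ n) ->
    (forall N, \sum_(n < N) K_ n <= K) ->
    exists2 f : unit -> C, normc (f tt) <= K & forall x, ctends (fun N => \sum_(n < N) f_ n x) (f x).
Proof.
move=> h hK; exists (fun=> csum (fun n => f_ n tt)); first exact: normc_csum h hK.
by case; exact: csum_cvg h hK.
Qed.

Definition num_scale : scale unit.
Proof.
apply: (@Scale unit (fun K f => normc (f tt) <= K) (fun K f => normc (f tt) <= K)).
- by move=> K K' f KK' h; exact: le_trans h KK'.
- by move=> K f f' <-.
- by move=> K c f h; rewrite normcM ler_wpM2l ?normc_ge0.
- by move=> K K' f f' h h'; apply: le_trans (le_normcD _ _) (lerD h h').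
- by rewrite normc0.
- by move=> K K' f f' h h'; rewrite normcM; apply: ler_pM; rewrite ?normc_ge0.
- exact: num_scale_series.
Defined.

Section fourier_scale.
Variables (rho s p : R).
Hypotheses (rho0 : 0 <= rho) (p2 : 1 / 2 < p) (ps : p <= s).

(** The multiplier norm includes the algebra constant [cP s p], so that [sP_mul] holds without a
    constant, however many factors a monomial has. *)
Definition fourier_scale : scale R.
Proof.
apply: (@Scale R (fun K f => exists2 K1, cP s p * K1 <= K & B rho s K1 f) (B rho p)).
- by move=> K K' f; exact: B_le.
- by move=> K f f'; exact: B_ext.
- by move=> K c f; exact: B_scale.
- by move=> K K' f f'; exact: B_add.
- split=> //; exists (fun=> 0); split.
  + exact: cmeas_cst.
  + by apply: L2le_ext (L2le0 _ 0) => x; rewrite normc0 mulr0.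
  + by move=> x; rewrite /IF /tf; under [X in cint _ _ X]eq_fun do rewrite mul0r; rewrite cint0 mulr0.
- move=> K K' f f' [K1 h1 B1] B2; apply: B_le (B_mul rho0 p2 ps B1 B2) => //.
  by apply: ler_wpM2r h1; exact: B_ge0 B2.
- move=> K_ K f_ h hK; exact: (B_series rho0 p2 h hK).
Defined.

End fourier_scale.
End scales.

Section power_series_operator.
Variables (R : realType) (d : nat).
Local Notation C := R[i].
Local Notation Z := ('I_d -> C).

(** Multiplication by a power series with majorant [be] does not worsen the majorant [ga], and so
    neither does any number of such multiplications. *)
Definition conv_dom (be ga : nat -> R) n := forall m, (m <= n)%N -> \sum_(i < m.+1) be i * ga (m - i)%N <= ga m.

(* The operator [A] maps the coefficients of two power series [u] and [f] to those of [Phi(u) f]. *)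
Record PS_operator (rho K : R) (Phi : Z -> C) (A : (nat -> Z) -> (nat -> C) -> nat -> C) : Prop := {
  op_causal : forall a a' f f' n, (forall m, (m <= n)%N -> a m = a' m) -> (forall m, (m <= n)%N -> f m = f' m) ->
    A a f n = A a' f' n;
  op_hom : forall t a f n, A (fun m k => t ^+ m * a m k) (fun m => t ^+ m * f m) n = t ^+ n * A a f n;
  op_bound : forall X (S : scale R X) (a : nat -> X -> Z) (f : nat -> X -> C) (L : R) (be ga : nat -> R) n,
    0 <= L -> (forall m, 0 <= ga m) ->
    (forall m k, (m <= n)%N -> sU S (rho * be m) (fun x => a m x k)) ->
    (forall m, (m <= n)%N -> sP S (L * ga m) (f m)) -> conv_dom be ga n ->
    sP S (K * L * ga n) (fun x => A (a^~ x) (f^~ x) n);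
  op_eval : forall (a : nat -> Z) f (L : R) (be ga : nat -> R) Ga, 0 <= L -> (forall m, 0 <= ga m) ->
    (forall m k, normc (a m k) <= rho * be m) -> (forall m, normc (f m) <= L * ga m) ->
    (forall n, conv_dom be ga n) -> (forall N, \sum_(m < N) be m <= 1) -> (forall N, \sum_(m < N) ga m <= Ga) ->
    ctends (fun N => \sum_(n < N) A a f n) (Phi (fun k => csum (fun m => a m k)) * csum f) }.

Lemma op_bound_num rho K Phi A (a : nat -> Z) (f : nat -> C) (L : R) (be ga : nat -> R) n :
  PS_operator rho K Phi A -> 0 <= L -> (forall m, 0 <= ga m) ->
  (forall m k, normc (a m k) <= rho * be m) -> (forall m, normc (f m) <= L * ga m) -> conv_dom be ga n ->
  normc (A a f n) <= K * L * ga n.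
Proof.
move=> hA L0 ga0 ha hf hc.
exact: (op_bound hA (S := num_scale R) (a := fun m _ => a m) (f := fun m _ => f m) L0 ga0
  (fun m k _ => ha m k) (fun m _ => hf m) hc).
Qed.

(** Induction on [PS]: a constant scales the series, a variable acts by the Cauchy product with its
    component of [a], and a countable sum of operators is taken coefficientwise. *)
Lemma PS_operator_exists rho K Phi : 0 <= rho -> PS rho K Phi -> exists A, PS_operator rho K Phi A.
Proof.
move=> r0; elim=> {K Phi} [K c cK|K Phi j hPS [A hA]|K_ Phi_ K Phi hPS ih hK hPhi].
- exists (fun (_ : nat -> Z) f n => c * f n); split.
  + by move=> a a' f f' n _ ->.
  + by move=> t a f n; rewrite mulrCA.
  + move=> X S a f L be ga n L0 ga0 ha hf hc.
    apply: sP_le (sP_scale c (hf n (leqnn n))).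
    by rewrite -mulrA; apply: ler_wpM2r => //; rewrite mulr_ge0.
  + move=> a f L be ga Ga L0 ga0 ha hf hc hbe hga.
    have hLG N : \sum_(m < N) L * ga m <= L * Ga by rewrite -mulr_sumr ler_wpM2l.
    apply: ctends_ext (ctendsZ c (csum_cvg hf hLG)) => N; exact: mulr_sumr.
- have K0 := PS_ge0 r0 hPS.
  exists (fun (a : nat -> Z) (f : nat -> C) n => \sum_(i < n.+1) a i j * A a f (n - i)%N); split.
  + move=> a a' f f' n haa hff; apply: eq_bigr => i _; rewrite haa; last by rewrite -ltnS.
    congr (_ * _); apply: (op_causal hA) => m mn; [apply: haa|apply: hff];
      by apply: leq_trans mn (leq_subr _ _).
  + move=> t a f n; rewrite mulr_sumr; apply: eq_bigr => i _; rewrite (op_hom hA).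
    rewrite mulrACA -exprD subnKC//; by rewrite -ltnS.
  + move=> X S a f L be ga n L0 ga0 ha hf hc.
    have h (i : 'I_n.+1) : sP S (rho * be i * (K * L * ga (n - i)%N)) (fun x => a i x j * A (a^~ x) (f^~ x) (n - i)%N).
      have il : (i <= n)%N by rewrite -ltnS.
      apply: sP_mul; first exact: ha.
      apply: (op_bound hA (be := be)) => //.
      * by move=> m k mn; apply: ha; apply: leq_trans mn (leq_subr _ _).
      * by move=> m mn; apply: hf; apply: leq_trans mn (leq_subr _ _).
      * by move=> m mn; apply: hc; apply: leq_trans mn (leq_subr _ _).
    apply: sP_le (sP_sum h).
    rewrite (_ : \sum_i _ = rho * K * L * \sum_(i < n.+1) be i * ga (n - i)%N); last first.
      by rewrite mulr_sumr; apply: eq_bigr => i _; ring.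
    by apply: ler_wpM2l; [rewrite !mulr_ge0|exact: hc].
  + move=> a f L be ga Ga L0 ga0 ha hf hc hbe hga.
    have hA1 := op_eval hA L0 ga0 ha hf hc hbe hga.
    have bA n : normc (A a f n) <= K * L * ga n.
      exact: op_bound_num hA L0 ga0 ha hf (hc n).
    have S1 N : \sum_(m < N) rho * be m <= rho by rewrite -mulr_sumr -[leRHS]mulr1 ler_wpM2l.
    have S2 N : \sum_(m < N) K * L * ga m <= K * L * Ga by rewrite -mulr_sumr ler_wpM2l ?mulr_ge0.
    have h1 := csum_cvg (fun m => ha m j) S1.
    by rewrite -mulrA; exact: cauchy_product (fun m => ha m j) S1 bA S2 h1 hA1.
- have [A_ hA] := choice ih.
  exists (fun a f n => csum (fun k => A_ k a f n)); split.
  + move=> a a' f f' n haa hff; congr csum; apply/funext => k; exact: (op_causal (hA k)).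
  + by move=> t a f n; rewrite -csumZ; congr csum; apply/funext => k; rewrite (op_hom (hA k)).
  + move=> X S a f L be ga n L0 ga0 ha hf hc.
    have h k : sP S (K_ k * (L * ga n)) (fun x => A_ k (a^~ x) (f^~ x) n).
      by rewrite mulrA; exact: (op_bound (hA k) (be := be)).
    have [|g hg cg] := sP_series (K := K * (L * ga n)) h.
      by move=> N; rewrite -mulr_suml ler_wpM2r ?mulr_ge0.
    by rewrite -mulrA; apply: sP_ext hg => x; rewrite (csumE (cg x)).
  + move=> a f L be ga Ga L0 ga0 ha hf hc hbe hga.
    have K0 k : 0 <= K_ k := PS_ge0 r0 (hPS k).
    have Ga0 : 0 <= Ga by have := hga 0%N; rewrite big_ord0.
    have bA k n : normc (A_ k a f n) <= K_ k * (L * ga n).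
      rewrite mulrA.
      exact: op_bound_num (hA k) L0 ga0 ha hf (hc n).
    have hA1 k := op_eval (hA k) L0 ga0 ha hf hc hbe hga.
    set u := fun k : 'I_d => _; set F := csum f.
    have hu k : normc (u k) <= rho.
      by apply: (normc_csum (fun m => ha m k)) => N; rewrite -mulr_sumr -[leRHS]mulr1 ler_wpM2l.
    have sK N n : \sum_(k < N) K_ k * (L * ga n) <= K * (L * ga n) by rewrite -mulr_suml ler_wpM2r ?mulr_ge0.
    have cA n := csum_cvg (fun k => bA k n) (fun N => sK N n).
    pose V k N := \sum_(n < N) A_ k a f n.
    have V_le k N : normc (V k N) <= K_ k * (L * Ga).
      apply: le_trans (normc_sum _ _ _) _; apply: (@le_trans _ _ (\sum_(n < N) K_ k * (L * ga n))).
        by apply: ler_sum => n _; exact: bA.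
      by rewrite -mulr_sumr -mulr_sumr ler_wpM2l// ler_wpM2l.
    have SK N : \sum_(k < N) K_ k * (L * Ga) <= K * (L * Ga) by rewrite -mulr_suml ler_wpM2r ?mulr_ge0.
    have t := tannery (x := fun N k => V k N) (fun N k => V_le k N) hA1 SK.
    have cPhi : ctends (fun N => \sum_(k < N) Phi_ k u * F) (Phi u * F).
      by have := ctendsZ F (hPhi u hu); rewrite mulrC; apply: ctends_ext => N; rewrite mulrC mulr_suml.
    have h1 : ctends (fun N => \sum_(k < N) V k N) (Phi u * F).
      by have := ctendsD t cPhi; rewrite add0r; apply: ctends_ext => N; rewrite -big_split/=; apply: eq_bigr => k _; rewrite subrK.
    (* Exchange of the sums over [k] and [n]: summing all [k] or only k < N differs by a tail of the
       majorants [K_ k * (L * Ga)], whatever the length of the sum over [n]. *)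
    have tail : ctends (fun N => \sum_(n < N) csum (fun k => A_ k a f n) - \sum_(k < N) V k N) 0.
      rewrite /ctends; apply/cvgrPdist_le => e e0.
      have [m hm] := sum_tail (fun k => mulr_ge0 (K0 k) (mulr_ge0 L0 Ga0)) SK e0.
      exists m => // N /= mN; rewrite sub0r normrN subr0 ger0_norm ?normc_ge0//.
      have cs : ctends (fun M => \sum_(n < N) \sum_(k < M) A_ k a f n) (\sum_(n < N) csum (fun k => A_ k a f n)).
        by have := ctends_sum (enum 'I_N) (fun n : 'I_N => cA n); rewrite big_enum/=; apply: ctends_ext => M; rewrite big_enum.
      have {}cs : ctends (fun M => \sum_(n < N) \sum_(k < M + N) A_ k a f n - \sum_(k < N) V k N)
          (\sum_(n < N) csum (fun k => A_ k a f n) - \sum_(k < N) V k N).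
        exact: ctendsD (ctends_shift N cs) (ctends_cst _).
      apply: ctends_bound cs => M.
      have -> : \sum_(n < N) \sum_(k < M + N) A_ k a f n - \sum_(k < N) V k N = \sum_(N <= k < M + N) V k N.
        rewrite exchange_big/= -!(big_mkord xpredT (fun k => V k N)) (big_cat_nat (n := N))//= ?leq_addl//.
        by rewrite addrAC subrr add0r.
      apply: le_trans (normc_sum _ _ _) _.
      apply: (@le_trans _ _ (\sum_(N <= k < M + N) K_ k * (L * Ga))); first by apply: ler_sum => k _; exact: V_le.
      have h2 := hm (M + N)%N (leq_trans mN (leq_addl _ _)).
      have h3 : \sum_(k < M + N) K_ k * (L * Ga) = \sum_(k < m) K_ k * (L * Ga) + (\sum_(m <= k < N) K_ k * (L * Ga) + \sum_(N <= k < M + N) K_ k * (L * Ga)).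
        by rewrite -!(big_mkord xpredT (fun k => K_ k * (L * Ga))) -big_cat_nat//= ?leq_addl// -big_cat_nat//= (leq_trans mN (leq_addl _ _)).
      have h4 : 0 <= \sum_(m <= k < N) K_ k * (L * Ga) by apply: sumr_ge0 => k _; rewrite !mulr_ge0.
      by rewrite h3 in h2; lra.
    by have := ctendsD tail h1; rewrite add0r; apply: ctends_ext => N; rewrite subrK.
Qed.

End power_series_operator.

Section catalan_weights.
Variable R : realType.

(** A summable sequence whose convolution square is at most 8 times itself ([ga_conv]): majorants of
    this shape survive the nonlinearity with the same constant at each order. *)
Definition ga (m : nat) : R := (m.+1%:R ^+ 2)^-1.

Lemma ga_gt0 m : 0 < ga m. Proof. by rewrite invr_gt0 exprn_gt0. Qed.
Lemma ga_ge0 m : 0 <= ga m. Proof. exact: ltW (ga_gt0 m). Qed.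

Lemma sum_ga N : \sum_(m < N) ga m <= 2.
Proof.
have h : \sum_(m < N.+1) ga m <= 2 - N.+1%:R^-1.
  elim: N => [|N ih]; first by rewrite big_ord_recl big_ord0 /ga expr1n invr1; lra.
  rewrite big_ord_recr/=; have n0 : 0 < N.+1%:R :> R by [].
  have n1 : 0 < N.+2%:R :> R by [].
  have : ga N.+1 <= N.+1%:R^-1 - N.+2%:R^-1.
    have -> : N.+1%:R^-1 - N.+2%:R^-1 = (N.+1%:R * N.+2%:R)^-1 :> R.
      rewrite -[N.+2%:R]natr1; move: (N.+1%:R : R) n0 => x x0; field.
      by rewrite !gt_eqF//; lra.
    rewrite /ga lef_pV2 ?posrE ?exprn_gt0 ?mulr_gt0//.
    by rewrite expr2 ler_wpM2r// ler_nat.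
  by move=> hh; apply: le_trans (lerD ih hh) _; rewrite addrA subrK.
apply: (@le_trans _ _ (\sum_(m < N.+1) ga m)); first by rewrite big_ord_recr/= lerDl ga_ge0.
by apply: le_trans h _; rewrite gerBl invr_ge0.
Qed.

(** With a + b = n + 2, the inequality (a - b)^2 >= 0 gives 1 / (a b)^2 <= 2 (1 / a^2 + 1 / b^2) /
    (a + b)^2; the two sums of inverse squares are at most 2 each. *)
Lemma ga_conv n : \sum_(i < n.+1) ga i * ga (n - i)%N <= 8 * ga n.
Proof.
have h (i : 'I_n.+1) : ga i * ga (n - i)%N <= 2 * (ga i + ga (n - i)%N) * ga n.+1.
  have il : (i <= n)%N by rewrite -ltnS.
  rewrite /ga; set a : R := i.+1%:R; set b : R := (n - i).+1%:R.
  have a0 : 0 < a by []. have b0 : 0 < b by [].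
  rewrite -subr_ge0; have -> : n.+2%:R = a + b :> R by rewrite /a /b -natrD addSn addnS subnKC.
  have -> : 2 * (a ^- 2 + b ^- 2) / (a + b) ^+ 2 - a ^- 2 / b ^+ 2 = ((a - b) / (a * b * (a + b))) ^+ 2.
    by field; rewrite !gt_eqF//; lra.
  exact: sqr_ge0.
have sr : \sum_(i < n.+1) ga (n - i)%N = \sum_(i < n.+1) ga i.
  rewrite (reindex_inj rev_ord_inj)/=; apply: eq_bigr => i _; congr ga.
  by rewrite subSS subKn// -ltnS.
apply: le_trans (ler_sum _ (fun i _ => h i)) _.
rewrite -mulr_suml -mulr_sumr big_split/= sr.
have h1 := sum_ga n.+1; have h2 := ga_gt0 n.+1.
have h3 : ga n.+1 <= ga n.
  rewrite /ga lef_pV2 ?posrE ?exprn_gt0//; apply: lerXn2r; rewrite ?nnegrE// ler_nat//.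
apply: (@le_trans _ _ (8 * ga n.+1)); last by rewrite ler_pM2l.
by rewrite ler_pM2r//; lra.
Qed.

Lemma ga_ratio n : ga n <= 4 * ga n.+1.
Proof.
rewrite /ga -[4]invrK -invfM lef_pV2 ?posrE ?mulr_gt0 ?invr_gt0 ?exprn_gt0//.
rewrite ler_pdivrMl// (_ : 4 = 2 ^+ 2) -?exprMn; last by ring.
apply: lerXn2r; rewrite ?nnegrE ?mulr_ge0//.
by rewrite -natrM ler_nat mul2n -addnn addSn addnS !ltnS leq_addl.
Qed.

End catalan_weights.

(** * The Cauchy-Kovalevskaya series *)

Section termwise_derivative.
Variable R : realType.
Local Notation C := R[i].
Local Notation c0 := (Num.sqrt (2 * pi : R))^-1.

Lemma cdiffD (f g : R -> C) x l m : cdiff f x l -> cdiff g x m -> cdiff (fun y => f y + g y) x (l + m).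
Proof.
move=> [c hc] [c' hc']; exists (c + c') => h; rewrite mulrDl.
rewrite (_ : _ - _ = (f (x + h) - f x - h%:C%C * l) + (g (x + h) - g x - h%:C%C * m)); last by ring.
by apply: le_trans (le_normcD _ _) (lerD _ _).
Qed.

Lemma cdiffZ (f : R -> C) x l c : cdiff f x l -> cdiff (fun y => c * f y) x (c * l).
Proof.
move=> [c' hc]; exists (normc c * c') => h; rewrite mulrCA -!mulrBr normcM -mulrA.
by rewrite ler_wpM2l ?normc_ge0.
Qed.

Lemma cdiff_sum (n : nat) (f_ : 'I_n -> R -> C) x (l_ : 'I_n -> C) : (forall i, cdiff (f_ i) x (l_ i)) ->
  cdiff (fun y => \sum_i f_ i y) x (\sum_i l_ i).
Proof.
elim: n f_ l_ => [|n ih] f_ l_ h.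
  by exists 0 => t; rewrite !big_ord0 mulr0 !subr0 normc0 mul0r.
under eq_fun do rewrite big_ord_recr/=; rewrite big_ord_recr/=.
exact: cdiffD (ih _ _ (fun i => h _)) (h _).
Qed.

Lemma cdiff_ext (f g : R -> C) x l : (forall y, f y = g y) -> cdiff f x l -> cdiff g x l.
Proof. by move=> /funext ->. Qed.

Lemma B_csum rho p (K_ : nat -> R) K (f_ : nat -> R -> C) : 0 <= rho -> 1 / 2 < p ->
  (forall n, B rho p (K_ n) (f_ n)) -> (forall N, \sum_(n < N) K_ n <= K) ->
  B rho p K (fun x => csum (f_^~ x)) /\ forall x, ctends (fun N => \sum_(n < N) f_ n x) (csum (f_^~ x)).
Proof.
move=> r0 p2 h hK; have [f hf cf] := B_series r0 p2 h hK.
have E x : csum (f_^~ x) = f x by exact: csumE (cf x).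
by split=> [|x]; [apply: B_ext hf => x|]; rewrite E//; exact: cf.
Qed.

(** The tail of the series is again in a ball of the weighted space, so the bound on its derivative
    tends to 0 with the tail of [K_]. *)
Lemma csum_deriv rho rho' p (K_ : nat -> R) K (f_ : nat -> R -> C) x : 0 <= rho -> rho < rho' -> 1 / 2 < p ->
  (forall n, B rho' p (K_ n) (f_ n)) -> (forall N, \sum_(n < N) K_ n <= K) ->
  ctends (fun N => \sum_(n < N) Dx (f_ n) x) (Dx (fun y => csum (f_^~ y)) x).
Proof.
move=> r0 rr p2 h hK; have r'0 : 0 <= rho' by exact: ltW (le_lt_trans r0 rr).
have K0 n : 0 <= K_ n := B_ge0 (h n).
have [hB hc] := B_csum r'0 p2 h hK; have dr : 0 < rho' - rho by rewrite subr_gt0.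
have [_ hd] := B_deriv r0 rr p2 hB.
pose cc := c0 * cS p / (rho' - rho).
have cc0 : 0 <= cc by rewrite divr_ge0 ?mulr_ge0 ?cS_ge0 ?(ltW dr) ?(ltW (c0_gt0 R)).
rewrite /ctends; apply/cvgrPdist_le => e e0; have e1 : 0 < e / (cc + 1) by rewrite divr_gt0// ltr_wpDl.
have [m hm] := sum_tail K0 hK e1.
exists m => // N /= mN; rewrite sub0r normrN ger0_norm ?normc_ge0//.
have hT M : \sum_(n < M) K_ (N + n)%N <= e / (cc + 1).
  have := hm (N + M)%N (leq_trans mN (leq_addr _ _)).
  rewrite big_split_ord/= => h1; have : \sum_(n < m) K_ n <= \sum_(n < N) K_ n; last by move=> h2; lra.
  rewrite -(subnKC mN) big_split_ord/= lerDl; exact: sumr_ge0.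
have [tB tc] := B_csum r'0 p2 (fun n => h (N + n)%N) hT.
have E y : csum (fun n => f_ (N + n)%N y) = csum (f_^~ y) - \sum_(n < N) f_ n y.
  apply: ctends_unique (tc y) _.
  apply: ctends_ext (ctendsD (ctends_shift N (hc y)) (ctends_cst (- \sum_(n < N) f_ n y))) => M /=.
  by rewrite addnC big_split_ord/= addrAC subrr add0r.
have [dB dd] := B_deriv r0 rr p2 tB.
have D1 : cdiff (fun y => csum (f_^~ y) + (-1) * \sum_(n < N) f_ n y) x
    (Dx (fun y => csum (f_^~ y)) x + (-1) * \sum_(n < N) Dx (f_ n) x).
  apply: cdiffD => //; apply: cdiffZ; apply: cdiff_sum => i.
  by have [_] := B_deriv r0 rr p2 (h i); exact.
have D2 : cdiff (fun y => csum (f_^~ y) + (-1) * \sum_(n < N) f_ n y) x (Dx (fun y => csum (fun n => f_ (N + n)%N y)) x).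
  by apply: cdiff_ext (dd x) => y; rewrite mulN1r E.
have := B_sup x r0 p2 dB; rewrite (cdiff_unique D2 D1) mulN1r normcB => hs.
apply: le_trans hs _; 
rewrite (_ : _ * _ = cc * (e / (cc + 1))); last by rewrite /cc; ring.
by rewrite mulrCA ler_piMr ?(ltW e0)// ler_pdivrMr ?mul1r ?lerDl// ltr_wpDl.
Qed.

End termwise_derivative.

Lemma ga_conv_dom (R : realType) (x : R) n : 0 <= x ->
  conv_dom (fun m => ga R m * x ^+ m / 8) (fun m => ga R m * x ^+ m) n.
Proof.
move=> x0 j _; rewrite (_ : \sum_(i < j.+1) _ = x ^+ j / 8 * \sum_(i < j.+1) ga R i * ga R (j - i)%N).
  rewrite mulrAC ler_pdivrMr// mulrC [leRHS]mulrAC.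
  by apply: ler_wpM2r; [rewrite exprn_ge0|rewrite mulrC; exact: ga_conv].
rewrite mulr_sumr; apply: eq_bigr => i _.
have e : x ^+ j = x ^+ i * x ^+ (j - i) by rewrite -exprD subnKC// -ltnS.
by rewrite e; ring.
Qed.

Lemma ctends_pred (R : realType) (u : nat -> R[i]) l : ctends u l -> ctends (fun n => u n.-1) l.
Proof. by move=> h; rewrite /ctends -(cvg_shiftn 1) /=; under eq_fun do rewrite addn1 /=; exact: h. Qed.

(** * The formal solution and its convergence *)

Section formal_solution.
Variables (R : realType) (d : nat).
Local Notation C := R[i].
Local Notation Z := ('I_d -> C).
Local Notation c0 := (Num.sqrt (2 * pi : R))^-1.
Variables (Phi : 'I_d -> 'I_d -> Z -> C) (A : 'I_d -> 'I_d -> (nat -> Z) -> (nat -> C) -> nat -> C).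
Variables (s sigma0 K Mk : R) (Mkl : 'I_d -> 'I_d -> R) (u0 : R -> Z).
Hypotheses (s2 : 1 / 2 < s) (sigma00 : 0 < sigma0) (K0 : 0 < K).
(** 8 is the constant of [ga_conv]: it cancels the 1/8 put into the majorant by [ga_conv_dom]. *)
Let rho := 8 * cP s s * K.
Hypothesis hA : forall k l, PS_operator rho (Mkl k l) (Phi k l) (A k l).
Hypothesis Mkl0 : forall k l, 0 <= Mkl k l.
Hypothesis hMk : forall k, \sum_l Mkl k l <= Mk.
Hypothesis hMk0 : 0 <= Mk.
Hypothesis hu0 : forall k, B sigma0 s K (fun x => u0 x k).

(** Comparison of the coefficients of T^n in the equation: (n + 1) a_(n+1) is the n-th coefficient
    of M(u) u_x, computed by the operators [A]. *)
Definition ck_next (a : nat -> R -> Z) n : R -> Z := fun x k =>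
  (n.+1%:R^-1)%:C%C * \sum_l A k l (a^~ x) (fun m => Dx (fun y => a m y l) x) n.

(** Each coefficient depends on all earlier ones; the recursion carries the table of those computed
    so far, correct up to index [n] at stage [n], and [ckS] recovers the recursion from
    causality. *)
Fixpoint ck_stage (n : nat) : nat -> R -> Z :=
  if n is n'.+1 then fun m => if (m <= n')%N then ck_stage n' m else ck_next (ck_stage n') n' else fun=> u0.

Definition ck n := ck_stage n n.

Lemma ck_stageE m n : (m <= n)%N -> ck_stage n m = ck m.
Proof.
elim: n => [|n ih]; first by rewrite leqn0 => /eqP ->.
by rewrite leq_eqVlt => /orP[/eqP ->//|]; rewrite ltnS => mn /=; rewrite mn ih.
Qed.

Lemma ckS n : ck n.+1 = ck_next ck n.
Proof.
rewrite /ck/= ltnn; apply/funext => x; apply/funext => k; congr (_ * _); apply: eq_bigr => l _.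
by apply: (op_causal (hA k l)) => m mn; rewrite ck_stageE.
Qed.

(** The constant of the derivative bound below. In [ckC], 4 is the bound on the ratio of consecutive
    weights [ga], and 1 keeps the constant positive. *)
Definition ckE : R := 2 * expR 1.
Definition ckC : R := 4 * ckE * Mk + 1.

Lemma ckE_gt0 : 0 < ckE. Proof. by rewrite mulr_gt0// expR_gt0. Qed.
Lemma ckC_gt0 : 0 < ckC. Proof. by rewrite ltr_wpDl// !mulr_ge0// ltW// ckE_gt0. Qed.

Lemma ck_deriv_bound n k : 
  (forall sigma, 0 <= sigma < sigma0 -> B sigma s (K * ga R n * (ckC / (sigma0 - sigma)) ^+ n) (fun x => ck n x k)) ->
  forall sigma, 0 <= sigma < sigma0 ->
    B sigma s (ckE * n.+1%:R * K * ga R n * (ckC / (sigma0 - sigma)) ^+ n / (sigma0 - sigma)) (Dx (fun x => ck n x k)) /\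
    forall x, cdiff (fun y => ck n y k) x (Dx (fun y => ck n y k) x).
Proof.
move=> hB sigma /andP[sg0 sg1]; set tau := sigma0 - sigma.
have t0 : 0 < tau by rewrite subr_gt0.
have n0 : 0 < n.+1%:R :> R by []. have n1 : 0 < n.+2%:R :> R by [].
(* Splitting off the fraction 1 / (n + 2) of the remaining radius: the derivative costs (n + 2) /
   tau, and the n-th power of the inverse radius grows only by (1 + 1 / (n + 1))^n <= e. *)
pose sg' := sigma + tau / n.+2%:R.
have lt1 : sigma < sg' by rewrite ltrDl divr_gt0.
have E1 : sigma0 - sg' = tau * n.+1%:R / n.+2%:R.
  rewrite /sg' opprD addrA -/tau -[n.+2%:R]natr1; move: (n.+1%:R : R) n0 => y y0; field.
  by rewrite gt_eqF//; lra.
have lt2 : sg' < sigma0 by rewrite -subr_gt0 E1 divr_gt0// mulr_gt0.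
have [|hD hd] := B_deriv sg0 lt1 s2 (hB sg' _); first by rewrite lt2 (le_trans sg0 (ltW lt1)).
split=> //; apply: B_le hD => //.
rewrite E1 (_ : sg' - sigma = tau / n.+2%:R); last by rewrite /sg' addrC addKr.
have -> : ckC / (tau * n.+1%:R / n.+2%:R) = (ckC / tau) * (n.+2%:R / n.+1%:R).
  by field; rewrite !gt_eqF.
have hexp : (n.+2%:R / n.+1%:R) ^+ n <= expR 1 :> R.
  have -> : n.+2%:R / n.+1%:R = 1 + n.+1%:R^-1 :> R by rewrite -[n.+2%:R]natr1 mulrDl divff ?gt_eqF// mul1r.
  apply: (@le_trans _ _ (expR n.+1%:R^-1 ^+ n)).
    by apply: lerXn2r; rewrite ?nnegrE ?addr_ge0 ?expR_ge0// expR_ge1Dx.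
  by rewrite -expRM_natl ler_expR ler_pdivrMr// mul1r ler_nat.
have h2 : n.+2%:R <= 2 * n.+1%:R :> R by rewrite -natrM ler_nat mul2n -addnn addSn addnS !ltnS leq_addl.
rewrite exprMn; set X := (ckC / tau) ^+ n.
have X0 : 0 <= X by rewrite exprn_ge0// divr_ge0 ?(ltW t0)// ltW// ckC_gt0.
rewrite (_ : K * ga R n * (X * (n.+2%:R / n.+1%:R) ^+ n) / (tau / n.+2%:R) = (K * ga R n * X / tau) * ((n.+2%:R / n.+1%:R) ^+ n * n.+2%:R)); last first.
  by field; rewrite !gt_eqF.
rewrite (_ : ckE * n.+1%:R * K * ga R n * X / tau = (K * ga R n * X / tau) * (expR 1 * (2 * n.+1%:R))); last by rewrite /ckE; ring.
apply: ler_wpM2l; last by apply: ler_pM; rewrite ?exprn_ge0 ?divr_ge0.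
by rewrite !mulr_ge0 ?invr_ge0 ?(ltW t0) ?ga_ge0// ltW.
Qed.

(** Induction over all earlier orders: differentiation costs (n + 1) / (sigma0 - sigma); the
    numerator is cancelled by the 1 / (n + 1) of the recursion, and the denominator raises the power
    of 1 / (sigma0 - sigma) by one. *)
Lemma ck_bound n k sigma : 0 <= sigma < sigma0 ->
  B sigma s (K * ga R n * (ckC / (sigma0 - sigma)) ^+ n) (fun x => ck n x k).
Proof.
elim/ltn_ind: n k sigma => -[|n] ih k sigma hs.
  rewrite expr0 mulr1 /ga expr1n invr1 mulr1; have /andP[s0 s1] := hs.
  by apply: B_le (hu0 k) => //; exact: ltW.
have /andP[s0 s1] := hs; set x := ckC / (sigma0 - sigma); set tau := sigma0 - sigma in x *.
have t0 : 0 < tau by rewrite subr_gt0.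
have x0 : 0 < x by rewrite divr_gt0// ckC_gt0.
have cP0 := cP_ge0 s s : 0 <= cP s s :> R.
pose be m : R := ga R m * x ^+ m / 8; pose gg m : R := ga R m * x ^+ m.
have gg0 m : 0 <= gg m by rewrite mulr_ge0 ?ga_ge0// exprn_ge0// ltW.
have hc m : conv_dom be gg m by apply: ga_conv_dom; exact: ltW.
pose L := ckE * n.+1%:R * K / tau.
have L0 : 0 <= L by rewrite divr_ge0 ?(ltW t0)// !mulr_ge0// ltW// ckE_gt0.
have h l : B sigma s (Mkl k l * L * gg n) (fun y => A k l (ck^~ y) (fun m => Dx (fun z => ck m z l) y) n).
  apply: (op_bound (hA k l) (S := fourier_scale s0 s2 (lexx s)) (a := ck) (f := fun m => Dx (fun z => ck m z l)) (be := be)) => //=.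
  - move=> m j mn; exists (K * ga R m * x ^+ m); last by apply: ih.
    by rewrite /rho /be le_eqVlt; apply/orP; left; apply/eqP; field.
  - move=> m mn; have [hD _] := ck_deriv_bound (fun sg hsg => ih m mn l sg hsg) hs.
    apply: B_le hD => //; rewrite -/tau -/x /L /gg.
    rewrite (_ : ckE * m.+1%:R * K * ga R m * x ^+ m / tau = (ckE * K / tau * (ga R m * x ^+ m)) * m.+1%:R); last by ring.
    rewrite (_ : ckE * n.+1%:R * K / tau * (ga R m * x ^+ m) = (ckE * K / tau * (ga R m * x ^+ m)) * n.+1%:R); last by ring.
    apply: ler_wpM2l; last by rewrite ler_nat ltnS.
    by rewrite mulr_ge0// ?gg0// divr_ge0 ?(ltW t0)// mulr_ge0// ltW// ckE_gt0.
have hsum := sP_sum (S := fourier_scale s0 s2 (lexx s)) h.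
rewrite ckS; apply: B_le (B_scale (n.+1%:R^-1)%:C%C s0 s2 hsum) => //.
rewrite normc_real ger0_norm ?invr_ge0//.
rewrite (_ : \sum_i _ = (\sum_l Mkl k l) * (L * gg n)); last by rewrite mulr_suml; apply: eq_bigr => l _; ring.
apply: (@le_trans _ _ (n.+1%:R^-1 * (Mk * (L * gg n)))).
  by apply: ler_wpM2l; [rewrite invr_ge0|exact: ler_wpM2r (mulr_ge0 L0 (gg0 n)) _ _ (hMk k)].
rewrite (_ : n.+1%:R^-1 * _ = K * x ^+ n / tau * (ckE * Mk * ga R n)); last first.
  have n1 : n.+1%:R != 0 :> R by [].
  have tn : tau != 0 by rewrite gt_eqF.
  by rewrite /L /gg; move: (n.+1%:R : R) n1 => y y0; field; rewrite y0 tn.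
rewrite (_ : K * ga R n.+1 * x ^+ n.+1 = K * x ^+ n / tau * (ckC * ga R n.+1)); last by rewrite exprS /x; ring.
apply: ler_wpM2l; first by rewrite divr_ge0 ?(ltW t0)// mulr_ge0 ?exprn_ge0 ?(ltW x0)// ltW.
have h1 := ga_ratio R n; have h2 := ga_gt0 R n.+1.
have h3 : 0 <= ckE * Mk by rewrite mulr_ge0// ltW// ckE_gt0.
rewrite /ckC; nra.
Qed.

Definition cksol (T : R) (x : R) : Z := fun k => csum (fun n => (T ^+ n)%:C%C * ck n x k).

Definition cksol1 (T : R) (x : R) : Z := fun k => csum (fun n => (n.+1%:R * T ^+ n)%:C%C * ck n.+1 x k).

Lemma geom_le (q : R) N : 0 <= q <= 1 / 2 -> \sum_(n < N) q ^+ n <= 2.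
Proof.
move=> /andP[q0 q1]; have h : (1 - q) * \sum_(n < N) q ^+ n <= 1.
  elim: N => [|N ih]; first by rewrite big_ord0 mulr0.
  have -> : \sum_(n < N.+1) q ^+ n = 1 + q * \sum_(n < N) q ^+ n.
    by rewrite big_ord_recl expr0 mulr_sumr; congr (_ + _); apply: eq_bigr => i _; rewrite -exprS.
  by nra.
have : 0 <= \sum_(n < N) q ^+ n by apply: sumr_ge0 => n _; exact: exprn_ge0.
by nra.
Qed.

Lemma ck_term (sigma q T : R) n k : 0 <= sigma < sigma0 -> 0 <= T -> ckC * T <= q * (sigma0 - sigma) ->
  B sigma s (K * ga R n * q ^+ n) (fun x => (T ^+ n)%:C%C * ck n x k).
Proof.
move=> hs T0 hT; have /andP[s0 s1] := hs; have t0 : 0 < sigma0 - sigma by rewrite subr_gt0.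
apply: B_le (B_scale (T ^+ n)%:C%C s0 s2 (ck_bound n k hs)) => //.
rewrite normc_real ger0_norm ?exprn_ge0// mulrCA -exprMn.
apply: ler_wpM2l; first by rewrite mulr_ge0 ?ga_ge0// ltW.
have X0 : 0 <= T * (ckC / (sigma0 - sigma)) by exact: mulr_ge0 T0 (divr_ge0 (ltW ckC_gt0) (ltW t0)).
have hq : T * (ckC / (sigma0 - sigma)) <= q by rewrite mulrA ler_pdivrMr// mulrC.
by apply: lerXn2r; rewrite ?nnegrE// (le_trans X0 hq).
Qed.

Lemma sum_Kga (q : R) N : 0 <= q <= 1 -> \sum_(n < N) K * ga R n * q ^+ n <= 2 * K.
Proof.
move=> /andP[q0 q1]; rewrite mulrC; apply: le_trans (_ : \sum_(n < N) K * ga R n <= _).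
  by apply: ler_sum => n _; rewrite ler_piMr ?exprn_ile1// mulr_ge0 ?ga_ge0// ltW.
by rewrite -mulr_sumr ler_pM2l// sum_ga.
Qed.

Lemma cksol_B (sigma T : R) k : 0 <= sigma < sigma0 -> 0 <= T -> ckC * T <= sigma0 - sigma ->
  B sigma s (2 * K) (fun x => cksol T x k) /\
  forall x, ctends (fun N => \sum_(n < N) (T ^+ n)%:C%C * ck n x k) (cksol T x k).
Proof.
move=> hs T0 hT; have /andP[s0 s1] := hs.
have h n := ck_term n k hs T0 (_ : ckC * T <= 1 * (sigma0 - sigma)).
by apply: B_csum => //; [move=> n; apply: h; rewrite mul1r|move=> N; apply: sum_Kga; rewrite ler01 lexx].
Qed.

Lemma cksol0 x k : cksol 0 x k = u0 x k.
Proof.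
apply: csumE; rewrite /ctends -(cvg_shiftn 1).
rewrite (_ : [sequence _]_n = fun=> 0) => [|]; first exact: cvg_cst.
apply/funext => n /=; rewrite addn1 big_ord_recl/= expr0 mul1r big1 => [|i _].
  by rewrite addr0 subrr normc0.
by rewrite expr0n mul0r.
Qed.

Let half_sub : sigma0 - sigma0 / 2 = sigma0 / 2.
Proof. by rewrite {1}[sigma0]splitr addrK. Qed.

Let half_in : 0 <= sigma0 / 2 < sigma0.
Proof. by rewrite divr_ge0 ?ltW//= ltr_pdivrMr// ltr_pMr// ltr1n. Qed.

Let half_pos : 0 < sigma0 / 2. Proof. by rewrite divr_gt0. Qed.

Lemma c0cS_le : c0 * cS s <= cP s s.
Proof.
have c1 : 0 <= c0 * cS s by rewrite mulr_ge0 ?cS_ge0// ltW// c0_gt0.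
have p1 : 1 <= 2 `^ s :> R.
  have h0 : 0 <= (1 / 2 : R) by [].
  have := ler_powR (_ : 1 <= (2 : R)) (le_trans h0 (ltW s2)); rewrite powRr0; apply.
  by rewrite ler1n.
rewrite /cP (_ : 2 * _ * _ = (4 * 2 `^ s) * (c0 * cS s)); last by ring.
by rewrite ler_peMl//; lra.
Qed.

Lemma cksol_Dx (T : R) x k : 0 <= T -> 2 * ckC * T <= sigma0 ->
  ctends (fun N => \sum_(n < N) (T ^+ n)%:C%C * Dx (fun y => ck n y k) x) (Dx (fun y => cksol T y k) x).
Proof.
move=> T0 hT; have hs : 0 <= sigma0 / 2 < sigma0.
  by rewrite divr_ge0 ?ltW//= ltr_pdivrMr// ltr_pMr// ltr1n.
have h n : B (sigma0 / 2) s (K * ga R n * 1 ^+ n) (fun y => (T ^+ n)%:C%C * ck n y k).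
  apply: ck_term => //; rewrite mul1r half_sub ler_pdivlMr// mulrC mulrA; exact: hT.
have h1 : 0 <= (1 : R) <= 1 by rewrite ler01 lexx.
have := csum_deriv x (lexx 0) half_pos s2 h (fun N => sum_Kga N h1).
apply: ctends_ext => N; apply: eq_bigr => n _; apply: DxE; apply: cdiffZ.
by have [] := ck_deriv_bound (fun sg hsg => ck_bound n k hsg) hs.
Qed.

(* The coefficients of [M(u) u_x] are [(n+1) a_(n+1)]. *)
Lemma cksol_eq (T : R) x k : 0 <= T -> 4 * ckC * T <= sigma0 ->
  cksol1 T x k = \sum_l Phi k l (cksol T x) * Dx (fun y => cksol T y l) x.
Proof.
move=> T0 hT; set tau := sigma0 / 2.
have t0 : 0 < tau by rewrite divr_gt0.
have hT2 : ckC * T <= 1 / 2 * tau.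
  by rewrite /tau; move: hT; rewrite -mulrA; move: (ckC * T) => y; lra.
pose a m j : C := T%:C%C ^+ m * ck m x j.
pose f l m : C := T%:C%C ^+ m * Dx (fun y => ck m y l) x.
have cPK0 : 0 <= cP s s * K by rewrite mulr_ge0 ?cP_ge0// ltW.
have ha m j : normc (a m j) <= rho * (ga R m * 1 ^+ m / 8).
  have h := ck_term m j half_in T0 (q := 1 / 2); rewrite half_sub in h.
  have := B_sup x (ltW t0) s2 (h hT2); rewrite rmorphXn => /le_trans; apply.
  rewrite expr1n mulr1 (_ : rho * _ = cP s s * (K * ga R m)); last by rewrite /rho; field.
  rewrite [c0 * (cS s * _)]mulrA; apply: ler_pM; rewrite ?mulr_ge0 ?cS_ge0 ?ga_ge0 ?exprn_ge0 ?(ltW K0) ?(ltW (c0_gt0 R)) ?c0cS_le//; try lra.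
  by rewrite ler_piMr ?exprn_ile1 ?mulr_ge0 ?ga_ge0 ?(ltW K0)//; lra.
pose L := c0 * cS s * (ckE * K / tau).
have L0 : 0 <= L by rewrite !mulr_ge0 ?cS_ge0 ?invr_ge0 ?(ltW t0) ?(ltW K0) ?(ltW (c0_gt0 R)) ?(ltW ckE_gt0).
have hf l m : normc (f l m) <= L * (ga R m * 1 ^+ m).
  have [hD _] := ck_deriv_bound (fun sg hsg => ck_bound m l hsg) half_in.
  have := B_sup x (ltW t0) s2 hD; rewrite half_sub -/tau => h.
  rewrite normcM normcX normc_real ger0_norm// expr1n mulr1.
  apply: le_trans (ler_wpM2l (exprn_ge0 m T0) h) _.
  have q0 : 0 <= ckC / tau * T by exact: mulr_ge0 (divr_ge0 (ltW ckC_gt0) (ltW t0)) T0.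
  have q2 : (ckC / tau * T) ^+ m <= (1 / 2) ^+ m.
    by apply: lerXn2r; rewrite ?nnegrE// mulrAC ler_pdivrMr.
  (* The factor m + 1 of the derivative bound is absorbed by the ratio 1/2, which T <= sigma0 / (4
     ckC) provides at the radius sigma0 / 2. *)
  have m2 : m.+1%:R * (1 / 2) ^+ m <= 1 :> R.
    elim: m {h hD q2} => [|m ih]; first by rewrite mul1r expr0.
    rewrite exprS -natr1; have : 1 <= m.+1%:R :> R by rewrite ler1n.
    have : 0 <= (1 / 2 : R) ^+ m by apply: exprn_ge0; lra.
    by nra.
  rewrite (_ : T ^+ m * _ = L * ga R m * (m.+1%:R * (ckC / tau * T) ^+ m)); last by rewrite [(ckC / tau * T) ^+ m]exprMn /L; ring.
  apply: ler_piMr; first by exact: mulr_ge0 L0 (ga_ge0 _ _).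
  by apply: le_trans m2; apply: ler_wpM2l.
have hc n : conv_dom (fun m => ga R m * 1 ^+ m / 8) (fun m => ga R m * 1 ^+ m) n by apply: ga_conv_dom.
have sga N : \sum_(m < N) ga R m * 1 ^+ m <= 2.
  by under eq_bigr do rewrite expr1n mulr1; exact: sum_ga.
have sbe N : \sum_(m < N) ga R m * 1 ^+ m / 8 <= 1.
  by rewrite -mulr_suml ler_pdivrMr// mul1r; apply: le_trans (sga N) _; lra.
have gg0 m : 0 <= ga R m * 1 ^+ m by rewrite expr1n mulr1 ga_ge0.
have hE l := op_eval (hA k l) L0 gg0 ha (hf l) hc sbe sga.
have Ef l : csum (f l) = Dx (fun y => cksol T y l) x.
  apply: csumE; have := cksol_Dx x l T0 _; rewrite /f; under eq_fun do under eq_bigr do rewrite rmorphXn; apply.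
  by apply: le_trans hT; rewrite -!mulrA; move: (ckC * T) (mulr_ge0 (ltW ckC_gt0) T0) => y y0; lra.
have Ea : (fun j => csum (fun m => a m j)) = cksol T x.
  by apply/funext => j; congr csum; apply/funext => m; rewrite /a rmorphXn.
have cs := ctends_sum (index_enum 'I_d) hE.
rewrite /cksol1; apply: csumE; rewrite Ea in cs.
under eq_bigr => l _ do rewrite -Ef.
apply: ctends_ext cs => N; rewrite exchange_big/=; apply: eq_bigr => n _.
(* Homogeneity [op_hom] extracts T^n, and n + 1 cancels against the recursion. *)
rewrite ckS /ck_next mulrA -rmorphM mulrAC divff// mul1r mulr_sumr; apply: eq_bigr => l _.
by rewrite (op_hom (hA k l)) rmorphXn.
Qed.

(** Induction on n after multiplying by T + h. The quadratic growth in n is affordable because the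
    weights [ga] cancel it in [cksol_taylor]. *)
Lemma taylor_coef (T h Y : R) n : 0 <= T <= Y -> 0 <= T + h <= Y ->
  `|(T + h) ^+ n.+2 - T ^+ n.+2 - h * (n.+2%:R * T ^+ n.+1)| <= n.+2%:R ^+ 2 * h ^+ 2 * Y ^+ n.
Proof.
move=> /andP[T0 TY] /andP[Th0 ThY]; have Y0 : 0 <= Y by exact: le_trans TY.
have P1 m : T ^+ m <= Y ^+ m by apply: lerXn2r; rewrite ?nnegrE.
elim: n => [|n ih].
  rewrite (_ : _ - _ = h ^+ 2); last by ring.
  rewrite ger0_norm ?sqr_ge0// expr0 mulr1 ler_peMl ?sqr_ge0//; lra.
set c := (_ - _ - _) in ih.
rewrite (_ : _ - _ - _ = (T + h) * c + n.+2%:R * T ^+ n.+1 * h ^+ 2); last first.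
  rewrite /c [(T + h) ^+ n.+3]exprS [T ^+ n.+3]exprS [T ^+ n.+2]exprS -[n.+3%:R]natr1.
  by move: ((T + h) ^+ n.+2) (T ^+ n.+1) (n.+2%:R) => p q r; ring.
apply: le_trans (ler_normD _ _) _; rewrite normrM ger0_norm//.
rewrite [`|_ * h ^+ 2|]ger0_norm; last by exact: mulr_ge0 (mulr_ge0 (ler0n _ _) (exprn_ge0 _ T0)) (sqr_ge0 _).
apply: (@le_trans _ _ (Y * (n.+2%:R ^+ 2 * h ^+ 2 * Y ^+ n) + n.+2%:R * Y ^+ n.+1 * h ^+ 2)).
  apply: lerD; first by apply: ler_pM.
  by apply: ler_wpM2r; [exact: sqr_ge0|apply: ler_wpM2l].
rewrite (_ : _ + _ = (n.+2%:R ^+ 2 + n.+2%:R) * (h ^+ 2 * Y ^+ n.+1)); last by rewrite [Y ^+ n.+1]exprS; ring.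
rewrite -mulrA; apply: ler_wpM2r; first by rewrite mulr_ge0 ?sqr_ge0 ?exprn_ge0.
rewrite -[n.+3%:R]natr1; have : 0 <= n.+2%:R :> R by []. by nra.
Qed.

(** The remainder has the coefficients [c n], of size (n + 1)^2 (h / Y)^2 Y^n; (n + 1)^2 cancels
    [ga n] and a geometric series of ratio 1/2 remains. The bound holds in the weighted space, as
    the energy estimate requires. *)
Lemma cksol_taylor (sigma T h Y : R) k : 0 <= sigma < sigma0 -> 0 <= T <= Y -> 0 <= T + h <= Y -> 0 < Y ->
  2 * ckC * Y <= sigma0 - sigma ->
  B sigma s (2 * (K * (h ^+ 2 / Y ^+ 2))) (fun x => cksol (T + h) x k - cksol T x k - h%:C%C * cksol1 T x k).
Proof.
move=> hs hTY hThY Y0 hY; have /andP[s0 s1] := hs; have t0 : 0 < sigma0 - sigma by rewrite subr_gt0.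
have qY : Y * (ckC / (sigma0 - sigma)) <= 1 / 2.
  rewrite mulrA ler_pdivrMr//; move: hY; rewrite -mulrA [Y * _]mulrC; move: (ckC * Y) => y; lra.
(* The term of index n + 1 meets the n-th term of [cksol1]; hence the shift [ctends_pred] at the
   end, and c 0 = 0. *)
pose c n : R := if n is m.+1 then (T + h) ^+ n - T ^+ n - h * (n%:R * T ^+ m) else 0.
have cY n : `|c n| <= n.+1%:R ^+ 2 * (h ^+ 2 / Y ^+ 2) * Y ^+ n.
  have E0 : 0 <= n.+1%:R ^+ 2 * (h ^+ 2 / Y ^+ 2) * Y ^+ n.
    by exact: mulr_ge0 (mulr_ge0 (sqr_ge0 _) (divr_ge0 (sqr_ge0 _) (sqr_ge0 _))) (exprn_ge0 _ (ltW Y0)).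
  case: n E0 => [|[|n]] E0; rewrite /c.
  - by rewrite normr0.
  - by rewrite expr0 !expr1 mulr1 mulr1 (_ : _ - _ = 0) ?normr0//; ring.
  apply: le_trans (taylor_coef n hTY hThY) _.
  rewrite (_ : n.+3%:R ^+ 2 * _ * _ = n.+3%:R ^+ 2 * h ^+ 2 * Y ^+ n); last first.
    by rewrite !exprS; field; rewrite gt_eqF.
  apply: ler_wpM2r; first by rewrite exprn_ge0// ltW.
  by apply: ler_wpM2r; [exact: sqr_ge0|apply: lerXn2r; rewrite ?nnegrE// ler_nat].
have hB n : B sigma s (K * (h ^+ 2 / Y ^+ 2) * (1 / 2) ^+ n) (fun x => (c n)%:C%C * ck n x k).
  apply: B_le (B_scale (c n)%:C%C s0 s2 (ck_bound n k hs)) => //.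
  have X0 : 0 <= ckC / (sigma0 - sigma) by rewrite divr_ge0// ltW// ckC_gt0.
  rewrite normc_real; apply: le_trans (ler_wpM2r _ (cY n)) _.
    by rewrite !mulr_ge0 ?ga_ge0 ?exprn_ge0 ?(ltW K0).
  rewrite (_ : _ * _ * _ * _ = (n.+1%:R ^+ 2 * ga R n) * (K * (h ^+ 2 / Y ^+ 2)) * (Y * (ckC / (sigma0 - sigma))) ^+ n); last by rewrite [(Y * _) ^+ n]exprMn; ring.
  rewrite /ga divff ?mul1r ?expf_neq0//; apply: ler_wpM2l.
    by exact: mulr_ge0 (ltW K0) (divr_ge0 (sqr_ge0 _) (sqr_ge0 _)).
  have Z0 := mulr_ge0 (ltW Y0) X0.
  by apply: lerXn2r; rewrite ?nnegrE// -[2^-1]mul1r; exact: qY.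
have sumK N : \sum_(n < N) K * (h ^+ 2 / Y ^+ 2) * (1 / 2) ^+ n <= 2 * (K * (h ^+ 2 / Y ^+ 2)).
  rewrite -mulr_sumr mulrC; apply: ler_wpM2r.
    by exact: mulr_ge0 (ltW K0) (divr_ge0 (sqr_ge0 _) (sqr_ge0 _)).
  by apply: geom_le; apply/andP; split; lra.
have [hR cR] := B_csum s0 s2 hB sumK.
apply: B_ext hR => x; apply: csumE.
have /andP[T0 TY] := hTY; have /andP[Th0 ThY] := hThY.
have cl t : 0 <= t -> t <= Y -> ckC * t <= sigma0 - sigma.
  move=> t1 tY; apply: le_trans hY; rewrite -mulrA; have := ler_wpM2l (ltW ckC_gt0) tY.
  by have := mulr_ge0 (ltW ckC_gt0) (ltW Y0); move: (ckC * Y) (ckC * t) => y z; lra.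
have [_ c1] := cksol_B k hs Th0 (cl _ Th0 ThY). have [_ c2] := cksol_B k hs T0 (cl _ T0 TY).
have hs1 : ctends (fun N => \sum_(n < N) (n.+1%:R * T ^+ n)%:C%C * ck n.+1 x k) (cksol1 T x k).
  pose W := c0 * (cS s * (K * (2 / Y))).
  apply: (@csum_cvg _ _ (fun n => W * (1 / 2) ^+ n) (2 * W)) => [n|N]; last first.
    rewrite -mulr_sumr mulrC; apply: ler_wpM2r.
      by exact: mulr_ge0 (ltW (c0_gt0 R)) (mulr_ge0 (cS_ge0 s) (mulr_ge0 (ltW K0) (divr_ge0 (ler0n _ _) (ltW Y0)))).
    by apply: geom_le; apply/andP; split; lra.
  have := B_sup x s0 s2 (ck_bound n.+1 k hs).
  rewrite normcM normc_real ger0_norm ?mulr_ge0 ?exprn_ge0// => hck.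
  apply: le_trans (ler_wpM2l _ hck) _; first by rewrite mulr_ge0 ?exprn_ge0.
  set q := ckC / (sigma0 - sigma).
  have q0 : 0 <= q by rewrite divr_ge0// ltW// ckC_gt0.
  rewrite [leLHS](_ : _ = (c0 * (cS s * K)) * ((n.+1%:R * ga R n.+1) * (q * (T * q) ^+ n))); last first.
    by rewrite [(T * q) ^+ n]exprMn [q ^+ n.+1]exprS; ring.
  rewrite /W [leRHS](_ : _ = (c0 * (cS s * K)) * (1 * (2 / Y * (1 / 2) ^+ n))); last by ring.
  apply: ler_wpM2l; first by exact: mulr_ge0 (ltW (c0_gt0 R)) (mulr_ge0 (cS_ge0 s) (ltW K0)).
  have Tq : 0 <= T * q by exact: mulr_ge0.
  apply: ler_pM; [exact: mulr_ge0 (ler0n _ _) (ga_ge0 _ _)|exact: mulr_ge0 q0 (exprn_ge0 _ Tq)| |].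
    rewrite /ga ler_pdivrMr ?exprn_gt0// mul1r -natrX ler_nat.
    by apply: leq_trans (leqnSn _) _; rewrite -{1}[n.+2]expn1 leq_exp2l.
  apply: ler_pM => //; first exact: exprn_ge0.
    rewrite ler_pdivlMr// mulrC; apply: le_trans qY _; lra.
  apply: lerXn2r; rewrite ?nnegrE//; last by apply: le_trans qY; apply: ler_wpM2r.
have := ctendsD (ctendsD (c1 x) (ctendsZ (-1) (c2 x))) (ctendsZ (- h%:C%C) (ctends_pred hs1)).
rewrite mulN1r mulNr; apply: ctends_ext => N.
case: N => [|N]; first by rewrite !big_ord0 !mulr0 !addr0.
have G (a b e t : R) (z : C) : (a - b - t * e)%:C%C * z = a%:C%C * z + -1 * (b%:C%C * z) + - t%:C%C * (e%:C%C * z).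
  by rewrite !rmorphB rmorphM; ring.
have E (i : 'I_N) : (c (lift ord0 i))%:C%C * ck (lift ord0 i) x k =
    ((T + h) ^+ (lift ord0 i))%:C%C * ck (lift ord0 i) x k + -1 * ((T ^+ (lift ord0 i))%:C%C * ck (lift ord0 i) x k)
    + - h%:C%C * ((i.+1%:R * T ^+ i)%:C%C * ck i.+1 x k).
  exact: G.
rewrite [RHS]big_ord_recl (eq_bigr _ (fun i _ => E i)) !big_split/= -!mulr_sumr.
rewrite !big_ord_recl/= !expr0.
move: (\sum_(i < N) _) (\sum_(i < N) _) (\sum_(i < N) _) (ck 0 x k) h%:C%C => a b e g f.
by rewrite mul0r add0r mul1r; ring.
Qed.

End formal_solution.

(** * The energy inequality *)

Section composition.
Variables (R : realType) (d : nat).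
Local Notation C := R[i].
Local Notation Z := ('I_d -> C).

(** Induction on [PS]: each variable acts as a multiplier of norm rho, which the constant of
    [PS_var] already contains; the limit of a sum is identified pointwise. *)
Lemma PS_comp (rho K L : R) Phi X (S : scale R X) (u : X -> Z) f : 0 <= rho -> PS rho K Phi ->
  (forall k, sU S rho (fun x => u x k)) -> (forall x k, normc (u x k) <= rho) -> 0 <= L -> sP S L f ->
  sP S (K * L) (fun x => Phi (u x) * f x).
Proof.
move=> r0 hPS hu hur L0 hf; elim: hPS => {K Phi} [K c cK|K Phi j hPS ih|K_ Phi_ K Phi hPS ih hK hPhi].
- by apply: sP_le (sP_scale c hf); apply: ler_wpM2r.
- by rewrite -mulrA; apply: sP_ext (sP_mul (hu j) ih) => x; rewrite mulrA.
- have [|g hg cg] := sP_series (K := K * L) ih; first by move=> N; rewrite -mulr_suml ler_wpM2r.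
  apply: sP_ext hg => x; apply: ctends_unique (cg x) _.
  have := ctendsZ (f x) (hPhi (u x) (hur x)); rewrite mulrC; apply: ctends_ext => N.
  by rewrite mulrC mulr_suml.
Qed.

(** Cauchy's estimate without derivatives: in u_j (Phi(u) - Phi(v)) + (u_j - v_j) Phi(v) each term
    contributes K D, and the doubled radius provides exactly this 2. *)
Lemma PS_lip (rho K D : R) Phi X (S : scale R X) (u v : X -> Z) f : 0 < rho -> PS (2 * rho) K Phi ->
  (forall k, sU S rho (fun x => u x k)) -> (forall k, sU S (2 * rho) (fun x => v x k)) ->
  (forall x k, normc (u x k) <= rho) -> (forall x k, normc (v x k) <= rho) ->
  0 <= D -> (forall k, sP S D (fun x => (u x k - v x k) * f x)) ->
  sP S (K / rho * D) (fun x => (Phi (u x) - Phi (v x)) * f x).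
Proof.
move=> r0 hPS hu hv hur hvr D0 hf; have r20 : 0 <= 2 * rho by rewrite mulr_ge0// ltW.
have rn : rho != 0 by rewrite gt_eqF.
have hvr2 x k : normc (v x k) <= 2 * rho by apply: le_trans (hvr x k) _; rewrite ler_peMl// ?ltW// ltr1n.
have hur2 x k : normc (u x k) <= 2 * rho by apply: le_trans (hur x k) _; rewrite ler_peMl// ?ltW// ltr1n.
elim: hPS => {K Phi} [K c cK|K Phi j hPS ih|K_ Phi_ K Phi hPS ih hK hPhi].
- apply: sP_le (sP_ext (f := fun=> 0) _ (sP0 S)) => [|x]; last by rewrite subrr mul0r.
  by rewrite mulr_ge0// divr_ge0 ?(ltW r0)//; apply: le_trans cK; exact: normc_ge0.
- have h1 := sP_mul (hu j) ih; have h2 := PS_comp r20 hPS hv hvr2 D0 (hf j).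
  apply: sP_le (sP_ext _ (sP_add h1 h2)) => [|x]; last by ring.
  by rewrite le_eqVlt; apply/orP; left; apply/eqP; field.
- have [|g hg cg] := sP_series (K := K / rho * D) ih.
    by move=> N; rewrite -!mulr_suml ler_wpM2r// ler_wpM2r// invr_ge0 ltW.
  apply: sP_ext hg => x; apply: ctends_unique (cg x) _.
  have := ctendsZ (f x) (ctendsD (hPhi (u x) (hur2 x)) (ctendsZ (-1) (hPhi (v x) (hvr2 x)))).
  rewrite mulrC mulN1r; apply: ctends_ext => N.
  by rewrite mulN1r -sumrB mulrC mulr_suml.
Qed.

End composition.

Section representative.
Variable R : realType.
Local Notation C := R[i].
Local Notation mu := (@lebesgue_measure R).
Local Notation cinteg := (cintegrable mu setT).
Local Notation cmeasR := (@cmeas _ (measurableTypeR R) R setT).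

(** Names the transform [g], which [B] hides; it is unique almost everywhere, so that energies can
    be computed with any choice. *)
Definition FB (f : R -> C) (g : R -> C) := [/\ cinteg g, L2f g & forall x, f x = IF g x].

Lemma FB_cmeas f g : FB f g -> cmeasR g. Proof. by case=> -[]. Qed.

Lemma FB_unique f g g' : FB f g -> FB f g' -> {ae mu, forall x, g x = g' x}.
Proof.
move=> [i1 l1 e1] [i2 l2 e2]; have h := isF_IF i1 l1; have h' := isF_IF i2 l2.
have e : IF g = IF g' by apply/funext => x; rewrite -e1 e2.
by apply: isF_unique h _ (L2f_IF i1 l1); rewrite e.
Qed.

Lemma FB_B rho p K f : 0 <= rho -> 1 / 2 < p -> B rho p K f ->
  exists2 g, FB f g & L2le mu K (fun xi => wt rho p xi * normc (g xi)).
Proof.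
move=> r0 p2 [K0 [g [mg gK gE]]]; exists g => //.
by have [] := wt_integ p2 r0 K0 mg gK; split.
Qed.

Lemma FB_add f g f' g' : FB f g -> FB f' g' -> FB (fun x => f x + f' x) (fun xi => g xi + g' xi).
Proof.
move=> [i1 l1 e1] [i2 l2 e2]; split.
- exact: (cintegrableD measurableT).
- have [m1 [K1 K10 h1]] := l1; have [m2 [K2 K20 h2]] := l2; split; first exact: cmeasD.
  exists (K1 + K2); first exact: addr_ge0.
  apply: L2le_le (L2leD K10 K20 h1 h2); first by apply: measurable_normc; exact: cmeasD.
  by move=> x; rewrite ger0_norm ?normc_ge0// le_normcD.
- by move=> x; rewrite IFD// e1 e2.
Qed.

Lemma FB_scale (c : C) f g : FB f g -> FB (fun x => c * f x) (fun xi => c * g xi).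
Proof.
move=> [i1 l1 e1]; split.
- exact: (cintegrableZ measurableT).
- have [m1 [K1 K10 h1]] := l1; split; first exact: cmeasZ.
  exists (normc c * K1); first by rewrite mulr_ge0 ?normc_ge0.
  have := L2leZ (normc c) h1; rewrite ger0_norm ?normc_ge0//.
  by apply: L2le_ext => x; rewrite normcM.
- by move=> x; rewrite IFZ// e1.
Qed.

Lemma FB_ext f f' g : (forall x, f x = f' x) -> FB f g -> FB f' g.
Proof. by move=> /funext ->. Qed.

Lemma L2le_ae (K : R) (f h : R -> R) : measurable_fun setT h -> {ae mu, forall x, f x = h x} -> L2le mu K f -> L2le mu K h.
Proof.
move=> mh fh fK; apply: (@L2le_lim _ (measurableTypeR R) R mu (fun=> f)) => //.
by apply: ae_mono fh => x <-; exact: cvg_cst.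
Qed.

Lemma FB_norm rho p K f g : 0 <= rho -> 1 / 2 < p -> B rho p K f -> FB f g ->
  L2le mu K (fun xi => wt rho p xi * normc (g xi)).
Proof.
move=> r0 p2 hB hg; have [g' hg' gK] := FB_B r0 p2 hB.
apply: L2le_ae gK; first by apply: measurable_wtM; exact: FB_cmeas hg.
by apply: ae_mono (FB_unique hg' hg) => x ->.
Qed.

Lemma B_FB rho p K f g : 0 <= K -> FB f g -> L2le mu K (fun xi => wt rho p xi * normc (g xi)) -> B rho p K f.
Proof. by move=> K0 hg gK; split=> //; exists g; split=> //; [exact: FB_cmeas hg|case: hg]. Qed.

Lemma FB_deriv rho p K f g : 0 < rho -> 1 / 2 < p -> B rho p K f -> FB f g -> FB (Dx f) (imul g).
Proof.
move=> rp p2 hB hg; have K0 := B_ge0 hB; have mg := FB_cmeas hg; have [_ _ gE] := hg.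
have gK := FB_norm (ltW rp) p2 hB hg.
have i2 := wt_kk2_integ rp p2 K0 mg gK.
have dE x : cdiff f x (IF (imul g) x).
  by have := @cdiff_IF R g x i2 mg; rewrite (_ : IF g = f)//; apply/funext => y; rewrite gE.
have Kr : 0 <= K / (rho - 0) by rewrite subr0 divr_ge0// ltW.
have [i l] := wt_integ p2 (lexx 0) Kr (cmeas_imul mg) (L2le_imul rp mg gK).
by split=> // x; rewrite (DxE (dE x)).
Qed.

End representative.

(** [energy_pointwise] multiplied by the squared weight and rearranged into the integrands of
    [gint]; stated for plain reals, where it is linear in the monomials. *)
Lemma energy_alg (R : realType) (E w a b c e k ki k2 qh hq h2 q2 hh : R) :
  w ^+ 2 * (E ^+ 2 * a ^+ 2 + qh * (k * b ^+ 2)) <=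
    w ^+ 2 * (b ^+ 2 + hq * (c ^+ 2 * ki) + (h2 * (q2 * (k2 * b ^+ 2) + b ^+ 2 + 2 * c ^+ 2) + hh * e ^+ 2)) ->
  1 * (E * w * a) ^+ 2 + qh * (k * (w * b) ^+ 2) <= 1 * (w * b) ^+ 2 + hq * (ki * (w * c) ^+ 2) +
    (h2 * (q2 * (k2 * (w * b) ^+ 2) + 1 * (w * b) ^+ 2 + 2 * (1 * (w * c) ^+ 2)) + hh * (1 * (w * e) ^+ 2)).
Proof. by rewrite !mul1r !exprMn; lra. Qed.

Section energy.
Variable R : realType.
Local Notation C := R[i].
Local Notation mu := (@lebesgue_measure R).

(** The difference vanishes at 0 and its derivative is 2 (e^{-2t} - 1 + 2t) >= 0. *)
Lemma expR_quadratic (x : R) : 0 <= x -> expR (- (2 * x)) <= 1 - 2 * x + 2 * x ^+ 2.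
Proof.
move=> x0; pose f (t : R) := 1 - 2 * t + 2 * t ^+ 2 - expR (- (2 * t)).
pose f' (t : R) := - 2 + 4 * t + 2 * expR (- (2 * t)).
have df (t : R) : is_derive t 1 f (f' t).
  rewrite /f; apply: is_derive_eq; rewrite /f' /GRing.scale/=; ring.
have f'0 (t : R) : 0 <= f' t.
  by rewrite /f'; have := expR_ge1Dx (- (2 * t)); lra.
have f00 : f 0 = 0 by rewrite /f !mulr0 oppr0 expR0 expr0n/= mulr0 !addr0 subrr.
suff : 0 <= f x - f 0 by rewrite f00 subr0 /f subr_ge0.
move: x0; rewrite le_eqVlt => /orP[/eqP <-|x0]; first by rewrite subrr.
have cf : {within `[0, x], continuous f}.
  by apply: continuous_subspaceT => t; apply/differentiable_continuous/derivable1_diffP; have [] := df t.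
by have [c _ ->] := MVT x0 (fun t _ => df t) cf; rewrite subr0 mulr_ge0// ltW.
Qed.

(* One step of length [h]; the loss [q h k |g|^2] due to the shrinking weight absorbs the half
   derivative lost in [F]. *)
Lemma energy_pointwise (q h k : R) (g F r : C) : 0 < q -> 0 < h -> 1 <= k ->
  expR (- (q * h * k)) ^+ 2 * normc (g + h%:C%C * F + r) ^+ 2 + q * h * (k * normc g ^+ 2) <=
  normc g ^+ 2 + (h / q) * (normc F ^+ 2 / k) +
  (h ^+ 2 * (2 * q ^+ 2 * (k ^+ 2 * normc g ^+ 2) + normc g ^+ 2 + 2 * normc F ^+ 2) + (2 + h ^- 2) * normc r ^+ 2).
Proof.
move=> q0 h0 k1; have k0 : 0 < k by exact: lt_le_trans k1.
set a := normc g; set b := normc F; set c := normc r.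
have a0 : 0 <= a := normc_ge0 _. have b0 : 0 <= b := normc_ge0 _. have c0 : 0 <= c := normc_ge0 _.
pose x := q * h * k; have x0 : 0 <= x by rewrite !mulr_ge0// ltW.
have -> : expR (- (q * h * k)) ^+ 2 = expR (- (2 * x)).
  by rewrite -expRM_natl /x; congr expR; ring.
set E := expR _; have E1 : E <= 1 - 2 * x + 2 * x ^+ 2 by exact: expR_quadratic.
have E2 : E <= 1 by rewrite -expR0 ler_expR oppr_le0 mulr_ge0.
have E0 : 0 <= E := expR_ge0 _.
have S : normc (g + h%:C%C * F + r) ^+ 2 <= a ^+ 2 + 2 * (a * (h * b + c)) + (h * b + c) ^+ 2.
  rewrite (_ : _ + _ + _ = (a + (h * b + c)) ^+ 2); last by ring.
  apply: lerXn2r; rewrite ?nnegrE ?normc_ge0 ?addr_ge0 ?mulr_ge0 ?(ltW h0)//.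
  rewrite -[g + _ + r]addrA; apply: le_trans (le_normcD _ _) _; rewrite lerD2l.
  by apply: le_trans (le_normcD _ _) _; rewrite normcM normc_real gtr0_norm.
have m0 : 0 <= a * (h * b + c) by rewrite mulr_ge0 ?addr_ge0 ?mulr_ge0 ?(ltW h0).
have P1 : E * normc (g + h%:C%C * F + r) ^+ 2 <= (1 - 2 * x + 2 * x ^+ 2) * a ^+ 2 + 2 * (a * (h * b + c)) + (h * b + c) ^+ 2.
  apply: le_trans (ler_wpM2l E0 S) _; rewrite !mulrDr; apply: lerD; last first.
    by rewrite ler_piMl ?sqr_ge0.
  apply: lerD; first by apply: ler_wpM2r; rewrite ?sqr_ge0.
  by rewrite -mulrDr -mulrDr ler_piMl// mulr_ge0// -mulrDr.
(* The shrinking weight gains 2 x a^2; half of it, q h k a^2, pays here for the cross term 2 h a b,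
   the other half stays on the left. *)
have Q1 : 2 * (a * (h * b)) <= q * h * (k * a ^+ 2) + (h / q) * (b ^+ 2 / k).
  rewrite -subr_ge0 (_ : _ - _ = (h / (q * k)) * (q * k * a - b) ^+ 2); last by field; rewrite !gt_eqF.
  by rewrite mulr_ge0 ?sqr_ge0// divr_ge0 ?mulr_ge0 ?ltW.
(* The remainder [r] will be O(h^2), so this splitting costs O(h^2) as well. *)
have Q2 : 2 * (a * c) <= h ^+ 2 * a ^+ 2 + h ^- 2 * c ^+ 2.
  rewrite -subr_ge0 (_ : _ - _ = (h * a - c / h) ^+ 2); last by field; rewrite gt_eqF.
  exact: sqr_ge0.
have Q3 : (h * b + c) ^+ 2 <= 2 * (h ^+ 2 * b ^+ 2) + 2 * c ^+ 2.
  rewrite -subr_ge0 (_ : _ - _ = (h * b - c) ^+ 2); last by ring.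
  exact: sqr_ge0.
have -> : h ^+ 2 * (2 * q ^+ 2 * (k ^+ 2 * a ^+ 2) + a ^+ 2 + 2 * b ^+ 2) + (2 + h ^- 2) * c ^+ 2 =
   2 * x ^+ 2 * a ^+ 2 + h ^+ 2 * a ^+ 2 + 2 * (h ^+ 2 * b ^+ 2) + 2 * c ^+ 2 + h ^- 2 * c ^+ 2.
  by rewrite /x; ring.
have -> : q * h * (k * a ^+ 2) = x * a ^+ 2 by rewrite /x; ring.
rewrite (_ : q * h * (k * a ^+ 2) = x * a ^+ 2) in Q1; last by rewrite /x; ring.
have P2 : a * (h * b + c) = a * (h * b) + a * c by exact: mulrDr.
by rewrite P2 in P1; lra.
Qed.

Variable s : R.
Hypothesis s1 : 1 / 2 <= s.
Local Notation gw := (gevrey_weight s).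

Definition om (xi : R) : R := Num.sqrt (1 + `|xi| `^ (2 * s)).

Lemma gwE sigma xi : gw sigma xi = expR (sigma * kk xi) * om xi.
Proof. by rewrite /gevrey_weight /kk addrC. Qed.

Lemma gw_ge0 sigma xi : 0 <= gw sigma xi.
Proof. by rewrite mulr_ge0 ?expR_ge0 ?sqrtr_ge0. Qed.

Lemma powR_half (y : R) : 0 <= y -> Num.sqrt (y `^ (2 * s)) = y `^ s.
Proof. by move=> y0; rewrite mulrC powRrM powR_mulrn ?powR_ge0// sqrtr_sqr ger0_norm ?powR_ge0. Qed.

(** 1 + |xi|^(2s) <= (1 + |xi|) kk^(2s - 1), since 2s - 1 >= 0. *)
Lemma gw_le sigma xi : gw sigma xi <= wt sigma s xi.
Proof.
rewrite gwE /wt; apply: ler_wpM2l; first exact: expR_ge0.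
rewrite -powR_half; last by exact: le_trans ler01 (kk_ge1 xi).
apply: ler_wsqrtr; have k1 := kk_ge1 xi; have k0 : 0 < kk xi by exact: lt_le_trans k1.
have e : 2 * s = 1 + (2 * s - 1) by ring.
have s0 : 0 <= 2 * s - 1 by have := s1; lra.
have sn0 : 2 * s != 0 by rewrite gt_eqF//; have := s1; lra.
have split_pow (y : R) : 0 < y -> y `^ (2 * s) = y * y `^ (2 * s - 1).
  by move=> y0; rewrite {1}e powRD ?powRr1 ?ltW//; apply/implyP => _; rewrite gt_eqF.
have a2 : `|xi| `^ (2 * s - 1) <= kk xi `^ (2 * s - 1).
  by apply: ge0_ler_powR => //; rewrite ?nnegrE ?(ltW k0)// /kk lerDr.
have a3 : `|xi| `^ (2 * s) <= `|xi| * kk xi `^ (2 * s - 1).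
  have [x0|x0] := eqVneq `|xi| 0; first by rewrite x0 powR0// mul0r.
  have xp : 0 < `|xi| by rewrite lt_neqAle eq_sym x0 normr_ge0.
  by rewrite (split_pow _ xp); exact: ler_wpM2l (ltW xp) _ _ a2.
have a1 : 1 <= kk xi `^ (2 * s - 1) by rewrite -[leLHS](powRr0 (kk xi)) ler_powR.
rewrite (split_pow _ k0); apply: le_trans (lerD a1 a3) _.
by move: (kk xi `^ _) => p; rewrite /kk le_eqVlt; apply/orP; left; apply/eqP; ring.
Qed.

Lemma wt_le sigma xi : wt sigma s xi <= 2 `^ s * gw sigma xi.
Proof.
rewrite gwE /wt mulrCA; apply: ler_wpM2l; first exact: expR_ge0.
have s0 : 0 <= s by have := s1; lra.
have o1 : 1 <= om xi by rewrite -sqrtr1 ler_sqrt ?lerDl ?powR_ge0// addr_ge0 ?powR_ge0.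
have [x1|x1] := leP `|xi| 1.
  apply: (@le_trans _ _ (2 `^ s)); last by rewrite ler_peMr ?powR_ge0.
  apply: ge0_ler_powR => //; rewrite ?nnegrE ?(le_trans ler01 (kk_ge1 xi))// /kk; lra.
apply: (@le_trans _ _ ((2 * `|xi|) `^ s)).
  apply: ge0_ler_powR => //; rewrite ?nnegrE ?(le_trans ler01 (kk_ge1 xi)) ?mulr_ge0// /kk; lra.
rewrite powRM//; apply: ler_wpM2l; first exact: powR_ge0.
by rewrite -powR_half// ler_wsqrtr// lerDr.
Qed.

Lemma gwB sigma t xi : gw (sigma - t) xi = expR (- (t * kk xi)) * gw sigma xi.
Proof. by rewrite !gwE mulrA -expRD; congr (expR _ * _); ring. Qed.

Lemma measurable_gw sigma : measurable_fun [set: R] (gw sigma).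
Proof.
rewrite (_ : gw sigma = fun xi => wt sigma 0 xi * om xi); last first.
  by apply/funext => xi; rewrite gwE wt_expR.
apply: measurable_funM; first exact: measurable_wt.
apply: (measurableT_comp (continuous_measurable_fun (@sqrt_continuous R))); apply: measurable_funD => //.
by apply: (measurableT_comp (@measurable_powR R (2 * s))); exact: continuous_measurable_fun (@norm_continuous R R^o).
Qed.

Definition nnm (f : R -> R) := measurable_fun [set: measurableTypeR R] f /\ forall x, 0 <= f x.

Lemma nnmD f g : nnm f -> nnm g -> nnm (fun x => f x + g x).
Proof. by move=> [m1 p1] [m2 p2]; split=> [|x]; [exact: measurable_funD|exact: addr_ge0]. Qed.

Lemma nnmZ c f : 0 <= c -> nnm f -> nnm (fun x => c * f x).
Proof. by move=> c0 [m1 p1]; split=> [|x]; [exact: measurable_funM|exact: mulr_ge0]. Qed.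

Lemma nnm_intD f g : nnm f -> nnm g -> (\int[mu]_x (f x + g x)%:E = \int[mu]_x (f x)%:E + \int[mu]_x (g x)%:E)%E.
Proof. by move=> [m1 p1] [m2 p2]; exact: integral_finD. Qed.

Lemma nnm_intZ c f : 0 <= c -> nnm f -> (\int[mu]_x (c * f x)%:E = c%:E * \int[mu]_x (f x)%:E)%E.
Proof. by move=> c0 [m1 p1]; exact: integral_finZ. Qed.

Definition gint sigma (w : R -> R) (g : R -> C) : \bar R := (\int[mu]_xi (w xi * (gw sigma xi * normc (g xi)) ^+ 2)%:E)%E.

Lemma energy_component (q h sigma : R) (g F r : R -> C) : 0 < q -> 0 < h ->
  @cmeas _ (measurableTypeR R) R setT g -> @cmeas _ (measurableTypeR R) R setT F -> @cmeas _ (measurableTypeR R) R setT r ->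
  (gint (sigma - q * h) (fun=> 1%R) (fun xi => g xi + h%:C%C * F xi + r xi)%R + (q * h)%:E * gint sigma (@kk R) g <=
   gint sigma (fun=> 1%R) g + (h / q)%:E * gint sigma (fun xi => (kk xi)^-1)%R F +
   ((h ^+ 2)%:E * ((2 * q ^+ 2)%:E * gint sigma (fun xi => kk xi ^+ 2)%R g + gint sigma (fun=> 1%R) g + 2%:E * gint sigma (fun=> 1%R) F)
     + (2 + h ^- 2)%:E * gint sigma (fun=> 1%R) r))%E.
Proof.
move=> q0 h0 mg mF mr.
have mk := @measurable_kk R; have mki : measurable_fun [set: R] (fun xi : R => (kk xi)^-1).
  by apply: continuous_measurable_fun => x; apply: cvgV; [rewrite gt_eqF// kk_gt0|exact: continuous_kk].
have N sg (w : R -> R) f : measurable_fun [set: R] w -> (forall xi, 0 <= w xi) -> @cmeas _ (measurableTypeR R) R setT f ->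
    nnm (fun xi => w xi * (gw sg xi * normc (f xi)) ^+ 2).
  move=> mw w0 mf; split; last by move=> xi; rewrite mulr_ge0 ?sqr_ge0.
  apply: measurable_funM => //; apply: (measurable_funX 2).
  by apply: measurable_funM; [exact: measurable_gw|exact: measurable_normc].
have k0 (xi : R) : 0 <= kk xi := ltW (kk_gt0 xi).
have ki0 (xi : R) : 0 <= (kk xi)^-1 by rewrite invr_ge0.
have mone : measurable_fun [set: R] (fun=> 1 : R) by exact: measurable_cst.
have one0 (xi : R) : 0 <= (1 : R) by [].
have k20 (xi : R) : 0 <= kk xi ^+ 2 := sqr_ge0 _.
have mk2 : measurable_fun [set: R] (fun xi : R => kk xi ^+ 2) by exact: (measurable_funX 2).
have ml : @cmeas _ (measurableTypeR R) R setT (fun xi => g xi + h%:C%C * F xi + r xi).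
  by apply: cmeasD => //; apply: cmeasD => //; exact: cmeasZ.
have n1 := N (sigma - q * h) _ _ mone one0 ml.
have n2 := N sigma _ _ mk k0 mg; have n3 := N sigma _ _ mone one0 mg; have n4 := N sigma _ _ mki ki0 mF.
have n5 := N sigma _ _ mk2 k20 mg; have n6 := N sigma _ _ mone one0 mF; have n7 := N sigma _ _ mone one0 mr.
have qh0 : 0 <= q * h by rewrite mulr_ge0 ?ltW.
have hq0 : 0 <= h / q by rewrite divr_ge0 ?ltW.
have h20 : 0 <= h ^+ 2 := sqr_ge0 h.
have q20 : 0 <= 2 * q ^+ 2 by rewrite mulr_ge0 ?sqr_ge0.
have hh0 : 0 <= 2 + h ^- 2 by rewrite addr_ge0 ?invr_ge0.
have two0 : 0 <= 2 :> R by [].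
have n8 := nnmD (nnmD (nnmZ q20 n5) n3) (nnmZ two0 n6).
rewrite /gint -(nnm_intZ qh0 n2) -(nnm_intD n1 (nnmZ qh0 n2)) -(nnm_intZ hq0 n4) -(nnm_intD n3 (nnmZ hq0 n4)).
rewrite -(nnm_intZ q20 n5) -(nnm_intD (nnmZ q20 n5) n3) -(nnm_intZ two0 n6) -(nnm_intD (nnmD (nnmZ q20 n5) n3) (nnmZ two0 n6)).
rewrite -(nnm_intZ h20 n8) -(nnm_intZ hh0 n7) -(nnm_intD (nnmZ h20 n8) (nnmZ hh0 n7)).
rewrite -(nnm_intD (nnmD n3 (nnmZ hq0 n4)) (nnmD (nnmZ h20 n8) (nnmZ hh0 n7))).
have nL := nnmD n1 (nnmZ qh0 n2).
have nR := nnmD (nnmD n3 (nnmZ hq0 n4)) (nnmD (nnmZ h20 n8) (nnmZ hh0 n7)).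
apply: (@le_integral_fin _ (measurableTypeR R) R mu _ _ nL.1 nR.1 nL.2) => xi.
have := energy_pointwise (g xi) (F xi) (r xi) q0 h0 (kk_ge1 xi).
move=> /(ler_wpM2l (sqr_ge0 (gw sigma xi))).
rewrite (gwB sigma (q * h) xi).
exact: energy_alg.
Qed.

Lemma gint_le sigma rho p c K (w : R -> R) (g : R -> C) : (forall xi, 0 <= w xi) -> measurable_fun [set: R] w ->
  @cmeas _ (measurableTypeR R) R setT g -> (forall xi, w xi * gw sigma xi ^+ 2 <= (c * wt rho p xi) ^+ 2) ->
  L2le mu K (fun xi => wt rho p xi * normc (g xi)) -> (gint sigma w g <= ((c * K) ^+ 2)%:E)%E.
Proof.
move=> w0 mw mg h gK; have [m hK] := L2leZ c gK; rewrite exprMn real_normK ?num_real// -exprMn in hK.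
apply: le_trans hK.
have mL : measurable_fun [set: measurableTypeR R] (fun xi => w xi * (gw sigma xi * normc (g xi)) ^+ 2).
  apply: measurable_funM => //; apply: (measurable_funX 2).
  by apply: measurable_funM; [exact: measurable_gw|exact: measurable_normc].
apply: (@le_integral_fin _ (measurableTypeR R) R mu _ _ mL) => [|xi|xi].
- exact: (measurable_funX 2).
- by rewrite mulr_ge0 ?sqr_ge0.
- rewrite [c * _]mulrA [(gw _ _ * _) ^+ 2]exprMn [(c * _ * _) ^+ 2]exprMn mulrA.
  exact: ler_wpM2r (sqr_ge0 _) _ _ (h xi).
Qed.

Lemma gw_sqr sigma xi : gw sigma xi ^+ 2 <= wt sigma s xi ^+ 2.
Proof.
have g0 := gw_ge0 sigma xi; have w0 := ltW (wt_gt0 sigma s xi).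
by apply: lerXn2r; rewrite ?nnegrE//; exact: gw_le.
Qed.

Lemma wt_half sigma xi : wt sigma (s - 1 / 2) xi ^+ 2 * kk xi = wt sigma s xi ^+ 2.
Proof.
have kp := kk_gt0 xi; rewrite /wt !exprMn -mulrA; congr (_ * _).
have e (a : R) : (kk xi `^ a) ^+ 2 = kk xi `^ (a * 2) by rewrite powRrM powR_mulrn ?powR_ge0.
rewrite !e -[X in _ * X](powRr1 (ltW kp)) -powRD; last by apply/implyP => _; rewrite gt_eqF.
by congr (_ `^ _); field.
Qed.

(** The spare radius [dl] pays for a full derivative; the bound serves finiteness and the O(h^2)
    error of a step, never the main balance. *)
Lemma gint_kk_sqr sigma dl K g : 0 < dl -> @cmeas _ (measurableTypeR R) R setT g ->
  L2le mu K (fun xi => wt (sigma + dl) s xi * normc (g xi)) ->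
  (gint sigma (fun xi => kk xi ^+ 2)%R g <= ((dl^-1 * K) ^+ 2)%:E)%E.
Proof.
move=> dl0 mg; apply: gint_le => // [xi||xi]; first exact: sqr_ge0.
  by apply: (measurable_funX 2); exact: measurable_kk.
have -> : wt (sigma + dl) s xi = wt sigma s xi * wt dl 0 xi by rewrite -wtD addr0.
have A0 : 0 <= kk xi * gw sigma xi by exact: mulr_ge0 (ltW (kk_gt0 xi)) (gw_ge0 _ _).
have di0 : 0 <= dl^-1 by rewrite invr_ge0 ltW.
have B0 : 0 <= dl^-1 * (wt sigma s xi * wt dl 0 xi) by exact: mulr_ge0 di0 (mulr_ge0 (ltW (wt_gt0 _ _ _)) (ltW (wt_gt0 _ _ _))).
rewrite -exprMn; apply: lerXn2r; rewrite ?nnegrE//.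
rewrite [leRHS]mulrCA [leLHS]mulrC; apply: ler_pM; [exact: gw_ge0|exact: ltW (kk_gt0 xi)|exact: gw_le|exact: kk_le_wt].
Qed.

Lemma gint_kkV sigma K F : @cmeas _ (measurableTypeR R) R setT F ->
  L2le mu K (fun xi => wt sigma (s - 1 / 2) xi * normc (F xi)) ->
  (gint sigma (fun xi => (kk xi)^-1)%R F <= (K ^+ 2)%:E)%E.
Proof.
move=> mF h; rewrite -[K]mul1r; apply: gint_le h => // [xi||xi]; first by rewrite invr_ge0 ltW// kk_gt0.
  by apply: continuous_measurable_fun => x; apply: cvgV; [rewrite gt_eqF// kk_gt0|exact: continuous_kk].
rewrite mul1r mulrC ler_pdivrMr ?kk_gt0// wt_half; exact: gw_sqr.
Qed.

(** A derivative with half a power of [kk] less in the weight amounts to half a derivative: it is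
    controlled by the dissipation, the integral with weight [kk], at no loss of radius. *)
Lemma L2le_imul_half sigma y g : 0 <= y -> @cmeas _ (measurableTypeR R) R setT g ->
  (gint sigma (@kk R) g <= y%:E)%E ->
  L2le mu (2 `^ s * Num.sqrt y) (fun xi => wt sigma (s - 1 / 2) xi * normc (imul g xi)).
Proof.
move=> y0 mg gy; split; first by apply: measurable_wtM; exact: cmeas_imul.
have n1 : nnm (fun xi => kk xi * (gw sigma xi * normc (g xi)) ^+ 2).
  split=> [|xi]; last by rewrite mulr_ge0 ?sqr_ge0// ltW// kk_gt0.
  apply: measurable_funM; first exact: measurable_kk.
  by apply: (measurable_funX 2); apply: measurable_funM; [exact: measurable_gw|exact: measurable_normc].
have c0 : 0 <= (2 `^ s) ^+ 2 :> R := sqr_ge0 _.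
apply: (@le_trans _ _ (((2 `^ s) ^+ 2)%:E * gint sigma (@kk R) g)%E); last first.
  by rewrite exprMn (sqr_sqrtr y0) [leRHS]EFinM; apply: lee_wpmul2l; rewrite ?lee_fin.
rewrite /gint -(nnm_intZ c0 n1).
apply: (@le_integral_fin _ (measurableTypeR R) R mu _ _ _ (nnmZ c0 n1).1) => [|xi|xi].
- by apply: (measurable_funX 2); apply: measurable_wtM; exact: cmeas_imul.
- exact: sqr_ge0.
rewrite normc_imul.
have k0 := kk_gt0 xi; have x0 := normr_ge0 xi.
have h1 : (wt sigma (s - 1 / 2) xi * `|xi|) ^+ 2 <= kk xi * (2 `^ s * gw sigma xi) ^+ 2.
  apply: (@le_trans _ _ (wt sigma (s - 1 / 2) xi ^+ 2 * kk xi * kk xi)).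
    rewrite exprMn -mulrA; apply: ler_wpM2l; first exact: sqr_ge0.
    by rewrite -expr2; apply: lerXn2r; rewrite ?nnegrE ?(ltW k0)// /kk lerDr.
  rewrite wt_half mulrC; apply: ler_wpM2l; first exact: ltW.
  have A0 : 0 <= wt sigma s xi := ltW (wt_gt0 sigma s xi).
  have B0 : 0 <= 2 `^ s * gw sigma xi by exact: mulr_ge0 (powR_ge0 _ _) (gw_ge0 _ _).
  by apply: lerXn2r; rewrite ?nnegrE//; exact: wt_le.
have E (c w x n a k : R) : (w * x) ^+ 2 <= k * (a * c) ^+ 2 -> (w * (x * n)) ^+ 2 <= a ^+ 2 * (k * (c * n) ^+ 2).
  by move=> hh; have := ler_wpM2r (sqr_ge0 n) hh; rewrite !exprMn; lra.
exact: E.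
Qed.

Lemma gint_ae sigma (w : R -> R) (g g' : R -> C) : {ae mu, forall xi, g xi = g' xi} ->
  measurable_fun [set: R] w -> @cmeas _ (measurableTypeR R) R setT g -> @cmeas _ (measurableTypeR R) R setT g' ->
  gint sigma w g = gint sigma w g'.
Proof.
move=> gg mw mg mg'; apply: ae_eq_integral => //.
- apply/measurable_EFinP; apply: measurable_funM => //; apply: (measurable_funX 2).
  by apply: measurable_funM; [exact: measurable_gw|exact: measurable_normc].
- apply/measurable_EFinP; apply: measurable_funM => //; apply: (measurable_funX 2).
  by apply: measurable_funM; [exact: measurable_gw|exact: measurable_normc].
- by apply: ae_mono gg => xi -> _.
Qed.

Definition hat (f : R -> C) : R -> C := xget (fun=> 0) [set g | FB f g].

Lemma hatP f g : FB f g -> FB f (hat f).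
Proof. by move=> h; rewrite /hat; case: xgetP => [g' _|/(_ g)]. Qed.

Definition energy sigma f := gint sigma (fun=> 1) (hat f).

Lemma energyE sigma f g : FB f g -> energy sigma f = gint sigma (fun=> 1) g.
Proof.
move=> h; apply: gint_ae; [exact: FB_unique (hatP h) h|exact: measurable_cst|exact: FB_cmeas (hatP h)|exact: FB_cmeas h].
Qed.

End energy.

(** Summed over components, the dissipation a y on the left dominates the cross terms up to c and,
    being finite, can be cancelled in the extended reals. *)
Lemma sum_cancel (R : realType) n (e1 e0 Y : 'I_n -> \bar R) (a b c y : R) :
  (forall k, e1 k + a%:E * Y k <= e0 k + b%:E)%E -> (forall k, 0 <= Y k)%E -> (\sum_k Y k = y%:E)%E ->
  n%:R * b <= a * y + c -> (\sum_k e1 k <= \sum_k e0 k + c%:E)%E.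
Proof.
move=> h Y0 Yy hb; have tot := lee_sum (index_enum 'I_n) (P := xpredT) (fun k _ => h k).
move: tot; rewrite !big_split -ge0_sume_distrr// Yy sumEFin sumr_const card_ord -EFinM => tot.
have fin : (a * y)%:E \is a fin_num by [].
rewrite -(leeD2rE _ _ fin); apply: le_trans tot _; rewrite -addeA; apply: leeD2l.
by rewrite -EFinD lee_fin -mulr_natl addrC.
Qed.

Section energy_decay.
Variables (R : realType) (d : nat).
Local Notation C := R[i].
Local Notation Z := ('I_d -> C).
Local Notation mu := (@lebesgue_measure R).
Variables (s sigma dl K rho N : R) (Nkl : 'I_d -> 'I_d -> R) (Phi : 'I_d -> 'I_d -> Z -> C).
Let p := s - 1 / 2.
Hypotheses (s1 : 1 < s) (K0 : 0 <= K) (sigma0 : 0 <= sigma) (dl0 : 0 < dl) (N0 : 0 <= N).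
Hypothesis hPhi : forall k l, PS rho (Nkl k l) (Phi k l).
Hypothesis hN : forall k, \sum_l Nkl k l <= N.
Hypotheses (rho1 : cP s s * K <= rho) (rho2 : cP s p * K <= rho).
Variables (u u1 r : R -> Z).
Hypothesis hu : forall k, B (sigma + dl) s K (fun x => u x k).
Hypothesis hu1 : forall x k, u1 x k = \sum_l Phi k l (u x) * Dx (fun y => u y l) x.
Variable Kr : R.
Hypothesis hr : forall k, B sigma s Kr (fun x => r x k).
Variables (q h : R).
Hypotheses (q0 : 0 < q) (h0 : 0 < h) (hq : Num.sqrt d%:R * (N * 2 `^ s) <= q).

Let p2 : 1 / 2 < p. Proof. by rewrite /p; have := s1; lra. Qed.
Let ps : p <= s. Proof. by rewrite /p; lra. Qed.
Let s2 : 1 / 2 < s. Proof. by have := s1; lra. Qed.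

(** u1 = M(u) u_x is bounded twice: crudely with exponent s and the spare radius [dl], which enters
    only the O(h^2) error; and with exponent p = s - 1/2 in terms of the dissipation [y], where s >
    1 makes p admissible. By [hq], the cross terms d (h / q) (N 2^s)^2 y are then absorbed by q h
    y. *)
Lemma energy_decay :
  (\sum_k energy s (sigma - q * h) (fun x => u x k + h%:C%C * u1 x k + r x k)%R <=
   \sum_k energy s sigma (fun x => u x k) +
     (d%:R * (h ^+ 2 * (2 * q ^+ 2 * (K / dl) ^+ 2 + K ^+ 2 + 2 * (N * (K / dl)) ^+ 2) + (2 + h ^- 2) * Kr ^+ 2))%:E)%E.
Proof.
have sd0 : 0 <= sigma + dl by rewrite addr_ge0 ?(ltW dl0)// sigma0.
have sdp : 0 < sigma + dl by rewrite ltr_wpDl.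
have sl : sigma < sigma + dl by rewrite ltrDl.
have rho0 : 0 <= rho by apply: le_trans rho1; rewrite mulr_ge0 ?cP_ge0.
have hus k : B sigma s K (fun x => u x k) by apply: B_le (hu k) => //; exact: ltW.
have hur x k : normc (u x k) <= rho.
  by apply: le_trans (B_sup x sigma0 s2 (hus k)) _; rewrite mulrA; apply: le_trans rho1; rewrite ler_wpM2r// c0cS_le.
pose g k := hat (fun x => u x k).
have hg k : FB (fun x => u x k) (g k) by have [g' hg' _] := FB_B sd0 s2 (hu k); exact: hatP hg'.
have gK k := FB_norm sd0 s2 (hu k) (hg k).
have mg k := FB_cmeas (hg k).
have hD l : B sigma s (K / dl) (Dx (fun x => u x l)).
  by have [] := B_deriv sigma0 sl s2 (hu l); rewrite addrC addKr.
have hF k : B sigma s (N * (K / dl)) (fun x => u1 x k).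
  have Kd0 : 0 <= K / dl by rewrite divr_ge0// ltW.
  have hl l := PS_comp (S := fourier_scale sigma0 s2 (lexx s)) rho0 (hPhi k l) (fun j => ex_intro2 _ _ K rho1 (hus j)) hur Kd0 (hD l).
  have := sP_sum hl; rewrite -mulr_suml => hs; apply: (B_ext (fun x => esym (hu1 x k))).
  by apply: B_le hs => //; exact: ler_wpM2r.
pose F k := hat (fun x => u1 x k).
have hFB k : FB (fun x => u1 x k) (F k) by have [g' hg' _] := FB_B sigma0 s2 (hF k); exact: hatP hg'.
have FK k := FB_norm sigma0 s2 (hF k) (hFB k).
pose rr k := hat (fun x => r x k).
have hrB k : FB (fun x => r x k) (rr k) by have [g' hg' _] := FB_B sigma0 s2 (hr k); exact: hatP hg'.
have rK k := FB_norm sigma0 s2 (hr k) (hrB k).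
have s12 : 1 / 2 <= s by exact: ltW.
have gK' k : L2le mu K (fun xi => wt sigma s xi * normc (g k xi)) by exact: FB_norm sigma0 s2 (hus k) (hg k).
have mF k := FB_cmeas (hFB k); have mr k := FB_cmeas (hrB k).
have mone : measurable_fun [set: R] (fun=> 1 : R) by exact: measurable_cst.
have I1 (f : R -> C) K' : @cmeas _ (measurableTypeR R) R setT f -> L2le mu K' (fun xi => wt sigma s xi * normc (f xi)) ->
    (gint s sigma (fun=> 1%R) f <= (K' ^+ 2)%:E)%E.
  move=> mf hf; rewrite -[K']mul1r; apply: gint_le hf => // xi; rewrite !mul1r; exact: gw_sqr.
pose Y k := gint s sigma (@kk R) (g k).
have Yk k : (Y k <= ((dl^-1 * K) ^+ 2)%:E)%E.
  apply: le_trans (gint_kk_sqr s12 dl0 (mg k) (gK k)).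
  have nY (w : R -> R) : measurable_fun [set: R] w -> (forall xi, 0 <= w xi) -> nnm (fun xi => w xi * (gevrey_weight s sigma xi * normc (g k xi)) ^+ 2).
    move=> mw w0; split; last by move=> xi; rewrite mulr_ge0 ?sqr_ge0.
    apply: measurable_funM => //; apply: (measurable_funX 2).
    by apply: measurable_funM; [exact: measurable_gw|exact: measurable_normc].
  have n1 := nY _ (@measurable_kk R) (fun xi => ltW (kk_gt0 xi)).
  have mk2 : measurable_fun [set: R] (fun xi : R => kk xi ^+ 2) by apply: (measurable_funX 2); exact: measurable_kk.
  have n2 := nY _ mk2 (fun xi => sqr_ge0 _).
  apply: (@le_integral_fin _ (measurableTypeR R) R mu _ _ n1.1 n2.1 n1.2) => xi.
  by apply: ler_wpM2r; [exact: sqr_ge0|rewrite expr2 ler_peMl ?kk_ge1// ltW// kk_gt0].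
have Y0 k : (0 <= Y k)%E.
  by apply: integral_ge0 => xi _; rewrite lee_fin mulr_ge0 ?sqr_ge0// ltW// kk_gt0.
have Yfin k : Y k \is a fin_num by rewrite ge0_fin_numE//; apply: le_lt_trans (Yk k) _; rewrite ltry.
(* The total dissipation; the spare radius makes it finite, which permits cancelling it. *)
pose y := \sum_k fine (Y k).
have y0 : 0 <= y by apply: sumr_ge0 => k _; exact: fine_ge0.
have Ysum : (\sum_k Y k = y%:E)%E.
  by rewrite /y -sumEFin; apply: eq_bigr => k _; rewrite fineK.
have Yle k : (Y k <= y%:E)%E.
  rewrite -(fineK (Yfin k)) lee_fin /y (bigD1 k)//= lerDl; apply: sumr_ge0 => j _; exact: fine_ge0.
have hDp l : B sigma p (2 `^ s * Num.sqrt y) (Dx (fun x => u x l)).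
  apply: B_FB (FB_deriv sdp s2 (hu l) (hg l)) _; first by rewrite mulr_ge0 ?powR_ge0 ?sqrtr_ge0.
  exact: L2le_imul_half y0 (mg l) (Yle l).
have hFp k : B sigma p (N * (2 `^ s * Num.sqrt y)) (fun x => u1 x k).
  have D0 : 0 <= 2 `^ s * Num.sqrt y by rewrite mulr_ge0 ?powR_ge0 ?sqrtr_ge0.
  have hl l := PS_comp (S := fourier_scale sigma0 p2 ps) rho0 (hPhi k l) (fun j => ex_intro2 _ _ K rho2 (hus j)) hur D0 (hDp l).
  have := sP_sum hl; rewrite -mulr_suml => hs; apply: (B_ext (fun x => esym (hu1 x k))).
  by apply: B_le hs => //; exact: ler_wpM2r.
have Xk k : (gint s sigma (fun xi => (kk xi)^-1)%R (F k) <= ((N * (2 `^ s * Num.sqrt y)) ^+ 2)%:E)%E.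
  exact: gint_kkV (mF k) (FB_norm sigma0 p2 (hFp k) (hFB k)).
pose err := h ^+ 2 * (2 * q ^+ 2 * (K / dl) ^+ 2 + K ^+ 2 + 2 * (N * (K / dl)) ^+ 2) + (2 + h ^- 2) * Kr ^+ 2.
have hq0 : 0 <= h / q by rewrite divr_ge0 ?ltW.
have step k : (energy s (sigma - q * h) (fun x => u x k + h%:C%C * u1 x k + r x k)%R + (q * h)%:E * Y k <=
    energy s sigma (fun x => u x k) + ((h / q) * (N * (2 `^ s * Num.sqrt y)) ^+ 2 + err)%:E)%E.
  have hv := FB_add (FB_add (hg k) (FB_scale h%:C%C (hFB k))) (hrB k).
  rewrite (energyE s (sigma - q * h) hv) (energyE s sigma (hg k)).
  apply: le_trans (energy_component s sigma q0 h0 (mg k) (mF k) (mr k)) _.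
  have q20 : 0 <= 2 * q ^+ 2 by rewrite mulr_ge0 ?sqr_ge0.
  have hh0 : 0 <= 2 + h ^- 2 by rewrite addr_ge0 ?invr_ge0 ?sqr_ge0.
  rewrite -addeA; apply: leeD2l; rewrite [leRHS]EFinD; apply: leeD.
    by rewrite [leRHS]EFinM; apply: lee_wpmul2l; rewrite ?lee_fin.
  rewrite /err [leRHS]EFinD; apply: leeD; last first.
    by rewrite [leRHS]EFinM; apply: lee_wpmul2l; [rewrite lee_fin|exact: I1].
  rewrite [leRHS]EFinM; apply: lee_wpmul2l; first by rewrite lee_fin sqr_ge0.
  rewrite [leRHS]EFinD; apply: leeD; last first.
    by rewrite [leRHS]EFinM; apply: lee_wpmul2l; [rewrite lee_fin|exact: I1].
  rewrite [leRHS]EFinD; apply: leeD; last exact: I1.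
  rewrite [leRHS]EFinM; apply: lee_wpmul2l; first by rewrite lee_fin.
  rewrite [K / dl]mulrC; exact: gint_kk_sqr.
apply: (sum_cancel step Y0 Ysum); rewrite mulrDr lerD2r.
have Q : d%:R * (N * 2 `^ s) ^+ 2 <= q ^+ 2.
  have A0 : 0 <= Num.sqrt d%:R * (N * 2 `^ s) by rewrite mulr_ge0 ?sqrtr_ge0// mulr_ge0 ?powR_ge0.
  rewrite -(sqr_sqrtr (ler0n R d)) -exprMn; apply: lerXn2r; rewrite ?nnegrE//; exact: ltW.
rewrite !exprMn (sqr_sqrtr y0).
rewrite (_ : d%:R * _ = (h / q * y) * (d%:R * (N * 2 `^ s) ^+ 2)); last by rewrite exprMn; ring.
rewrite (_ : q * h * y = (h / q * y) * q ^+ 2); last by field; rewrite gt_eqF.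
by apply: ler_wpM2l => //; rewrite mulr_ge0.
Qed.

End energy_decay.

(** * Existence *)

(** n equal steps accumulate an error c T1^2 / n; [n] is taken large enough for the admissible step
    size and for the given [eps]. *)
Lemma euler_steps (R : realType) (e : R -> \bar R) (c h0 T1 : R) : 0 < h0 -> 0 <= c -> 0 <= T1 ->
  (forall T h : R, 0 <= T -> 0 < h -> h <= h0 -> T + h <= T1 -> (e (T + h)%R <= e T + (c * h ^+ 2)%:E)%E) ->
  (e T1 <= e 0%R)%E.
Proof.
move=> h00 c0; rewrite le_eqVlt => /orP[/eqP <-//|T0] step.
apply/lee_addgt0Pr => eps eps0.
pose n := (maxn (Num.bound (T1 / h0)) (Num.bound (c * T1 ^+ 2 / eps))).+1.
have n0 : 0 < n%:R :> R by [].
have nge (m : nat) : (m <= n.-1)%N -> m%:R <= n%:R :> R by move=> h; rewrite ler_nat; exact: leq_trans h (leqnSn _).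
have n1 : T1 / h0 <= n%:R.
  apply: le_trans (ltW (archi_boundP _)) (nge _ (leq_maxl _ _)); rewrite divr_ge0 ?ltW//.
have n2 : c * T1 ^+ 2 / eps <= n%:R.
  by apply: le_trans (ltW (archi_boundP _)) (nge _ (leq_maxr _ _)); rewrite divr_ge0 ?mulr_ge0 ?sqr_ge0// ltW.
pose h := T1 / n%:R; have hp : 0 < h by rewrite divr_gt0.
have hh : h <= h0 by rewrite ler_pdivrMr// mulrC -ler_pdivrMr.
have main (m : nat) : (m <= n)%N -> (e (m%:R * h)%R <= e 0%R + (m%:R * (c * h ^+ 2))%:E)%E.
  elim: m => [|m ih] mn; first by rewrite !mul0r adde0.
  rewrite -natr1 !mulrDl !mul1r EFinD addeA.
  apply: le_trans (step _ _ _ hp hh _) _.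
  - by rewrite mulr_ge0// ltW.
  - have -> : m%:R * h + h = m.+1%:R * h by rewrite -natr1 mulrDl mul1r.
    by rewrite /h mulrCA ler_piMr ?(ltW T0)// ler_pdivrMr// mul1r ler_nat.
  - by apply: leeD2r; apply: ih; exact: ltnW.
have := main n (leqnn n); rewrite {1}/h mulrCA divff ?gt_eqF// mulr1 => /le_trans; apply.
apply: leeD2l; rewrite lee_fin /h.
rewrite (_ : n%:R * _ = c * T1 ^+ 2 / n%:R); last by field; rewrite gt_eqF.
by rewrite ler_pdivrMr// [eps * _]mulrC -ler_pdivrMr.
Qed.

Lemma err_bound (R : realType) (h X Kr : R) : 0 < h -> h <= 1 ->
  h ^+ 2 * X + (2 + h ^- 2) * (Kr * h ^+ 2) ^+ 2 <= (X + 3 * Kr ^+ 2) * h ^+ 2.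
Proof.
move=> h0 h1; rewrite [leLHS](_ : _ = (X + Kr ^+ 2 * (2 * h ^+ 2 + 1)) * h ^+ 2); last by field; rewrite gt_eqF.
apply: ler_wpM2r; first exact: sqr_ge0.
rewrite lerD2l mulrC; apply: ler_wpM2r; first exact: sqr_ge0.
have : h ^+ 2 <= 1 by rewrite exprn_ile1// ltW.
by lra.
Qed.

Lemma le_eqtrans (R : realType) (x y z : \bar R) : x = y -> (y <= z)%E -> (x <= z)%E.
Proof. by move=> ->. Qed.

Section solution.
Variables (R : realType) (d : nat).
Local Notation C := R[i].
Local Notation Z := ('I_d -> C).
Local Notation mu := (@lebesgue_measure R).

Definition cnorm (g : 'I_d -> R -> C) xi : R := Num.sqrt (\sum_k normc (g k xi) ^+ 2).

Lemma measurable_cnorm g : (forall k, @cmeas _ (measurableTypeR R) R setT (g k)) -> measurable_fun [set: R] (cnorm g).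
Proof.
move=> mg; apply: (measurableT_comp (continuous_measurable_fun (@sqrt_continuous R))).
have m k : measurable_fun [set: measurableTypeR R] (fun x => normc (g k x) ^+ 2).
  by apply: (measurable_funX 2); exact: measurable_normc (mg k).
exact: measurable_sum.
Qed.

Lemma gint_sum s sigma g : (forall k, @cmeas _ (measurableTypeR R) R setT (g k)) ->
  (\sum_k gint s sigma (fun=> 1%R) (g k) = \int[mu]_xi ((gevrey_weight s sigma xi * cnorm g xi) ^+ 2)%:E)%E.
Proof.
move=> mg; rewrite -ge0_integral_sum//.
- apply: eq_integral => xi _; rewrite exprMn sqr_sqrtr; last by apply: sumr_ge0 => k _; exact: sqr_ge0.
  by rewrite mulr_sumr -sumEFin; apply: eq_bigr => k _; rewrite mul1r exprMn.
- move=> k; apply/measurable_EFinP; apply: measurable_funM => //; apply: (measurable_funX 2).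
  by apply: measurable_funM; [exact: measurable_gw|exact: measurable_normc].
- by move=> k xi _; rewrite lee_fin mul1r sqr_ge0.
Qed.

(** The weights at the radii (1 - 1 / (n + 2)) sigma converge to the weight at sigma, and Fatou's
    lemma keeps the bound. *)
Lemma energy_limit s sigma E g : 0 <= sigma -> (forall k, @cmeas _ (measurableTypeR R) R setT (g k)) -> 0 <= E ->
  (forall n : nat, (\sum_k gint s ((1 - (n.+2%:R)^-1) * sigma) (fun=> 1%R) (g k) <= (E ^+ 2)%:E)%E) ->
  L2le mu E (fun xi => gevrey_weight s sigma xi * cnorm g xi).
Proof.
move=> s0 mg E0 h.
have ms sg : measurable_fun [set: R] (fun xi => gevrey_weight s sg xi * cnorm g xi).
  by apply: measurable_funM; [exact: measurable_gw|exact: measurable_cnorm].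
apply: (@L2le_lim _ (measurableTypeR R) R mu (fun n xi => gevrey_weight s ((1 - (n.+2%:R)^-1) * sigma) xi * cnorm g xi)) => [|n|].
- exact: ms.
- by split; [exact: ms|rewrite -gint_sum].
apply: (@aeW _ (measurableTypeR R) R mu) => xi.
apply: cvgMl; rewrite /gevrey_weight; apply: cvgMl.
apply: continuous_cvg; first exact: continuous_expR.
apply: cvgMl; rewrite -[X in _ --> X]mul1r; apply: cvgMl.
rewrite -[X in _ --> X]subr0; apply: cvgB; first exact: cvg_cst.
have hh := @cvg_harmonic R; rewrite -(cvg_shiftS (fun n : nat => n.+1%:R^-1 : R)) in hh; exact: hh.
Qed.

Variables (s sigma0 K Mk N rho eta : R) (Mkl Nkl : 'I_d -> 'I_d -> R) (Phi : 'I_d -> 'I_d -> Z -> C) (u0 : R -> Z).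
Variable A : 'I_d -> 'I_d -> (nat -> Z) -> (nat -> C) -> nat -> C.
Hypotheses (s1 : 1 < s) (sigma00 : 0 < sigma0) (K0 : 0 < K) (Mk0 : 0 <= Mk) (N0 : 0 <= N).
Hypothesis hA : forall k l, PS_operator (8 * cP s s * K) (Mkl k l) (Phi k l) (A k l).
Hypothesis hM : forall k, \sum_l Mkl k l <= Mk.
Hypothesis hPhi : forall k l, PS rho (Nkl k l) (Phi k l).
Hypothesis hN : forall k, \sum_l Nkl k l <= N.
Hypotheses (rho1 : cP s s * (2 * K) <= rho) (rho2 : cP s (s - 1 / 2) * (2 * K) <= rho).
Hypotheses (eta1 : 16 * ckC Mk <= eta) (eta2 : 2 * (Num.sqrt d%:R * (N * 2 `^ s)) <= eta).
Hypothesis hu0 : forall k, B sigma0 s K (fun x => u0 x k).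

Let s2 : 1 / 2 < s. Proof. by have := s1; lra. Qed.
Let C0 : 0 < ckC Mk. Proof. exact: ckC_gt0. Qed.
Let eta0 : 0 < eta. Proof. by have := C0; have := eta1; lra. Qed.
Local Notation u := (cksol A u0).

(** Shrinking the radius by theta < 1 leaves room [dl] for one more derivative and for the Taylor
    remainder; constants depending on theta affect only the step error, which [euler_steps] removes.
    The effective rate is theta eta >= eta / 2, whence the 2 in [eta2]. *)
Lemma energy_theta theta T : 1 / 2 <= theta < 1 -> 0 <= T <= sigma0 / eta ->
  (\sum_k energy s (theta * (sigma0 - eta * T)) (fun x => u T x k) <=
   \sum_k energy s (theta * sigma0) (fun x => u0 x k))%E.
Proof.
move=> /andP[th1 th2] /andP[T0 TT].
have e0 := eta0; have c0 := C0; have sg0 := sigma00; have e1 := eta1; have k0 := K0.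
pose dl := (1 - theta) * sigma0 / 2.
have dl0 : 0 < dl by rewrite /dl divr_gt0// mulr_gt0// subr_gt0.
(* [Y = t + b] will be the time radius of the Taylor remainder; b > 0 does not depend on t, which
   makes the step error uniform. *)
pose b := dl / (2 * ckC Mk); have b0 : 0 < b by rewrite divr_gt0// mulr_gt0.
have cb : 2 * ckC Mk * b = dl by rewrite /b mulrCA divff ?mulr1// gt_eqF// mulr_gt0.
have etaT t : t <= sigma0 / eta -> eta * t <= sigma0 by move=> h; rewrite mulrC -ler_pdivlMr.
pose Kr := 2 * (K / b ^+ 2).
have Kr0 : 0 <= Kr by rewrite mulr_ge0// divr_ge0 ?sqr_ge0// ltW.
pose q := theta * eta; have q0 : 0 < q by rewrite mulr_gt0//; lra.
pose c := d%:R * ((2 * q ^+ 2 * (2 * K / dl) ^+ 2 + (2 * K) ^+ 2 + 2 * (N * (2 * K / dl)) ^+ 2) + 3 * Kr ^+ 2).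
have cc0 : 0 <= c by exact: mulr_ge0 (ler0n _ _) (addr_ge0 (addr_ge0 (addr_ge0 (mulr_ge0 (mulr_ge0 (ler0n _ 2) (sqr_ge0 _))
    (sqr_ge0 _)) (sqr_ge0 _)) (mulr_ge0 (ler0n _ 2) (sqr_ge0 _))) (mulr_ge0 (ler0n _ 3) (sqr_ge0 _))).
have -> : (\sum_k energy s (theta * sigma0) (fun x => u0 x k) = \sum_k energy s (theta * (sigma0 - eta * 0)) (fun x => u 0 x k))%E.
  apply: eq_bigr => k _; rewrite mulr0 subr0; congr energy; apply/funext => x; by rewrite cksol0.
have h00 : 0 < Num.min 1 b by rewrite lt_min ltr01.
apply: (euler_steps (e := fun t => (\sum_k energy s (theta * (sigma0 - eta * t)) (fun x => u t x k))%E) h00 cc0 T0) => t h t0 h0.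
rewrite le_min => /andP[h1 hb] thT.
have et : eta * t <= sigma0 by apply: etaT; apply: le_trans TT; apply: le_trans thT; rewrite lerDl ltW.
have ct : 16 * (ckC Mk * t) <= eta * t by rewrite mulrA ler_wpM2r.
have ct0 : 0 <= ckC Mk * t by rewrite mulr_ge0// ltW.
pose sg := theta * (sigma0 - eta * t).
have sg0' : 0 <= sg by rewrite mulr_ge0 ?subr_ge0//; lra.
have theta_et : 1 / 2 * (eta * t) <= theta * (eta * t) by rewrite ler_wpM2r// mulr_ge0// ltW.
have dle : dl = sigma0 / 2 - theta * sigma0 / 2 by rewrite /dl; field.
have th_sg : theta * sigma0 < sigma0 by rewrite gtr_pMl.
have sge : sg = theta * sigma0 - theta * (eta * t) by rewrite /sg mulrBr.
have H1 k : B (sg + dl) s (2 * K) (fun x => u t x k).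
  have [] := cksol_B s2 K0 hA hM Mk0 hu0 (sigma := sg + dl) (T := t) k _ t0 _ => //; last by lra.
  by apply/andP; split; lra.
have H2 x k : cksol1 A u0 t x k = \sum_l Phi k l (u t x) * Dx (fun y => u t y l) x.
  by apply: (cksol_eq s2 sigma00 K0 hA hM Mk0 hu0) => //; rewrite -mulrA; lra.
pose Y := t + b.
have H3 k : B sg s (Kr * h ^+ 2) (fun x => u (t + h) x k - u t x k - h%:C%C * cksol1 A u0 t x k).
  have Y0 : 0 < Y by rewrite ltr_wpDl.
  apply: B_le (cksol_taylor s2 K0 hA hM Mk0 hu0 (sigma := sg) (T := t) (h := h) (Y := Y) k _ _ _ Y0 _) => //.
  - have bY : (Y ^+ 2)^-1 <= (b ^+ 2)^-1.
      rewrite lef_pV2 ?posrE ?exprn_gt0//; apply: lerXn2r; rewrite ?nnegrE ?(ltW b0) ?(ltW Y0)//.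
      by rewrite /Y lerDr.
    rewrite /Kr (_ : 2 * (K * (h ^+ 2 / Y ^+ 2)) = (2 * K * h ^+ 2) * (Y ^+ 2)^-1); last by ring.
    rewrite (_ : 2 * (K / b ^+ 2) * h ^+ 2 = (2 * K * h ^+ 2) * (b ^+ 2)^-1); last by ring.
    by apply: ler_wpM2l => //; rewrite mulr_ge0 ?sqr_ge0// mulr_ge0// ltW.
  - apply/andP; split=> //; have : 0 <= theta * (eta * t) by rewrite !mulr_ge0//; lra.
    by lra.
  - by rewrite t0 /Y lerDl ltW.
  - by rewrite addr_ge0 ?(ltW h0)//= /Y lerD2l.
  - rewrite /Y mulrDr cb -mulrA; lra.
have q2 : Num.sqrt d%:R * (N * 2 `^ s) <= q.
  have : 0 <= Num.sqrt d%:R * (N * 2 `^ s) by rewrite mulr_ge0 ?sqrtr_ge0// mulr_ge0 ?powR_ge0.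
  have := eta2; move: (Num.sqrt _ * _) => z; rewrite /q; have := mulr_ge0 (_ : 0 <= theta - 1 / 2) (ltW e0).
  by move=> hz; have {}hz := hz _; lra.
have K20 : 0 <= 2 * K by rewrite mulr_ge0// ltW.
have D := energy_decay s1 K20 sg0' dl0 N0 hPhi hN rho1 rho2 H1 H2 H3 q0 h0 q2.
have E1 : theta * (sigma0 - eta * (t + h)) = sg - q * h by rewrite /sg /q; ring.
have E2 : (\sum_k energy s (theta * (sigma0 - eta * (t + h))) (fun x => u (t + h) x k) =
   \sum_k energy s (sg - q * h) (fun x => u t x k + h%:C%C * cksol1 A u0 t x k + (u (t + h) x k - u t x k - h%:C%C * cksol1 A u0 t x k))%R)%E.
  apply: eq_bigr => k _; rewrite E1; congr energy; apply/funext => x.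
  by move: (u (t + h) x k) (u t x k) (_ * _) => a b' e'; ring.
apply: (le_eqtrans E2); apply: le_trans D _; apply: leeD2l; rewrite lee_fin.
apply: le_trans (ler_wpM2l (ler0n R d) (err_bound _ _ h0 h1)) _.
by rewrite [leLHS]mulrA.
Qed.

(** theta tends to 1 in [energy_theta]; the right-hand side there is first bounded by the data at
    the full radius sigma0. *)
Lemma energy_sol T r (g g0 : 'I_d -> R -> C) : 0 <= T <= sigma0 / eta -> 0 <= r ->
  (forall k, FB (fun x => u0 x k) (g0 k)) -> (forall k, FB (fun x => u T x k) (g k)) ->
  L2le mu r (fun xi => gevrey_weight s sigma0 xi * cnorm g0 xi) ->
  L2le mu r (fun xi => gevrey_weight s (sigma0 - eta * T) xi * cnorm g xi).
Proof.
move=> hT r0 hg0 hg [_ h0]; have /andP[T0 TT] := hT.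
have mg k := FB_cmeas (hg k); have mg0 k := FB_cmeas (hg0 k).
have sT : 0 <= sigma0 - eta * T by rewrite subr_ge0 mulrC -ler_pdivlMr// eta0.
apply: energy_limit => // n; set th := 1 - _.
have th1 : 1 / 2 <= th < 1.
  have n2 : (n.+2%:R : R)^-1 <= 1 / 2 by rewrite div1r lef_pV2 ?posrE// ler_nat.
  have n3 : 0 < (n.+2%:R : R)^-1 by rewrite invr_gt0.
  move: n2 n3; rewrite /th; move: (n.+2%:R^-1 : R) => w; move=> w1 w2.
  by apply/andP; split; lra.
have := energy_theta th1 hT.
under eq_bigr => k _ do rewrite (energyE s _ (hg k)).
under [X in (_ <= X)%E -> _]eq_bigr => k _ do rewrite (energyE s _ (hg0 k)).
move=> /le_trans; apply; apply: le_trans h0; rewrite gint_sum//.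
apply: (@le_integral_fin _ (measurableTypeR R) R mu) => [|||xi].
- by apply: (measurable_funX 2); apply: measurable_funM; [exact: measurable_gw|exact: measurable_cnorm].
- by apply: (measurable_funX 2); apply: measurable_funM; [exact: measurable_gw|exact: measurable_cnorm].
- by move=> xi; exact: sqr_ge0.
have c0 : 0 <= cnorm g0 xi by exact: sqrtr_ge0.
apply: lerXn2r; rewrite ?nnegrE ?(mulr_ge0 (gw_ge0 _ _ _) c0)//.
apply: ler_wpM2r => //; rewrite !gwE; apply: ler_wpM2r; first exact: sqrtr_ge0.
rewrite ler_expR; apply: ler_wpM2r; first exact: ltW (kk_gt0 xi).
by rewrite ler_piMl ?(ltW sigma00)//; move: th1 => /andP[_ /ltW].
Qed.

Lemma sol_radius T : 0 <= T <= sigma0 / eta -> 16 * (ckC Mk * T) <= sigma0 /\ 16 * (ckC Mk * T) <= eta * T.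
Proof.
move=> /andP[T0 TT]; have c1 : 16 * (ckC Mk * T) <= eta * T by rewrite mulrA ler_wpM2r.
split=> //; apply: le_trans c1 _; rewrite mulrC -ler_pdivlMr//; exact: eta0.
Qed.

Lemma sol_B T k : 0 <= T <= sigma0 / eta -> B (sigma0 - eta * T) s (2 * K) (fun x => u T x k).
Proof.
move=> hT; have [c1 c2] := sol_radius hT; have /andP[T0 TT] := hT.
have C0' := C0; have e0 := eta0.
(* The series bound asks for a radius strictly below sigma0, so T = 0 is read off the data. *)
move: T0; rewrite le_eqVlt => /orP[/eqP <-|T0].
  rewrite mulr0 subr0 (_ : (fun x => u 0 x k) = fun x => u0 x k); last by apply/funext => x; exact: cksol0.
  by apply: B_le (hu0 k) => //; rewrite ler_peMl// ?ltW// ltr1n.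
have sT : 0 <= sigma0 - eta * T by rewrite subr_ge0 mulrC -ler_pdivlMr.
have cT : 0 <= ckC Mk * T by rewrite mulr_ge0// ltW.
have eT : 0 < eta * T by rewrite mulr_gt0.
have h1 : 0 <= sigma0 - eta * T < sigma0 by rewrite sT gtrBl.
have h2 : ckC Mk * T <= sigma0 - (sigma0 - eta * T) by lra.
by have [] := cksol_B s2 K0 hA hM Mk0 hu0 k h1 (ltW T0) h2.
Qed.

(** eta is so large that the series stays far from its limit of convergence: the constructed
    solution keeps the radius sigma0 / 2 throughout, so that its derivatives in X exist at every
    time. *)
Lemma sol_B_half T k : 0 <= T <= sigma0 / eta -> B (sigma0 / 2) s (2 * K) (fun x => u T x k).
Proof.
move=> hT; have [c1 c2] := sol_radius hT; have /andP[T0 TT] := hT.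
have cT : 0 <= ckC Mk * T by rewrite mulr_ge0// ltW// C0.
have s0 := sigma00.
have h1 : 0 <= sigma0 / 2 < sigma0 by rewrite divr_ge0 ?ltW//= ltr_pdivrMr// ltr_pMr// ltr1n.
have h2 : ckC Mk * T <= sigma0 - sigma0 / 2 by lra.
by have [] := cksol_B s2 K0 hA hM Mk0 hu0 k h1 T0 h2.
Qed.

Lemma sol_eq T x k : 0 <= T <= sigma0 / eta ->
  cksol1 A u0 T x k = \sum_l Phi k l (u T x) * Dx (fun y => u T y l) x.
Proof.
move=> hT; have [c1 c2] := sol_radius hT; have /andP[T0 TT] := hT.
have cT : 0 <= ckC Mk * T by rewrite mulr_ge0// ltW// C0.
by apply: (cksol_eq s2 sigma00 K0 hA hM Mk0 hu0) => //; rewrite -mulrA; lra.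
Qed.

Lemma sol_diff : exists c : R, forall T T' x k, 0 <= T <= sigma0 / eta -> 0 <= T' <= sigma0 / eta ->
  normc (u T' x k - u T x k - (T' - T)%:C%C * cksol1 A u0 T x k) <= c * (T' - T) ^+ 2.
Proof.
have s0 := sigma00; have Y0 : 0 < sigma0 / eta by rewrite divr_gt0// eta0.
have Yin : 0 <= sigma0 / eta <= sigma0 / eta by rewrite (ltW Y0) lexx.
have [c1 _] := sol_radius Yin.
have hs : (0 : R) <= 0 < sigma0 by rewrite lexx.
exists ((Num.sqrt (2 * pi))^-1 * (cS s * (2 * (K / (sigma0 / eta) ^+ 2)))) => T T' x k hT hT'.
have h2 : 2 * ckC Mk * (sigma0 / eta) <= sigma0 - 0 by rewrite -mulrA; lra.
have TT : T + (T' - T) = T' by rewrite addrC subrK.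
have h3 : 0 <= T + (T' - T) <= sigma0 / eta by rewrite TT.
have := B_sup x (lexx 0) s2 (cksol_taylor s2 K0 hA hM Mk0 hu0 k hs hT h3 Y0 h2).
rewrite TT => /le_trans; apply; rewrite le_eqVlt; apply/orP; left; apply/eqP; ring.
Qed.

End solution.

(** * Uniqueness *)

Section differences.
Variable R : realType.
Local Notation C := R[i].
Local Notation mu := (@lebesgue_measure R).
Local Notation c0 := (Num.sqrt (2 * pi : R))^-1.
Local Notation cinteg := (@cintegrable _ (measurableTypeR R) R mu setT).
Local Notation cmeasR := (@cmeas _ (measurableTypeR R) R setT).

Fixpoint fdiff (hs : seq R) (f : R -> C) : R -> C :=
  if hs is h :: hs' then fdiff hs' (fun x => f (x + h) - f x) else f.

Definition hprod (hs : seq R) : R := \prod_(h <- hs) `|h|.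

(* The functions with [|f^(n)| <= a n], tested on differences, which commute with derivatives in a parameter. *)
Definition dclass (a : nat -> R) (f : R -> C) : Prop :=
  forall hs x, normc (fdiff hs f x) <= a (size hs) * hprod hs.

Lemma hprod_ge0 hs : 0 <= hprod hs. Proof. by apply: prodr_ge0 => h _. Qed.

Lemma hprod_cons h hs : hprod (h :: hs) = `|h| * hprod hs. Proof. exact: big_cons. Qed.

Lemma fdiff_ext hs f g : (forall x, f x = g x) -> fdiff hs f =1 fdiff hs g.
Proof. by move=> /funext ->. Qed.

Lemma fdiffD hs f g x : fdiff hs (fun y => f y + g y) x = fdiff hs f x + fdiff hs g x.
Proof.
elim: hs f g => //= h hs ih f g; rewrite -ih; apply: fdiff_ext => y.
by rewrite opprD addrACA.
Qed.

Lemma fdiffZ hs c f x : fdiff hs (fun y => c * f y) x = c * fdiff hs f x.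
Proof. by elim: hs f => //= h hs ih f; rewrite -ih; apply: fdiff_ext => y; rewrite mulrBr. Qed.

Lemma fdiffB hs f g x : fdiff hs (fun y => f y - g y) x = fdiff hs f x - fdiff hs g x.
Proof.
rewrite -mulN1r -fdiffZ -fdiffD; apply: fdiff_ext => y; by rewrite mulN1r.
Qed.

Lemma fdiff0 hs x : fdiff hs (fun=> 0) x = 0.
Proof. by elim: hs => //= h hs ih; rewrite -[RHS]ih; apply: fdiff_ext => y; rewrite subr0. Qed.

Lemma fdiff_sum hs N (f_ : nat -> R -> C) x :
  fdiff hs (fun y => \sum_(n < N) f_ n y) x = \sum_(n < N) fdiff hs (f_ n) x.
Proof.
elim: N => [|N ih].
  by rewrite big_ord0 (_ : (fun y => _) = fun=> 0) ?fdiff0//; apply/funext => y; rewrite big_ord0.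
by rewrite big_ord_recr/= -ih -fdiffD; apply: fdiff_ext => y; rewrite big_ord_recr.
Qed.

Lemma fdiff_shift hs h f x : fdiff hs (fun y => f (y + h)) x = fdiff hs f (x + h).
Proof.
elim: hs f => //= k hs ih f; rewrite -ih; apply: fdiff_ext => y.
by rewrite addrAC.
Qed.

Lemma fdiff_step hs h f x : fdiff hs f (x + h) - fdiff hs f x = fdiff (h :: hs) f x.
Proof. by rewrite /= fdiffB fdiff_shift. Qed.

Lemma dclass_le a b f : (forall n, a n <= b n) -> dclass a f -> dclass b f.
Proof. by move=> ab h hs x; apply: le_trans (h hs x) _; rewrite ler_wpM2r// hprod_ge0. Qed.

Lemma dclass_step a f h : dclass a f -> dclass (fun n => a n.+1 * `|h|) (fun x => f (x + h) - f x).
Proof. by move=> hf hs x; have := hf (h :: hs) x; rewrite hprod_cons mulrA. Qed.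

Lemma dclass_shift a f h : dclass a f -> dclass a (fun x => f (x + h)).
Proof. by move=> hf hs x; rewrite fdiff_shift. Qed.

(** Leibniz' rule on the level of bounds for n-th derivatives. *)
Definition binconv (a b : nat -> R) n : R := \sum_(j < n.+1) 'C(n, j)%:R * (a j * b (n - j)%N).

Lemma binconvS a b n : binconv a b n.+1 = binconv a (fun j => b j.+1) n + binconv (fun j => a j.+1) b n.
Proof.
rewrite /binconv big_ord_recl/= bin0 subn0.
rewrite (eq_bigr (fun i : 'I_n.+1 => 'C(n, i.+1)%:R * (a i.+1 * b (n - i)%N) + 'C(n, i)%:R * (a i.+1 * b (n - i)%N))); last first.
  by move=> i _; rewrite /bump leq0n add1n binS natrD mulrDl subSS.
rewrite big_split/= addrA; congr (_ + _).
rewrite big_ord_recr/= bin_small// mul0r addr0 [RHS]big_ord_recl/= bin0 subn0; congr (_ + _).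
apply: eq_bigr => i _; rewrite /bump/= add1n; congr (_ * (_ * b _)).
by rewrite subnSK.
Qed.

Lemma binconvZ a b (c : R) n : binconv (fun j => a j * c) b n = binconv a b n * c.
Proof. by rewrite /binconv mulr_suml; apply: eq_bigr => j _; ring. Qed.

Lemma binconvZr a b (c : R) n : binconv a (fun j => b j * c) n = binconv a b n * c.
Proof. by rewrite /binconv mulr_suml; apply: eq_bigr => j _; ring. Qed.

(** f(x+h) g(x+h) - f(x) g(x) = f(x+h) Dg + (Df) g; the shifted factor has the same bounds, and the
    two terms combine by Pascal's rule [binconvS]. *)
Lemma dclassM a b f g : dclass a f -> dclass b g -> dclass (binconv a b) (fun x => f x * g x).
Proof.
move=> hf hg hs; elim: hs a b f g hf hg => [|h hs ih] a b f g hf hg x.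
  rewrite /binconv/= big_ord1 bin0 mul1r /hprod big_nil mulr1 normcM.
  have := hf [::] x; have := hg [::] x; rewrite /= /hprod big_nil !mulr1 => hg0 hf0.
  by apply: ler_pM; rewrite ?normc_ge0.
have -> : fdiff (h :: hs) (fun x => f x * g x) x =
    fdiff hs (fun x => f (x + h) * (g (x + h) - g x)) x + fdiff hs (fun x => (f (x + h) - f x) * g x) x.
  by rewrite -fdiffD /=; apply: fdiff_ext => y; ring.
apply: le_trans (le_normcD _ _) _.
have h1 := ih _ _ _ _ (@dclass_shift _ _ h hf) (@dclass_step _ _ h hg) x.
have h2 := ih _ _ _ _ (@dclass_step _ _ h hf) hg x.
rewrite binconvZr in h1; rewrite binconvZ in h2.
by rewrite hprod_cons mulrA binconvS mulrDl mulrDl; exact: lerD h1 h2.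
Qed.

Lemma dclassD a b f g : dclass a f -> dclass b g -> dclass (fun n => a n + b n) (fun x => f x + g x).
Proof. by move=> hf hg hs x; rewrite fdiffD mulrDl; apply: le_trans (le_normcD _ _) (lerD _ _). Qed.

Lemma dclassB a b f g : dclass a f -> dclass b g -> dclass (fun n => a n + b n) (fun x => f x - g x).
Proof. by move=> hf hg hs x; rewrite fdiffB mulrDl; apply: le_trans (le_normcB _ _) (lerD _ _). Qed.

Lemma dclassZ a c f : dclass a f -> dclass (fun n => normc c * a n) (fun x => c * f x).
Proof. by move=> hf hs x; rewrite fdiffZ normcM -mulrA ler_wpM2l// normc_ge0. Qed.

Lemma ctends_fdiff hs (u : nat -> R -> C) f x : (forall y, ctends (u^~ y) (f y)) ->
  ctends (fun N => fdiff hs (u N) x) (fdiff hs f x).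
Proof.
elim: hs u f => [|h hs ih] u f hu; first exact: hu.
apply: (ih (fun N y => u N (y + h) - u N y)) => y.
have := ctendsD (hu (y + h)) (ctendsZ (-1) (hu y)); rewrite mulN1r.
by apply: ctends_ext => n; rewrite mulN1r.
Qed.

Lemma cdiffB (f g : R -> C) x l m : cdiff f x l -> cdiff g x m -> cdiff (fun y => f y - g y) x (l - m).
Proof.
move=> [c hf] [c' hg]; exists (c + c') => h.
have -> : f (x + h) - g (x + h) - (f x - g x) - h%:C%C * (l - m) =
  (f (x + h) - f x - h%:C%C * l) - (g (x + h) - g x - h%:C%C * m) by ring.
by rewrite mulrDl; apply: le_trans (le_normcB _ _) (lerD _ _).
Qed.

Lemma cdiff_fdiff hs f f' x : (forall y, cdiff f y (f' y)) -> cdiff (fdiff hs f) x (fdiff hs f' x).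
Proof.
elim: hs f f' => [|h hs ih] f f' hf; first exact: hf.
apply: (ih (fun y => f (y + h) - f y) (fun y => f' (y + h) - f' y)) => y.
apply: (cdiffB (f := fun y => f (y + h))); last exact: hf.
by have [c hc] := hf (y + h); exists c => t; rewrite (addrAC y t h).
Qed.

Lemma cdiff_lip f x l (L : R) : cdiff f x l -> (forall h, normc (f (x + h) - f x) <= L * `|h|) -> normc l <= L.
Proof.
move=> [c hc] hL; apply/ler_addgt0Pl => e e0.
pose t := e / (`|c| + 1); have c1 : 0 < `|c| + 1 by rewrite ltr_wpDl.
have t0 : 0 < t by rewrite divr_gt0.
rewrite -(ler_pM2l t0) -{1}(gtr0_norm t0) -normc_real -normcM.
have -> : t%:C%C * l = (f (x + t) - f x) - (f (x + t) - f x - t%:C%C * l) by rewrite subKr.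
apply: le_trans (le_normcB _ _) _; apply: le_trans (lerD (hL t) (hc t)) _.
rewrite (gtr0_norm t0) mulrDr [t * L]mulrC [leLHS]addrC lerD2r expr2 mulrCA ler_wpM2l ?(ltW t0)//.
rewrite /t mulrA ler_pdivrMr// [e * _]mulrC; apply: ler_wpM2r; first exact: ltW.
by rewrite (le_trans (ler_norm _))// lerDl.
Qed.

(** The derivative of an iterated difference is a limit of quotients, that is, of one more
    difference divided by its step. *)
Lemma dclass_deriv a f f' : (forall x, cdiff f x (f' x)) -> dclass a f -> dclass (fun n => a n.+1) f'.
Proof.
move=> df hf hs x; apply: cdiff_lip (cdiff_fdiff hs x df) _ => h.
by rewrite fdiff_step -mulrA [_ * `|h|]mulrC -hprod_cons; exact: hf.
Qed.

Lemma dclass_sup a f x : dclass a f -> normc (f x) <= a 0%N.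
Proof. by move=> /(_ [::] x); rewrite /hprod big_nil mulr1. Qed.

(** Derivative bounds of a function analytic in a strip of width of order 1 / al. *)
Definition multip (al : R) (n : nat) : R := n`!%:R * al ^+ n.

Lemma multip_ge0 al n : 0 <= al -> 0 <= multip al n.
Proof. by move=> a0; rewrite mulr_ge0// exprn_ge0. Qed.

Definition dsym (hs : seq R) (xi : R) : C := \prod_(h <- hs) (cexpi (1 * (xi * h)) - 1).

Lemma fdiff_IF hs g x : cinteg g ->
  fdiff hs (IF g) x = IF (fun xi => dsym hs xi * g xi) x.
Proof.
elim: hs g => [|h hs ih] g ig /=.
  by congr (IF _ x); apply/funext => xi; rewrite /dsym big_nil mul1r.
have ie : cinteg (fun xi => cexpi (1 * (xi * h)) * g xi).
  have := cintegrable_mulb ig (measurable_expi1 1 h) (fun t => _); rewrite (_ : (fun x => g x * _) = (fun xi => cexpi (1 * (xi * h)) * g xi)).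
    by apply => t; rewrite normc_expi.
  by apply/funext => xi; rewrite mulrC.
have in1 : cinteg (fun xi => -1 * g xi) by exact: cintegrableZ.
have E xi : (cexpi (1 * (xi * h)) - 1) * g xi = cexpi (1 * (xi * h)) * g xi + -1 * g xi by ring.
have ig' : cinteg (fun xi => (cexpi (1 * (xi * h)) - 1) * g xi).
  by rewrite (funext E); exact: cintegrableD.
transitivity (fdiff hs (IF (fun xi => (cexpi (1 * (xi * h)) - 1) * g xi)) x); last first.
  by rewrite ih//; congr (IF _ x); apply/funext => xi; rewrite /dsym big_cons mulrA; congr (_ * _); exact: mulrC.
apply: fdiff_ext => y; rewrite (funext E) IFD// IFZ// mulN1r; congr (_ - _).
rewrite /IF /tf; congr (_ * _); apply: eq_cint => xi _.
have mulAC (a b c : C) : a * (b * c) = c * a * b by ring.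
by rewrite (mulrDr xi) mulrDr cexpiD; exact: mulAC.
Qed.

Lemma exprn_le_expR (x : R) n : 0 <= x -> x ^+ n <= n`!%:R * expR x.
Proof.
move=> x0; case: n => [|n]; first by rewrite expr0 fact0 mul1r -expR0 ler_expR.
rewrite -ler_pdivrMl ?ltr0n ?fact_gt0// mulrC.
by apply: le_trans (expR_ge1Dxn n x0); rewrite lerDr.
Qed.

Lemma cmeas_dsym hs : cmeasR (dsym hs).
Proof.
rewrite /dsym; elim: hs => [|h hs ih].
  by under eq_fun do rewrite big_nil; exact: cmeas_cst.
under eq_fun do rewrite big_cons; apply: cmeasM ih => //.
by apply: cmeasB; [exact: measurable_expi1|exact: cmeas_cst].
Qed.

Lemma normc_dsym hs xi : normc (dsym hs xi) <= `|xi| ^+ size hs * hprod hs.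
Proof.
rewrite /dsym /hprod; elim: hs => [|h hs ih]; first by rewrite !big_nil expr0 mulr1 normc1.
rewrite !big_cons normcM exprS mulrACA; apply: ler_pM; rewrite ?normc_ge0//.
by rewrite mul1r -normrM; exact: cexpi_sub1.
Qed.

(** On the transform side a difference multiplies by e^{i xi h} - 1, at most |xi| |h|; then |xi|^n
    <= n! rho^(-n) e^{rho |xi|} trades the exponential weight for factorial bounds. *)
Lemma B_dclass (rho p K : R) f : 0 < rho -> 1 / 2 < p -> B rho p K f ->
  dclass (fun n => c0 * (cS p * K) * multip rho^-1 n) f.
Proof.
move=> r0 p2 [K0 [g [mg hg fE]]] hs x.
have [ig _] := wt_integ p2 (ltW r0) K0 mg hg.
pose q := dsym hs; have mq : cmeasR q := cmeas_dsym hs; have qle := normc_dsym hs.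
set c := multip rho^-1 (size hs) * hprod hs.
have c_ge0 : 0 <= c by rewrite mulr_ge0 ?hprod_ge0// multip_ge0// invr_ge0 ltW.
have Bq : B 0 p (c * K) (fdiff hs f).
  split; first exact: mulr_ge0.
  exists (fun xi => q xi * g xi); split; first exact: cmeasM.
    have := L2leZ c hg; rewrite ger0_norm//; apply: L2le_le.
      by apply: measurable_wtM; exact: cmeasM.
    move=> xi; rewrite normr_wtM normcM.
    have -> : wt rho p xi = wt 0 p xi * wt rho 0 xi by rewrite -wtD addr0 add0r.
    have qc : normc (q xi) <= c * wt rho 0 xi.
      apply: le_trans (qle xi) _; rewrite /c mulrAC; apply: ler_wpM2r; first exact: hprod_ge0.
      have h := exprn_le_expR (size hs) (mulr_ge0 (ltW r0) (normr_ge0 xi)).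
      rewrite wt_expR /multip mulrAC exprVn ler_pdivlMr ?exprn_gt0// mulrC -exprMn.
      apply: le_trans h _; rewrite ler_wpM2l// ler_expR ler_wpM2l ?(ltW r0)// /kk lerDr//.
    have w0 := ltW (wt_gt0 0 p xi).
    have h := ler_wpM2r (mulr_ge0 w0 (normc_ge0 (g xi))) qc.
    move: h; congr (_ <= _); ring.
  by move=> y; rewrite (fdiff_ext hs fE) fdiff_IF.
apply: le_trans (B_sup x (lexx 0) p2 Bq) _.
by rewrite le_eqVlt /c; apply/orP; left; apply/eqP; ring.
Qed.

Lemma dclass0 a f : dclass a f -> 0 <= a 0%N.
Proof. by move=> /(dclass_sup 0); apply: le_trans; exact: normc_ge0. Qed.

(** The binomial times j! is a falling factorial of n, at most the one of n + m. *)
Lemma bin_fact_le n m j : (j <= n)%N -> ('C(n, j) * (j`! * (n - j + m)`!) <= (n + m)`!)%N.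
Proof.
move=> jn; rewrite mulnA bin_ffact -(@ffact_fact (n + m) j); last exact: leq_trans (leq_addr _ _).
by rewrite addnBAC// leq_mul2r !ffact_prod leq_prod ?orbT// => i _; rewrite leq_sub2r// leq_addr.
Qed.

(** A derivative moves m to m + 1 at the price of [al] ([shclassS]); the accumulated m! is
    compensated by the 1 / m! of m integrations in time. *)
Definition shclass (al : R) m (n : nat) : R := (n + m)`!%:R * al ^+ n.

(** The halves in [K / 2] and [al / 2] turn the Leibniz sum into a geometric sum of 2^(-j-1), at
    most 1, so that products cost no constant. *)
Lemma binconv_shclass al m K K' n : 0 <= al -> 0 <= K -> 0 <= K' ->
  binconv (fun i => K / 2 * multip (al / 2) i) (fun i => K' * shclass al m i) n <= K * K' * shclass al m n.
Proof.
move=> a0 K0 K'0; rewrite /binconv.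
have half k : \sum_(j < k) (1 / 2 : R) ^+ j.+1 <= 1.
  suff -> : \sum_(j < k) (1 / 2 : R) ^+ j.+1 = 1 - (1 / 2) ^+ k by rewrite gerBl exprn_ge0// divr_ge0.
  elim: k => [|k ih]; first by rewrite big_ord0 expr0 subrr.
  by rewrite big_ord_recr/= ih exprS; field.
have c0 : 0 <= K * K' * shclass al m n by rewrite !mulr_ge0// exprn_ge0.
apply: le_trans (_ : \sum_(j < n.+1) (1 / 2) ^+ j.+1 * (K * K' * shclass al m n) <= _); last first.
  by rewrite -mulr_suml ler_piMl.
apply: ler_sum => j _; have jn : (j <= n)%N by rewrite -ltnS.
have E : al ^+ n = al ^+ j * al ^+ (n - j) by rewrite -exprD subnKC.
rewrite /multip /shclass E.
have -> : 'C(n, j)%:R * (K / 2 * (j`!%:R * (al / 2) ^+ j) * (K' * ((n - j + m)`!%:R * al ^+ (n - j)))) =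
  ('C(n, j) * (j`! * (n - j + m)`!))%:R * ((1 / 2) ^+ j.+1 * (K * K' * (al ^+ j * al ^+ (n - j)))) :> R.
  rewrite !natrM exprS [(al / 2) ^+ j]exprMn mul1r.
  move: ('C(n, j)%:R : R) (j`!%:R : R) ((n - j + m)`!%:R : R) (al ^+ j) (al ^+ (n - j)) (2^-1 ^+ j : R) => a b c x y z.
  by field.
have -> : (1 / 2) ^+ j.+1 * (K * K' * ((n + m)`!%:R * (al ^+ j * al ^+ (n - j)))) =
  (n + m)`!%:R * ((1 / 2) ^+ j.+1 * (K * K' * (al ^+ j * al ^+ (n - j)))) :> R by ring.
apply: ler_wpM2r; last by rewrite ler_nat bin_fact_le.
apply: mulr_ge0; first by rewrite exprn_ge0// divr_ge0.
by apply: mulr_ge0; [exact: mulr_ge0|apply: mulr_ge0; exact: exprn_ge0].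
Qed.

Definition diff_scale (al : R) (m : nat) (a0 : 0 <= al) : scale R R.
Proof.
apply: (@Scale R R (fun K f => dclass (fun i => K / 2 * multip (al / 2) i) f)
  (fun K f => dclass (fun i => K * shclass al m i) f)).
- by move=> K K' f KK'; apply: dclass_le => n; rewrite ler_wpM2r// mulr_ge0// exprn_ge0.
- by move=> K f f' /funext ->.
- by move=> K c f /(dclassZ c); apply: dclass_le => n; rewrite mulrA.
- by move=> K K' f f' h h'; apply: dclass_le (dclassD h h') => n; rewrite mulrDl.
- by move=> hs x; rewrite fdiff0 !mul0r normc0.
- move=> K K' f f' h h'; apply: dclass_le (dclassM h h') => n; apply: binconv_shclass => //.
  + by have := dclass0 h; rewrite /multip fact0 expr0 mulr1 mulr1 pmulr_lge0// invr_gt0.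
  + by have := dclass0 h'; rewrite /shclass expr0 mulr1 pmulr_lge0// ltr0n fact_gt0.
- move=> K_ K f_ h hK; exists (fun x => csum (fun n => f_ n x)) => [hs x|x].
    have cf y : ctends (fun N => \sum_(n < N) f_ n y) (csum (fun n => f_ n y)).
      apply: (@csum_cvg _ _ (fun n => K_ n * shclass al m 0) (K * shclass al m 0)) => [n|N].
        exact: dclass_sup (h n).
      by rewrite -mulr_suml ler_wpM2r// mulr_ge0// exprn_ge0.
    apply: ctends_bound (ctends_fdiff hs x cf) => N.
    rewrite fdiff_sum; apply: le_trans (normc_sum _ _ _) _.
    apply: (@le_trans _ _ (\sum_(n < N) K_ n * shclass al m (size hs) * hprod hs)).
      by apply: ler_sum => n _; exact: h.
    rewrite -!mulr_suml; apply: ler_wpM2r; first exact: hprod_ge0.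
    by apply: ler_wpM2r; rewrite // mulr_ge0// exprn_ge0.
  apply: (@csum_cvg _ _ (fun n => K_ n * shclass al m 0) (K * shclass al m 0)) => [n|N].
    exact: dclass_sup (h n).
  by rewrite -mulr_suml ler_wpM2r// mulr_ge0// exprn_ge0.
Defined.

End differences.

Section uniqueness.
Variables (R : realType) (d : nat).
Local Notation Re := (@complex.Re R).
Local Notation Im := (@complex.Im R).
Local Notation C := R[i].
Local Notation Z := ('I_d -> C).

Lemma is_derive_mon (c q a r : R) m :
  is_derive r 1 (fun r => c * (q * (r - a)) ^+ m.+1) (c * (m.+1%:R * (q * (r - a)) ^+ m * q)).
Proof.
have h : is_derive r 1 (fun r => q * (r - a)) q.
  by apply: is_derive_eq; rewrite subr0 /GRing.scale/= mulr1.
have := is_deriveZ c (is_deriveX m.+1 h).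
by rewrite exprfctE.
Qed.

Lemma is_cderiveB (f g : R -> C) t l m : is_cderive f t l -> is_cderive g t m ->
  is_cderive (fun r => f r - g r) t (l - m).
Proof.
move=> [a1 a2] [b1 b2]; split.
  rewrite ReDc ReNc (_ : _ \o _ = (fun r => Re (f r)) - (fun r => Re (g r))); last first.
    by apply/funext => r; rewrite /= ReDc ReNc.
  exact: is_deriveB.
rewrite ImDc ImNc (_ : _ \o _ = (fun r => Im (f r)) - (fun r => Im (g r))); last first.
  by apply/funext => r; rewrite /= ImDc ImNc.
exact: is_deriveB.
Qed.

Lemma is_cderive_fdiff hs (f : R -> R -> C) f' t x : (forall y, is_cderive (f^~ y) t (f' y)) ->
  is_cderive (fun r => fdiff hs (f r) x) t (fdiff hs f' x).
Proof.
elim: hs f f' => [|h hs ih] f f' hf; first exact: hf.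
by apply: (ih (fun r y => f r (y + h) - f r y) (fun y => f' (y + h) - f' y)) => y; exact: is_cderiveB.
Qed.

Lemma within_fdiff (P : C -> R) (A : set R) hs (f : R -> R -> C) x : (forall a b, P (a - b) = P a - P b) ->
  (forall y, {within A, continuous (fun r => P (f r y))}) ->
  {within A, continuous (fun r => P (fdiff hs (f r) x))}.
Proof.
move=> PB; elim: hs f => [|h hs ih] f hf; first exact: hf.
apply: (ih (fun r y => f r (y + h) - f r y)) => y.
under eq_fun do rewrite PB.
by move=> r; apply: cvgB; exact: hf.
Qed.

Variables (Phi : 'I_d -> 'I_d -> Z -> C) (rho al N : R) (Nkl : 'I_d -> 'I_d -> R).
Hypotheses (rho0 : 0 < rho) (al0 : 0 < al) (N0 : 0 <= N).
Hypothesis hPhi : forall k l, PS (2 * rho) (Nkl k l) (Phi k l).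
Hypothesis hN : forall k, \sum_l Nkl k l <= N.

Variables (b : R) (u v uX vX : R -> R -> Z).
(** The rate is al / 4 because one halving pays for differentiating once ([multip_double]) and the
    other for acting as a multiplier in [diff_scale]. *)
Let bounded (w : R -> R -> Z) := forall t k, 0 <= t <= b -> dclass (fun i => rho / 2 * multip (al / 4) i) (fun x => w t x k).
Let rhs (w wX : R -> R -> Z) t x k := \sum_l Phi k l (w t x) * wX t x l.
Let solves (w wX : R -> R -> Z) :=
  [/\ bounded w, forall t x k, 0 < t < b -> cdiff (fun y => w t y k) x (wX t x k),
      forall t x k, 0 < t < b -> is_cderive (fun r => w r x k) t (rhs w wX t x k) &
      forall x k, {within `[0, b], continuous (fun t => Re (w t x k))} /\
                  {within `[0, b], continuous (fun t => Im (w t x k))}].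
Hypotheses (hu : solves u uX) (hv : solves v vX).

Lemma multip_double i : multip (al / 4) i.+1 <= al / 4 * multip (al / 2) i.
Proof.
have E : al / 2 = 2 * (al / 4) :> R by field.
rewrite /multip E [(2 * _) ^+ i]exprMn exprS factS natrM.
have p0 : 0 <= i`!%:R * (al / 4 * (al / 4) ^+ i) :> R.
  by rewrite mulr_ge0// mulr_ge0 ?exprn_ge0// divr_ge0// ltW.
have h : i.+1%:R <= 2 ^+ i :> R by rewrite -natrX ler_nat ltn_expl.
have := ler_wpM2r p0 h; move: (al / 4) (i.+1%:R : R) (i`!%:R : R) (2 ^+ i : R) => q x y z.
move: (q ^+ i) => w; by congr (_ <= _); ring.
Qed.

Lemma multip_quarter i : multip (al / 4) i <= multip (al / 2) i.
Proof.
rewrite /multip ler_wpM2l// lerXn2r ?nnegrE ?divr_ge0 ?(ltW al0)// ler_pM2l//.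
by rewrite lef_pV2 ?posrE// ler_nat.
Qed.

Lemma shclassS m i : shclass al m i.+1 = al * shclass al m.+1 i.
Proof. by rewrite /shclass addSnnS exprS mulrCA. Qed.

Lemma shclass_le m i : shclass al m i <= shclass al m.+1 i.
Proof.
rewrite /shclass ler_wpM2r ?exprn_ge0 ?(ltW al0)// ler_nat addnS factS.
by rewrite leq_pmull.
Qed.

(** M(u) u_x - M(v) v_x = M(u) (u - v)_x + (M(u) - M(v)) v_x. The first term differentiates the
    difference and raises m to m + 1; the second is handled by [PS_lip]. Together they cost 5/4 al N
    D, rounded up to 2 al N D. *)
Lemma rhs_bound m D t k : 0 < t < b -> 0 <= D ->
  (forall k, dclass (fun i => D * shclass al m i) (fun x => u t x k - v t x k)) ->
  dclass (fun i => 2 * al * N * D * shclass al m.+1 i) (fun x => rhs u uX t x k - rhs v vX t x k).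
Proof.
move=> tb D0 hw; have [ub duX _ _] := hu; have [vb dvX _ _] := hv.
have tb' : 0 <= t <= b by move: tb => /andP[/ltW -> /ltW ->].
pose S := diff_scale m.+1 (ltW al0).
have small (w : R -> R -> Z) K j : bounded w -> rho <= K -> sU S K (fun x => w t x j).
  move=> wb rK; apply: dclass_le (wb t j tb') => i; apply: ler_pM; last exact: multip_quarter.
  - by rewrite divr_ge0// ltW.
  - by apply: multip_ge0; rewrite divr_ge0// ltW.
  - by rewrite ler_wpM2r// invr_ge0.
have bnd (w : R -> R -> Z) x j : bounded w -> normc (w t x j) <= rho.
  move=> wb; apply: le_trans (dclass_sup x (wb t j tb')) _.
  by rewrite /multip fact0 expr0 !mulr1 ler_pdivrMr// ler_peMr ?ler1n// ltW.
have r2 : rho <= 2 * rho by rewrite ler_peMl ?ler1n// ltW.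
have dX (w wX : R -> R -> Z) j : bounded w -> (forall t x k, 0 < t < b -> cdiff (fun y => w t y k) x (wX t x k)) ->
    sU S (rho * (al / 4)) (fun x => wX t x j).
  move=> wb dw; apply: dclass_le (dclass_deriv (fun x => dw t x j tb) (wb t j tb')) => i.
  rewrite [leRHS](_ : _ = rho / 2 * (al / 4 * multip (al / 2) i)); last by ring.
  by rewrite ler_wpM2l ?divr_ge0 ?(ltW rho0)//; exact: multip_double.
have h1 l : sP S (Nkl k l * (D * al)) (fun x => Phi k l (u t x) * (uX t x l - vX t x l)).
  apply: (PS_comp (rho := 2 * rho)) => //.
  - by rewrite mulr_ge0// ltW.
  - by move=> j; exact: small.
  - by move=> x j; apply: le_trans (bnd _ _ _ ub) r2.
  - by rewrite mulr_ge0// ltW.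
  apply: dclass_le (dclass_deriv (f := fun x => u t x l - v t x l) _ (hw l)) => [i|x].
    by rewrite shclassS mulrA.
  by apply: cdiffB; [exact: duX|exact: dvX].
have h2 l : sP S (Nkl k l / rho * (rho * (al / 4) * D)) (fun x => (Phi k l (u t x) - Phi k l (v t x)) * vX t x l).
  apply: PS_lip => //.
  - by move=> j; exact: small.
  - by move=> j; exact: small.
  - by move=> x j; exact: bnd.
  - by move=> x j; exact: bnd.
  - by rewrite !mulr_ge0 ?invr_ge0// ltW.
  move=> j; have hj : sP S D (fun x => u t x j - v t x j).
    by apply: dclass_le (hw j) => i; rewrite ler_wpM2l//; exact: shclass_le.
  by apply: sP_ext (sP_mul (dX v vX l vb dvX) hj) => x; exact: mulrC.
have h := sP_sum (fun l => sP_add (h1 l) (h2 l)).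
apply: sP_le (sP_ext _ h) => [|x]; last first.
  by rewrite /rhs -sumrB; apply: eq_bigr => l _; ring.
rewrite (eq_bigr (fun l => Nkl k l * (5 / 4 * al * D))); last first.
  by move=> l _; move: (Nkl k l) rho0 => n r0; field; rewrite gt_eqF.
rewrite -mulr_suml; apply: le_trans (ler_wpM2r _ (hN k)) _; first by rewrite !mulr_ge0// ltW.
have := mulr_ge0 N0 (mulr_ge0 (ltW al0) D0); nra.
Qed.

(** Induction on m: the start is the bound on the two solutions, and the mean value inequality in
    time, applied to each iterated difference, integrates [rhs_bound]. *)
Lemma unique_step a m t k : 0 <= a <= b -> (forall x k, u a x k = v a x k) -> a <= t <= b ->
  dclass (fun i => rho * (2 * al * N * (t - a)) ^+ m / m`!%:R * shclass al m i) (fun x => u t x k - v t x k).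
Proof.
move=> /andP[a0 ab] uva; have [ub _ cu wu] := hu; have [vb _ cv wv] := hv.
elim: m t k => [|m ih] t k /andP[at0 tb].
  have t0b : 0 <= t <= b by rewrite tb (le_trans a0).
  apply: dclass_le (dclassB (ub t k t0b) (vb t k t0b)) => i.
  rewrite expr0 fact0 divr1 mulr1 -mulrDl -splitr ler_wpM2l ?(ltW rho0)//.
  rewrite /shclass addn0 /multip ler_wpM2l// lerXn2r ?nnegrE ?divr_ge0 ?(ltW al0)//.
  by rewrite ler_pdivrMr// ler_peMr ?ltW// ltr1n.
move=> hs x.
pose Q := 2 * al * N; pose H := rho * (shclass al m.+1 (size hs) * hprod hs).
(* The majorant vanishing at [a], whose derivative [g'] is the bound furnished by [rhs_bound] and
   the induction hypothesis. *)
pose g := fun r : R => H / m.+1`!%:R * (Q * (r - a)) ^+ m.+1.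
pose g' := fun r : R => H / m`!%:R * Q * (Q * (r - a)) ^+ m.
have itv r : r \in `]a, t[ -> [/\ a < r, r < t & 0 < r < b].
  rewrite in_itv/= => /andP[ar rt]; split=> //; rewrite (le_lt_trans a0)//=.
  exact: lt_le_trans tb.
have sub : `[a, t] `<=` `[0, b].
  move=> r /=; rewrite !in_itv/= => /andP[ar rt].
  by rewrite (le_trans a0)//= (le_trans rt).
have dg (r : R) : is_derive r 1 g (g' r).
  rewrite (_ : g' r = H / m.+1`!%:R * (m.+1%:R * (Q * (r - a)) ^+ m * Q)); first exact: is_derive_mon.
  rewrite /g' factS natrM.
  have f0 : m`!%:R != 0 :> R by rewrite pnatr_eq0 -lt0n fact_gt0.
  have m0 : m.+1%:R != 0 :> R by rewrite pnatr_eq0.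
  move: (m.+1%:R : R) (m`!%:R : R) f0 m0 ((Q * (r - a)) ^+ m) => p q p0 q0 z; field.
  by rewrite p0 q0.
have cw (P : C -> R) : (forall p q, P (p - q) = P p - P q) -> (forall x, {within `[0, b], continuous (fun r => P (u r x k))}) ->
   (forall x, {within `[0, b], continuous (fun r => P (v r x k))}) ->
   {within `[a, t], continuous (P \o (fun r => fdiff hs (fun x => u r x k - v r x k) x))}.
  move=> PB hPu hPv; apply: continuous_subspaceW sub _.
  apply: (within_fdiff (f := fun r x => u r x k - v r x k)) => // y.
  rewrite (_ : (fun r => _) = fun r => P (u r y k) - P (v r y k)); last by apply/funext => r; exact: PB.
  by move=> r; apply: cvgB; [exact: hPu|exact: hPv].
have := @complex_mvt R (fun r => fdiff hs (fun x => u r x k - v r x k) x)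
  (fun r => fdiff hs (fun x => rhs u uX r x k - rhs v vX r x k) x) g g' a t at0.
have -> : fdiff hs (fun x => u a x k - v a x k) x = 0.
  by rewrite -(fdiff0 hs x); apply: fdiff_ext => y; rewrite uva subrr.
have -> : g a = 0 by rewrite /g subrr mulr0 expr0n/= mulr0.
rewrite !subr0 => mvt.
apply: le_trans (mvt _ (fun r _ => dg r) _ _ _ _) _.
- move=> r /itv[_ _ r0b]; apply: (@is_cderive_fdiff hs (fun r x => u r x k - v r x k)) => y.
  by apply: is_cderiveB; [exact: cu|exact: cv].
- by apply: cw => [p q|y|y]; [rewrite ReDc ReNc|have [] := wu y k|have [] := wv y k].
- by apply: cw => [p q|y|y]; [rewrite ImDc ImNc|have [] := wu y k|have [] := wv y k].
- by apply: continuous_subspaceT => r; have [/derivable1_diffP/differentiable_continuous] := dg r.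
- move=> r /itv[ar rt r0b].
  have art : a <= r <= b by rewrite ltW//= ltW//; case/andP: r0b.
  have D0 : 0 <= rho * (2 * al * N * (r - a)) ^+ m / m`!%:R.
    rewrite divr_ge0// mulr_ge0 ?(ltW rho0)// exprn_ge0// mulr_ge0 ?subr_ge0 ?(ltW ar)//.
    by rewrite mulr_ge0// mulr_ge0// ltW.
  apply: le_trans (rhs_bound k r0b D0 (fun k => ih r k art) hs x) _.
  by rewrite /g' /H -/Q le_eqVlt; apply/orP; left; apply/eqP; ring.
by rewrite /g /H -/Q le_eqVlt; apply/orP; left; apply/eqP; ring.
Qed.

(** Without differences the m! of [shclass] cancels 1 / m!, leaving rho q^m with q <= 1/2, for every
    m. *)
Lemma unique_near a t x k : 0 <= a <= b -> (forall x k, u a x k = v a x k) -> a <= t <= b ->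
  4 * al * N * (t - a) <= 1 -> u t x k = v t x k.
Proof.
move=> ab uva atb small; apply/eqP; rewrite -subr_eq0 -normc_eq0 eq_le normc_ge0 andbT.
have at0 : 0 <= t - a by rewrite subr_ge0; case/andP: atb.
set w := normc _; set q := 2 * al * N * (t - a).
have q0 : 0 <= q by rewrite /q mulr_ge0// mulr_ge0// mulr_ge0// ltW.
have q1 : `|q| < 1 by rewrite ger0_norm// /q; lra.
have wle m : w <= rho * q ^+ m.
  have := dclass_sup x (unique_step m k ab uva atb); rewrite /shclass expr0 mulr1 add0n divfK//.
have cv : rho * q ^+ m @[m --> \oo] --> rho * 0 by apply: cvgM; [exact: cvg_cst|exact: cvg_expr].
by rewrite mulr0 in cv; exact: le_cvg wle cv.
Qed.

(** Continuation in steps of the fixed length 1 / D, on each of which [unique_near] applies. *)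
Lemma unique_sol t x k : (forall x k, u 0 x k = v 0 x k) -> 0 <= t <= b -> u t x k = v t x k.
Proof.
move=> uv0 /andP[t0 tb]; pose D := 4 * al * N + 1.
have D1 : 0 < D by rewrite ltr_wpDl// mulr_ge0// mulr_ge0// ltW.
have b0 : 0 <= b := le_trans t0 tb.
suff H n : forall t x k, 0 <= t <= b -> t <= n%:R / D -> u t x k = v t x k.
  apply: (H (Num.bound (t * D))); first by rewrite t0.
  by rewrite ler_pdivlMr// ltW// archi_boundP// mulr_ge0// ltW.
elim: n => [|n ih] r y j /andP[r0 rb] rn.
  by have -> : r = 0 by apply/eqP; rewrite eq_le r0 andbT; rewrite mul0r in rn.
have [rle|rgt] := leP r (n%:R / D); first by apply: ih; rewrite ?r0.
have n0 : 0 <= n%:R / D by rewrite divr_ge0// ltW.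
have nb : n%:R / D <= b by apply: le_trans rb; exact: ltW.
apply: (unique_near (a := n%:R / D)); rewrite ?n0 ?(ltW rgt) ?rb//.
- by move=> z l; apply: ih; rewrite ?n0.
- apply: (@le_trans _ _ (D * D^-1)); last by rewrite mulfV// gt_eqF.
  apply: ler_pM; rewrite ?subr_ge0 ?(ltW rgt)//; first by rewrite !mulr_ge0// ltW.
    by rewrite /D lerDl.
  by move: rn; rewrite -natr1 mulrDl mul1r lerBlDl.
Qed.

End uniqueness.

(** * Vector-valued Fourier transforms *)

Section vector_fourier.
Variables (R : realType) (d : nat).
Local Notation C := R[i].
Local Notation V := 'cV[C]_d.
Local Notation mu := (@lebesgue_measure R).
Local Notation c0 := (Num.sqrt (2 * pi : R))^-1.
Local Notation cinteg := (@cintegrable _ (measurableTypeR R) R mu setT).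
Local Notation cmeasR := (@cmeas _ (measurableTypeR R) R setT).
Local Notation comp u := (fun i x => (u : R -> V) x i 0).

Lemma cvec_normE (v : V) : cvec_norm v = Num.sqrt (\sum_i normc (v i 0) ^+ 2).
Proof. by congr Num.sqrt; apply: eq_bigr => i _; rewrite sqr_normcE. Qed.

Lemma cvec_norm_comp (u : R -> V) x : cvec_norm (u x) = cnorm (comp u) x.
Proof. exact: cvec_normE. Qed.

Lemma cnorm_sqr (g : 'I_d -> R -> C) x : cnorm g x ^+ 2 = \sum_i normc (g i x) ^+ 2.
Proof. by rewrite sqr_sqrtr// sumr_ge0// => i _; exact: sqr_ge0. Qed.

Lemma normc_le_cnorm (g : 'I_d -> R -> C) i x : normc (g i x) <= cnorm g x.
Proof.
rewrite -(@ler_pXn2r _ 2)// ?nnegrE ?normc_ge0 ?sqrtr_ge0// cnorm_sqr (bigD1 i)//= lerDl.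
by apply: sumr_ge0 => j _; exact: sqr_ge0.
Qed.

Lemma L2le_cnorm (K : 'I_d -> R) (g : 'I_d -> R -> C) (r : R) : (forall i, cmeasR (g i)) ->
  (forall i, L2le mu (K i) (fun x => normc (g i x))) -> 0 <= r -> \sum_i K i ^+ 2 <= r ^+ 2 ->
  L2le mu r (cnorm g).
Proof.
move=> mg gK r0 Kr; split; first exact: measurable_cnorm.
apply: le_trans (_ : (\sum_i (K i ^+ 2)%:E <= _)%E); last by rewrite sumEFin lee_fin.
have -> : (\int[mu]_x (cnorm g x ^+ 2)%:E = \sum_i \int[mu]_x (normc (g i x) ^+ 2)%:E)%E.
  rewrite -ge0_integral_sum//.
  - by apply: eq_integral => x _; rewrite cnorm_sqr sumEFin.
  - by move=> i; apply/measurable_EFinP; apply: (measurable_funX 2); exact: measurable_normc (mg i).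
  - by move=> i x _; rewrite lee_fin sqr_ge0.
by apply: lee_sum => i _; exact: (gK i).2.
Qed.

Lemma L2norm_le (f : R -> V) (r : R) : cvec_measurable f -> 0 <= r ->
  (L2norm f <= r%:E)%E <-> L2le mu r (cnorm (comp f)).
Proof.
move=> mf r0; have mn : measurable_fun [set: R] (cnorm (comp f)) by exact: measurable_cnorm mf.
have n2 : (2 : R) != 0 by [].
have E : (L2norm f `^ 2 = \int[mu]_x (cnorm (comp f) x ^+ 2)%:E)%E.
  rewrite /L2norm powR_Lnorm//; apply: eq_integral => x _.
  rewrite /= cvec_norm_comp ger0_norm ?sqrtr_ge0//.
  by rewrite -(powR_mulrn 2) ?sqrtr_ge0.
have r2 : (r%:E `^ 2 = (r ^+ 2)%:E)%E by rewrite poweR_EFin powR_mulrn.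
have N0 : (0 <= L2norm f)%E by exact: Lnorm_ge0.
split=> [h|[_]].
  split=> //; rewrite -E -r2; apply: gt0_ler_poweR => //.
  - by rewrite in_itv/= N0 leey.
  - by rewrite in_itv/= lee_fin r0 leey.
rewrite -E -r2 => h.
have h2 : ((L2norm f `^ 2) `^ 2^-1 <= (r%:E `^ 2) `^ 2^-1)%E.
  apply: gt0_ler_poweR => //.
  - by rewrite in_itv/= leey andbT; exact: poweR_ge0.
  - by rewrite r2 in_itv/= leey andbT lee_fin sqr_ge0.
by move: h2; rewrite -!poweRrM mulfV// !poweRe1.
Qed.

Lemma fourier_truncE (a : R) (u : R -> V) xi i : fourier_trunc a u xi i 0 = FT a (comp u i) xi.
Proof.
rewrite mxE /FT /tf; congr (_ * _); rewrite /cintegral.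
have mI : measurable (`[- a, a]%classic : set (measurableTypeR R)) by exact: measurable_itv.
rewrite /cint; congr Complex; rewrite /Rintegral integral_mkcond; congr fine; apply: eq_integral => x _.
  rewrite patchE /trunc indicE mulN1r cexpiNE; case: ifPn => _; last by rewrite !mul0r.
  by rewrite mul1r.
rewrite patchE /trunc indicE mulN1r cexpiNE; case: ifPn => _; last by rewrite !mul0r.
by rewrite mul1r.
Qed.

Lemma cvg_ereal0P (f : R -> \bar R) : (forall a, (0 <= f a)%E) ->
  f a @[a --> +oo] --> 0%E <-> forall e : R, 0 < e -> exists A : R, forall a, A <= a -> (f a <= e%:E)%E.
Proof.
move=> f0; split.
  move=> /fine_cvgP[ffin]; move/cvgrPdist_le => cv e e0.
  have := filterI ffin (cv e e0) => -[A [_ hA]].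
  exists (A + 1) => a Aa; have [] := hA a; first by apply: lt_le_trans Aa; rewrite ltrDl.
  move=> fa; rewrite sub0r normrN -[X in (X <= _)%E]fineK// lee_fin => h.
  exact: le_trans (ler_norm _) h.
move=> h; apply/fine_cvgP; split.
  have [A hA] := h 1 ltr01; exists A; split; first exact: num_real.
  move=> a /ltW /hA h1; rewrite fin_numE -ltey; apply/andP; split.
    by rewrite -ltNye (lt_le_trans _ (f0 a)).
  exact: le_lt_trans h1 (ltry _).
apply/cvgrPdist_le => e e0; have [A hA] := h e e0; exists A; split; first exact: num_real.
move=> a /ltW /hA h1; rewrite sub0r normrN ger0_norm ?fine_ge0//.
have ff : f a \is a fin_num.
  rewrite fin_numE -ltey -ltNye (lt_le_trans _ (f0 a))//=; exact: le_lt_trans h1 (ltry _).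
by rewrite -lee_fin fineK.
Qed.

Lemma square_integrableP (u : R -> V) : square_integrable u <-> forall i, L2f (comp u i).
Proof.
split=> [[mu_ uoo] i|h].
  have r0 : 0 <= fine (L2norm u) by rewrite fine_ge0// Lnorm_ge0.
  have h : (L2norm u <= (fine (L2norm u))%:E)%E by rewrite fineK// ge0_fin_numE// Lnorm_ge0.
  have {}h := (L2norm_le mu_ r0).1 h.
  split; first exact: mu_; exists (fine (L2norm u)) => //; apply: L2le_le h.
    by apply: measurable_normc; exact: mu_.
  by move=> x; rewrite ger0_norm ?normc_ge0//; exact: (normc_le_cnorm (comp u)).
have hK0 i : exists K, 0 <= K /\ L2le mu K (fun x => normc (u x i 0)) by have [_ [K]] := h i; exists K.
have [K hK] := choice hK0.
have mu_ : cvec_measurable u by move=> i; exact: (h i).1.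
split=> //; set r := Num.sqrt (\sum_i K i ^+ 2).
have r0 : 0 <= r by exact: sqrtr_ge0.
apply: le_lt_trans ((L2norm_le mu_ r0).2 _) (ltry _).
apply: (@L2le_cnorm K) => //; first by move=> i; have [] := hK i.
by rewrite sqr_sqrtr// sumr_ge0// => i _; exact: sqr_ge0.
Qed.

Lemma cvec_measurableB (v w : R -> V) : cvec_measurable v -> cvec_measurable w ->
  cvec_measurable (fun x => v x - w x).
Proof.
move=> mv mw i; rewrite (_ : (fun x => complex.Re _) = fun x => complex.Re (v x i 0 - w x i 0)); last first.
  by apply/funext => x; rewrite !mxE.
rewrite (_ : (fun x => complex.Im _) = fun x => complex.Im (v x i 0 - w x i 0)); last first.
  by apply/funext => x; rewrite !mxE.
exact: (cmeasB (mv i) (mw i)).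
Qed.

Lemma cvec_measurable_trunc a (u : R -> V) : square_integrable u -> cvec_measurable (fourier_trunc a u).
Proof.
move=> /square_integrableP hu i.
have E : (fun x => fourier_trunc a u x i 0) = FT a (comp u i) by apply/funext => x; exact: fourier_truncE.
have := cmeas_FT a (hu i); rewrite -E; exact.
Qed.

Lemma is_fourierP (u v : R -> V) : square_integrable u ->
  is_fourier u v <-> forall i, isF (comp u i) (comp v i).
Proof.
move=> su; pose D a := fun xi => v xi - fourier_trunc a u xi.
have DE a i : (fun x => normc (D a x i 0)) = fun x => normc (v x i 0 - FT a (comp u i) x).
  by apply/funext => x; rewrite !mxE -fourier_truncE !mxE.
have mD a : cvec_measurable v -> cvec_measurable (D a).
  by move=> mv; apply: cvec_measurableB => //; exact: cvec_measurable_trunc.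
have N0 a : (0 <= L2norm (D a))%E by exact: Lnorm_ge0.
split=> [[sv /(cvg_ereal0P N0) cv] i|h].
  have vL := (square_integrableP v).1 sv; split; first exact: vL.
  move=> e e0; have [A hA] := cv e e0; exists A => a Aa.
  have h := (L2norm_le (mD a sv.1) (ltW e0)).1 (hA a Aa).
  rewrite -DE; apply: L2le_le h; first by apply: measurable_normc; exact: (mD a sv.1).
  by move=> x; rewrite ger0_norm ?normc_ge0//; exact: (normc_le_cnorm (comp (D a))).
have sv : square_integrable v by apply/square_integrableP => i; exact: (h i).1.
split=> //; apply/(cvg_ereal0P N0) => e e0.
(* The d components, each at most e / (d + 1), combine to at most e, also for d = 0. *)
have e1 : 0 < e / d.+1%:R by rewrite divr_gt0.
have [A hA] := choice (fun i => (h i).2 _ e1).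
exists (\sum_i `|A i|) => a Aa; apply: ((L2norm_le (mD a sv.1) (ltW e0)).2 _).
apply: (@L2le_cnorm (fun=> e / d.+1%:R)); [by move=> i; exact: (mD a sv.1)| |exact: ltW|].
  move=> i; rewrite (DE a i); apply: hA; apply: le_trans Aa; rewrite (bigD1 i)//=.
  by rewrite (le_trans (ler_norm _))// lerDl sumr_ge0.
rewrite sumr_const card_ord expr_div_n -(mulr_natr _ d) -mulrA ler_piMr ?sqr_ge0//.
rewrite mulrC ler_pdivrMr ?exprn_gt0// mul1r -natrX ler_nat.
by rewrite (leq_trans (leqnSn d))// expnS expn1 leq_pmulr.
Qed.

(** The components have transforms by [isF_exists], so the choice in [fourier] does not fall back on
    its default. *)
Lemma fourierP (u : R -> V) : square_integrable u -> is_fourier u (fourier u).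
Proof.
move=> su; rewrite /fourier; case: xgetP => [v -> //|none].
have [v hv] := choice (fun i => isF_exists ((square_integrableP u).1 su i)).
exfalso; apply: (none (fun x => \col_i v i x)); apply/is_fourierP => // i.
suff -> : comp (fun x => \col_i v i x) i = v i by exact: hv.
by apply/funext => x; rewrite mxE.
Qed.

(** Transforms are unique almost everywhere, so [fourier u] may be exchanged for any transforms of
    the components. *)
Lemma gevrey_norm_le s sigma (u : R -> V) (g : 'I_d -> R -> C) (r : R) : square_integrable u -> 0 <= r ->
  (forall i, isF (comp u i) (g i)) ->
  (gevrey_norm s sigma u <= r%:E)%E <-> L2le mu r (fun xi => gevrey_weight s sigma xi * cnorm g xi).
Proof.
move=> su r0 hg; have hF := (is_fourierP _ su).1 (fourierP su).
pose w := fun xi => real_complex R (gevrey_weight s sigma xi) *: fourier u xi.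
have mfu i : cmeasR (comp (fourier u) i) by exact: (hF i).1.1.
have mg i : cmeasR (g i) by exact: (hg i).1.1.
have mw : cvec_measurable w.
  move=> i; have E : (fun x => w x i 0) = fun x => (gevrey_weight s sigma x)%:C%C * fourier u x i 0.
    by apply/funext => x; rewrite mxE.
  suff : cmeasR (fun x => w x i 0) by [].
  rewrite E; apply: cmeasM => //; apply: cmeas_real; exact: measurable_gw.
have wE xi : cnorm (comp w) xi = gevrey_weight s sigma xi * cnorm (comp (fourier u)) xi.
  rewrite /cnorm -[gevrey_weight s sigma xi]ger0_norm ?gw_ge0// -sqrtr_sqr -sqrtrM ?sqr_ge0// mulr_sumr.
  by congr Num.sqrt; apply: eq_bigr => i _; rewrite mxE normcM normc_real exprMn real_normK ?num_real.
have h i : {ae mu, forall x, g i x = fourier u x i 0}.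
  by apply: isF_unique (hg i) (hF i) _; exact: (square_integrableP u).1.
have ae : {ae mu, forall xi, gevrey_weight s sigma xi * cnorm g xi = cnorm (comp w) xi}.
  have : {ae mu, forall xi, forall i, g i xi = fourier u xi i 0} by exact: filter_forall h.
  apply: ae_mono => xi E; rewrite wE; congr (_ * _); congr Num.sqrt.
  by apply: eq_bigr => i _; rewrite E.
have mgw : measurable_fun [set: R] (fun xi => gevrey_weight s sigma xi * cnorm g xi).
  by apply: measurable_funM; [exact: measurable_gw|exact: measurable_cnorm].
split=> [hn|hL].
  apply: L2le_ae mgw _ ((L2norm_le mw r0).1 hn).
  by apply: ae_mono ae => xi ->.
apply: ((L2norm_le mw r0).2 _); apply: L2le_ae ae hL; exact: measurable_cnorm mw.
Qed.

(** Entry of the data: the weighted bound makes the transform integrable, so inversion gives a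
    representative defined at every point, equal to [u] almost everywhere. 2^s is the loss of
    [wt_le]; the sharp bound by [r] with the true weight is kept alongside for the energy. *)
Lemma gevrey_IF s sigma (u : R -> V) (r : R) : 1 / 2 < s -> 0 <= sigma -> 0 <= r -> gevrey s sigma u ->
  (gevrey_norm s sigma u <= r%:E)%E -> exists g : 'I_d -> R -> C,
  [/\ forall i, cinteg (g i) /\ L2f (g i), forall i, {ae mu, forall x, u x i 0 = IF (g i) x},
      forall i, B sigma s (2 `^ s * r) (IF (g i)) & L2le mu r (fun xi => gevrey_weight s sigma xi * cnorm g xi)].
Proof.
move=> s2 sg0 r0 [su _] hr; have hF := (is_fourierP _ su).1 (fourierP su).
pose g i := comp (fourier u) i; have hg := (gevrey_norm_le s sigma su r0 hF).1 hr.
have mg i : cmeasR (g i) by exact: (hF i).1.1.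
have p0 : 0 <= 2 `^ s * r by rewrite mulr_ge0// powR_ge0.
have hw i : L2le mu (2 `^ s * r) (fun xi => wt sigma s xi * normc (g i xi)).
  have := L2leZ (2 `^ s) hg; rewrite ger0_norm ?powR_ge0//; apply: L2le_le.
    by apply: measurable_wtM; exact: mg.
  move=> xi; rewrite normr_wtM mulrA; apply: ler_pM; rewrite ?normc_ge0//.
  - exact: ltW (wt_gt0 _ _ _).
  - by apply: wt_le; lra.
  - exact: normc_le_cnorm.
have ig i := wt_integ s2 sg0 p0 (mg i) (hw i).
exists g; split=> // i.
- by apply: fourier_inversion (hF i) _; [exact: (square_integrableP u).1|have [] := ig i].
- by split=> //; exists (g i); split=> //; exact: mg.
Qed.

Lemma FB_gevrey s sigma (u : R -> V) (g : 'I_d -> R -> C) (r : R) : 0 <= r ->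
  (forall i, FB (comp u i) (g i)) -> L2le mu r (fun xi => gevrey_weight s sigma xi * cnorm g xi) ->
  gevrey s sigma u /\ (gevrey_norm s sigma u <= r%:E)%E.
Proof.
move=> r0 hg gr.
have E i : comp u i = IF (g i) by apply/funext => x; have [_ _ ->] := hg i.
have su : square_integrable u.
  by apply/square_integrableP => i; rewrite E; apply: L2f_IF; have [] := hg i.
have hF i : isF (comp u i) (g i) by rewrite E; apply: isF_IF; have [] := hg i.
have h := (gevrey_norm_le s sigma su r0 hF).2 gr.
by split=> //; split=> //; exact: le_lt_trans h (ltry _).
Qed.

End vector_fourier.

(** * Solutions *)

Section vector_topology.
Variables (R : realType) (d : nat).
Local Notation C := R[i].
Local Notation V := 'cV[C]_d.
Local Notation mu := (@lebesgue_measure R).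
Local Notation Re := (@complex.Re R).
Local Notation Im := (@complex.Im R).

Lemma row_sum_le (F : 'I_d -> 'I_d -> R) k : (forall k l, 0 <= F k l) -> \sum_l F k l <= \sum_k \sum_l F k l.
Proof. by move=> F0; rewrite [leRHS](bigD1 k)//= lerDl sumr_ge0// => j _; exact: sumr_ge0. Qed.

Lemma subr_via (a b c : C) : a - b = (c - b) - (c - a).
Proof. by ring. Qed.

Lemma ae_dense (P : R -> Prop) (a b : R) : {ae mu, forall x, P x} -> a < b -> exists2 x, a < x < b & P x.
Proof.
move=> [B [mB B0 PB]] ab; apply: contrapT => none.
have sub : `]a, b[%classic `<=` B.
  move=> x /=; rewrite in_itv/= => xab; apply: PB => Px; apply: none; exists x => //.
have : (mu `]a, b[%classic <= mu B)%E.
  by apply: le_measure; rewrite ?inE//; exact: measurable_itv.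
by rewrite B0 lebesgue_measure_itv/= lte_fin ab -EFinB lee_fin subr_le0 leNgt ab.
Qed.

Lemma cS_gt0 (p : R) : 1 / 2 < p -> 0 < cS p.
Proof.
move=> p2; rewrite lt_neqAle cS_ge0 andbT; apply/eqP => E.
have h : {ae mu, forall x, (kk x `^ p)^-1 = 0}.
  apply: L2le_ae0 => e e0; apply: L2le_leK (L2le_kk p2); by rewrite -E lexx ltW.
have [x _ /eqP] := ae_dense h ltr01.
by rewrite gt_eqF// invr_gt0 powR_gt0// kk_gt0.
Qed.

Lemma within_cvgP (A : set R) (f : R -> V) x (l : V) : f t @[t --> within A (nbhs x)] --> l <->
  forall e : R, 0 < e -> exists2 dl : R, 0 < dl & forall t, A t -> `|t - x| < dl -> forall k, normc (f t k 0 - l k 0) < e.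
Proof.
split=> [h e e0|h P /nbhs_cmx [e e0 eP]].
  have : nbhs l [set w : V | forall k, normc (w k 0 - l k 0) < e].
    by apply/nbhs_cmx; exists e => // w hw k; exact: hw.
  move=> /h; rewrite /nbhs/= /within/= => /nbhs_ballP[dl /= dl0 hd].
  by exists dl => // t At tx k; apply: hd => //; rewrite /ball/= distrC.
have [dl dl0 hd] := h e e0; rewrite /nbhs/= /within/=; apply/nbhs_ballP; exists dl => //= t tx At.
by apply: eP => i j; rewrite ord1; apply: hd => //; rewrite distrC.
Qed.

Lemma is_deriv_withinP (A : set R) (f : R -> V) x (l : V) : is_deriv_within A f x l <->
  forall e : R, 0 < e -> exists2 dl : R, 0 < dl & forall t, A t -> t != x -> `|t - x| < dl ->
    forall k, normc ((t - x)^-1%:C%C * (f t k 0 - f x k 0) - l k 0) < e.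
Proof.
have E t k : (real_complex R (t - x)^-1 *: (f t - f x)) k 0 = (t - x)^-1%:C%C * (f t k 0 - f x k 0) by rewrite !mxE.
rewrite /is_deriv_within; split=> [/within_cvgP h e e0|h].
  have [dl dl0 hd] := h e e0; exists dl => // t At tx td k; rewrite -E; apply: hd => //.
  by split=> // /eqP; rewrite (negbTE tx).
apply/within_cvgP => e e0; have [dl dl0 hd] := h e e0; exists dl => // t [At tx] td k.
by rewrite E; apply: hd => //; apply/eqP.
Qed.

Lemma quadratic_deriv_within (A : set R) (f : R -> V) x (l : V) (c : R) :
  (forall t k, A t -> normc (f t k 0 - f x k 0 - (t - x)%:C%C * l k 0) <= c * (t - x) ^+ 2) ->
  is_deriv_within A f x l.
Proof.
move=> h; apply/is_deriv_withinP => e e0; have c1 : 0 < `|c| + 1 by rewrite ltr_wpDl.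
exists (e / (`|c| + 1)); first by rewrite divr_gt0.
move=> t At tx td k; have tx0 : t - x != 0 by rewrite subr_eq0.
have tp : 0 < `|t - x| by rewrite normr_gt0.
have tC : (t - x)^-1%:C%C * (t - x)%:C%C = 1 :> C by rewrite -rmorphM mulVf.
have -> : (t - x)^-1%:C%C * (f t k 0 - f x k 0) - l k 0 =
   (t - x)^-1%:C%C * (f t k 0 - f x k 0 - (t - x)%:C%C * l k 0).
  by rewrite [RHS]mulrBr mulrA tC mul1r.
rewrite normcM normc_real normfV mulrC ltr_pdivrMr//.
apply: le_lt_trans (h t k At) _; rewrite -[(t - x) ^+ 2]real_normK ?num_real// expr2 mulrA ltr_pM2r//.
apply: le_lt_trans (_ : (`|c| + 1) * `|t - x| < _); last by rewrite mulrC -ltr_pdivlMr.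
by apply: ler_wpM2r => //; rewrite (le_trans (ler_norm _))// lerDl.
Qed.

Lemma cdiff_deriv_within (f : R -> V) x (l : 'I_d -> C) : (forall k, cdiff (fun y => f y k 0) x (l k)) ->
  is_deriv_within [set: R] f x (\col_k l k).
Proof.
move=> /choice [c hc]; apply: (quadratic_deriv_within (c := \sum_k `|c k|)) => z k _; rewrite mxE.
have := hc k (z - x); rewrite [x + _]addrC subrK => /le_trans; apply.
by apply: ler_wpM2r; rewrite ?sqr_ge0// (bigD1 k)//= (le_trans (ler_norm _))// lerDl sumr_ge0.
Qed.

Lemma deriv_within_cts (A : set R) (f : R -> V) x (l : V) : is_deriv_within A f x l ->
  f t @[t --> within A (nbhs x)] --> f x.
Proof.
move=> /is_deriv_withinP h; apply/within_cvgP => e e0.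
have [dl dl0 hd] := h 1 ltr01; pose m := \sum_k normc (l k 0) + 1.
have m0 : 0 < m by rewrite ltr_wpDl// sumr_ge0// => k _; exact: normc_ge0.
exists (Num.min dl (e / m)); first by rewrite lt_min dl0 divr_gt0.
move=> t At; rewrite lt_min => /andP[td te] k.
have [->|tx] := eqVneq t x; first by rewrite subrr normc0.
have tp : 0 < `|t - x| by rewrite normr_gt0 subr_eq0.
have tC : (t - x)%:C%C * (t - x)^-1%:C%C = 1 :> C by rewrite -rmorphM mulfV// subr_eq0.
have -> : f t k 0 - f x k 0 = (t - x)%:C%C * ((t - x)^-1%:C%C * (f t k 0 - f x k 0)) by rewrite mulrA tC mul1r.
set q := _ * (f t k 0 - _).
have qm : normc q < m.
  have := hd t At tx td k; rewrite -/q => q1.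
  have := le_normcD (q - l k 0) (l k 0); rewrite subrK => /le_lt_trans; apply.
  rewrite addrC; apply: ler_ltD => //; rewrite (bigD1 k)//= lerDl.
  by rewrite sumr_ge0// => j _; exact: normc_ge0.
rewrite normcM normc_real; apply: le_lt_trans (_ : `|t - x| * m < _).
  by rewrite ler_wpM2l// ltW.
by rewrite -ltr_pdivlMr.
Qed.

Lemma deriv_within_unique (f : R -> V) x l k m : is_deriv_within [set: R] f x l ->
  cdiff (fun y => f y k 0) x m -> l k 0 = m.
Proof.
move=> /is_deriv_withinP h [c hc]; apply/eqP; rewrite -subr_eq0 -normc_eq0 eq_le normc_ge0 andbT.
apply/ler_addgt0Pl => e e0; rewrite addr0.
have e2 : 0 < e / 2 by rewrite divr_gt0.
have [dl dl0 hd] := h _ e2.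
have c1 : 0 < `|c| + 1 by rewrite ltr_wpDl.
pose t := Num.min (dl / 2) (e / 2 / (`|c| + 1)).
have t0 : 0 < t by rewrite lt_min !divr_gt0.
have tdl : t < dl by rewrite gt_min ltr_pdivrMr// ltr_pMr// ltr1n.
have te : t * (`|c| + 1) <= e / 2 by rewrite -ler_pdivlMr// ge_min lexx orbT.
have tx : x + t != x by rewrite -subr_eq0 addrAC subrr add0r gt_eqF.
have := hd (x + t) I tx; rewrite [x + t - x]addrAC subrr add0r gtr0_norm// => /(_ tdl k) h1.
have tC : t^-1%:C%C * t%:C%C = 1 :> C by rewrite -rmorphM mulVf// gt_eqF.
have h2 : normc (t^-1%:C%C * (f (x + t) k 0 - f x k 0) - m) <= e / 2.
  have -> : t^-1%:C%C * (f (x + t) k 0 - f x k 0) - m = t^-1%:C%C * (f (x + t) k 0 - f x k 0 - t%:C%C * m).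
    by rewrite [RHS]mulrBr mulrA tC mul1r.
  rewrite normcM normc_real gtr0_norm ?invr_gt0// mulrC ler_pdivrMr//.
  apply: le_trans (hc t) _; apply: le_trans (_ : (`|c| + 1) * t ^+ 2 <= _).
    by rewrite ler_wpM2r ?sqr_ge0// (le_trans (ler_norm _))// lerDl.
  by rewrite expr2 mulrA ler_wpM2r ?(ltW t0)// mulrC.
have -> : l k 0 - m = (t^-1%:C%C * (f (x + t) k 0 - f x k 0) - m) - (t^-1%:C%C * (f (x + t) k 0 - f x k 0) - l k 0).
  exact: subr_via.
by apply: le_trans (le_normcB _ _) _; have := splitr e; move: h1 h2; lra.
Qed.

Lemma deriv_within_cderive (a b : R) (f : R -> V) t l k : is_deriv_within `[a, b] f t l -> a < t < b ->
  is_cderive (fun r => f r k 0) t (l k 0).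
Proof.
move=> /is_deriv_withinP h /andP[at_ tb].
have key (P : C -> R) : (forall z w, P (z - w) = P z - P w) -> (forall (c : R) z, P (c%:C%C * z) = c * P z) ->
    (forall z, `|P z| <= normc z) -> is_derive t 1 (P \o (fun r => f r k 0)) (P (l k 0)).
  move=> PB PZ Pn.
  have cv : (fun h : R => h^-1 *: ((P \o (fun r => f r k 0)) (h *: (1 : R) + t) - (P \o (fun r => f r k 0)) t)) @ 0^' --> P (l k 0).
    apply/cvgrPdist_lt => e e0; have [dl dl0 hd] := h e e0.
    rewrite /dnbhs /within/= ; apply/nbhs_ballP; exists (Num.min dl (Num.min (t - a) (b - t))).
      by rewrite /= !lt_min dl0 !subr_gt0 at_.
    move=> q; rewrite /ball/= sub0r normrN !lt_min => /andP[qd /andP[qa qb]] q0.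
    have := hd (q + t); rewrite addrK => H.
    have tin : `[a, b]%classic (q + t).
      rewrite /= in_itv/=; move: qa qb => /ltr_normlP[q1 q2] /ltr_normlP[q3 q4]; apply/andP; split; lra.
    have tn : q + t != t by rewrite -subr_eq0 addrK.
    have {}H := H tin tn qd k; rewrite /= /GRing.scale/= mulr1 distrC -PB -PZ -PB.
    exact: le_lt_trans (Pn _) H.
  by apply: DeriveDef; [apply/cvg_ex; exists (P (l k 0))|exact/cvg_lim].
split; apply: key.
- by move=> z w; rewrite ReDc ReNc.
- by move=> c z; rewrite ReMc/= mul0r subr0.
- exact: normc_Re.
- by move=> z w; rewrite ImDc ImNc.
- by move=> c z; rewrite ImMc/= mul0r addr0.
- exact: normc_Im.
Qed.

Lemma within_component (P : C -> R) (A : set R) (f : R -> V) k : (forall z w, P (z - w) = P z - P w) ->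
  (forall z, `|P z| <= normc z) -> {within A, continuous f} -> {within A, continuous (fun t => P (f t k 0))}.
Proof.
move=> PB Pn /subspace_continuousP h; apply/subspace_continuousP => x Ax.
have /within_cvgP hx := h x Ax; apply/cvgrPdist_lt => e e0; have [dl dl0 hd] := hx e e0.
rewrite /within/=; apply/nbhs_ballP; exists dl => //= t; rewrite /ball/= distrC => tx At.
by rewrite distrC -PB; apply: le_lt_trans (Pn _) (hd t At tx k).
Qed.

(** A set of full measure meets every interval ([ae_dense]), so continuity extends the equality. *)
Lemma cts_ae_eq (f g : R -> V) : (forall x, f t @[t --> within [set: R] (nbhs x)] --> f x) ->
  (forall x, g t @[t --> within [set: R] (nbhs x)] --> g x) -> {ae mu, forall x, f x = g x} -> forall x, f x = g x.
Proof.
move=> cf cg fg x; apply/matrixP => k j; rewrite ord1.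
apply/eqP; rewrite -subr_eq0 -normc_eq0 eq_le normc_ge0 andbT.
apply/ler_addgt0Pl => e e0; rewrite addr0; have e2 : 0 < e / 2 by rewrite divr_gt0.
have [d1 d10 h1] := (within_cvgP _ _ _ _).1 (cf x) _ e2.
have [d2 d20 h2] := (within_cvgP _ _ _ _).1 (cg x) _ e2.
have xm : x < x + Num.min d1 d2 by rewrite ltrDl lt_min d10.
have [y /andP[xy ym] fgy] := ae_dense fg xm.
have yd : `|y - x| < Num.min d1 d2 by rewrite gtr0_norm ?subr_gt0// ltrBlDl.
move: yd; rewrite lt_min => /andP[y1 y2].
have := h1 y I y1 k; have := h2 y I y2 k; rewrite fgy => b1 b2.
have -> : f x k 0 - g x k 0 = (g y k 0 - g x k 0) - (g y k 0 - f x k 0) by exact: subr_via.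
by apply: le_trans (le_normcB _ _) _; have := splitr e; move: b1 b2; lra.
Qed.

End vector_topology.

Section solutions.
Variables (R : realType) (d : nat).
Local Notation C := R[i].
Local Notation V := 'cV[C]_d.
Local Notation mu := (@lebesgue_measure R).
Local Notation c0 := (Num.sqrt (2 * pi : R))^-1.
Variables (M : V -> 'M[C]_d) (s sigma0 eta : R) (u0 : R -> V).
Hypotheses (hM : entire M) (s1 : 1 < s) (sigma00 : 0 < sigma0) (eta0 : 0 < eta).
Let s2 : 1 / 2 < s. Proof. by have := s1; lra. Qed.
Local Notation Dxv w t x := (\col_k Dx (fun y => (w : R -> R -> V) t y k 0) x).

Lemma solution_cts w t x : is_solution M s sigma0 eta u0 w -> 0 <= t < sigma0 / eta ->
  w t y @[y --> within [set: R] (nbhs x)] --> w t x.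
Proof. by move=> [_ _ _ _ eq] tT; have [uX dX _] := eq t x tT; exact: deriv_within_cts dX. Qed.

(** The Gevrey norm gives an inverse transform equal to w(t) only almost everywhere; the spatial
    derivative in the equation makes w(t) continuous, and equality holds everywhere. The bound is
    uniform because the supremum over T is finite, and the radius at [b] serves all earlier
    times. *)
Lemma solution_B w : is_solution M s sigma0 eta u0 w -> exists2 K, 0 <= K & forall b t k,
  0 <= b < sigma0 / eta -> 0 <= t <= b -> B (sigma0 - eta * b) s K (fun x => w t x k 0).
Proof.
move=> hw; have [gw_ supw _ _ _] := hw.
have T0in : (0 : R) \in `[0, sigma0 / eta] by rewrite in_itv/= lexx divr_ge0// ltW.
pose r := fine (gevrey_sup s sigma0 eta w).
have le_sup t : t \in `[0, sigma0 / eta] -> (gevrey_norm s (sigma0 - eta * t) (w t) <= gevrey_sup s sigma0 eta w)%E.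
  by move=> tT; apply: ereal_sup_ubound; exists t.
have N0 t : (0 <= gevrey_norm s (sigma0 - eta * t) (w t))%E by exact: Lnorm_ge0.
have sup0 : (0 <= gevrey_sup s sigma0 eta w)%E by apply: le_trans (N0 0) (le_sup 0 T0in).
have rE : gevrey_sup s sigma0 eta w = r%:E by rewrite fineK// ge0_fin_numE.
have r0 : 0 <= r by rewrite fine_ge0.
exists (2 `^ s * r); first by rewrite mulr_ge0// powR_ge0.
move=> b t k /andP[b0 bT] /andP[t0 tb].
have tT : t < sigma0 / eta by exact: le_lt_trans bT.
have tin : t \in `[0, sigma0 / eta] by rewrite in_itv/= t0 ltW.
have st : 0 < sigma0 - eta * t by rewrite subr_gt0 mulrC -ltr_pdivlMr.
have := le_sup t tin; rewrite rE => hr.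
have [g [_ wg gB _]] := gevrey_IF s2 (ltW st) r0 (gw_ t tin) hr.
apply: (@B_le _ (sigma0 - eta * t) _ s s (2 `^ s * r) _ _) => //.
  by rewrite lerD2l lerN2 ler_pM2l.
apply: B_ext (gB k) => x; apply/esym.
have cw y : w t z @[z --> within [set: R] (nbhs y)] --> w t y.
  by apply: solution_cts hw _; rewrite t0.
pose G y : V := \col_i IF (g i) y.
have cG y : G z @[z --> within [set: R] (nbhs y)] --> G y.
  apply: (deriv_within_cts (l := \col_i Dx (IF (g i)) y)); apply: cdiff_deriv_within => i.
  by under eq_fun do rewrite mxE; have [_ h] := B_deriv (lexx 0) st s2 (gB i); exact: h.
have ae : {ae mu, forall y, w t y = G y}.
  have : {ae mu, forall y, forall i, w t y i 0 = IF (g i) y} by exact: filter_forall wg.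
  by apply: ae_mono => y E; apply/matrixP => i j; rewrite ord1 E mxE.
by rewrite (cts_ae_eq cw cG ae) mxE.
Qed.

Lemma solution_deriv w b t x : is_solution M s sigma0 eta u0 w -> 0 < t < b -> b < sigma0 / eta ->
  (forall k, cdiff (fun y => w t y k 0) x (Dx (fun y => w t y k 0) x)) /\
  (forall k, is_cderive (fun r => w r x k 0) t (\sum_l M (w t x) k l * Dx (fun y => w t y l 0) x)).
Proof.
move=> hw /andP[t0 tb] bT; have [K K0 hB] := solution_B hw.
have tT : t < sigma0 / eta by exact: lt_trans bT.
have ht k := hB b t k (introT andP (conj (ltW (lt_trans t0 tb)) bT)) (introT andP (conj (ltW t0) (ltW tb))).
have sb : 0 < sigma0 - eta * b by rewrite subr_gt0 mulrC -ltr_pdivlMr.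
have hd k := (B_deriv (lexx 0) sb s2 (ht k)).2 x.
split=> // k; have [_ _ _ _ eq] := hw.
have [|uX dX dT] := eq t x; first by rewrite in_itv/= ltW.
have := deriv_within_cderive k dT (introT andP (conj t0 tT)); rewrite mxE.
by under eq_bigr => l _ do rewrite (deriv_within_unique dX (hd l)).
Qed.

(** On [0, b] with b before the final time both solutions keep the positive radius sigma0 - eta b
    and [unique_sol] applies; the final time, where no radius is left, follows by continuity in
    T. *)
Lemma solution_unique v w T X : is_solution M s sigma0 eta u0 v -> is_solution M s sigma0 eta u0 w ->
  0 <= T <= sigma0 / eta -> v T X = w T X.
Proof.
move=> hv hw.
have Y0 : 0 < sigma0 / eta by rewrite divr_gt0.
have h0 x : v 0 x = w 0 x.
  have z0 : 0 <= (0 : R) < sigma0 / eta by rewrite lexx.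
  apply: cts_ae_eq => [y|y|]; [exact: solution_cts hv z0|exact: solution_cts hw z0|].
  have [_ _ v0 _ _] := hv; have [_ _ w0 _ _] := hw.
  by apply: ae_mono (ae_and v0 w0) => y [-> ->].
have inner b : 0 <= b < sigma0 / eta -> v b X = w b X.
  move=> hb; have /andP[b0 bT] := hb.
  have [Kv Kv0 Bv] := solution_B hv; have [Kw Kw0 Bw] := solution_B hw.
  have sb : 0 < sigma0 - eta * b by rewrite subr_gt0 mulrC -ltr_pdivlMr.
  (* Chosen so that rho / 2 bounds both solutions and, with [al] below, al / 4 is the inverse of the
     radius; the summand 1 keeps rho positive. *)
  pose rho := 2 * (c0 * (cS s * (Kv + Kw + 1))).
  have rho0 : 0 < rho by rewrite !mulr_gt0// ?c0_gt0 ?cS_gt0// ltr_wpDl// addr_ge0.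
  pose al := 4 * (sigma0 - eta * b)^-1; have al0 : 0 < al by rewrite mulr_gt0// invr_gt0.
  have [Nkl hN] := choice (fun kl : 'I_d * 'I_d => entire_PS hM kl.1 kl.2 (mulr_gt0 (ltr0n R 2) rho0)).
  have N0 kl : 0 <= Nkl kl by apply: PS_ge0 (hN kl); rewrite mulr_ge0// ltW.
  pose N := \sum_k \sum_l Nkl (k, l).
  have hNk k : \sum_l Nkl (k, l) <= N by exact: (row_sum_le (F := fun k l => Nkl (k, l))).
  have solves z K : is_solution M s sigma0 eta u0 z -> 0 <= K -> K <= Kv + Kw ->
      (forall b t k, 0 <= b < sigma0 / eta -> 0 <= t <= b -> B (sigma0 - eta * b) s K (fun x => z t x k 0)) ->
      let z' := fun t x k => z t x k 0 in let zX := fun t x k => Dx (fun y => z t y k 0) x in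
      [/\ forall t k, 0 <= t <= b -> dclass (fun i => rho / 2 * multip (al / 4) i) (fun x => z' t x k),
        forall t x k, 0 < t < b -> cdiff (fun y => z' t y k) x (zX t x k),
        forall t x k, 0 < t < b -> is_cderive (fun r => z' r x k) t (\sum_l M (colv (z' t x)) k l * zX t x l) &
        forall x k, {within `[0, b], continuous (fun t => complex.Re (z' t x k))} /\
                    {within `[0, b], continuous (fun t => complex.Im (z' t x k))}].
    move=> hz K0 KK zB z' zX; split.
    - move=> t k htb; apply: dclass_le (B_dclass sb s2 (zB b t k hb htb)) => i.
      rewrite [al / 4]mulrC mulKf//; apply: ler_wpM2r; first by rewrite multip_ge0// invr_ge0 ltW.
      rewrite [leRHS]mulrC mulKf//; apply: ler_wpM2l; first exact: ltW (c0_gt0 R).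
      apply: ler_wpM2l; first exact: cS_ge0.
      by apply: le_trans KK _; rewrite lerDl.
    - by move=> t x k htb; have [h _] := solution_deriv x hz htb bT; exact: h.
    - move=> t x k htb; have [_ h] := solution_deriv x hz htb bT.
      have -> : colv (z' t x) = z t x by apply/matrixP => i j; rewrite ord1 mxE.
      exact: h.
    - have [_ _ _ cz _] := hz => x k.
      have sub : `[0, b] `<=` `[0, sigma0 / eta].
        by move=> t /=; rewrite !in_itv/= => /andP[-> tb]; rewrite (le_trans tb)// ltW.
      split; apply: continuous_subspaceW sub _; apply: within_component (cz x).
      + by move=> p q; rewrite ReDc ReNc.
      + exact: normc_Re.
      + by move=> p q; rewrite ImDc ImNc.
      + exact: normc_Im.
  have KvS : Kv <= Kv + Kw by rewrite lerDl.
  have KwS : Kw <= Kv + Kw by rewrite lerDr.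
  have N_ge0 : 0 <= N by apply: sumr_ge0 => k _; exact: sumr_ge0.
  have hPhi k l : PS (2 * rho) (Nkl (k, l)) (fun z => M (colv z) k l) by exact: (hN (k, l)).
  have bb : 0 <= b <= b by rewrite b0 lexx.
  have h0' x k : v 0 x k 0 = w 0 x k 0 by rewrite h0.
  apply/matrixP => k j; rewrite ord1.
  have U := unique_sol (Nkl := fun k l => Nkl (k, l)) rho0 al0 N_ge0 hPhi hNk.
  exact: (U b _ _ _ _ (solves v Kv hv Kv0 KvS Bv) (solves w Kw hw Kw0 KwS Bw) b X k h0' bb).
move=> /andP[T0]; rewrite le_eqVlt => /orP[/eqP TE|TT]; last by apply: inner; rewrite T0.
have [_ _ _ cv _] := hv; have [_ _ _ cw _] := hw.
have Yin : `[0, sigma0 / eta]%classic (sigma0 / eta) by rewrite /= in_itv/= lexx ltW.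
have hcv := (within_cvgP _ _ _ _).1 ((subspace_continuousP _ _).1 (cv X) _ Yin).
have hcw := (within_cvgP _ _ _ _).1 ((subspace_continuousP _ _).1 (cw X) _ Yin).
rewrite TE; apply/matrixP => k j; rewrite ord1.
apply/eqP; rewrite -subr_eq0 -normc_eq0 eq_le normc_ge0 andbT.
apply/ler_addgt0Pl => e e0; rewrite addr0; have e2 : 0 < e / 2 by rewrite divr_gt0.
have [d1 d10 h1] := hcv _ e2; have [d2 d20 h2] := hcw _ e2.
(* The time Y - m / 2 is close enough to Y for both solutions and, since m <= Y, not negative. *)
pose Y := sigma0 / eta; pose m := Num.min (Num.min d1 d2) Y.
have m0 : 0 < m by rewrite !lt_min d10 d20.
have mY : m <= Y by rewrite ge_min lexx orbT.
have tin : 0 <= Y - m / 2 < Y.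
  by apply/andP; split; move: m0 mY; lra.
have tin' : `[0, sigma0 / eta]%classic (Y - m / 2) by move: tin => /andP[t1 t2]; rewrite /= in_itv/= t1 ltW.
have td : `|Y - m / 2 - Y| < m.
  have -> : Y - m / 2 - Y = - (m / 2) by lra.
  by rewrite normrN gtr0_norm ?divr_gt0//; move: m0; lra.
have : m <= Num.min d1 d2 by rewrite ge_min lexx.
rewrite le_min => /andP[m1 m2].
have := h1 _ tin' (lt_le_trans td m1) k; have := h2 _ tin' (lt_le_trans td m2) k.
rewrite (inner _ tin) /= => b1 b2.
rewrite (@subr_via R _ _ (w (Y - m / 2) X k 0)).
by apply: le_trans (le_normcB _ _) _; have := splitr e; move: b1 b2; rewrite /from_subspace/=; lra.
Qed.

End solutions.

Theorem theorem3p1 (R : realType) (d : nat) (hd : (0 < d)%N)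
    (M : 'cV[R[i]]_d -> 'M[R[i]]_d) (hM : entire M)
    (s sigma0 : R) (hs : 1 < s) (hsigma0 : 0 < sigma0)
    (r : R) (hr : 0 < r) :
  exists2 eta : R, 0 < eta &
    forall u0 : R -> 'cV[R[i]]_d,
      gevrey s sigma0 u0 -> (gevrey_norm s sigma0 u0 <= r%:E)%E ->
      exists u : R -> R -> 'cV[R[i]]_d,
        [/\ is_solution M s sigma0 eta u0 u,
            (forall v, is_solution M s sigma0 eta u0 v ->
               forall T X, T \in `[0, sigma0 / eta] -> v T X = u T X) &
            (gevrey_sup s sigma0 eta u <= r%:E)%E].
Proof.
have s2 : 1 / 2 < s by move: hs; lra.
(* A bound for the weighted norm of all admissible data; the constants up to [eta] are fixed before
   [u0] appears. *)
pose K := 2 `^ s * r; have K0 : 0 < K by rewrite mulr_gt0// powR_gt0.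
pose Phi (k l : 'I_d) (z : 'I_d -> R[i]) := M (colv z) k l.
have cP0 : 0 < cP s s.
  apply: lt_le_trans (c0cS_le s2); rewrite mulr_gt0 ?cS_gt0//; exact: c0_gt0.
have rA0 : 0 < 8 * cP s s * K := mulr_gt0 (mulr_gt0 (ltr0n R 8) cP0) K0.
pose rho := cP s s * (2 * K) + cP s (s - 1 / 2) * (2 * K).
have rho1 : cP s s * (2 * K) <= rho by rewrite lerDl mulr_ge0 ?cP_ge0// mulr_ge0// ltW.
have rho2 : cP s (s - 1 / 2) * (2 * K) <= rho by rewrite lerDr mulr_ge0 ?cP_ge0// mulr_ge0// ltW.
have rho0 : 0 < rho by apply: lt_le_trans rho1; exact: mulr_gt0 cP0 (mulr_gt0 _ K0).
(* Two expansions of [M]: one on the radius dictated by the series majorants, the other on [rho],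
   which accommodates the solution, of norm 2 K, as a multiplier for both exponents s and s -
   1/2. *)
have [Mkl hMkl] := choice (fun kl : 'I_d * 'I_d => entire_PS hM kl.1 kl.2 rA0).
have [Nkl hNkl] := choice (fun kl : 'I_d * 'I_d => entire_PS hM kl.1 kl.2 rho0).
have Mkl0 kl : 0 <= Mkl kl by exact: PS_ge0 (ltW rA0) (hMkl kl).
have Nkl0 kl : 0 <= Nkl kl by exact: PS_ge0 (ltW rho0) (hNkl kl).
have [A hA] := choice (fun kl => PS_operator_exists (ltW rA0) (hMkl kl)).
pose Mk := \sum_k \sum_l Mkl (k, l); pose N := \sum_k \sum_l Nkl (k, l).
have hMk k : \sum_l Mkl (k, l) <= Mk by exact: (row_sum_le (F := fun k l => Mkl (k, l))).
have hN k : \sum_l Nkl (k, l) <= N by exact: (row_sum_le (F := fun k l => Nkl (k, l))).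
have Mk0 : 0 <= Mk by apply: sumr_ge0 => k _; exact: sumr_ge0.
have N0 : 0 <= N by apply: sumr_ge0 => k _; exact: sumr_ge0.
(* First summand: convergence of the series, with room to spare. Second: enough dissipation to
   absorb M(u) u_x. *)
pose eta := 16 * ckC Mk + 2 * (Num.sqrt d%:R * (N * 2 `^ s)).
have C0 : 0 < ckC Mk by exact: ckC_gt0.
have e2 : 0 <= 2 * (Num.sqrt d%:R * (N * 2 `^ s)).
  by rewrite mulr_ge0// mulr_ge0 ?sqrtr_ge0// mulr_ge0// powR_ge0.
have eta1 : 16 * ckC Mk <= eta by rewrite lerDl.
have eta2 : 2 * (Num.sqrt d%:R * (N * 2 `^ s)) <= eta by rewrite lerDr mulr_ge0// ltW.
have eta0 : 0 < eta by rewrite ltr_wpDr// mulr_gt0.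
exists eta => // u0 hu0 hu0r.
have [g0 [g0i u0E g0B g0r]] := gevrey_IF s2 (ltW hsigma0) (ltW hr) hu0 hu0r.
pose w0 := fun x k => IF (g0 k) x.
pose A' := fun k l => A (k, l).
have hA' k l : PS_operator (8 * cP s s * K) (Mkl (k, l)) (Phi k l) (A' k l) by exact: hA.
have hPhi k l : PS rho (Nkl (k, l)) (Phi k l) by exact: (hNkl (k, l)).
have F0 k : FB (fun x => w0 x k) (g0 k) by have [] := g0i k.
pose w := cksol A' w0; pose u := fun T X => colv (w T X).
have B0 k : B sigma0 s K (fun x => w0 x k) by exact: g0B.
have uE T X k : u T X k 0 = w T X k by rewrite mxE.
have Y0 : 0 < sigma0 / eta by rewrite divr_gt0.
have norm_le T : 0 <= T <= sigma0 / eta ->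
    gevrey s (sigma0 - eta * T) (u T) /\ (gevrey_norm s (sigma0 - eta * T) (u T) <= r%:E)%E.
  move=> hT; have sT : 0 <= sigma0 - eta * T.
    by rewrite subr_ge0 mulrC -ler_pdivlMr//; case/andP: hT.
  have hB k := sol_B hs K0 Mk0 hA' hMk eta1 B0 k hT.
  have hB' k : exists g, FB (fun x => w T x k) g by have [g hg _] := FB_B sT s2 (hB k); exists g.
  have [g hF] := choice hB'.
  have hr' := energy_sol hs hsigma0 K0 Mk0 N0 hA' hMk hPhi hN rho1 rho2 eta1 eta2 B0 hT (ltW hr) F0 hF g0r.
  apply: FB_gevrey (ltW hr) _ hr' => k.
  by apply: FB_ext (hF k) => x; rewrite uE.
have sup_le : (gevrey_sup s sigma0 eta u <= r%:E)%E.
  apply: ge_ereal_sup => _ [T /= TT <-]; move: TT; rewrite in_itv/= => TT.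
  by have [] := norm_le T TT.
have [c hc] := sol_diff hs hsigma0 K0 Mk0 hA' hMk eta1 B0.
have dT T X : T \in `[0, sigma0 / eta] ->
    is_deriv_within `[0, sigma0 / eta] (fun t => u t X) T (M (u T X) *m (\col_k Dx (fun y => w T y k) X)).
  rewrite in_itv/= => TT; apply: (quadratic_deriv_within (c := c)) => t k; rewrite /= in_itv/= => tt.
  rewrite !uE (_ : (_ *m _) k 0 = cksol1 A' w0 T X k); first exact: hc.
  rewrite (sol_eq hs hsigma0 K0 Mk0 hA' hMk eta1 B0)// mxE.
  by apply: eq_bigr => l _; rewrite mxE.
have sol : is_solution M s sigma0 eta u0 u.
  split.
  - by move=> T; rewrite in_itv/= => TT; have [] := norm_le T TT.
  - by apply: le_lt_trans sup_le (ltry _).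
  (* The series starts from the representative [w0], which agrees with [u0] almost everywhere. *)
  - have : {ae lebesgue_measure, forall x, forall k, u0 x k 0 = IF (g0 k) x} by exact: filter_forall u0E.
    apply: ae_mono => x E; apply/matrixP => k j; rewrite ord1 uE E; exact: cksol0.
  - move=> X; apply/subspace_continuousP => T TT.
    by have := deriv_within_cts (dT T X TT).
  - move=> T X TT; have TT' : 0 <= T <= sigma0 / eta by move: TT; rewrite in_itv/= => /andP[-> /ltW ->].
    exists (\col_k Dx (fun y => w T y k) X); last by apply: dT; rewrite in_itv.
    have s0 : 0 < sigma0 / 2 by rewrite divr_gt0.
    apply: cdiff_deriv_within => k; under eq_fun do rewrite uE.
    have [_ h] := B_deriv (lexx 0) s0 s2 (sol_B_half hs hsigma0 K0 Mk0 hA' hMk eta1 B0 k TT').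
    exact: h.
exists u; split=> // v hv T X; rewrite in_itv/= => TT.
exact: (solution_unique hM hs hsigma0 eta0 X hv sol TT).
Qed.
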